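(* Let $Y$ be a smooth variety over a field $L$ of characteristic zero and let $M$ be a nonzero holonomic left $\mathcal{D}_Y$-module. Then the singular support of $M$ is a Lagrangian subvariety of $(T^*_Y,\omega_Y)$.
   Context: $\mathcal{D}_Y$ is the sheaf of algebraic differential operators on $Y$ with its filtration by order, whose associated graded ring is $\mathcal{O}_{T^*_Y}$ (viewed as a sheaf of algebras on $Y$). The singular support of a coherent left $\mathcal{D}_Y$-module $M$ is the support in $T^*_Y$ (with reduced structure) of $gr^\Gamma M$ for any good filtration $\Gamma$ of $M$ (a filtration by coherent $\mathcal{O}_Y$-submodules, exhaustive, bounded below, compatible with the order filtration, with $gr^\Gamma M$ coherent over $\mathcal{O}_{T^*_Y}$); it is independent of $\Gamma$. $M$ is holonomic (in the usual sense) if it is coherent and, over each connected component of $Y$ (of dimension $n$, say), it is zero or its singular support has dimension $n$. For a smooth scheme $Q$ over a field, $\theta_Q$ is the canonical $1$-form on $T^*_Q$ (locally $\sum_i\xi_i\,dy_i$ in coordinates $y_i$ on $Q$ and dual fiber coordinates $\xi_i$) and $\omega_Q:=d\theta_Q$ is the symplectic form. A (reduced) subvariety $i:Z\hookrightarrow T^*_Q$ is a Lagrangian subvariety of $(T^*_Q,\omega_Q)$ if it contains a dense open subset $V\subset Z$ with $(i^*\omega_Q)|_V=0$ and if at each of its points $z$ it is of dimension equal to the dimension of $Q$ at the image of $z$. *)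

(* Defs.v *)
From HB Require Import structures.
From mathcomp Require Import all_boot all_order all_algebra.
From mathcomp Require Import boolp classical_sets topology.

Set Implicit Arguments.
Unset Strict Implicit.
Unset Printing Implicit Defensive.

Import GRing.Theory.
Local Open Scope classical_set_scope.
Local Open Scope ring_scope.

Record opens (X : topologicalType) := Opens {
  oset :> set X;
  oset_open : open oset }.

Definition opens_mem (X : topologicalType) (U : opens X) : X -> Prop := oset U.
Coercion opens_mem : opens >-> Funclass.

Definition opensI (X : topologicalType) (U V : opens X) : opens X :=
  Opens (openI (oset_open U) (oset_open V)).

Lemma opensIl (X : topologicalType) (U V : opens X) : opensI U V `<=` U.
Proof. exact: subIsetl. Qed.

Lemma opensIr (X : topologicalType) (U V : opens X) : opensI U V `<=` V.
Proof. exact: subIsetr. Qed.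

Definition presheaf_axiom (X : topologicalType) (F : opens X -> Type)
    (r : forall U V : opens X, V `<=` U -> F U -> F V) : Prop :=
  (forall (U : opens X) (h : U `<=` U) s, r U U h s = s) /\
  (forall (U V W : opens X) (hVU : V `<=` U) (hWV : W `<=` V) (hWU : W `<=` U) s,
     r U W hWU s = r V W hWV (r U V hVU s)).

Definition sheaf_axiom (X : topologicalType) (F : opens X -> Type)
    (r : forall U V : opens X, V `<=` U -> F U -> F V) : Prop :=
  forall (I : Type) (U : opens X) (V : I -> opens X)
    (hV : forall i, V i `<=` U),
    (forall x, U x -> exists i, V i x) ->
  forall s : forall i, F (V i),
    (forall i j (W : opens X) (hi : W `<=` V i) (hj : W `<=` V j),
       r (V i) W hi (s i) = r (V j) W hj (s j)) ->
  exists! t : F U, forall i, r U (V i) (hV i) t = s i.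

Record ringedSpace (L : fieldType) := RingedSpace {
  pt :> topologicalType;
  O : opens pt -> comPzRingType;
  res : forall U V : opens pt, V `<=` U -> {rmorphism O U -> O V};
  cst : forall U : opens pt, {rmorphism L -> O U};
  O_presheaf : presheaf_axiom (fun U V (h : V `<=` U) => res h : O U -> O V);
  O_sheaf : sheaf_axiom (fun U V (h : V `<=` U) => res h : O U -> O V);
  res_cst : forall (U V : opens pt) (h : V `<=` U) c,
    res h (cst U c) = cst V c }.

Section Schemes.
Variables (L : fieldType) (X : ringedSpace L).

(* [x] lies in [U] and the germ of [f] at [x] is a unit *)
Definition unit_at (U : opens X) (f : O U) (x : X) : Prop :=
  exists (V : opens X) (h : V `<=` U), V x /\ exists g, g * res h f = 1.

Lemma open_unit_at (U : opens X) (f : O U) : open [set x | unit_at f x].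
Proof.
rewrite openE => x /= [V [h [Vx Hg]]]; rewrite /interior nbhsE /=.
exists V => /=; first by split => //; exact: oset_open.
by move=> y Vy; exists V, h.
Qed.

Definition basic_open (U : opens X) (f : O U) : opens X := Opens (open_unit_at f).

Lemma basic_open_sub (U : opens X) (f : O U) : basic_open f `<=` U.
Proof. by move=> x [V [h [Vx _]]]; exact: h. Qed.

(* All stalks are local rings: non-units of each stalk are stable under sums,
   and 0 is not a unit. *)
Definition locally_ringed : Prop :=
  forall (U : opens X) (x : X), U x ->
    ~ unit_at (0 : O U) x /\
    (forall f g : O U, unit_at (f + g) x -> unit_at f x \/ unit_at g x).

Definition prime_ideal (A : comPzRingType) (p : set A) : Prop :=
  [/\ p 0, ~ p 1,
      (forall a b, p a -> p b -> p (a + b)),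
      (forall a b, p b -> p (a * b))
    & (forall a b, p (a * b) -> p a \/ p b)].

(* For locally ringed [X]: the canonical map [U -> Spec (O U)], sending [x] to
   the ideal of the functions whose germ at [x] is not a unit, is an isomorphism
   of locally ringed spaces.  It is bijective (first clause), a homeomorphism
   since the preimages of the principal open sets form a basis of [U] (second
   clause), and identifies [O (basic_open f)] with the localization of [O U] at
   [f] (last two clauses). *)
Definition affine (U : opens X) : Prop :=
  [/\ (forall p : set (O U), prime_ideal p ->
         exists! x, U x /\ forall f, p f <-> ~ unit_at f x),
      (forall (V : opens X) x, V `<=` U -> V x ->
         exists f : O U, unit_at f x /\ basic_open f `<=` V),
      (forall (f : O U) (s : O (basic_open f)),
         exists (n : nat) (a : O U),
           res (@basic_open_sub U f) a = s * res (@basic_open_sub U f) f ^+ n)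
    & (forall f a : O U, res (@basic_open_sub U f) a = 0 ->
         exists n : nat, f ^+ n * a = 0)].

Definition scheme : Prop :=
  locally_ringed /\ forall x : X, exists U : opens X, U x /\ affine U.

Definition finitely_generated_algebra (U : opens X) : Prop :=
  exists gens : seq (O U), forall S : set (O U),
    (forall c, S (cst U c)) -> (forall a, a \in gens -> S a) ->
    (forall a b, S a -> S b -> S (a + b)) ->
    (forall a b, S a -> S b -> S (a * b)) ->
    forall a, S a.

Definition finite_type : Prop :=
  exists (n : nat) (U : 'I_n -> opens X),
    (forall x, exists i, U i x) /\
    (forall i, affine (U i) /\ finitely_generated_algebra (U i)).

(* The diagonal of [X] over [L] is a closed immersion: over each product of
   affine open sets [U], [V], it is affine and given by a surjection
   [O U (x)_L O V -> O (U `&` V)]. *)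
Definition separated : Prop :=
  forall U V : opens X, affine U -> affine V ->
    affine (opensI U V) /\
    forall c : O (opensI U V), exists s : seq (O U * O V),
      c = \sum_(ab <- s) res (@opensIl _ U V) ab.1
                       * res (@opensIr _ U V) ab.2.

(* Infinitesimal lifting property of the [L]-algebra [O U]. *)
Definition formally_smooth (U : opens X) : Prop :=
  forall (C B : comPzRingType) (c : {rmorphism L -> C}) (q : {rmorphism C -> B}),
    (forall b, exists a, q a = b) ->
    (forall a a', q a = 0 -> q a' = 0 -> a * a' = 0) ->
  forall phi : {rmorphism O U -> B},
    (forall k, phi (cst U k) = q (c k)) ->
  exists psi : {rmorphism O U -> C},
    (forall k, psi (cst U k) = c k) /\ (forall f, q (psi f) = phi f).

(* Together with [finite_type], this says that [X] is smooth over [L]. *)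
Definition locally_formally_smooth : Prop :=
  forall x : X, exists U : opens X, [/\ U x, affine U & formally_smooth U].

Definition smooth_variety : Prop :=
  [/\ scheme, separated, finite_type & locally_formally_smooth].

End Schemes.

Definition preim (X Y : topologicalType) (f : X -> Y) (cf : continuous f)
    (U : opens Y) : opens X :=
  Opens (open_comp (fun x _ => cf x) (oset_open U)).

Record morphism (L : fieldType) (X Y : ringedSpace L) := Morphism {
  mfun :> X -> Y;
  mfun_continuous : continuous mfun;
  pull : forall U : opens Y,
    {rmorphism O U -> O (preim mfun_continuous U)};
  pull_res : forall (U V : opens Y) (h : V `<=` U)
      (h' : preim mfun_continuous V `<=` preim mfun_continuous U) f,
    pull V (res h f) = res h' (pull U f);
  pull_cst : forall (U : opens Y) c, pull U (cst U c) = cst _ c;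
  pull_local : forall (U : opens Y) (f : O U) (x : X),
    U (mfun x) -> unit_at (pull U f) x -> unit_at f (mfun x) }.

Definition minv (L : fieldType) (X Y : ringedSpace L) (f : morphism X Y)
  (U : opens Y) : opens X := preim (@mfun_continuous _ _ _ f) U.

Section Dimension.
Variable X : topologicalType.

Definition irreducible (A : set X) : Prop :=
  A !=set0 /\ forall C D : set X, closed C -> closed D ->
    A `<=` C `|` D -> A `<=` C \/ A `<=` D.

(* There is a chain of length [n] of irreducible closed subsets of the
   subspace [S]. *)
Definition dim_ge (S : set X) (n : nat) : Prop :=
  exists Z : nat -> set X,
    (forall i, (i <= n)%N -> irreducible (Z i) /\ Z i = S `&` closure (Z i)) /\
    (forall i, (i < n)%N -> Z i `<` Z i.+1).

Definition dim_eq (S : set X) (n : nat) : Prop := dim_ge S n /\ ~ dim_ge S n.+1.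

(* The dimension of [S] at [x], i.e. the least dimension of an open
   neighbourhood of [x] in [S], is [n]. *)
Definition dim_at (S : set X) (x : X) (n : nat) : Prop :=
  (exists V : opens X, V x /\ dim_eq (S `&` V) n) /\
  (forall V : opens X, V x -> dim_ge (S `&` V) n).

End Dimension.

(* [dord k.+1 p] : [p] is a differential operator of order at most [k] in the
   sense of Grothendieck; [dord 0 p] : [p] is zero. *)
Fixpoint dord (A : comPzRingType) (k : nat) (p : A -> A) : Prop :=
  if k is k'.+1 then forall a, dord k' (fun x => p (a * x) - a * p x)
  else forall x, p x = 0.

Section Dord.
Variable A : comPzRingType.
Implicit Types p q : A -> A.

Lemma eq_dord k p q : p =1 q -> dord k p -> dord k q.
Proof. by move=> /funext ->. Qed.

Lemma dord0 k p : (forall x, p x = 0) -> dord k p.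
Proof.
elim: k p => [|k IH] p p0 //= a; apply: IH => x.
by rewrite !p0 mulr0 subr0.
Qed.

Lemma dordS k p : dord k p -> dord k.+1 p.
Proof.
elim: k p => [|k IH] p dp; first exact: dord0.
by move=> a; apply: IH; exact: dp.
Qed.

Lemma dord_le k l p : (k <= l)%N -> dord k p -> dord l p.
Proof.
move=> /subnK <- dp; elim: (l - k)%N => [|n IH] //.
by rewrite addSn; apply: dordS.
Qed.

Lemma dordD k p q : dord k p -> dord k q -> dord k (fun x => p x + q x).
Proof.
elim: k p q => [|k IH] p q /= dp dq => [x|a]; first by rewrite dp dq addr0.
apply: eq_dord (IH _ _ (dp a) (dq a)) => x /=.
by rewrite mulrDr opprD addrACA.
Qed.

Lemma dordN k p : dord k p -> dord k (fun x => - p x).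
Proof.
elim: k p => [|k IH] p /= dp => [x|a]; first by rewrite dp oppr0.
apply: eq_dord (IH _ (dp a)) => x /=.
by rewrite mulrN opprD.
Qed.

Lemma dord_mul a : dord 1 (fun x : A => a * x).
Proof. by move=> b x; rewrite mulrCA subrr. Qed.

Lemma dord_comp k l p q : (forall x y, p (x - y) = p x - p y) ->
  dord k p -> dord l q -> dord (k + l) (fun x => p (q x)).
Proof.
move=> pB; have p0 : p 0 = 0 by have := pB 0 0; rewrite !subrr.
have [n] := ubnP (k + l); elim: n k l p q pB p0 => // n IH [|k] [|l] p q pB p0.
- by move=> _ /= dp _ x; rewrite dp.
- by move=> _ dp _; apply: dord0 => x; rewrite (dp : forall x, p x = 0).
- by move=> _ _ dq; apply: dord0 => x; rewrite (dq : forall x, q x = 0).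
rewrite ltnS => le_n dp dq a.
have d1 : dord (k.+1 + l) (fun x => p (q (a * x) - a * q x)).
  by apply: (IH k.+1 l p (fun x => q (a * x) - a * q x) pB p0 _ dp (dq a));
     rewrite addSnnS.
have d2 : dord (k + l.+1) (fun x => p (a * q x) - a * p (q x)).
  apply: (IH k l.+1 (fun x => p (a * x) - a * p x) q _ _ le_n (dp a) dq).
    by move=> x y; rewrite mulrBr !pB mulrBr !opprD !opprK addrACA.
  by rewrite mulr0 p0 mulr0 subrr.
rewrite addSnnS in d1.
apply: eq_dord (dordD d1 d2) => x /=.
by rewrite pB addrA subrK.
Qed.

End Dord.

Section DiffOp.
Variables (L : fieldType) (Y : ringedSpace L).

(* Sections over [U] of the sheaf of differential operators: the [L]-linear
   endomorphisms of the sheaf [O] restricted to [U] which are locally of finite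
   order. *)
Record dop (U : opens Y) := Dop {
  dfam : forall V : opens Y, V `<=` U -> O V -> O V;
  dfam_linear : forall (V : opens Y) (h : V `<=` U) c f g,
    dfam h (cst V c * f + g) = cst V c * dfam h f + dfam h g;
  dfam_res : forall (V W : opens Y) (hV : V `<=` U) (hW : W `<=` U)
      (h : W `<=` V) f,
    res h (dfam hV f) = dfam hW (res h f);
  dfam_order : forall x, U x -> exists (V : opens Y) (k : nat), V x /\
    forall (W : opens Y) (h : W `<=` U), W `<=` V -> dord k (dfam h) }.

Lemma dopP (U : opens Y) (P Q : dop U) :
  (forall (V : opens Y) (h : V `<=` U) f, dfam P h f = dfam Q h f) -> P = Q.
Proof.
case: P Q => [p p1 p2 p3] [q q1 q2 q3] /= pq.
have e : p = q.
  by apply: functional_extensionality_dep => V;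
     apply: functional_extensionality_dep => h; apply/funext => f; apply: pq.
move: q1 q2 q3; rewrite -e => q1 q2 q3.
by rewrite (Prop_irrelevance q1 p1) (Prop_irrelevance q2 p2)
           (Prop_irrelevance q3 p3).
Qed.

Lemma dfamB (U : opens Y) (P : dop U) (V : opens Y) (h : V `<=` U) f g :
  dfam P h (f - g) = dfam P h f - dfam P h g.
Proof.
have := dfam_linear P h (- 1) g f.
by rewrite rmorphN rmorph1 !mulN1r ![- _ + _]addrC.
Qed.

Section Ops.
Variable U : opens Y.
Implicit Types P Q : dop U.

Lemma dop_order2 P Q x : U x -> exists (V : opens Y) (k l : nat), V x /\
  forall (W : opens Y) (h : W `<=` U), W `<=` V ->
    dord k (dfam P h) /\ dord l (dfam Q h).
Proof.
move=> Ux.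
have [V [k [Vx HV]]] := dfam_order P Ux.
have [V' [l [Vx' HV']]] := dfam_order Q Ux.
exists (opensI V V'), k, l; split; first by split.
by move=> W h hW; split; [apply: HV | apply: HV'] => y /hW [].
Qed.

Definition dop_zero : dop U.
refine (@Dop U (fun V _ _ => 0) _ _ _).
- by move=> *; rewrite mulr0 addr0.
- by move=> *; rewrite rmorph0.
- by move=> x Ux; exists U, 0%N.
Defined.

Definition dop_add P Q : dop U.
refine (@Dop U (fun V h f => dfam P h f + dfam Q h f) _ _ _).
- by move=> *; rewrite !dfam_linear mulrDr addrACA.
- by move=> V W hV hW h f; rewrite rmorphD /= !(dfam_res _ hV hW h).
- move=> x Ux; have [V [k [l [Vx H]]]] := dop_order2 P Q Ux.
  exists V, (maxn k l); split=> // W h /(H W h) [HP HQ].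
  by apply: dordD; [apply: dord_le HP | apply: dord_le HQ];
     rewrite ?leq_maxl ?leq_maxr.
Defined.

Definition dop_opp P : dop U.
refine (@Dop U (fun V h f => - dfam P h f) _ _ _).
- by move=> *; rewrite !dfam_linear opprD mulrN.
- by move=> V W hV hW h f; rewrite rmorphN /= (dfam_res _ hV hW h).
- move=> x Ux; have [V [k [Vx H]]] := dfam_order P Ux.
  by exists V, k; split=> // W h /(H W h) HP; apply: dordN.
Defined.

Definition dop_one : dop U.
refine (@Dop U (fun V _ f => f) _ _ _).
- by [].
- by [].
- move=> x Ux; exists U, 1%N; split=> // W h _ a y /=.
  by rewrite subrr.
Defined.

Definition dop_mul P Q : dop U.
refine (@Dop U (fun V h f => dfam P h (dfam Q h f)) _ _ _).
- by move=> *; rewrite !dfam_linear.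
- by move=> V W hV hW h f; rewrite !(dfam_res _ hV hW h).
- move=> x Ux; have [V [k [l [Vx H]]]] := dop_order2 P Q Ux.
  exists V, (k + l)%N; split=> // W h /(H W h) [HP HQ].
  by apply: dord_comp => //; exact: dfamB.
Defined.

Lemma dop_addA : associative dop_add.
Proof. by move=> P Q S; apply: dopP => V h f /=; rewrite addrA. Qed.
Lemma dop_addC : commutative dop_add.
Proof. by move=> P Q; apply: dopP => V h f /=; rewrite addrC. Qed.
Lemma dop_add0 : left_id dop_zero dop_add.
Proof. by move=> P; apply: dopP => V h f /=; rewrite add0r. Qed.
Lemma dop_addN : left_inverse dop_zero dop_opp dop_add.
Proof. by move=> P; apply: dopP => V h f /=; rewrite addNr. Qed.
Lemma dop_mulA : associative dop_mul.
Proof. by move=> P Q S; apply: dopP. Qed.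
Lemma dop_mul1 : left_id dop_one dop_mul.
Proof. by move=> P; apply: dopP. Qed.
Lemma dop_mulr1 : right_id dop_one dop_mul.
Proof. by move=> P; apply: dopP. Qed.
Lemma dop_mulDl : left_distributive dop_mul dop_add.
Proof. by move=> P Q S; apply: dopP. Qed.
Lemma dop_mulDr : right_distributive dop_mul dop_add.
Proof.
move=> P Q S; apply: dopP => V h f /=.
by have := dfam_linear P h 1 (dfam Q h f) (dfam S h f); rewrite rmorph1 !mul1r.
Qed.

HB.instance Definition _ := gen_eqMixin (dop U).
HB.instance Definition _ := gen_choiceMixin (dop U).
HB.instance Definition _ := GRing.isPzRing.Build (dop U)
  dop_addA dop_addC dop_add0 dop_addN dop_mulA dop_mul1 dop_mulr1
  dop_mulDl dop_mulDr.

Definition dop_fun (f : O U) : dop U.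
refine (@Dop U (fun V h g => res h f * g) _ _ _).
- by move=> V h c g1 g2; rewrite mulrDr mulrCA.
- move=> V W hV hW h g; rewrite rmorphM /=; congr (_ * _).
  by symmetry; apply: (O_presheaf Y).2.
- by move=> x Ux; exists U, 1%N; split=> // W h _; apply: dord_mul.
Defined.

Definition dop_app P (f : O U) : O U := dfam P (@subset_refl _ U) f.

Definition order_le (k : nat) P : Prop :=
  forall (V : opens Y) (h : V `<=` U), dord k.+1 (dfam P h).

Definition derivation P : Prop :=
  forall (V : opens Y) (h : V `<=` U) f g,
    dfam P h (f * g) = dfam P h f * g + f * dfam P h g.

(* Sections over [U] of the tangent sheaf; an [L]-derivation is of order at
   most 1, so that all of them belong to [dop U]. *)
Definition vfield := {v : dop U | derivation v}.

End Ops.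

Definition dres (U V : opens Y) (h : V `<=` U) (P : dop U) : dop V.
refine (@Dop V (fun W hW => dfam P (subset_trans hW h)) _ _ _).
- by move=> *; rewrite dfam_linear.
- by move=> *; apply: dfam_res.
- move=> x /h Ux; have [V' [k [Vx H]]] := dfam_order P Ux.
  by exists V', k; split=> // W hW; apply: H.
Defined.

Definition Dsheaf (U : opens Y) : pzRingType := dop U.

End DiffOp.

Record moduleSheaf (X : topologicalType) (R : opens X -> pzRingType)
    (rres : forall U V : opens X, V `<=` U -> R U -> R V) := ModuleSheaf {
  sec :> forall U : opens X, lmodType (R U);
  mres : forall U V : opens X, V `<=` U -> sec U -> sec V;
  mresD : forall (U V : opens X) (h : V `<=` U) m n,
    mres h (m + n) = mres h m + mres h n;
  mresZ : forall (U V : opens X) (h : V `<=` U) r m,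
    mres h (r *: m) = rres U V h r *: mres h m;
  m_presheaf : presheaf_axiom (fun U V (h : V `<=` U) => @mres U V h);
  m_sheaf : sheaf_axiom (fun U V (h : V `<=` U) => @mres U V h) }.

Definition Omodule (L : fieldType) (X : ringedSpace L) :=
  @moduleSheaf X (fun U => O U) (fun U V h => res h).

Definition Dmodule (L : fieldType) (Y : ringedSpace L) :=
  @moduleSheaf Y (@Dsheaf L Y) (@dres L Y).

(* Coherence over a sheaf of rings [R] of a subsheaf [N] of a sheaf [M] of
   abelian groups, [R] acting on [M] through [act]. *)
Section Coherence.
Variables (X : topologicalType) (R : opens X -> pzRingType)
  (rres : forall U V : opens X, V `<=` U -> R U -> R V)
  (M : opens X -> zmodType)
  (mr : forall U V : opens X, V `<=` U -> M U -> M V)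
  (act : forall U : opens X, R U -> M U -> M U)
  (N : forall U : opens X, set (M U)).

Definition locally_spanned (V : opens X) n (m : 'I_n -> M V) : Prop :=
  forall (W : opens X) (hW : W `<=` V) (s : M W), N s -> forall x, W x ->
    exists (W' : opens X) (h : W' `<=` W) (h' : W' `<=` V), W' x /\
      exists r : 'I_n -> R W',
        mr h s = \sum_i act (r i) (mr h' (m i)).

Definition finite_type_module : Prop :=
  forall x : X, exists (V : opens X) n (m : 'I_n -> M V),
    [/\ V x, (forall i, N (m i)) & locally_spanned m].

Definition relation (V W : opens X) (h : W `<=` V) n (m : 'I_n -> M V)
    (r : 'I_n -> R W) : Prop :=
  \sum_i act (r i) (mr h (m i)) = 0.

Definition relations_finite_type (V : opens X) n (m : 'I_n -> M V) : Prop :=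
  forall x, V x -> exists (V' : opens X) (hV : V' `<=` V) q
      (rel : 'I_q -> 'I_n -> R V'),
    [/\ V' x, (forall j, relation hV m (rel j))
      & forall (W : opens X) (hW : W `<=` V) (h : W `<=` V') (r : 'I_n -> R W),
          relation hW m r ->
          forall y, W y -> exists (W' : opens X) (k : W' `<=` W)
              (k' : W' `<=` V'), W' y /\
            exists c : 'I_q -> R W', forall i,
              rres k (r i) = \sum_j c j * rres k' (rel j i)].

Definition coherent : Prop :=
  finite_type_module /\
  forall (V : opens X) n (m : 'I_n -> M V),
    (forall i, N (m i)) -> relations_finite_type m.

End Coherence.

Definition coherent_module (X : topologicalType) (R : opens X -> pzRingType)
    (rres : forall U V : opens X, V `<=` U -> R U -> R V)
    (M : moduleSheaf rres) : Prop :=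
  coherent rres (M := fun U => M U) (@mres _ _ _ M) (fun U r m => r *: m)
    (fun U => setT).

Definition support (X : topologicalType) (R : opens X -> pzRingType)
    (rres : forall U V : opens X, V `<=` U -> R U -> R V)
    (M : moduleSheaf rres) : set X :=
  [set x | exists (U : opens X) (m : M U), U x /\
    forall (V : opens X) (h : V `<=` U), V x -> mres h m <> 0].

Definition nonzero_on (X : topologicalType) (R : opens X -> pzRingType)
    (rres : forall U V : opens X, V `<=` U -> R U -> R V)
    (M : moduleSheaf rres) (C : set X) : Prop :=
  exists (U : opens X) (m : M U), U `<=` C /\ m <> 0.

(* [T = Spec_Y (Sym Theta_Y)]: [T] is affine over [Y] and, over each affine open
   set [U], the functions on its preimage form the symmetric algebra over [O U]
   of the module of vector fields on [U].  [taut] sends a vector field to the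
   corresponding function, linear on the fibers. *)
Record cotangentBundle (L : fieldType) (Y : ringedSpace L) := CotangentBundle {
  cot :> ringedSpace L;
  cot_scheme : scheme cot;
  proj : morphism cot Y;
  taut : forall U : opens Y, vfield U -> O (minv proj U);
  tautD : forall (U : opens Y) (u v w : vfield U),
    sval w = sval u + sval v -> taut w = taut u + taut v;
  tautZ : forall (U : opens Y) (f : O U) (v w : vfield U),
    sval w = dop_fun f * sval v -> taut w = pull proj U f * taut v;
  taut_res : forall (U V : opens Y) (h : V `<=` U)
      (h' : minv proj V `<=` minv proj U) (v : vfield U) (w : vfield V),
    sval w = dres h (sval v) -> taut w = res h' (taut v);
  cot_affine : forall U : opens Y, affine U -> affine (minv proj U);
  cot_sym : forall U : opens Y, affine U ->
    forall (C : comPzRingType) (phi : {rmorphism O U -> C})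
      (tau : vfield U -> C),
    (forall u v w : vfield U,
       sval w = sval u + sval v -> tau w = tau u + tau v) ->
    (forall f (v w : vfield U),
       sval w = dop_fun f * sval v -> tau w = phi f * tau v) ->
    let extends (psi : {rmorphism O (minv proj U) -> C}) :=
      (forall f, psi (pull proj U f) = phi f) /\
      (forall v, psi (taut v) = tau v) in
    (exists psi, extends psi) /\
    (forall psi psi', extends psi -> extends psi' -> psi =1 psi') }.

Section SingularSupport.
Variables (L : fieldType) (Y : ringedSpace L) (T : cotangentBundle Y)
  (M : Dmodule Y).
Notation pi := (proj T).

Definition filtration := int -> forall U : opens Y, set (M U).

Definition O_act (U : opens Y) (f : O U) (m : M U) : M U :=
  (dop_fun f : Dsheaf U) *: m.

Definition O_submodule (N : forall U : opens Y, set (M U)) : Prop :=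
  [/\ (forall U, N U 0),
      (forall (U : opens Y) m n, N U m -> N U n -> N U (m + n)),
      (forall (U : opens Y) f m, N U m -> N U (O_act f m)),
      (forall (U V : opens Y) (h : V `<=` U) m, N U m -> N V (mres h m))
    & (forall (U : opens Y) m,
         (forall x, U x -> exists (V : opens Y) (h : V `<=` U),
            V x /\ N V (mres h m)) -> N U m)].

Definition coherent_O_submodule (N : forall U : opens Y, set (M U)) : Prop :=
  O_submodule N /\
  coherent (R := fun U => O U) (fun U V h => res h) (M := fun U => M U) (@mres _ _ _ M)
    O_act N.

Definition compatible_filtration (G : filtration) : Prop :=
  [/\ (forall k, coherent_O_submodule (G k)),
      (forall k (U : opens Y) m, G k U m -> G (k + 1) U m),
      (forall (U : opens Y) (m : M U) x, U x ->
         exists (V : opens Y) (h : V `<=` U) k, V x /\ G k V (mres h m)),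
      (exists k0 : int, forall (k : int) (U : opens Y) m, (k <= k0)%R -> G k U m -> m = 0)
    & (forall (j : nat) k (U : opens Y) (P : dop U) m,
         order_le j P -> G k U m -> G (k + j%:Z) U ((P : Dsheaf U) *: m))].

(* [E], with the maps [s k] sending sections of [G k] to their classes in
   [G k / G (k - 1)], is the associated graded module of [G], viewed as a
   module on the cotangent bundle: a function [f] on [Y] and a vector field [v]
   act on classes by [f [m]_k = [f m]_k] and [taut v [m]_k = [v m]_(k+1)], and
   over an affine open set [U], the sections of [E] on the preimage of [U] are the
   direct sum over [k] of the quotients [G k U / G (k - 1) U]. *)
Record is_gr (G : filtration) (E : Omodule T)
    (s : int -> forall U : opens Y, M U -> E (minv pi U)) : Prop := IsGr {
  gr_add : forall k (U : opens Y) m n, G k U m -> G k U n ->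
    s k U (m + n) = s k U m + s k U n;
  gr_fun : forall k (U : opens Y) f m, G k U m ->
    s k U (O_act f m) = pull pi U f *: s k U m;
  gr_taut : forall k (U : opens Y) (v : vfield U) m, G k U m ->
    s (k + 1) U ((sval v : Dsheaf U) *: m) = taut T v *: s k U m;
  gr_res : forall k (U V : opens Y) (h : V `<=` U)
      (h' : minv pi V `<=` minv pi U) m, G k U m ->
    s k V (mres h m) = mres h' (s k U m);
  gr_ker : forall k (U : opens Y) m, affine U -> G k U m ->
    (s k U m = 0 <-> G (k - 1) U m);
  gr_span : forall (U : opens Y) (e : E (minv pi U)), affine U ->
    exists (k0 : int) n (m : 'I_n -> M U),
      (forall i : 'I_n, G (k0 + i%:Z) U (m i)) /\
      e = \sum_(i < n) s (k0 + i%:Z) U (m i);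
  gr_direct : forall (U : opens Y) (k0 : int) n (m : 'I_n -> M U), affine U ->
    (forall i : 'I_n, G (k0 + i%:Z) U (m i)) ->
    \sum_(i < n) s (k0 + i%:Z) U (m i) = 0 ->
    forall i : 'I_n, s (k0 + i%:Z) U (m i) = 0 }.

(* [Z] is the support of the associated graded module of a good filtration
   of [M] (and does not depend on it). *)
Definition singular_support (Z : set T) : Prop :=
  exists (G : filtration) (E : Omodule T)
      (s : int -> forall U : opens Y, M U -> E (minv pi U)),
    [/\ compatible_filtration G, is_gr G s, coherent_module E & Z = support E].

Definition holonomic : Prop :=
  coherent_module M /\
  exists2 Z : set T, singular_support Z &
    forall y : Y, exists2 n : nat,
      dim_eq (connected_component setT y) n &
      ~ nonzero_on M (connected_component setT y) \/
      dim_eq (Z `&` pi @^-1` connected_component setT y) n.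

End SingularSupport.

(* An alternating [L]-biderivation of [A] ([c] being the structure map of the
   [L]-algebra [A]) with values in [E]; these are the [A]-linear maps to [E] from
   the module of Kaehler 2-forms of [A] over [L], evaluated on [da /\ db]. *)
Definition alternating_biderivation (L A : comPzRingType) (c : L -> A)
    (E : lmodType A) (b : A -> A -> E) : Prop :=
  [/\ (forall f, b f f = 0),
      (forall f g h, b (f + g) h = b f h + b g h),
      (forall f g h, b h (f + g) = b h f + b h g),
      (forall f g h, b (f * g) h = f *: b g h + g *: b f h)
    & (forall k h, b (c k) h = 0)].

(* The 1-form [sum_i a_i d(b_i)] is represented by the family of the
   [(a_i, b_i)]; its differential [sum_i da_i /\ db_i] vanishes in the module of
   Kaehler 2-forms iff all linear maps from that module kill it. *)
Definition closed_1form (L A : comPzRingType) (c : L -> A) n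
    (theta : 'I_n -> A * A) : Prop :=
  forall (E : lmodType A) (b : A -> A -> E), alternating_biderivation c b ->
    \sum_i b (theta i).1 (theta i).2 = 0.

Section Lagrangian.
Variables (L : fieldType) (Y : ringedSpace L) (T : cotangentBundle Y).
Notation pi := (proj T).

Definition coordinates (U : opens Y) n (y : 'I_n -> O U)
    (d : 'I_n -> vfield U) : Prop :=
  (forall i j, dop_app (sval (d i)) (y j) = (i == j)%:R) /\
  (forall (V : opens Y) (h : V `<=` U) (v : vfield V),
     sval v = \sum_i dop_fun (dop_app (sval v) (res h (y i)))
                     * dres h (sval (d i))).

(* [sum_i xi_i dy_i], with [xi i = taut (d i)], restricted to [W] *)
Definition canonical_1form (U : opens Y) n (y : 'I_n -> O U)
    (d : 'I_n -> vfield U) (W : opens T) (h : W `<=` minv pi U)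
    (i : 'I_n) : O W * O W :=
  (res h (taut T (d i)), res h (pull pi U (y i))).

(* [R] is the ring of functions on the trace on [W] of the closed subset [Z]
   with its reduced structure: [q] is onto and kills the functions which
   vanish on [Z]. *)
Definition reduced_trace (Z : set T) (W : opens T) (R : comPzRingType)
    (q : {rmorphism O W -> R}) : Prop :=
  (forall r, exists f, q f = r) /\
  (forall f, q f = 0 <-> forall z, Z z -> W z -> ~ unit_at f z).

(* The pullback of the symplectic form to [Z] vanishes near [z]. *)
Definition isotropic_at (Z : set T) (z : T) : Prop :=
  exists (U : opens Y) n (y : 'I_n -> O U) (d : 'I_n -> vfield U)
      (W : opens T) (h : W `<=` minv pi U),
    [/\ coordinates y d, W z, affine W
      & forall (R : comPzRingType) (q : {rmorphism O W -> R}),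
          reduced_trace Z q ->
          closed_1form (fun k : L => q (cst W k))
            (fun i => (q (canonical_1form y d h i).1,
                       q (canonical_1form y d h i).2))].

Definition lagrangian (Z : set T) : Prop :=
  [/\ closed Z,
      (exists V : opens T, Z `<=` closure (Z `&` V) /\
         forall z, Z z -> V z -> isotropic_at Z z)
    & (forall z, Z z -> exists2 n : nat,
         dim_at setT (pi z) n & dim_at Z z n)].

End Lagrangian.

(* Main.v *)
(* At a generic point of a component of the singular support, with prime ideal
   [P] in the algebra [S] of functions on the cotangent space over a coordinate
   neighbourhood, one has [{P, P} `<=` P] (Gabber).  This is proved by a trace
   argument over [S], for the action of the Rees algebra on the Rees module of
   [M], on a basis over a maximal polynomial subalgebra [O] of [S] meeting [P]
   in [0].  Hence the gradients of the elements of [P] span an isotropic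
   subspace of the [2n]-dimensional space over the residue field, and the
   component has dimension at least [n].  Holonomicity gives the other
   inequality, so that this subspace is Lagrangian: near the generic point, the
   symplectic form lies in the ideal generated by the [dp] with [p] in [P], and
   its pullback vanishes.

   Dimensions are computed by comparing chains of primes with families which are
   algebraically independent modulo a prime.  The coordinates come from formal
   smoothness, applied to a subalgebra of a square-zero extension of [O U], and
   extending derivations to residue fields bounds the dimension of [Y].  Any two
   good filtrations are comparable up to a shift over an affine open set, whence
   the independence of the singular support. *)
From HB Require Import structures.
From mathcomp Require Import all_boot all_order all_algebra perm ssrAC ring zify.
From mathcomp Require Import boolp classical_sets topology.
Require Import Defs.

Set Implicit Arguments.
Unset Strict Implicit.
Unset Printing Implicit Defensive.

Import GRing.Theory.
Local Open Scope classical_set_scope.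
Local Open Scope ring_scope.

(** * Prime ideals of noetherian rings *)

(** Modules are never localized. The localization of [E] at a minimal prime [P] of its annihilator
    has finite length, and [O], whose nonzero elements lie outside [P], plays the role of a
    coefficient field: statements about the localization are made up to a factor outside [P]
    ([tors], [tors2]), and such factors are traded for elements of [O], over whose fractions the
    localization is finite-dimensional. The obstacle is that the trace has to be taken in
    [N / t^2 N], on which [O] does not act: an element of [O] has many lifts, and lifts commute only
    modulo [t]. Hence the matrices have operators as entries, and the coefficient of [t] in a
    commutator is computed only modulo higher levels of the flag, which is enough for its diagonal.
    Strict triangularity with respect to the flag is what makes the error terms disappear there.
    Characteristic zero is used for the rank [n] in the trace, for the derivative of a minimal
    relation, for the factor 2 of the symplectic form and for the factorials in the independence of
    coordinates. *)

Definition ideal (A : comPzRingType) (I : set A) : Prop :=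
  [/\ I 0, (forall a b, I a -> I b -> I (a + b)) & (forall a b, I b -> I (a * b))].

Definition fgen (A : comPzRingType) (I : set A) : Prop :=
  exists n (g : 'I_n -> A), (forall i, I (g i)) /\
    forall a, I a -> exists c : 'I_n -> A, a = \sum_i c i * g i.

Definition noeth (A : comPzRingType) : Prop := forall I : set A, ideal I -> fgen I.

Section Ideals.
Variable A : comPzRingType.
Implicit Types I J P Q : set A.

Lemma prime_ideal_ideal P : prime_ideal P -> ideal P.
Proof. by case. Qed.

Lemma ideal0 : ideal [set (0 : A)].
Proof. by split=> //= [a b -> ->|a b ->]; rewrite ?addr0 ?mulr0. Qed.

Lemma idealN I a : ideal I -> I a -> I (- a).
Proof. by move=> [_ _ IM] Ia; rewrite -mulN1r; exact: IM. Qed.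

Lemma idealB I a b : ideal I -> I a -> I b -> I (a - b).
Proof. by move=> iI Ia Ib; case: (iI) => _ ID _; apply: ID => //; exact: idealN. Qed.

Lemma idealMr I a b : ideal I -> I a -> I (a * b).
Proof. by move=> [_ _ IM] Ia; rewrite mulrC; exact: IM. Qed.

Lemma ideal_sum I (T : Type) (r : seq T) (p : pred T) (F : T -> A) :
  ideal I -> (forall i, p i -> I (F i)) -> I (\sum_(i <- r | p i) F i).
Proof. by move=> [I0 ID IM] IF; apply: big_ind. Qed.

Lemma prime_notM P a b : prime_ideal P -> ~ P a -> ~ P b -> ~ P (a * b).
Proof. by move=> [_ _ _ _ pP] Pa Pb /pP []. Qed.

Lemma prime_notX P a n : prime_ideal P -> ~ P a -> ~ P (a ^+ n).
Proof.
move=> pP Pa; elim: n => [|n IH]; first by rewrite expr0; case: pP.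
by rewrite exprS; apply: prime_notM.
Qed.

Lemma prime_X P a n : prime_ideal P -> P (a ^+ n) -> P a.
Proof. by move=> pP /(contraPP (@prime_notX P a n pP)). Qed.

Lemma ideal_adjoin I x : ideal I ->
  ideal [set a | exists b c, I b /\ a = b + c * x].
Proof.
move=> iI; case: (iI) => I0 ID IM; split.
- by exists 0, 0; rewrite mul0r addr0.
- move=> _ _ [b [c [Ib ->]]] [b' [c' [Ib' ->]]].
  by exists (b + b'), (c + c'); split; [exact: ID | ring].
- move=> a _ [b [c [Ib ->]]].
  by exists (a * b), (a * c); split; [exact: IM | ring].
Qed.

Lemma sub_adjoin I x : I `<=` [set a | exists b c, I b /\ a = b + c * x].
Proof. by move=> a Ia; exists a, 0; rewrite mul0r addr0. Qed.

Lemma mem_adjoin I x : ideal I -> [set a | exists b c, I b /\ a = b + c * x] x.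
Proof. by case=> I0 _ _; exists 0, 1; rewrite mul1r add0r. Qed.

(** An ideal maximal among those that contain [I] and avoid [M] is prime: if it contains neither [a]
    nor [b], adjoining either of them meets [M], and the product of the two elements found would lie
    in the ideal as soon as [a * b] does. *)
Lemma krull (I M : set A) : ideal I -> M 1 ->
  (forall a b, M a -> M b -> M (a * b)) -> (forall a, I a -> ~ M a) ->
  exists Q, [/\ prime_ideal Q, I `<=` Q & forall a, Q a -> ~ M a].
Proof.
move=> iI M1 MM IM.
pose good J := [/\ ideal J, I `<=` J & forall a, J a -> ~ M a].
have [|Q [QQ maxQ]] := @Zorn_bigcup _ [set J | J = set0 \/ good J].
  move=> F FP totF.
  have [[J0 [FJ0 gJ0]]|noJ] := pselect (exists J, F J /\ good J); last first.
    left; rewrite -subset0 => a [J FJ Ja].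
    by case: (FP _ FJ) => [J0|gJ]; [rewrite J0 in Ja | apply: noJ; exists J].
  right; split.
  - split.
    + by exists J0 => //; case: gJ0 => -[].
    + move=> a b [J FJ Ja] [K FK Kb].
      have [JK|KJ] := totF _ _ FJ FK.
        exists K => //; case: (FP _ FK) => [K0|[[_ KD _] _ _]]; first by rewrite K0 in Kb.
        by apply: KD => //; exact: JK.
      exists J => //; case: (FP _ FJ) => [K0|[[_ KD _] _ _]]; first by rewrite K0 in Ja.
      by apply: KD => //; exact: KJ.
    + move=> a b [J FJ Jb]; exists J => //.
      by case: (FP _ FJ) => [K0|[[_ _ KM] _ _]]; [rewrite K0 in Jb | exact: KM].
  - by move=> a Ia; exists J0 => //; case: gJ0 => _ sI _; exact: sI.
  - move=> a [J FJ Ja]; case: (FP _ FJ) => [K0|[_ _ h]]; first by rewrite K0 in Ja.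
    exact: h.
have [iQ IQ QM] : good Q.
  case: QQ => // Q0; exfalso; apply: (maxQ I).
    by rewrite Q0; split => // /(_ 0); apply; case: iI.
  by right; split.
exists Q; split => //; case: (iQ) => Q0 QD QMu; split => //.
  by move/QM; exact.
move=> a b Qab; apply: contrapT => /not_orP [Qa Qb].
have key x : ~ Q x -> exists b c, Q b /\ M (b + c * x).
  move=> Qx; apply: contrapT => no.
  apply: (maxQ [set a | exists b c, Q b /\ a = b + c * x]); last first.
    right; split; first exact: ideal_adjoin.
    - by apply: subset_trans IQ _; exact: sub_adjoin.
    - by move=> _ [b' [c [Qb' ->]]] Mb; apply: no; exists b', c.
  by split; [exact: sub_adjoin | move=> /(_ _ (mem_adjoin x iQ))].
have [u [c [Qu Mu]]] := key _ Qa; have [v [d [Qv Mv]]] := key _ Qb.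
apply: (QM _ _ (MM _ _ Mu Mv)).
have -> : (u + c * a) * (v + d * b) = (v + d * b) * u + (c * a) * v + c * d * (a * b) by ring.
by apply: (QD); [apply: (QD)|]; apply: (QMu).
Qed.

(** A maximal counterexample exists by Zorn's lemma, because the union of a chain of ideals is
    finitely generated and thus already a member of the chain. *)
Lemma noeth_ind (Pr : set A -> Prop) : noeth A ->
  (forall I, ideal I -> (forall J, ideal J -> I `<` J -> Pr J) -> Pr I) ->
  forall I, ideal I -> Pr I.
Proof.
move=> nA ind I iI; apply: contrapT => nI.
pose bad J := ideal J /\ ~ Pr J.
have [|Q [QQ maxQ]] := @Zorn_bigcup _ [set J | J = set0 \/ bad J].
  move=> F FP totF.
  have [[J0 [FJ0 gJ0]]|noJ] := pselect (exists J, F J /\ bad J); last first.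
    left; rewrite -subset0 => a [J FJ Ja].
    by case: (FP _ FJ) => [J0|gJ]; [rewrite J0 in Ja | apply: noJ; exists J].
  right.
  have iU : ideal (\bigcup_(X in F) X).
    split.
    + by exists J0 => //; case: gJ0 => -[].
    + move=> a b [J FJ Ja] [K FK Kb].
      have [JK|KJ] := totF _ _ FJ FK.
        exists K => //; case: (FP _ FK) => [K0|[[_ KD _] _]]; first by rewrite K0 in Kb.
        by apply: KD => //; exact: JK.
      exists J => //; case: (FP _ FJ) => [K0|[[_ KD _] _]]; first by rewrite K0 in Ja.
      by apply: KD => //; exact: KJ.
    + move=> a b [J FJ Jb]; exists J => //.
      by case: (FP _ FJ) => [K0|[[_ _ KM] _]]; [rewrite K0 in Jb | exact: KM].
  have [n [g [gU Ug]]] := nA _ iU.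
  have [J [FJ gJ]] : exists J, F J /\ J !=set0 /\ forall i, J (g i).
    elim: n g gU {Ug} => [|n IH] g gU.
      by exists J0; split => //; split; [exists 0; case: gJ0 => -[] | case].
    have [J [FJ [nJ hJ]]] := IH (fun i => g (lift ord0 i)) (fun i => gU _).
    have [K FK Kg] := gU ord0.
    have [JK|KJ] := totF _ _ FJ FK.
      exists K; split => //; split; first by exists (g ord0).
      by move=> i; case: (unliftP ord0 i) => [j ->|-> //]; exact/JK/hJ.
    exists J; split => //; split => //.
    by move=> i; case: (unliftP ord0 i) => [j ->|->]; [exact: hJ | exact: KJ].
  suff <- : J = \bigcup_(X in F) X.
    case: (FP _ FJ) => // e; case: gJ => -[x]; rewrite e.
    by [].
  apply/seteqP; split => [a Ja|a /Ug [c ->]]; first by exists J.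
  case: gJ => nJ gJ.
  case: (FP _ FJ) => [e|[iJ _]]; first by case: nJ => x; rewrite e.
  by apply: ideal_sum => // i _; case: iJ => _ _; apply.
have [iQ nQ] : bad Q.
  case: QQ => // Q0; exfalso; apply: (maxQ I); last by right.
  by rewrite Q0; split => // /(_ 0); apply; case: iI.
apply: nQ; apply: ind => // J iJ QJ; apply: contrapT => nJ.
by apply: (maxQ J QJ); right.
Qed.

(** By noetherian induction: if [a * b] is in [I] while [a] and [b] are not, every prime over [I]
    contains [I + (a)] or [I + (b)]. *)
Lemma finite_primes I : noeth A -> ideal I ->
  exists s : seq (set A),
    (forall p : set A, p \in s -> prime_ideal p /\ I `<=` p) /\
    (forall Q, prime_ideal Q -> I `<=` Q -> exists p : set A, p \in s /\ p `<=` Q).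
Proof.
move=> nA; move: I; apply: noeth_ind => // I iI IH.
have [I1|I1] := pselect (I 1).
  by exists [::]; split => // Q [_ Q1 _ _ _] IQ; case: Q1; exact: IQ.
have [pI|npI] := pselect (prime_ideal I).
  exists [:: I]; split => [p|Q pQ IQ]; last by exists I; rewrite mem_head.
  by rewrite mem_seq1 => /eqP ->; split.
have [a [b [Iab Ia Ib]]] : exists a b, [/\ I (a * b), ~ I a & ~ I b].
  apply: contrapT => no; apply: npI; case: (iI) => I0 ID IM; split => // a b Iab.
  by apply: contrapT => /not_orP [Ia Ib]; apply: no; exists a, b.
have h x : ~ I x -> I `<` [set a | exists b c, I b /\ a = b + c * x].
  by move=> Ix; split; [exact: sub_adjoin | move=> /(_ _ (mem_adjoin x iI))].
have [s1 [s1p s1Q]] := IH _ (ideal_adjoin a iI) (h _ Ia).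
have [s2 [s2p s2Q]] := IH _ (ideal_adjoin b iI) (h _ Ib).
exists (s1 ++ s2); split => [p|Q pQ IQ].
  rewrite mem_cat => /orP [/s1p|/s2p] [pp sp]; split => //;
    by apply: subset_trans sp; exact: sub_adjoin.
have sub x : Q x -> [set a | exists b c, I b /\ a = b + c * x] `<=` Q.
  by case: pQ => _ _ QD QM _ Qx _ [u [c [Iu ->]]]; apply: QD; [exact: IQ | exact: QM].
have [/sub/(s1Q _ pQ) [p [ps pQ']]|/sub/(s2Q _ pQ) [p [ps pQ']]] : Q a \/ Q b.
- by case: pQ => _ _ _ _; apply; exact: IQ.
- by exists p; rewrite mem_cat ps.
- by exists p; rewrite mem_cat ps orbT.
Qed.

Definition min_prime I P := [/\ prime_ideal P, I `<=` P &
  forall Q, prime_ideal Q -> I `<=` Q -> Q `<=` P -> Q = P].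

(** [P] is a minimal member of the list of [finite_primes], and [g] a product of elements of the
    members not contained in [P]. Where [g] does not vanish, the zeros of [I] are those of [P]
    alone: [g] isolates one irreducible component. *)
Lemma exists_min_prime I Q : noeth A -> ideal I -> prime_ideal Q -> I `<=` Q ->
  exists P, [/\ min_prime I P, P `<=` Q & exists g, ~ P g /\
    forall Q', prime_ideal Q' -> I `<=` Q' -> ~ Q' g -> P `<=` Q'].
Proof.
move=> nA iI pQ IQ; have [s [sp sQ]] := finite_primes nA iI.
have [p0 [p0s p0Q]] := sQ _ pQ IQ.
have [P [Ps PQ Pmin]] : exists P, [/\ P \in s, P `<=` Q &
    forall p : set A, p \in s -> p `<=` P -> p = P].
  move: p0 p0s p0Q => p.
  (* Descent on the number of members of the list contained in [p]; passing to a strictly smaller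
     [q] loses at least [p] itself. *)
  have [k] := ubnP (size [seq q <- s | `[< q `<=` p >]]).
  elim: k p => // k IH p lek ps pQ'.
  have [|] := pselect (forall q, q \in s -> q `<=` p -> q = p); first by exists p.
  move=> /existsNP [q /not_implyP [qs /not_implyP [qp qNp]]].
  apply: (IH q) => //; last exact: subset_trans pQ'.
  rewrite -ltnS; apply: leq_trans lek; rewrite ltnS !size_filter.
  have sub : subpred (fun r => `[< r `<=` q >]) (fun r => `[< r `<=` p >]).
    by move=> r /asboolP rq; apply/asboolP; exact: subset_trans qp.
  rewrite ltn_neqAle sub_count // andbT; apply/eqP => e.
  have /(_ p ps) : {in s, forall r, `[< r `<=` q >] = `[< r `<=` p >]}.
    elim: (s) e => [//|r s' IH'] /=.
    have := sub_count sub s'; have := sub r.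
    case: (asboolP (r `<=` q)) => a; case: (asboolP (r `<=` p)) => b /= h1 h2 e r';
      rewrite inE => /orP [/eqP->|rs']; do ?[by apply/asboolP/asboolP];
      do ?[by rewrite (asboolT a) (asboolT b)]; do ?[by rewrite (asboolF a) (asboolF b)];
      try (by have := h1 isT); try (by apply: IH' => //; lia); by exfalso; lia.
  rewrite (asboolT (@subset_refl _ p)) => /asboolP pq.
  by apply: qNp; apply/seteqP.
have [pP IP] := sp _ Ps.
exists P; split => //.
  split => // Q' pQ' IQ' Q'P; have [p [ps pQ'']] := sQ _ pQ' IQ'.
  have e := Pmin _ ps (subset_trans pQ'' Q'P).
  by apply/seteqP; split => //; rewrite -e.
have [g [Pg gs]] : exists g, ~ P g /\ forall p : set A, p \in s -> ~ (p `<=` P) -> p g.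
  elim: s {sp sQ p0s Ps Pmin} (fun p ps => (sp p ps).1) => [|p s IH] sp.
    by exists 1; case: pP.
  have [q qs|g [Pg gs]] := IH; first by apply: sp; rewrite inE qs orbT.
  have [pP'|/existsNP [h /not_implyP [ph Ph]]] := pselect (p `<=` P).
    by exists g; split => // q; rewrite inE => /orP [/eqP -> //|]; exact: gs.
  exists (g * h); split; first exact: prime_notM.
  move=> q; rewrite inE => /orP [/eqP ->|qs] nq.
    by have [|_ _ _ qM _] := sp p; [exact: mem_head | exact: qM].
  by rewrite mulrC; have [|_ _ _ qM _] := sp q; [by rewrite inE qs orbT | apply: qM; apply: gs].
exists g; split => // Q' pQ' IQ' Q'g; have [p [ps pQ'']] := sQ _ pQ' IQ'.
have [pP'|npP] := pselect (p `<=` P); first by rewrite -(Pmin _ ps pP').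
by case: Q'g; apply: pQ''; apply: gs.
Qed.

(** Otherwise [krull], applied to the products of powers of [a] with elements outside [P], gives a
    prime over [I] that is contained in [P] and misses [a], against minimality. *)
Lemma min_prime_nilp I P a : ideal I -> min_prime I P -> P a ->
  exists s n, ~ P s /\ I (s * a ^+ n).
Proof.
move=> iI [pP IP Pmin] Pa; apply: contrapT => no.
pose M := [set x | exists s n, ~ P s /\ x = s * a ^+ n].
have [||b Ib [s [n [Ps e]]]|Q [pQ IQ QM]] := @krull I M iI.
- by exists 1, 0%N; rewrite expr0 mulr1; case: pP.
- move=> _ _ [s [n [Ps ->]]] [s' [n' [Ps' ->]]].
  exists (s * s'), (n + n')%N; split; first exact: prime_notM.
  by rewrite exprD; ring.
- by apply: no; exists s, n; rewrite -e.
have QP : Q `<=` P.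
  move=> x Qx; apply: contrapT => Px; apply: (QM _ Qx).
  by exists x, 0%N; rewrite expr0 mulr1.
apply: (QM a); first by rewrite (Pmin _ pQ IQ QP).
by exists 1, 1%N; rewrite expr1 mul1r; split => //; case: pP.
Qed.

End Ideals.

(** * The Hilbert basis theorem and finitely generated algebras *)

Section Noetherian.

Lemma span_ideal (A : comPzRingType) n (g : 'I_n -> A) :
  ideal [set a | exists c : 'I_n -> A, a = \sum_i c i * g i].
Proof.
split.
- by exists (fun=> 0); rewrite big1 // => i _; rewrite mul0r.
- move=> _ _ [c ->] [d ->]; exists (fun i => c i + d i).
  by rewrite -big_split; apply: eq_bigr => i _; rewrite mulrDl.
- move=> a _ [c ->]; exists (fun i => a * c i).
  by rewrite mulr_sumr; apply: eq_bigr => i _; rewrite mulrA.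
Qed.

Lemma span_mem (A : comPzRingType) n (g : 'I_n -> A) i :
  exists c : 'I_n -> A, g i = \sum_j c j * g j.
Proof.
exists (fun j => (j == i)%:R); rewrite (bigD1 i) //= eqxx mul1r big1 ?addr0 //.
by move=> j /negPf ->; rewrite mul0r.
Qed.

Lemma fgen_seq (A : comPzRingType) (I : set A) (s : seq A) :
  (forall x, x \in s -> I x) ->
  (forall J, ideal J -> (forall x, x \in s -> J x) -> I `<=` J) -> fgen I.
Proof.
move=> sI Is; exists (size s), (fun i => s`_i); split=> [i|].
  by apply: sI; exact: mem_nth.
apply: (Is _ (span_ideal _)) => x xs.
have xs' : (index x s < size s)%N by rewrite index_mem.
have [c e] := span_mem (fun i : 'I_(size s) => s`_i) (Ordinal xs').
by exists c; rewrite -e /= nth_index.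
Qed.

Lemma noeth_field (L : fieldType) : noeth L.
Proof.
move=> I [I0 ID IM]; have [[x [Ix x0]]|no] := pselect (exists x, I x /\ x != 0).
  exists 1%N, (fun=> x); split=> // a _; exists (fun=> a / x).
  by rewrite big_ord1 divfK.
exists 0%N, (fun=> 0); split=> [[]//|a Ia]; exists (fun=> 0).
by rewrite big_ord0; apply/eqP; apply: contrapT => a0; apply: no; exists a; split=> //; apply/negP.
Qed.

Lemma noeth_surj (B A : comPzRingType) (f : {rmorphism B -> A}) :
  (forall a, exists b, f b = a) -> noeth B -> noeth A.
Proof.
move=> fS nB I iI.
have iJ : ideal (f @^-1` I).
  case: iI => I0 ID IM; split=> [|a b|a b] /=.
  - by rewrite rmorph0.
  - by rewrite rmorphD; exact: ID.
  - by rewrite rmorphM; exact: IM.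
have [n [g [gI Ig]]] := nB _ iJ; exists n, (f \o g); split=> // a Ia.
have [b e] := fS a; case: (Ig b) => [|c ebc]; first by rewrite /= e.
exists (f \o c); rewrite -e ebc rmorph_sum; apply: eq_bigr => i _.
by rewrite rmorphM.
Qed.

(** The ideals [lead d] of leading coefficients increase with [d] and are all contained in some
    [lead D]. Elements of size at most [D.+1] are generated one degree at a time; the degree of any
    other is lowered by a multiple of one of these. *)
Lemma hilbert (R : comNzRingType) : noeth R -> noeth {poly R}.
Proof.
move=> nR I iI; case: (iI) => I0 ID IM.
pose lead d := [set a : R | exists f, [/\ I f, (size f <= d.+1)%N & f`_d = a]].
have iL d : ideal (lead d).
  split.
  - by exists 0; rewrite size_poly0 coef0.
  - move=> _ _ [f [If sf <-]] [g [Ig sg <-]]; exists (f + g); split; first exact: ID.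
      by rewrite (leq_trans (size_polyD _ _)) // geq_max sf.
    by rewrite coefD.
  - move=> a _ [f [If sf <-]]; exists (a%:P * f); split; first exact: IM.
      by rewrite mul_polyC (leq_trans (size_scale_leq _ _)).
    by rewrite coefCM.
have monoL d k : lead d `<=` lead (d + k)%N.
  move=> _ [f [If sf <-]]; exists ('X^k * f); split; first exact: IM.
    by rewrite (leq_trans (size_polyMleq _ _)) // size_polyXn; lia.
  by rewrite coefXnM ltnNge leq_addl addnK.
have mono d e : (d <= e)%N -> lead d `<=` lead e.
  by move=> /subnKC <-; exact: monoL.
have iU : ideal (\bigcup_d lead d).
  split.
  - by exists 0%N => //; case: (iL 0%N).
  - move=> a b [d _ da] [e _ eb]; exists (maxn d e) => //.
    by case: (iL (maxn d e)) => _ LD _; apply: LD;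
       [exact: (mono _ _ (leq_maxl _ _)) | exact: (mono _ _ (leq_maxr _ _))].
  - by move=> a b [d _ db]; exists d => //; case: (iL d) => _ _; apply.
have [n [g [gU Ug]]] := nR _ iU.
have [D hD] : exists D, forall d, lead d `<=` lead D.
  have [D hD] : exists D, forall i, lead D (g i).
    elim: n g gU {Ug} => [|n IH] g gU; first by exists 0%N; case.
    have [D hD] := IH (fun i => g (lift ord0 i)) (fun i => gU _).
    have [e _ ge] := gU ord0; exists (maxn D e) => i.
    case: (unliftP ord0 i) => [j ->|->]; first exact: (mono _ _ (leq_maxl _ _) _ (hD j)).
    exact: (mono _ _ (leq_maxr _ _)).
  exists D => d a da; have [|c ->] := Ug a; first by exists d.
  by apply: ideal_sum => // i _; case: (iL D) => _ _; apply.
have [s [sI Is]] : exists s : seq {poly R}, (forall x, x \in s -> I x) /\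
   forall J, ideal J -> (forall x, x \in s -> J x) ->
   forall f, I f -> (size f <= D.+1)%N -> J f.
  elim: (D.+1) => [|d [s [sI Is]]].
    exists [::]; split=> // J [J0 _ _] _ f _.
    by rewrite leqn0 size_poly_eq0 => /eqP ->.
  have [m [h [hl lh]]] := nR _ (iL d).
  have [F hF] := choice hl.
  exists (s ++ [seq F i | i <- enum 'I_m]); split.
    move=> x; rewrite mem_cat => /orP [/sI//|/mapP [i _ ->]].
    by case: (hF i).
  move=> J iJ sJ f If sf.
  have [|c e] := lh f`_d; first by exists f.
  rewrite -(subrK (\sum_i (c i)%:P * F i) f).
  have Ji i : J (F i).
    by apply: sJ; rewrite mem_cat; apply/orP; right; apply: map_f; rewrite mem_enum.
  have Js : J (\sum_i (c i)%:P * F i).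
    by apply: ideal_sum => // i _; case: iJ => _ _; apply.
  case: (iJ) => _ JD _; apply: JD => //; apply: (Is J iJ).
  - by move=> x xs; apply: sJ; rewrite mem_cat xs.
  - apply: idealB => //; apply: ideal_sum => // i _; apply: IM.
    by case: (hF i).
  apply/leq_sizeP => j dj.
  rewrite coefB coef_sum.
  have -> : \sum_i ((c i)%:P * F i)`_j = \sum_i c i * (F i)`_j.
    by apply: eq_bigr => i _; rewrite coefCM.
  move: dj; rewrite leq_eqVlt => /orP [/eqP <-|dj].
    rewrite e; apply/eqP; rewrite subr_eq0; apply/eqP; apply: eq_bigr => i _.
    by case: (hF i) => _ _ ->.
  rewrite (leq_sizeP _ _ sf) // big1 ?subr0 // => i _.
  by have [_ sF _] := hF i; rewrite (leq_sizeP _ _ sF) ?mulr0.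
apply: (fgen_seq sI) => J iJ sJ f If.
have [k] := ubnP (size f); elim: k f If => // k IH f If.
rewrite ltnS => sfk.
have [sf|sf] := leqP (size f) D.+1; first exact: (Is J).
have [|h [Ih sh eh]] := hD (size f).-1 f`_(size f).-1.
  by exists f; split=> //; lia.
pose q := 'X^((size f).-1 - D) * h.
have Jh : J h by apply: (Is J).
rewrite -(subrK q f); case: (iJ) => _ JD JM; apply: (JD); last exact: JM.
apply: IH; first by apply: idealB => //; apply: IM.
apply: (@leq_trans (size f)); last exact: sfk.
have f0 : (0 < size f)%N by exact: leq_ltn_trans sf.
rewrite -[X in (_ < X)%N](prednK f0) ltnS.
apply/leq_sizeP => j; rewrite coefB coefXnM leq_eqVlt => /orP [/eqP <-|lj].
  by rewrite ifF ?subKn ?eh ?subrr //; lia.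
rewrite ifF; last by lia.
rewrite (nth_default 0 (_ : (size f <= j)%N)); last by rewrite -(prednK f0).
by rewrite (leq_sizeP _ _ sh) ?subr0 //; lia.
Qed.

Definition fg_alg (L A : comPzRingType) (k : L -> A) (gens : seq A) : Prop :=
  forall S : set A, (forall c, S (k c)) -> (forall a, a \in gens -> S a) ->
    (forall a b, S a -> S b -> S (a + b)) ->
    (forall a b, S a -> S b -> S (a * b)) -> forall a, S a.

(** Rings of sections may be zero; this gives a ring with [1 != 0] the structure required for
    polynomials and quotients. *)
Definition nonzero_ring (A : comPzRingType) (h : (1 : A) != 0) : comNzRingType :=
  HB.pack_for comNzRingType (GRing.ComPzRing.sort A) (GRing.ComPzRing.class A) (GRing.PzSemiRing_isNonZero.Build A h).

Lemma noeth_fg (L : fieldType) (A : comPzRingType) (k : {rmorphism L -> A}) gens :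
  fg_alg k gens -> noeth A.
Proof.
have [e10 _ I iI|n10] := eqVneq (1 : A) 0.
  exists 0%N, (fun=> 0); split=> [[]//|a _]; exists (fun=> 0).
  by rewrite big_ord0 -[a]mul1r e10 mul0r.
pose A' := nonzero_ring n10.
pose k' : {rmorphism L -> A'} := k.
move=> fg.
suff [C [nC [g [gk gg]]]] : exists C : comNzRingType, noeth C /\
    exists g : {rmorphism C -> A'}, (forall c, exists x, g x = k c) /\
      forall a, a \in gens -> exists x, g x = a.
  apply: (@noeth_surj C A g) => //; apply: (fg) => //.
  - by move=> _ _ [x <-] [y <-]; exists (x + y); rewrite (rmorphD g).
  - by move=> _ _ [x <-] [y <-]; exists (x * y); rewrite (rmorphM g).
elim: gens {fg} => [|u gens [C [nC [g [gk gg]]]]].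
  exists L; split; first exact: noeth_field.
  by exists k'; split=> // c; exists c.
exists {poly C}; split; first exact: hilbert.
have cu : commr_rmorph g u by move=> x; exact: (@mulrC A').
exists (horner_morph cu); split.
  by move=> c; have [x <-] := gk c; exists x%:P; exact: horner_morphC.
move=> a; rewrite inE => /orP [/eqP ->|/gg [x <-]]; last first.
  by exists x%:P; exact: horner_morphC.
by exists 'X; exact: horner_morphX.
Qed.

End Noetherian.

(** * Residue domains and residue fields of primes *)

Section Residue.
Variables (A : comPzRingType) (P : set A) (pP : prime_ideal P).

Lemma prime_nz : (1 : A) != 0.
Proof. by apply/eqP => e; case: pP => P0 P1 _ _ _; apply: P1; rewrite e. Qed.

Let A' := nonzero_ring prime_nz.
Let S : pred A' := fun x => `[< P x >].

Lemma residue_idealr : idealr_closed S.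
Proof.
case: pP => P0 P1 PD PM _; split=> [||a u v].
- exact/asboolP.
- by apply/negP => /asboolP.
- move=> /asboolP Pu /asboolP Pv; apply/asboolP; apply: PD => //; exact: PM.
Qed.

Lemma residue_primer : prime_idealr_closed S.
Proof.
case: pP => _ _ _ _ PP u v /asboolP /PP [h|h]; apply/orP; [left|right]; exact/asboolP.
Qed.

HB.instance Definition _ := isIdealr.Build A' S residue_idealr.
HB.instance Definition _ := isPrimeIdealrClosed.Build A' S residue_primer.

Let Q := {ideal_quot (S : prime_idealr A')}.

Lemma residue_quot : exists (D : idomainType) (f : {rmorphism A -> D}),
  (forall a, f a = 0 <-> P a) /\ forall d, exists a, f a = d.
Proof.
pose u : pred Q := fun x => `[< exists y, y * x = 1 >].
pose inv (x : Q) : Q := if pselect (exists y, y * x = 1) is left h then projT1 (cid h) else x.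
have mulVx : {in u, left_inverse 1 inv *%R}.
  move=> x /asboolP ux; rewrite /inv; case: pselect => // h.
  by case: cid.
have unitPl (x y : Q) : y * x = 1 -> u x by move=> e; apply/asboolP; exists y.
have inv_out : {in [predC u], inv =1 id}.
  move=> x ux; rewrite /inv; case: pselect => // h.
  by move: ux => /negP []; exact/asboolP.
pose Qc : comNzRingType := Q.
pose Qu : comUnitRingType := HB.pack_for comUnitRingType (GRing.ComNzRing.sort Qc)
  (GRing.ComNzRing.class Qc)
  (GRing.ComNzRing_hasMulInverse.Build Q mulVx unitPl inv_out).
pose Qi : idomainType := HB.pack_for idomainType (GRing.ComUnitRing.sort Qu)
  (GRing.ComUnitRing.class Qu)
  (GRing.ComUnitRing_isIntegral.Build Qu (@Quotient.rquot_IdomainAxiom A' S)).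
pose f : {rmorphism A -> Qi} := (\pi_Q%qT : {rmorphism A' -> Q}).
exists Qi, f; split=> [a|d]; last by exists (repr d); exact: reprK.
rewrite -(rmorph0 f); split=> [e|Pa].
  apply/asboolP; rewrite -[a]subr0; move: e => /eqP.
  by rewrite -Quotient.idealrBE.
by apply/eqP; rewrite -Quotient.idealrBE subr0; exact/asboolP.
Qed.

Lemma residue_field : exists (K : fieldType) (f : {rmorphism A -> K}),
  (forall a, f a = 0 <-> P a) /\
  forall u, exists a b, ~ P b /\ u = f a / f b.
Proof.
have [D [f [fP fS]]] := residue_quot.
exists {fraction D}, (@tofrac D \o f); split=> [a|u].
  by rewrite -fP /=; split=> [/eqP|->]; [rewrite tofrac_eq0 => /eqP | rewrite tofrac0].
elim/quotW: u => u; have [a ea] := fS (frac u).1; have [b eb] := fS (frac u).2.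
have b0 : f b != 0 by rewrite eb; exact: denom_ratioP.
exists a, b; split; first by move/fP/eqP; exact/negP.
have b0' : tofrac (f b) != 0 by rewrite tofrac_eq0.
apply: (mulIf b0'); rewrite /= divfK //.
unlock tofrac; rewrite -[LHS]FracField.pi_mul; apply/eqmodP => /=.
rewrite FracField.equivfE /FracField.mulf /= !numden_Ratio ?oner_neq0 ?mulr1 ?denom_ratioP //.
by rewrite eb ea mulrC.
Qed.

End Residue.

(** * Algebraic independence modulo a prime *)

Section Towers.
Variables (L : fieldType) (charL : [pchar L] =i pred0).
Variables (A : comPzRingType) (k : {rmorphism L -> A}).
Implicit Types (P Q O : set A) (x : A).

Definition subalg O := [/\ (forall c, O (k c)),
  (forall a b, O a -> O b -> O (a + b)) & (forall a b, O a -> O b -> O (a * b))].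

Definition adj O x : set A :=
  [set a | exists n (c : nat -> A), (forall i, O (c i)) /\ a = \sum_(i < n) c i * x ^+ i].

(** Transcendence of [x] over the residues of [O]. Coefficients are asked to lie in [P]; when [O]
    comes from a tower this means that they are zero, by [tower_zero]. *)
Definition trans P O x := forall n (c : nat -> A), (forall i, O (c i)) ->
  P (\sum_(i < n) c i * x ^+ i) -> forall i, (i < n)%N -> P (c i).

(* [xs] is algebraically independent modulo [P] and generates [O]. *)
Inductive tower P : seq A -> set A -> Prop :=
| Tower0 : tower P [::] (range k)
| TowerS x xs O : tower P xs O -> trans P O x -> tower P (x :: xs) (adj O x).

Definition alg P O x := exists n (c : nat -> A),
  [/\ forall i, O (c i), P (\sum_(i < n.+1) c i * x ^+ i) & ~ P (c n)].

Lemma subalg1 O : subalg O -> O 1.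
Proof. by case=> Ok _ _; rewrite -(rmorph1 k). Qed.

Lemma subalg0 O : subalg O -> O 0.
Proof. by case=> Ok _ _; rewrite -(rmorph0 k). Qed.

Lemma subalgN O a : subalg O -> O a -> O (- a).
Proof.
move=> [Ok _ OM] Oa; rewrite -mulN1r -(rmorph1 k) -(rmorphN k); exact: OM.
Qed.

Lemma subalgX O a n : subalg O -> O a -> O (a ^+ n).
Proof.
move=> sO Oa; elim: n => [|n IH]; first by rewrite expr0; exact: subalg1.
by rewrite exprS; case: sO => _ _; apply.
Qed.

Lemma subalg_sum O (T : Type) (r : seq T) (p : pred T) (F : T -> A) :
  subalg O -> (forall i, p i -> O (F i)) -> O (\sum_(i <- r | p i) F i).
Proof. by move=> sO OF; apply: big_ind => //; [exact: subalg0 | case: sO]. Qed.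

Lemma adj_widen O x a m : subalg O -> adj O x a ->
  exists n (c : nat -> A), [/\ (m <= n)%N, forall i, O (c i),
    forall i, (n <= i)%N -> c i = 0 & a = \sum_(i < n) c i * x ^+ i].
Proof.
move=> sO [n [c [Oc ->]]].
exists (maxn m n), (fun i => if (i < n)%N then c i else 0); split.
- exact: leq_maxl.
- by move=> i; case: ifP => // _; exact: subalg0.
- by move=> i; rewrite geq_max ltnNge => /andP [_ ->].
- have := big_ord_widen (maxn m n) (fun i => c i * x ^+ i) (leq_maxr m n).
  move=> ->; rewrite big_mkcond /=; apply: eq_bigr => i _.
  by case: ifP; rewrite ?mul0r.
Qed.

Lemma sub_adj O x : subalg O -> O `<=` adj O x.
Proof.
move=> sO a Oa; exists 1%N, (fun=> a); split=> //.
by rewrite big_ord1 expr0 mulr1.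
Qed.

Lemma mem_adj O x : subalg O -> adj O x x.
Proof.
move=> sO; exists 2%N, (fun i => (i == 1%N)%:R); split=> [i|].
  by case: eqP; [move=> _; exact: subalg1 | move=> _; exact: subalg0].
by rewrite big_ord_recl big_ord1 /= mul0r add0r mul1r expr1.
Qed.

Lemma adj_subalg O x : subalg O -> subalg (adj O x).
Proof.
move=> sO; case: (sO) => Ok OD OM.
have aD a b : adj O x a -> adj O x b -> adj O x (a + b).
  move=> Oa Ob; have [n [c [_ Oc _ ->]]] := adj_widen 0 sO Oa.
  have [m [d [nm Od _ ->]]] := adj_widen n sO Ob.
  have [n' [c' [mn Oc' _ ->]]] : exists n' (c' : nat -> A), [/\ (n' = m)%N, forall i, O (c' i),
      true & \sum_(i < n) c i * x ^+ i = \sum_(i < n') c' i * x ^+ i].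
    exists m, (fun i => if (i < n)%N then c i else 0); split=> //.
      by move=> i; case: ifP => // _; exact: subalg0.
    rewrite (big_ord_widen m (fun i => c i * x ^+ i) nm) big_mkcond /=.
    by apply: eq_bigr => i _; case: ifP; rewrite ?mul0r.
  rewrite mn; exists m, (fun i => c' i + d i); split=> [i|]; first exact: OD.
  by rewrite -big_split; apply: eq_bigr => i _; rewrite mulrDl.
split=> //.
- by move=> c; apply: sub_adj.
- move=> a b [n [c [Oc ->]]] Ob.
  have xM y : adj O x y -> adj O x (x * y).
    move=> [m [d [Od ->]]]; exists m.+1, (fun i => if i is j.+1 then d j else 0).
    split=> [[|j]|]; [exact: subalg0 | exact: Od |].
    rewrite big_ord_recl mul0r add0r mulr_sumr; apply: eq_bigr => i _.
    by rewrite /= /bump /= exprS mulrCA.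
  have cM y z : O y -> adj O x z -> adj O x (y * z).
    move=> Oy [m [d [Od ->]]]; exists m, (fun i => y * d i).
    split=> [i|]; first exact: OM.
    by rewrite mulr_sumr; apply: eq_bigr => i _; rewrite mulrA.
  rewrite mulr_suml; apply: big_ind => //; first by apply: (@sub_adj _ x sO); exact: subalg0.
  move=> i _; rewrite -mulrA; apply: cM => //.
  elim: (i : nat) => [|j IH]; first by rewrite expr0 mul1r.
  by rewrite exprS -mulrA; exact: xM.
Qed.

Lemma tower_subalg P xs O : tower P xs O -> subalg O.
Proof.
elim=> {xs O} [|x xs O _ sO _]; last exact: adj_subalg.
split=> [c|_ _ [a _ <-] [b _ <-]|_ _ [a _ <-] [b _ <-]]; first by exists c.
- by exists (a + b); rewrite ?rmorphD.
- by exists (a * b); rewrite ?rmorphM.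
Qed.

Lemma prime_cst P c : prime_ideal P -> P (k c) -> c = 0.
Proof.
move=> [_ P1 _ PM _] Pc; apply/eqP/negP => /negP c0; apply: P1.
by rewrite -(rmorph1 k) -(mulVf c0) rmorphM; exact: PM.
Qed.

Lemma prime_nat P n : prime_ideal P -> P n%:R -> n = 0%N.
Proof.
move=> pP; rewrite -(rmorph_nat k) => /(prime_cst pP) /eqP.
by move/(pcharf0P L): charL => ->; move/eqP.
Qed.

(** Hence [O] embeds in the quotient by [P], and its nonzero elements can serve as denominators. *)
Lemma tower_zero P xs O a : prime_ideal P -> tower P xs O -> O a -> P a -> a = 0.
Proof.
move=> pP t; elim: t a => {xs O} [a [c _ <-] /(prime_cst pP) ->|x xs O _ IH tx].
  by rewrite rmorph0.
move=> _ [n [c [Oc ->]]] /(tx _ _ Oc) cP.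
by rewrite big1 // => i _; rewrite (IH (c i)) ?mul0r //; exact: cP.
Qed.

Lemma tower_up P Q xs O : P `<=` Q -> tower P xs O ->
  (forall a, O a -> Q a -> P a) -> tower Q xs O.
Proof.
move=> PQ; elim=> {xs O} [_|x xs O t IH tx h]; first exact: Tower0.
have sO := tower_subalg t.
apply: TowerS; first by apply: IH => a Oa; apply: h; exact: sub_adj.
move=> n c Oc Qs i lin; apply: PQ; apply: (tx n c) => //; apply: h => //.
by exists n, c.
Qed.

(** An element [s] of [Q] outside [P] is transcendental over [O] modulo [P]: the constant
    coefficient of a relation lies in [Q], hence is 0 because [O] meets [Q] in 0, and the relation
    can be divided by [s]. A chain of primes thus yields a tower of the same length at its smallest
    member. *)
Lemma tower_down P Q xs O s : prime_ideal P -> prime_ideal Q -> P `<=` Q ->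
  Q s -> ~ P s -> tower Q xs O -> tower P (s :: xs) (adj O s).
Proof.
move=> pP pQ PQ Qs Ps t.
have P0 : P 0 by case: pP.
apply: TowerS.
  elim: t => {xs O} [|x xs O t IH tx]; first exact: Tower0.
  apply: TowerS => // n c Oc Pn i lin.
  by rewrite (tower_zero pQ t (Oc i)) //; apply: (tx n c) => //; exact: PQ.
move=> n c Oc; elim: n c Oc => // n IH c Oc Pn.
have c0 : c 0%N = 0.
  apply: (tower_zero pQ t (Oc 0%N)).
  move: (PQ _ Pn); rewrite big_ord_recl /= expr0 mulr1 => Qn.
  rewrite -[c 0%N](addrK (\sum_(i < n) c (bump 0 i) * s ^+ bump 0 i)).
  have iQ := prime_ideal_ideal pQ.
  apply: (idealB iQ Qn); apply: (ideal_sum _ iQ) => i _.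
  by rewrite /bump /= exprS mulrCA; apply: (idealMr _ iQ).
have Pn' : P (\sum_(i < n) c i.+1 * s ^+ i).
  move: Pn; rewrite big_ord_recl /= c0 mul0r add0r.
  have -> : \sum_(i < n) c (bump 0 i) * s ^+ bump 0 i = s * \sum_(i < n) c i.+1 * s ^+ i.
    by rewrite mulr_sumr; apply: eq_bigr => i _; rewrite /bump /= exprS mulrCA.
  by case: (pP) => _ _ _ _ PP /PP [].
move=> [_|i lin]; first by rewrite c0.
exact: (IH (fun i => c i.+1)).
Qed.

Lemma chain_tower (Q : nat -> set A) n : (forall i, (i <= n)%N -> prime_ideal (Q i)) ->
  (forall i, (i < n)%N -> Q i.+1 `<` Q i) ->
  exists xs O, tower (Q n) xs O /\ size xs = n.
Proof.
elim: n => [|n IH] pQ cQ; first by exists [::], (range k); split => //; exact: Tower0.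
have [||xs [O [t sxs]]] := IH; [by move=> i h; apply: pQ; lia|by move=> i h; apply: cQ; lia|].
have [s1 /existsNP [s /not_implyP [Qs nQs]]] := cQ n (leqnn _).
exists (s :: xs), (adj O s); split; last by rewrite /= sxs.
by apply: (tower_down (pQ _ _) (pQ n _) s1 Qs nQs t).
Qed.

Lemma not_trans_alg P O x : ideal P -> ~ trans P O x -> alg P O x.
Proof.
move=> iP /existsNP [n /existsNP [c /not_implyP [Oc /not_implyP [Pn /existsNP [i /not_implyP [lin nPi]]]]]].
elim: n lin Pn => // n IH lin Pn.
have [Pcn|nPcn] := pselect (P (c n)); last by exists n, c.
apply: IH.
  move: lin; rewrite ltnS leq_eqVlt => /orP [/eqP e|//].
  by rewrite e in nPi.
move: Pn; rewrite big_ord_recr /= => Pn.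
rewrite -[X in P X](addrK (c n * x ^+ n)); apply: idealB => //.
exact: idealMr.
Qed.

(* A relation of minimal degree is as required. *)
Lemma alg_min P O x : prime_ideal P -> subalg O -> alg P O x ->
  exists n (c : nat -> A), [/\ forall i, O (c i), P (\sum_(i < n.+1) c i * x ^+ i),
    ~ P (\sum_(i < n) (i.+1%:R * c i.+1) * x ^+ i) & ~ P x -> ~ P (c 0%N)].
Proof.
move=> pP sO ax.
have iP := prime_ideal_ideal pP.
pose B n := `[< exists c : nat -> A,
  [/\ forall i, O (c i), P (\sum_(i < n.+1) c i * x ^+ i) & ~ P (c n)] >].
have exB : exists n, B n by case: ax => n ?; exists n; exact/asboolP.
case: (ex_minnP exB) => n /asboolP [c [Oc Pn nPn]] nmin.
exists n, c; split=> // [Pd|nPx P0].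
  case: n c Oc Pn nPn nmin Pd => [|n] c Oc Pn nPn nmin Pd.
    by apply: nPn; move: Pn; rewrite big_ord1 expr0 mulr1.
  have : B n; last by move/nmin; rewrite ltnn.
  apply/asboolP; exists (fun i => i.+1%:R * c i.+1); split=> //.
    by move=> i; case: (sO) => Ok _ OM; apply: OM => //; rewrite -(rmorph_nat k).
  by case: (pP) => _ _ _ _ PP /PP [/(prime_nat pP)|].
case: n c Oc Pn nPn nmin P0 => [|n] c Oc Pn nPn nmin P0; first by apply: nPn.
have : B n; last by move/nmin; rewrite ltnn.
apply/asboolP; exists (fun i => c i.+1); split=> //.
have : P (x * \sum_(i < n.+1) c i.+1 * x ^+ i).
  have -> : x * \sum_(i < n.+1) c i.+1 * x ^+ i = \sum_(i < n.+2) c i * x ^+ i - c 0%N.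
    rewrite [in RHS]big_ord_recl expr0 mulr1 addrC addKr mulr_sumr.
    by apply: eq_bigr => i _; rewrite /= /bump /= exprS mulrCA.
  exact: idealB.
by case: (pP) => _ _ _ _ PP /PP [].
Qed.

Lemma alg_sub P O O' x : O `<=` O' -> alg P O x -> alg P O' x.
Proof. by move=> OO' [n [c [Oc Pn nP]]]; exists n, c; split => // i; exact: OO'. Qed.

Lemma mem_alg P O x : prime_ideal P -> subalg O -> O x -> alg P O x.
Proof.
move=> pP sO Ox; exists 1%N, (fun i => if i is 0%N then - x else 1); split.
- by case=> [|i]; [exact: subalgN | exact: subalg1].
- rewrite big_ord_recl big_ord1 expr0 mulr1 expr1 mul1r addNr.
  by case: pP.
- by case: pP.
Qed.

(** Greedy choice: an element of [zs] is adjoined if it is transcendental over what is already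
    there, and is algebraic otherwise. *)
Lemma tower_extend P xs O (zs : seq A) : prime_ideal P -> tower P xs O ->
  exists ys O', [/\ tower P (ys ++ xs) O', O `<=` O', {subset ys <= zs} &
    forall z, z \in zs -> alg P O' z].
Proof.
move=> pP t; elim: zs => [|z zs [ys [O' [t' OO' yz az]]]].
  by exists [::], O; split.
have sO' := tower_subalg t'.
have [tz|/(not_trans_alg (prime_ideal_ideal pP)) algz] := pselect (trans P O' z).
  exists (z :: ys), (adj O' z); split.
  - exact: TowerS.
  - by apply: subset_trans OO' _; exact: sub_adj.
  - move=> y; rewrite !inE => /orP [->//|/yz ->]; exact: orbT.
  - move=> y; rewrite inE => /orP [/eqP ->|/az].
      by apply: mem_alg => //; [exact: adj_subalg | exact: mem_adj].
    by apply: alg_sub; exact: sub_adj.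
exists ys, O'; split => //.
- by move=> y /yz; rewrite inE => ->; exact: orbT.
- by move=> y; rewrite inE => /orP [/eqP ->|/az].
Qed.

(* [R] is, up to denominators in [O] and modulo [P], a finite [O]-module. *)
Definition finite_over P O (R : set A) := exists h (I : finType) (X : I -> A),
  [/\ O h, ~ P h, (exists i, X i = 1) &
    forall s, R s -> exists e (c : I -> A),
      (forall i, O (c i)) /\ P (h ^+ e * s - \sum_i c i * X i)].

(** The leading coefficient [c n] of a relation of [g] joins the denominator; the new generators are
    the products of the old ones with the powers of [g] below the degree of the relation. *)
Lemma finite_over_adj P O R g : prime_ideal P -> subalg O ->
  finite_over P O R -> alg P O g -> finite_over P O (adj R g).
Proof.
move=> pP sO [h [I [X [Oh nPh [i1 Xi1] hX]]]] [n [c [Oc Pn nPn]]].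
have iP := prime_ideal_ideal pP; case: (sO) => Ok OD OM; case: (iP) => P0 PD PM.
have pow j : exists e (b : 'I_n -> A), (forall i, O (b i)) /\
    P (c n ^+ e * g ^+ j - \sum_i b i * g ^+ i).
  elim: j => [|j [e [b [Ob Pb]]]].
    case: n c Oc Pn nPn => [|n] c Oc Pn nPn.
      by case: nPn; move: Pn; rewrite big_ord1 expr0 mulr1.
    exists 0%N, (fun i => (i == ord0)%:R); split.
      by move=> i; case: eqP => _; [exact: subalg1 | exact: subalg0].
    rewrite big_ord_recl /= !expr0 !mulr1 big1 ?addr0 ?subrr // => i _.
    by rewrite mul0r.
  case: n c Oc Pn nPn b Ob Pb => [|n] c Oc Pn nPn b Ob Pb.
    by case: nPn; move: Pn; rewrite big_ord1 expr0 mulr1.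
  (* The expression of [g ^+ j] is multiplied by [c n.+1 * g], and the power [g ^+ n.+1] that
     appears is removed by subtracting [b ord_max] times the relation. *)
  exists e.+1, (fun i : 'I_n.+1 =>
    c n.+1 * (if unlift ord0 i is Some i' then b (widen_ord (leqnSn n) i') else 0) - b ord_max * c i).
  split.
    move=> i; apply: OD; last by apply: subalgN => //; exact: OM.
    by apply: OM => //; case: unlift => [i'|]; [exact: Ob | exact: subalg0].
  set S := \sum_i _.
  have -> : S = c n.+1 * (g * \sum_i b i * g ^+ i)
      - b ord_max * \sum_(i < n.+2) c i * g ^+ i.
    rewrite /S; under eq_bigr do rewrite mulrBl.
    rewrite big_split /= sumrN.
    rewrite [\sum_(i < n.+1) b i * _]big_ord_recr /= [\sum_(i < n.+2) _]big_ord_recr /=.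
    rewrite big_ord_recl /= unlift_none mulr0 mul0r add0r.
    have -> : \sum_(i < n) c n.+1 * (if unlift ord0 (lift ord0 i) is Some i' then b (widen_ord (leqnSn n) i') else 0) *
        g ^+ bump 0 i = c n.+1 * (g * \sum_(i < n) b (widen_ord (leqnSn n) i) * g ^+ i).
      rewrite !mulr_sumr; apply: eq_bigr => i _; rewrite liftK /bump /= exprS; ring.
    have -> : \sum_(i < n.+1) b ord_max * c i * g ^+ i = b ord_max * \sum_(i < n.+1) c i * g ^+ i.
      by rewrite mulr_sumr; apply: eq_bigr => i _; rewrite mulrA.
    rewrite !mulrDr exprS; ring.
  have -> : c n.+1 ^+ e.+1 * g ^+ j.+1 -
      (c n.+1 * (g * \sum_i b i * g ^+ i) - b ord_max * \sum_(i < n.+2) c i * g ^+ i) =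
     c n.+1 * g * (c n.+1 ^+ e * g ^+ j - \sum_i b i * g ^+ i) +
     b ord_max * \sum_(i < n.+2) c i * g ^+ i by rewrite !exprS; ring.
  by apply: PD; apply: (PM).
case: n c Oc Pn nPn pow => [|n] c Oc Pn nPn pow.
  by case: nPn; move: Pn; rewrite big_ord1 expr0 mulr1.
pose Y (ij : I * 'I_n.+1) := X ij.1 * g ^+ ij.2.
pose d := h * c n.+1.
pose good s := exists e (b : I * 'I_n.+1 -> A), (forall i, O (b i)) /\
    P (d ^+ e * s - \sum_i b i * Y i).
have Od : O d by apply: OM.
have gD s t : good s -> good t -> good (s + t).
  move=> [e [b [Ob Pb]]] [f [a [Oa Pa]]].
  exists (e + f)%N, (fun i => d ^+ f * b i + d ^+ e * a i); split.
    by move=> i; apply: OD; apply: OM => //; exact: subalgX.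
  have -> : \sum_i (d ^+ f * b i + d ^+ e * a i) * Y i =
     d ^+ f * (\sum_i b i * Y i) + d ^+ e * \sum_i a i * Y i.
    by rewrite !mulr_sumr -big_split; apply: eq_bigr => i _ /=; ring.
  have -> : d ^+ (e + f) * (s + t) - (d ^+ f * (\sum_i b i * Y i) + d ^+ e * \sum_i a i * Y i) =
    d ^+ f * (d ^+ e * s - \sum_i b i * Y i) + d ^+ e * (d ^+ f * t - \sum_i a i * Y i).
    by rewrite exprD; ring.
  by apply: PD; apply: (PM).
have gM r j : R r -> good (r * g ^+ j).
  move=> Rr; have [e [a [Oa Pa]]] := hX _ Rr; have [f [b [Ob Pb]]] := pow j.
  exists (e + f)%N, (fun ij => h ^+ f * c n.+1 ^+ e * (a ij.1 * b ij.2)); split.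
    by move=> i; do ?apply: (OM) => //; exact: subalgX.
  have -> : \sum_i h ^+ f * c n.+1 ^+ e * (a i.1 * b i.2) * Y i =
     h ^+ f * c n.+1 ^+ e * ((\sum_i a i * X i) * (\sum_i b i * g ^+ i)).
    rewrite big_distrlr /= pair_bigA mulr_sumr; apply: eq_bigr => i _; rewrite /Y; ring.
  have -> : d ^+ (e + f) * (r * g ^+ j) -
     h ^+ f * c n.+1 ^+ e * ((\sum_i a i * X i) * (\sum_i b i * g ^+ i)) =
     h ^+ f * c n.+1 ^+ e * (c n.+1 ^+ f * g ^+ j * (h ^+ e * r - \sum_i a i * X i) +
       (\sum_i a i * X i) * (c n.+1 ^+ f * g ^+ j - \sum_i b i * g ^+ i)).
    by rewrite exprMn !exprD; ring.
  by apply: (PM); apply: PD; apply: (PM).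
exists d, (I * 'I_n.+1)%type, Y; split => //.
- exact: prime_notM.
- exists (i1, ord0); rewrite /Y /= expr0 mulr1.
  exact: Xi1.
- move=> _ [l [r [Rr ->]]].
  have [e [b [Ob Pb]]] : good (\sum_(i < l) r i * g ^+ i).
    apply: big_ind => //; last by move=> i _; exact: gM.
    exists 0%N, (fun=> 0); split; first by move=> _; exact: subalg0.
    by rewrite mulr0 big1 ?subrr // => i _; rewrite mul0r.
  by exists e, b.
Qed.

Lemma finite_over_fg P O gens : prime_ideal P -> subalg O -> fg_alg k gens ->
  (forall g, g \in gens -> alg P O g) -> finite_over P O setT.
Proof.
move=> pP sO fg ag.
suff [R [sR fR gR]] : exists R, [/\ subalg R, finite_over P O R & forall g, g \in gens -> R g].
  suff <- : R = setT by [].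
  by apply/seteqP; split => // a _; case: sR => Rk RD RM; apply: fg.
elim: gens ag {fg} => [|g gens IH] ag.
  exists O; split => //; exists 1, 'I_1, (fun=> 1); split.
  - exact: subalg1.
  - by case: pP.
  - by exists ord0.
  - move=> s Os; exists 0%N, (fun=> s); split => //.
    by rewrite big_ord1 expr0 mul1r mulr1 subrr; case: pP.
have [|R [sR fR gR]] := IH; first by move=> z zg; apply: ag; rewrite inE zg orbT.
exists (adj R g); split.
- exact: adj_subalg.
- by apply: finite_over_adj => //; apply: ag; exact: mem_head.
- move=> z; rewrite inE => /orP [/eqP ->|/gR Rz]; first exact: mem_adj.
  exact: sub_adj.
Qed.

(** Modulo [g] the matrix is scalar; the congruence is carried through the Leibniz formula. *)
Lemma det_congr (R : comPzRingType) n (u g : R) (B : 'M[R]_n) :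
  exists o, \det (u%:M - g *: B) = u ^+ n + g * o.
Proof.
rewrite -(det_scalar n u) /determinant.
pose R2 (a b : R) := exists o, a = b + g * o.
suff : R2 (\det (u%:M - g *: B)) (\det (u%:M : 'M[R]_n)) by [].
have RD a b c d : R2 a b -> R2 c d -> R2 (a + c) (b + d).
  by move=> [o ->] [p ->]; exists (o + p); ring.
have RM a b c d : R2 a b -> R2 c d -> R2 (a * c) (b * d).
  by move=> [o ->] [p ->]; exists (o * d + b * p + g * o * p); ring.
have R00 a : R2 a a by exists 0; rewrite mulr0 addr0.
apply: (big_ind2 R2) => // s _; apply: (RM) => //.
apply: (big_ind2 R2) => // i _; exists (- B i ((s : {perm _}) i)).
by rewrite !mxE; ring.
Qed.

Definition coefs_in (K : nzRingType) (phi : A -> K) O (p : {poly K}) :=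
  forall i, exists a, O a /\ p`_i = phi a.

Section CoefsIn.
Variables (K : comNzRingType) (phi : {rmorphism A -> K}) (O : set A).
Hypothesis sO : subalg O.
Notation cO := (coefs_in phi O).

Lemma coefs_inC a : O a -> cO (phi a)%:P.
Proof.
move=> Oa i; rewrite coefC; case: ifP => _; first by exists a.
by exists 0; rewrite rmorph0; split => //; exact: subalg0.
Qed.

Lemma coefs_in0 : cO 0.
Proof. by rewrite -[0]/(0%:P) -(rmorph0 phi); apply: coefs_inC; exact: subalg0. Qed.

Lemma coefs_in1 : cO 1.
Proof. by rewrite -[1]/(1%:P) -(rmorph1 phi); apply: coefs_inC; exact: subalg1. Qed.

Lemma coefs_inX : cO 'X.
Proof.
move=> i; rewrite coefX; exists (i == 1%N)%:R; rewrite rmorph_nat; split => //.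
by case: eqP => _; [exact: subalg1 | exact: subalg0].
Qed.

Lemma coefs_inD p q : cO p -> cO q -> cO (p + q).
Proof.
move=> hp hq i; have [a [Oa ea]] := hp i; have [b [Ob eb]] := hq i.
by exists (a + b); rewrite coefD ea eb rmorphD; split => //; case: sO => _ OD _; exact: OD.
Qed.

Lemma coefs_inN p : cO p -> cO (- p).
Proof.
move=> hp i; have [a [Oa ea]] := hp i; exists (- a).
by rewrite coefN ea rmorphN; split => //; exact: subalgN.
Qed.

Lemma coefs_inM p q : cO p -> cO q -> cO (p * q).
Proof.
move=> hp hq i; rewrite coefM.
apply: (big_ind (fun u => exists a, O a /\ u = phi a)).
- by exists 0; rewrite rmorph0; split => //; exact: subalg0.
- move=> _ _ [a [Oa ->]] [b [Ob ->]]; exists (a + b); rewrite rmorphD.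
  by split => //; case: sO => _ OD _; exact: OD.
- move=> j _; have [a [Oa ea]] := hp j; have [b [Ob eb]] := hq (i - j)%N.
  by exists (a * b); rewrite ea eb rmorphM; split => //; case: sO => _ _; exact.
Qed.

Lemma coefs_inE p n : cO p -> cO (p ^+ n).
Proof.
move=> hp; elim: n => [|n IH]; first by rewrite expr0; exact: coefs_in1.
by rewrite exprS; exact: coefs_inM.
Qed.

Lemma coefs_in_det n (B : 'M[{poly K}]_n) : (forall i j, cO (B i j)) -> cO (\det B).
Proof.
move=> OB; apply: big_ind; [exact: coefs_in0 | exact: coefs_inD |].
move=> s _; apply: coefs_inM; first by apply: coefs_inE; apply: coefs_inN; exact: coefs_in1.
by apply: big_ind => //; [exact: coefs_in1 | exact: coefs_inM].
Qed.

End CoefsIn.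

Lemma root_alg (K : fieldType) (phi : {rmorphism A -> K}) P O x (p : {poly K}) :
  (forall a, phi a = 0 <-> P a) -> coefs_in phi O p -> p != 0 -> p.[phi x] = 0 ->
  alg P O x.
Proof.
move=> phiP /choice [a ha] p0 e; exists (size p).-1, a; split.
- by move=> i; case: (ha i).
- apply/phiP; rewrite rmorph_sum -[RHS]e horner_coef prednK ?size_poly_gt0 //.
  by apply: eq_bigr => j _; rewrite rmorphM rmorphXn; case: (ha j) => _ ->.
- by move/phiP; case: (ha (size p).-1) => _ <- /eqP; rewrite lead_coef_eq0 (negPf p0).
Qed.

(** Determinant trick: up to a power of the denominator [h], multiplication by [x] acts on the
    generators [X] modulo [P] through a matrix over [O]. The polynomial [p] is a nonzero constant
    times a characteristic polynomial, and it vanishes at [x] because the vector of the [X i], which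
    has an entry 1, is in the kernel. *)
Lemma finite_alg P O x : prime_ideal P -> subalg O -> finite_over P O setT -> alg P O x.
Proof.
move=> pP sO [h [Ix [X [Oh nPh [i1 Xi1] hX]]]].
have [K [phi [phiP _]]] := residue_field pP.
have /choice [e /choice [al hal]] := fun i => hX (x * X i) I.
pose E := (\sum_i e i)%N.
have leE i : (e i <= E)%N by rewrite /E (bigD1 i) //= leq_addr.
pose al' i j := h ^+ (E - e i) * al i j.
have rel i : phi h ^+ E * phi x * phi (X i) = \sum_j phi (al' i j) * phi (X j).
  have [_ /phiP] := hal i; rewrite rmorphB rmorphM rmorphXn rmorphM => /eqP.
  rewrite subr_eq0 => /eqP h1; rewrite -(subnK (leE i)) exprD -!mulrA h1.
  rewrite rmorph_sum mulr_sumr; apply: eq_bigr => j _.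
  by rewrite /al' !rmorphM rmorphXn mulrA.
pose N := #|Ix|.
pose B : 'M[K]_N := \matrix_(i, j) phi (al' (enum_val i) (enum_val j)).
pose d := phi h ^+ E.
have d0 : d != 0 by rewrite expf_neq0 //; apply/eqP => /phiP.
pose p := \det ((d%:P * 'X)%:M - map_mx polyC B).
have ep : p = (d ^+ N)%:P * char_poly (d^-1 *: B).
  rewrite polyC_exp -[char_poly _]/(\det (char_poly_mx (d^-1 *: B))).
  rewrite -(detZ (d%:P) (char_poly_mx (d^-1 *: B))); congr (\det _); apply/matrixP => i j.
  rewrite !mxE mulrBr -polyCM mulrA divff // mul1r.
  by case: (i == j); rewrite ?mulr0.
apply: (@root_alg _ phi P O x p phiP).
- apply: (coefs_in_det sO) => i j; rewrite !mxE; apply: (coefs_inD sO).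
    case: (i == j); last exact: coefs_in0.
    rewrite mulr1n; apply: (coefs_inM sO); last exact: coefs_inX.
    by rewrite /d -rmorphXn; apply: (coefs_inC _ sO); exact: subalgX.
  apply: (coefs_inN sO); apply: (coefs_inC _ sO); case: (sO) => _ _ OM; apply: OM.
    exact: subalgX.
  by case: (hal (enum_val i)).
- rewrite ep; apply: mulf_neq0; first by rewrite polyC_eq0 expf_neq0.
  exact/monic_neq0/char_poly_monic.
rewrite -[_.[_]]/(horner_eval (phi x) p) /p -det_map_mx -det_tr.
apply/eqP/det0P; exists (\row_j phi (X (enum_val j))).
  apply/eqP => /rowP /(_ (enum_rank i1)); rewrite !mxE enum_rankK Xi1 rmorph1.
  by move/eqP; rewrite oner_eq0.
have BE i j : map_mx (horner_eval (phi x)) ((d%:P * 'X)%:M - map_mx polyC B) i j =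
    (d * phi x) *+ (i == j) - phi (al' (enum_val i) (enum_val j)).
  by rewrite mxE /horner_eval !mxE hornerD hornerN hornerC hornerMn hornerM hornerX hornerC.
apply/rowP => i; rewrite mxE [RHS]mxE.
under eq_bigr => j _ do rewrite mxE [X in _ * X]mxE BE mulrBr.
rewrite big_split /= sumrN (bigD1 i) //= eqxx mulr1n big1 ?addr0; last first.
  by move=> j /negPf ji; rewrite eq_sym ji mulr0n mulr0.
apply/eqP; rewrite subr_eq0; apply/eqP.
rewrite mulrC rel (reindex (@enum_val _ (mem Ix))) /=; last first.
  by apply: onW_bij; exact: enum_val_bij.
by apply: eq_bigr => j _; rewrite mulrC.
Qed.

(** The constant coefficient of a relation of minimal degree is outside [P]; moved to the other
    side, it is a multiple of [x]. *)
Lemma alg_inverse P O x : prime_ideal P -> subalg O -> alg P O x -> ~ P x ->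
  exists y c, [/\ O c, ~ P c & P (x * y - c)].
Proof.
move=> pP sO ax nPx; have [n [c [Oc Pn _ /(_ nPx) nP0]]] := alg_min pP sO ax.
exists (- \sum_(i < n) c i.+1 * x ^+ i), (c 0%N); split => //.
have -> : x * - (\sum_(i < n) c i.+1 * x ^+ i) - c 0%N = - \sum_(i < n.+1) c i * x ^+ i.
  rewrite big_ord_recl expr0 mulr1 mulrN mulr_sumr -opprD addrC; congr (- (_ + _)).
  by apply: eq_bigr => i _; rewrite /= /bump /= exprS mulrCA.
by apply: idealN => //; exact: prime_ideal_ideal.
Qed.

(** The last variable [x] of a tower is sacrificed. Over [adj O x], the algebra is finite up to a
    denominator [h], and [f] divides some [h'] modulo [P]. A prime over [P] and [g = 1 + x * h * h']
    that avoids the products of nonzero elements of [O] with powers of [f] preserves both the tower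
    of [O] and the condition on [f]. If there were none, the polynomial [G] in [x] representing [g]
    would divide a nonzero constant. *)
Lemma prime_step P xs O f gens m : prime_ideal P -> fg_alg k gens ->
  tower P xs O -> size xs = m.+1 -> ~ P f ->
  exists Q ys O', [/\ prime_ideal Q, P `<` Q, ~ Q f, tower Q ys O' & (m <= size ys)%N].
Proof.
move=> pP fg t0 sxs nPf.
have [ys [O1 [t1 _ _ alg1]]] := tower_extend (gens ++ [:: f]) pP t0.
have ex : exists x ws O,
    [/\ tower P ws O, trans P O x & (m <= size ws)%N] /\ O1 = adj O x.
  move: t1; move e : (ys ++ xs) => zs t1; case: t1 e => [|x ws O2 t tx] e.
    by have := congr1 size e; rewrite size_cat sxs /=; lia.
  exists x, ws, O2; split=> //; split=> //.
  by have := congr1 size e; rewrite size_cat sxs /=; lia.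
case: ex => x [ws [O' [[t tx szw] eO1]]]; clear O t0 t1; rename O' into O.
rewrite {O1}eO1 in alg1.
have sO := tower_subalg t; have sOx := adj_subalg x sO.
have iP := prime_ideal_ideal pP.
have [K [phi [phiP _]]] := residue_field pP.
pose pO := coefs_in phi O.
have pO1 : pO 1 := coefs_in1 phi sO.
have pOX : pO 'X := coefs_inX phi sO.
have pOC a (Oa : O a) : pO (phi a)%:P := coefs_inC phi sO Oa.
have pOD p q (hp : pO p) (hq : pO q) : pO (p + q) := coefs_inD sO hp hq.
have pOM p q (hp : pO p) (hq : pO q) : pO (p * q) := coefs_inM sO hp hq.
have pOE p n (hp : pO p) : pO (p ^+ n) := coefs_inE sO n hp.
have pOroot p : pO p -> p.[phi x] = 0 -> p = 0.
  move=> /choice [a ha] e.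
  apply/polyP => i; rewrite coef0; have [lis|] := ltnP i (size p); last exact: nth_default.
  have [_ ->] := ha i; apply/phiP; apply: (tx (size p) a) => // [j|].
    by case: (ha j).
  apply/phiP; rewrite rmorph_sum -[RHS]e horner_coef; apply: eq_bigr => j _.
  by rewrite rmorphM rmorphXn; case: (ha j) => _ ->.
have ev a : adj O x a -> exists p, pO p /\ phi a = p.[phi x].
  move=> [n [c [Oc ->]]]; exists (\sum_(i < n) (phi (c i))%:P * 'X^i); split.
    apply: (big_ind pO) => [|p q|i _]; [exact: coefs_in0 | exact: pOD |].
    by apply: (pOM); [exact: pOC | exact: pOE].
  rewrite rmorph_sum horner_sum; apply: eq_bigr => i _.
  by rewrite !hornerE rmorphM rmorphXn.
have [h [Ix [X [Oh nPh [i1 Xi1] hX]]]] : finite_over P (adj O x) setT.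
  by apply: (finite_over_fg pP sOx fg) => g gg; apply: alg1; rewrite mem_cat gg.
have [h' [t' [Oh' nPh' Ph']]] : exists h' t', [/\ adj O x h', ~ P h' & P (h' - f * t')].
  have [|t' [c [Oc nPc Pc]]] := alg_inverse pP sOx (alg1 f _) nPf.
    by rewrite mem_cat mem_head orbT.
  by exists c, t'; split => //; rewrite -opprB; apply: idealN.
have [ph [Oph eh]] := ev _ Oh; have [ph' [Oph' eh']] := ev _ Oh'.
have ph0 : ph != 0 by apply/eqP => e; apply: nPh; apply/phiP; rewrite eh e horner0.
have ph'0 : ph' != 0 by apply/eqP => e; apply: nPh'; apply/phiP; rewrite eh' e horner0.
(* The summand 1 makes [G] coprime to the polynomials [ph] and [ph'] of [h] and [h'], and the factor
   ['X] makes its degree positive. *)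
pose g := 1 + x * h * h'; pose G := 1 + 'X * (ph * ph').
have Og : pO G by apply: (pOD) => //; apply: (pOM) => //; exact: pOM.
have eg : phi g = G.[phi x].
  rewrite /g /G !hornerE rmorphD rmorph1 !rmorphM eh eh' /=; ring.
have sG : (1 < size G)%N.
  have sX : (1 < size ('X * (ph * ph') : {poly K})%R)%N.
    by rewrite mulrC size_mulX ?mulf_neq0 // ltnS size_poly_gt0 mulf_neq0.
  by rewrite /G addrC size_polyDl // size_poly1.
pose M : set A := [set a | exists c n, [/\ O c, c <> 0 & a = c * f ^+ n]].
pose J : set A := [set a | exists b c, P b /\ a = b + c * g].
have O0P c : O c -> P c -> c = 0 by exact: (tower_zero pP t).
have [||a Ja [c [n [Oc c0 ea]]]|Q [pQ JQ QM]] := @krull _ J M (ideal_adjoin g iP).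
- exists 1, 0%N; split; [exact: subalg1 | | by rewrite mul1r].
  by move=> e; case: (pP) => P0 P1 _ _ _; apply: P1; rewrite e.
- move=> _ _ [c [n [Oc c0 ->]]] [d [n' [Od d0 ->]]].
  exists (c * d), (n + n')%N; split.
  + by case: (sO) => _ _; exact.
  + move=> e; case: (pP) => P0 _ _ _ PP; case: (PP c d); first by rewrite e.
      by move/(O0P _ Oc).
    by move/(O0P _ Od).
  + by rewrite exprD; ring.
- have [b [s [Pb eb]]] := Ja.
  have e1 : phi c * phi f ^+ n = phi s * phi g.
    by rewrite -rmorphXn -rmorphM -ea eb rmorphD rmorphM (phiP b).2 // add0r.
  have e2 : phi h' = phi f * phi t'.
    by apply/eqP; rewrite -subr_eq0 -rmorphM -rmorphB; apply/eqP/phiP.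
  pose s' := s * t' ^+ n.
  have e3 : phi c * phi h' ^+ n = phi s' * phi g.
    by rewrite e2 exprMn mulrA e1 /s' rmorphM rmorphXn; ring.
  have /choice [e /choice [al hal]] := fun i => hX (s' * X i) I.
  pose E := (\sum_i e i)%N.
  have leE i : (e i <= E)%N by rewrite /E (bigD1 i) //= leq_addr.
  have /choice [pa hpa] : forall ij : Ix * Ix, exists p, pO p /\
      phi (h ^+ (E - e ij.1) * al ij.1 ij.2) = p.[phi x].
    move=> [i j] /=; apply: ev; case: (sOx) => _ _ OM; apply: OM.
      exact: subalgX.
    by case: (hal i).
  have rel i : phi h ^+ E * phi s' * phi (X i) = \sum_j (pa (i, j)).[phi x] * phi (X j).
    have [_ /phiP] := hal i; rewrite rmorphB rmorphM rmorphXn rmorphM => /eqP.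
    rewrite subr_eq0 => /eqP h1; rewrite -(subnK (leE i)) exprD -!mulrA h1.
    rewrite rmorph_sum mulr_sumr; apply: eq_bigr => j _.
    by case: (hpa (i, j)) => _ <-; rewrite !rmorphM rmorphXn mulrA.
  pose U := ph ^+ E * (phi c)%:P * ph' ^+ n.
  have eU : U.[phi x] = phi h ^+ E * phi s' * phi g.
    by rewrite /U !hornerM hornerC !horner_exp -eh -eh' -!mulrA e3; ring.
  pose N := #|Ix|.
  pose Bp : 'M[{poly K}]_N := \matrix_(i, j) pa (enum_val i, enum_val j).
  (* At [x], the scalar [U] and the matrix [G *: Bp] act alike on the vector of the [X i]. So [D]
     vanishes at [x] and, [x] being transcendental, is 0; modulo [G] it is [U ^+ N]. *)
  pose D := \det (U%:M - G *: Bp).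
  have OU : pO U by apply: (pOM); [apply: (pOM); [exact: pOE | exact: pOC] | exact: pOE].
  have OD : pO D.
    apply: (coefs_in_det sO) => i j; rewrite !mxE; apply: (pOD).
      by rewrite -mulr_natr; apply: (pOM) => //; case: (_ == _) => //; exact: coefs_in0.
    by apply: (coefs_inN sO); apply: (pOM) => //; case: (hpa (enum_val i, enum_val j)).
  have D0 : D = 0.
    apply: (pOroot _ OD); rewrite -[_.[_]]/(horner_eval (phi x) D) /D -det_map_mx -det_tr.
    apply/eqP/det0P; exists (\row_j phi (X (enum_val j))).
      apply/eqP => /rowP /(_ (enum_rank i1)); rewrite !mxE enum_rankK Xi1 rmorph1.
      by move/eqP; rewrite oner_eq0.
    have BE i j : map_mx (horner_eval (phi x)) (U%:M - G *: Bp) i j =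
        U.[phi x] *+ (i == j) - G.[phi x] * (pa (enum_val i, enum_val j)).[phi x].
      by rewrite mxE /horner_eval !mxE hornerD hornerN hornerM hornerMn.
    apply/rowP => i; rewrite mxE [RHS]mxE.
    under eq_bigr => j _ do rewrite mxE [X in _ * X]mxE BE mulrBr.
    rewrite big_split /= sumrN (bigD1 i) //= eqxx mulr1n big1 ?addr0; last first.
      by move=> j /negPf ji; rewrite eq_sym ji mulr0n mulr0.
    rewrite eU -eg.
    apply/eqP; rewrite subr_eq0; apply/eqP.
    have -> : phi (X (enum_val i)) * (phi h ^+ E * phi s' * phi g) =
       phi g * (phi h ^+ E * phi s' * phi (X (enum_val i))) by ring.
    rewrite rel (reindex (@enum_val _ (mem Ix))) /=; last first.
      by apply: onW_bij; exact: enum_val_bij.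
    by rewrite mulr_sumr; apply: eq_bigr => j _; ring.
  have [o] := det_congr U G Bp; rewrite -/D D0 => eo.
  have GU : G %| U ^+ N.
    by apply/dvdpP; exists (- o); apply/eqP; rewrite mulNr -addr_eq0 mulrC -eo.
  have cop q : q %| ph * ph' -> coprimep G q.
    move=> qp; apply: (coprimep_dvdl qp).
    apply/Bezout_eq1_coprimepP; exists (1, - 'X) => /=.
    by rewrite /G; ring.
  have : G %| (phi c)%:P ^+ N.
    move: GU; rewrite /U exprMn Gauss_dvdpl; last first.
      by do 2?apply: coprimep_expr; apply: cop; exact: dvdp_mull.
    rewrite exprMn Gauss_dvdpr //.
    by do 2?apply: coprimep_expr; apply: cop; exact: dvdp_mulr.
  move/dvdp_leq; rewrite -rmorphXn size_polyC.
  have nz : phi c ^+ N != 0.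
    by rewrite expf_neq0 //; apply/eqP => /phiP /(O0P _ Oc).
  by rewrite polyC_eq0 nz => /(_ isT); rewrite leqNgt sG.
- exists Q, ws, O; split => //.
  + split; first by move=> p Pp; apply: JQ; exists p, 0; rewrite mul0r addr0.
    move=> /(_ g) h0; have : P g by apply: h0; apply: JQ; exact: mem_adjoin.
    move/phiP; rewrite eg => /(pOroot _ Og) G0; by rewrite G0 size_poly0 in sG.
  + move=> Qf; apply: (QM f Qf); exists 1, 1%N; split; [exact: subalg1 | |by rewrite mul1r].
    by move=> e; case: (pP) => P0 P1 _ _ _; apply: P1; rewrite e.
  + apply: tower_up t _; first by move=> p Pp; apply: JQ; exists p, 0; rewrite mul0r addr0.
    move=> a Oa Qa; apply: contrapT => nPa; apply: (QM a Qa); exists a, 0%N.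
    split => //; last by rewrite mulr1.
    by move=> e; apply: nPa; rewrite e; case: pP.
Qed.

Lemma prime_chain P xs O f gens m : prime_ideal P -> fg_alg k gens ->
  tower P xs O -> (m <= size xs)%N -> ~ P f ->
  exists Q : nat -> set A, [/\ Q 0%N = P, forall i, prime_ideal (Q i),
    forall i, ~ Q i f & forall i, (i < m)%N -> Q i `<` Q i.+1].
Proof.
move=> pP fg; elim: m P xs O pP => [|m IH] P xs O pP t mxs nPf.
  by exists (fun=> P); split.
case: xs t mxs => [//|x xs] t mxs.
have [Q [ys [O' [pQ PQ nQf t' szy]]]] := prime_step pP fg t (erefl (size xs).+1) nPf.
have [R [R0 pR nRf cR]] := IH _ _ _ pQ t' (leq_trans (mxs : (m <= size xs)%N) szy) nQf.
exists (fun i => if i is j.+1 then R j else P); split => //.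
- by case.
- by case.
- by case=> [_|i]; [rewrite R0 | exact: cR].
Qed.

End Towers.

(** * Involutivity of minimal primes of the annihilator *)

Section FlaggedBasis.
Variables (L : fieldType) (S : comPzRingType) (k : {rmorphism L -> S}).
Variables (E : lmodType S) (P : set S) (pP : prime_ideal P).
Let iP : ideal P := prime_ideal_ideal pP.

Definition ann (F : lmodType S) : set S := [set a | forall e : F, a *: e = 0].

Lemma ann_ideal (F : lmodType S) : ideal (ann F).
Proof.
split=> [e|a b ha hb e|a b hb e]; first by rewrite scale0r.
- by rewrite scalerDl ha hb addr0.
- by rewrite -scalerA hb scaler0.
Qed.

(** The kernel of the map from [E] to its localization at [P]. *)
Definition tors (e : E) := exists h, ~ P h /\ h *: e = 0.

Lemma tors0 : tors 0.
Proof. by exists 1; rewrite scaler0; case: pP. Qed.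

Lemma torsD e f : tors e -> tors f -> tors (e + f).
Proof.
move=> [h [Ph he]] [g [Pg gf]]; exists (h * g); split; first exact: prime_notM.
by rewrite scalerDr -[X in _ + X]scalerA gf scaler0 addr0 mulrC -scalerA he scaler0.
Qed.

Lemma torsZ a e : tors e -> tors (a *: e).
Proof.
by move=> [h [Ph he]]; exists h; rewrite scalerA mulrC -scalerA he scaler0.
Qed.

Lemma torsN e : tors e -> tors (- e).
Proof. by rewrite -scaleN1r; exact: torsZ. Qed.

Lemma tors_sum (T : Type) (r : seq T) (p : pred T) (F : T -> E) :
  (forall i, p i -> tors (F i)) -> tors (\sum_(i <- r | p i) F i).
Proof. by move=> h; apply: big_ind => //; [exact: tors0 | exact: torsD]. Qed.

Lemma tors_sat h e : ~ P h -> tors (h *: e) -> tors e.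
Proof.
move=> Ph [g [Pg ge]]; exists (g * h); split; first exact: prime_notM.
by rewrite -scalerA.
Qed.

(* [flag l] is [P ^ l E]. *)
Fixpoint flag (l : nat) : set E := if l is l'.+1 then
  [set e | exists n (p : 'I_n -> S) (f : 'I_n -> E),
     [/\ forall i, P (p i), forall i, flag l' (f i) & e = \sum_i p i *: f i]]
  else setT.

Lemma flagZ l a e : flag l e -> flag l (a *: e).
Proof.
case: l => [//|l] [n [p [f [Pp Ff ->]]]].
exists n, (fun i => a * p i), f; split=> //; first by move=> i; case: iP => _ _; apply.
by rewrite scaler_sumr; apply: eq_bigr => i _; rewrite scalerA.
Qed.

Lemma flagM l p e : P p -> flag l e -> flag l.+1 (p *: e).
Proof.
by move=> Pp Fe; exists 1%N, (fun=> p), (fun=> e); rewrite big_ord1.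
Qed.

Lemma flag_linear (z : E -> E) l e : (forall e f, z (e + f) = z e + z f) ->
  (forall a e, z (a *: e) = a *: z e) -> flag l e -> flag l (z e).
Proof.
move=> zD zZ; elim: l e => [//|l IH] _ [n [p [f [Pp Ff ->]]]].
exists n, p, (z \o f); split=> // [i|]; first exact: (IH _ (Ff i)).
have z0 : z 0 = 0 by rewrite -[X in z X](scale0r 0) zZ scale0r.
by rewrite (big_morph z zD z0); apply: eq_bigr => i _; rewrite zZ.
Qed.

Hypothesis Efg : exists n (v : 'I_n -> E), forall e, exists c : 'I_n -> S, e = \sum_i c i *: v i.
Hypothesis Snoeth : noeth S.
Hypothesis Pmin : min_prime (ann E) P.

Inductive mon (s : seq S) : nat -> E -> Prop :=
| Mon0 e : mon s 0 e
| MonS l p e : p \in s -> mon s l e -> mon s l.+1 (p *: e).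

Lemma mon_cons p s l e : mon (p :: s) l e ->
  exists i j f, [/\ (i + j)%N = l, mon s j f & e = p ^+ i *: f].
Proof.
elim=> {l e} [e|l q e]; first by exists 0%N, 0%N, e; rewrite scale1r; split=> //; exact: Mon0.
rewrite inE => /orP [/eqP ->|qs] _ [i [j [f [<- mf ->]]]].
  by exists i.+1, j, f; rewrite scalerA -exprS addSn.
exists i, j.+1, (q *: f); rewrite addnS; split=> //; first exact: MonS.
by rewrite !scalerA mulrC.
Qed.

(** Each element of [s] is nilpotent on the localization of [E], by [min_prime_nilp], and in a long
    product at least one of them occurs to a high power. *)
Lemma mon_tors (s : seq S) : (forall p, p \in s -> P p) ->
  exists N, forall l e, (N <= l)%N -> mon s l e -> tors e.
Proof.
elim: s => [|p s IH] sP.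
  by exists 1%N => l e l0 m; case: m l0.
have [|N hN] := IH; first by move=> q qs; apply: sP; rewrite inE qs orbT.
have [h [m [Ph hm]]] := min_prime_nilp (ann_ideal E) Pmin (sP p (mem_head _ _)).
exists (m + N)%N => l e lel /mon_cons [i [j [f [eij mf ->]]]].
have [mi|im] := leqP m i; last by apply: torsZ; apply: (hN j) => //; lia.
exists h; split=> //; rewrite -(subnKC mi) exprD -scalerA scalerA.
exact: hm.
Qed.

Lemma flag_family : exists s : seq S, (forall p, p \in s -> P p) /\
  forall l, exists (I : finType) (w : I -> E), (forall i, mon s l (w i)) /\
    (forall i, flag l (w i)) /\
    forall e, flag l e -> exists c : I -> S, e = \sum_i c i *: w i.
Proof.
have [r [pi [Ppi piP]]] := Snoeth iP.
exists (codom pi); split; first by move=> _ /codomP [i ->].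
elim=> [|l [I [w [wmon [wflag wgen]]]]].
  have [n [v hv]] := Efg; exists 'I_n, v; split; first by move=> i; exact: Mon0.
  by split=> // e _; exact: hv.
exists ('I_r * I)%type, (fun jm => pi jm.1 *: w jm.2); split.
  by move=> [j m]; apply: MonS => //; exact: codom_f.
split; first by move=> [j m]; apply: flagM.
move=> _ [n [p [f [Pp Ff ->]]]].
have /choice [b hb] := fun i => piP _ (Pp i).
have /choice [c hc] := fun i => wgen _ (Ff i).
exists (fun jm => \sum_i b i jm.1 * c i jm.2).
rewrite -(pair_bigA _ (fun j m => (\sum_i b i j * c i m) *: (pi j *: w m))) /=.
under [RHS]eq_bigr => j _.
  under eq_bigr => m _ do rewrite scaler_suml.
  rewrite exchange_big; over.
rewrite /= exchange_big; apply: eq_bigr => i _ /=.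
rewrite {1}(hb i) scaler_suml; apply: eq_bigr => j _.
rewrite {1}(hc i) scaler_sumr; apply: eq_bigr => m _.
rewrite !scalerA; congr (_ *: _); ring.
Qed.

Variable O : set S.
Hypothesis sO : subalg k O.
Hypothesis OP : forall a, O a -> P a -> a = 0.
Hypothesis Ofin : finite_over P O setT.

(** Over the fractions of [O] and modulo torsion, [e] is a combination of those [b i] whose level
    [lv i] is at least [l]. *)
Definition in_span n (b : nat -> E) (lv : nat -> nat) l (e : E) :=
  exists c (al : nat -> S), [/\ O c, ~ P c, forall i, O (al i),
    forall i, (lv i < l)%N -> al i = 0 & tors (c *: e - \sum_(i < n) al i *: b i)].

Definition indep n (b : nat -> E) := forall al : nat -> S, (forall i, O (al i)) ->
  tors (\sum_(i < n) al i *: b i) -> forall i, (i < n)%N -> al i = 0.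

Section InSpan.
Variables (n : nat) (b : nat -> E) (lv : nat -> nat).
Notation R := (in_span n b lv).

Lemma in_span_tors l e : tors e -> R l e.
Proof.
move=> te; exists 1, (fun=> 0); split=> //; [exact: (subalg1 sO)|by case: pP| |].
- by move=> _; exact: (subalg0 sO).
- by rewrite scale1r big1 ?subr0 // => i _; rewrite scale0r.
Qed.

Lemma in_spanD l e f : R l e -> R l f -> R l (e + f).
Proof.
move=> [c [al [Oc Pc Oal al0 te]]] [d [be [Od Pd Obe be0 tf]]].
case: (sO) => _ OD OM.
exists (c * d), (fun i => d * al i + c * be i); split.
- exact: OM.
- exact: prime_notM.
- by move=> i; apply: (OD); apply: (OM).
- by move=> i li; rewrite al0 // be0 // !mulr0 addr0.
- have -> : (c * d) *: (e + f) - \sum_(i < n) (d * al i + c * be i) *: b i =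
     d *: (c *: e - \sum_(i < n) al i *: b i) + c *: (d *: f - \sum_(i < n) be i *: b i).
    rewrite !scalerBr !scaler_sumr scalerDr !scalerA [d * c]mulrC.
    rewrite addrACA -opprD -big_split /=; congr (_ - _); apply: eq_bigr => i _.
    by rewrite scalerDl !scalerA.
  by apply: torsD; exact: torsZ.
Qed.

Lemma in_span_sum l (T : Type) (r : seq T) (p : pred T) (F : T -> E) :
  (forall i, p i -> R l (F i)) -> R l (\sum_(i <- r | p i) F i).
Proof.
move=> h; apply: big_ind => //; first by apply: in_span_tors; exact: tors0.
exact: in_spanD.
Qed.

Lemma in_spanZ l a e : O a -> R l e -> R l (a *: e).
Proof.
move=> Oa [c [al [Oc Pc Oal al0 te]]]; case: (sO) => _ _ OM.
exists c, (fun i => a * al i); split=> //.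
- by move=> i; exact: OM.
- by move=> i li; rewrite al0 // mulr0.
- have -> : c *: (a *: e) - \sum_(i < n) (a * al i) *: b i =
     a *: (c *: e - \sum_(i < n) al i *: b i).
    rewrite scalerBr scaler_sumr !scalerA mulrC; congr (_ - _).
    by apply: eq_bigr => i _; rewrite scalerA.
  exact: torsZ.
Qed.

Lemma in_spanN l e : R l e -> R l (- e).
Proof.
by rewrite -scaleN1r; apply: in_spanZ; apply: (subalgN sO); exact: (subalg1 sO).
Qed.

Lemma in_span_cancel l c e : O c -> ~ P c -> R l (c *: e) -> R l e.
Proof.
move=> Oc Pc [d [al [Od Pd Oal al0 te]]]; exists (d * c), al; split=> //.
- by case: (sO) => _ _; apply.
- exact: prime_notM.
- by rewrite -scalerA.
Qed.

Lemma in_span_le l l' e : (l <= l')%N -> R l' e -> R l e.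
Proof.
move=> ll [c [al [Oc Pc Oal al0 te]]]; exists c, al; split=> // i li.
by apply: al0; exact: leq_trans ll.
Qed.

Lemma in_span_mem l i : (i < n)%N -> (l <= lv i)%N -> R l (b i).
Proof.
move=> lin ll; exists 1, (fun j => (j == i)%:R); split.
- exact: (subalg1 sO).
- by case: pP.
- by move=> j; case: eqP => _; [exact: (subalg1 sO) | exact: (subalg0 sO)].
- by move=> j jl; case: eqP => // e; move: ll; rewrite -e leqNgt jl.
- rewrite (bigD1 (Ordinal lin)) //= eqxx !scale1r big1 ?addr0 ?subrr; first exact: tors0.
  by move=> j /negPf; rewrite -(inj_eq val_inj) /= => ->; rewrite scale0r.
Qed.

End InSpan.

Lemma extend_basis n b lv l (ws : seq E) : indep n b ->
  (forall i, (i < n)%N -> (l <= lv i)%N /\ flag (lv i) (b i)) ->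
  (forall w, w \in ws -> flag l w) ->
  exists n' b' lv', [/\ indep n' b',
    forall i, (i < n')%N -> (l <= lv' i)%N /\ flag (lv' i) (b' i),
    forall l' e, in_span n b lv l' e -> in_span n' b' lv' l' e &
    forall w, w \in ws -> in_span n' b' lv' l w].
Proof.
move=> ib hb; elim: ws => [|w ws IH] hw; first by exists n, b, lv; split.
have [|n1 [b1 [lv1 [i1 h1 s1 m1]]]] := IH; first by move=> v vs; apply: hw; rewrite inE vs orbT.
have [dw|ndw] := pselect (in_span n1 b1 lv1 l w).
  by exists n1, b1, lv1; split=> // v; rewrite inE => /orP [/eqP ->|/m1].
pose b2 i := if (i < n1)%N then b1 i else w.
pose lv2 i := if (i < n1)%N then lv1 i else l.
have sumb (al : nat -> S) : \sum_(i < n1.+1) al i *: b2 i = \sum_(i < n1) al i *: b1 i + al n1 *: w.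
  rewrite big_ord_recr /= {2}/b2 ltnn; congr (_ + _); apply: eq_bigr => i _.
  by rewrite /b2 ltn_ord.
have s2 l' e : in_span n1 b1 lv1 l' e -> in_span n1.+1 b2 lv2 l' e.
  move=> [c [al [Oc Pc Oal al0 te]]].
  exists c, (fun i => if (i < n1)%N then al i else 0); split=> //.
  - by move=> i; case: ifP => // _; exact: (subalg0 sO).
  - by move=> i; rewrite /lv2; case: ifP => // _; exact: al0.
  - rewrite (sumb (fun i => if (i < n1)%N then al i else 0)) ltnn scale0r addr0; move: te; congr tors; congr (_ - _).
    by apply: eq_bigr => i _; rewrite ltn_ord.
exists n1.+1, b2, lv2; split.
- move=> al Oal; rewrite sumb => ta.
  have aln : al n1 = 0.
    apply: contrapT => aln; apply: ndw.
    exists (al n1), (fun i => if (i < n1)%N then - al i else 0); split=> //.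
    + by move=> /(OP (Oal _)).
    + by move=> i; case: ifP => _; [exact: (subalgN sO) | exact: (subalg0 sO)].
    + by move=> i il; case: ifP => // /h1 [lel _]; move: il; rewrite ltnNge lel.
    + move: ta; congr tors; rewrite addrC -sumrN; congr (_ + _).
      by apply: eq_bigr => i _; rewrite ltn_ord scaleNr opprK.
  move: ta; rewrite aln scale0r addr0 => /(i1 _ Oal) h i.
  by rewrite ltnS leq_eqVlt => /orP [/eqP ->|/h].
- move=> i _; rewrite /lv2 /b2; case: ifP => [/h1 //|_]; split=> //.
  by apply: hw; exact: mem_head.
- by move=> l' e /s1 /s2.
- move=> v; rewrite inE => /orP [/eqP ->|/m1 /s2 //].
  have : in_span n1.+1 b2 lv2 l (b2 n1) by apply: in_span_mem => //; rewrite /lv2 ltnn.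
  by rewrite /b2 ltnn.
Qed.

(** A basis of the localization of [E] over the fractions of [O], adapted to the flag. It starts at
    a level [N] where the flag is torsion and proceeds to lower [l]: up to a denominator, a
    coefficient in [S] is a combination of the [X j] over [O] plus an element of [P], and the latter
    leads into the level [l.+1] already treated. *)
Lemma flagged_basis : exists n b lv, [/\ indep n b, (0 < n)%N,
  forall i, (i < n)%N -> flag (lv i) (b i) &
  forall l e, flag l e -> in_span n b lv l e].
Proof.
have [s [sP fam]] := flag_family.
have [N hN] := mon_tors sP.
have tN l e : (N <= l)%N -> flag l e -> tors e.
  move=> Nl; have [I [w [wm [_ wg]]]] := fam l; move=> /wg [c ->].
  by apply: tors_sum => i _; apply: torsZ; apply: (hN l).
suff [n [b [lv [ib hb sb]]]] : exists n b lv, [/\ indep n b,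
    forall i, (i < n)%N -> (0 <= lv i)%N /\ flag (lv i) (b i) &
    forall l e, (0 <= l)%N -> flag l e -> in_span n b lv l e].
  exists n, b, lv; split=> // [|i /hb [] //|l e]; last exact: sb.
  (* Were the basis empty, the generators of [E] would be torsion, and the product of their
     denominators would annihilate [E] without lying in [P]. *)
  rewrite lt0n; apply/eqP => n0.
  have allt e : tors e.
    have [//|c [al [Oc Pc _ _]]] := sb 0%N e (leqnn _).
    by rewrite n0 big_ord0 subr0; exact: tors_sat.
  have [m [v hv]] := Efg; have /choice [h hh] := fun i => allt (v i).
  case: Pmin => _ annP _; have : P (\prod_i h i).
    apply: annP => e; have [c ->] := hv e; rewrite scaler_sumr big1 // => i _.
    rewrite scalerA mulrC (bigD1 i) //= [h i * _]mulrC mulrA -scalerA.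
    by case: (hh i) => _ ->; rewrite scaler0.
  have : ~ P (\prod_i h i).
    apply: (big_ind (fun x => ~ P x)); [by case: pP | by move=> x y; exact: prime_notM |].
    by move=> i _; case: (hh i).
  by [].
have [d] := ubnP (N - 0)%N; move: (0%N) => l0.
elim: d l0 => // d IH l ltd.
have [Nl|lN] := leqP N l.
  exists 0%N, (fun=> 0), (fun=> 0%N); split=> // l' e ll' /(tN l' e (leq_trans Nl ll')).
  exact: in_span_tors.
have [|n [b [lv [ib hb sb]]]] := IH l.+1; first by lia.
have [Ix [w [_ [wf wg]]]] := fam l.
have [h [J [X [Oh Ph _ hX]]]] := Ofin.
have [||n' [b' [lv' [ib' hb' s1 s2]]]] :=
    @extend_basis n b lv l [seq X jm.1 *: w jm.2 | jm <- enum {: J * Ix}] ib.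
- by move=> i /hb [lb fb]; split=> //; exact: ltnW.
- by move=> _ /mapP [[j m] _ ->]; exact: flagZ.
exists n', b', lv'; split=> // l' e; rewrite leq_eqVlt => /orP [/eqP <-|ll'] fe; last exact/s1/sb.
have [c ->] := wg _ fe; apply: in_span_sum => i _.
have [m [al [Oal Pal]]] := hX (c i) I.
apply: (@in_span_cancel _ _ _ _ (h ^+ m)); [exact: (subalgX _ sO) | exact: prime_notX |].
rewrite scalerA -[_ * _](subrK (\sum_j al j * X j)) scalerDl; apply: in_spanD.
  by apply: (@in_span_le _ _ _ _ l.+1) => //; apply: s1; apply: sb => //; exact: flagM.
rewrite scaler_suml; apply: in_span_sum => j _; rewrite -scalerA; apply: in_spanZ => //.
by apply: s2; apply/mapP; exists (j, i); rewrite ?mem_enum.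
Qed.

End FlaggedBasis.

(** * The trace argument in the quotient of the Rees module by the square of [t] *)

Section Gabber.
Variables (L : fieldType) (charL : [pchar L] =i pred0).
Variables (S : comPzRingType) (kS : {rmorphism L -> S}) (gens : seq S).
Hypothesis Sfg : fg_alg kS gens.
Variable br : S -> S -> S.
Hypothesis brMl : forall a b c, br (a * b) c = a * br b c + b * br a c.
Hypothesis brMr : forall a b c, br c (a * b) = a * br c b + b * br c a.
Hypothesis br0l : forall a, br 0 a = 0.
Variables (E : lmodType S) (P : set S).
Hypothesis Efg : exists n (v : 'I_n -> E), forall e, exists c : 'I_n -> S, e = \sum_i c i *: v i.
Hypothesis Pmin : min_prime (ann E) P.

(* [N] plays the role of the Rees module of a filtered module with associated
   graded module [E = N / t N], and [lift x a] means that [x] is the action on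
   [N] of an element of the Rees algebra with symbol [a]. *)
Variables (N : zmodType) (Nin : set N) (t : N -> N) (q : N -> E).
Variable lift : (N -> N) -> S -> Prop.
Hypothesis ND : forall n m, Nin n -> Nin m -> Nin (n + m).
Hypothesis NN : forall n, Nin n -> Nin (- n).
Hypothesis N0 : Nin 0.
Hypothesis tD : forall n m, t (n + m) = t n + t m.
Hypothesis Nt : forall n, Nin n -> Nin (t n).
Hypothesis t_inj : forall n, t n = 0 -> n = 0.
Hypothesis qD : forall n m, Nin n -> Nin m -> q (n + m) = q n + q m.
Hypothesis qt : forall n, Nin n -> q (t n) = 0.
Hypothesis q_ker : forall n, Nin n -> q n = 0 -> exists m, Nin m /\ n = t m.
Hypothesis q_surj : forall e, exists n, Nin n /\ q n = e.
Hypothesis liftD : forall x a n m, lift x a -> x (n + m) = x n + x m.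
Hypothesis liftN : forall x a n, lift x a -> Nin n -> Nin (x n).
Hypothesis lift_t : forall x a n, lift x a -> x (t n) = t (x n).
Hypothesis lift_q : forall x a n, lift x a -> Nin n -> q (x n) = a *: q n.
Hypothesis lift_0 : lift (fun=> 0) 0.
Hypothesis lift_opp : forall x a, lift x a -> lift (fun n => - x n) (- a).
Hypothesis lift_ex : forall a, exists x, lift x a.
Hypothesis lift_add : forall x y a b, lift x a -> lift y b ->
  lift (fun n => x n + y n) (a + b).
Hypothesis lift_mul : forall x y a b, lift x a -> lift y b ->
  lift (fun n => x (y n)) (a * b).
Hypothesis lift_br : forall x y a b, lift x a -> lift y b ->
  exists z, lift z (br a b) /\ forall n, Nin n -> x (y n) - y (x n) = t (z n).

Let pP : prime_ideal P. Proof. by case: Pmin. Qed.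
Let iP : ideal P := prime_ideal_ideal pP.
Notation tors := (tors P).

Let t0 : t 0 = 0.
Proof. by apply: (addrI (t 0)); rewrite -tD !addr0. Qed.
Let tN n : t (- n) = - t n.
Proof. by apply: (addrI (t n)); rewrite -tD !subrr t0. Qed.
Let tB n m : t (n - m) = t n - t m. Proof. by rewrite tD tN. Qed.
Let q0 : q 0 = 0.
Proof. by apply: (addrI (q 0)); rewrite -qD // !addr0. Qed.
Let qN n : Nin n -> q (- n) = - q n.
Proof. by move=> Nn; apply: (addrI (q n)); rewrite -qD ?subrr ?q0 //; exact: NN. Qed.
Let qB n m : Nin n -> Nin m -> q (n - m) = q n - q m.
Proof. by move=> Nn Nm; rewrite qD ?qN //; exact: NN. Qed.
Let NB n m : Nin n -> Nin m -> Nin (n - m).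
Proof. by move=> Nn Nm; apply: ND => //; exact: NN. Qed.
Let lift0 x a : lift x a -> x 0 = 0.
Proof. by move=> lx; apply: (addrI (x 0)); rewrite -(liftD _ _ lx) !addr0. Qed.
Let liftNeg x a n : lift x a -> x (- n) = - x n.
Proof.
by move=> lx; apply: (addrI (x n)); rewrite -(liftD _ _ lx) !subrr (lift0 lx).
Qed.
Let liftB x a n m : lift x a -> x (n - m) = x n - x m.
Proof. by move=> lx; rewrite (liftD _ _ lx) (liftNeg _ lx). Qed.
Let lift_sum x a n (F : 'I_n -> N) : lift x a -> x (\sum_i F i) = \sum_i x (F i).
Proof.
move=> lx; apply: (big_morph x); [by move=> *; exact: (liftD _ _ lx) | exact: lift0 lx].
Qed.
Let t_sum n (F : 'I_n -> N) : t (\sum_i F i) = \sum_i t (F i).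
Proof. exact: (big_morph t tD t0). Qed.
Let N_sum n (F : 'I_n -> N) : (forall i, Nin (F i)) -> Nin (\sum_i F i).
Proof. by move=> NF; apply: big_ind. Qed.
Let q_sum n (F : 'I_n -> N) : (forall i, Nin (F i)) -> q (\sum_i F i) = \sum_i q (F i).
Proof.
move=> NF; suff [] : Nin (\sum_i F i) /\ q (\sum_i F i) = \sum_i q (F i) by [].
apply: (big_ind2 (fun x y => Nin x /\ q x = y)) => [|x1 y1 x2 y2 [N1 <-] [N2 <-]|i _] //.
by split; [exact: ND | exact: qD].
Qed.

(* the kernel of the localization at [P] of [N / t^2 N] *)
Definition tors2 n := Nin n /\ exists h s m, [/\ ~ P h, lift s h, Nin m & s n = t (t m)].

(** The denominator [s] does not commute with [x]: the commutator leaves a term [t (w n)], and a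
    second application of [s] moves it into [t^2 N]. Hence the denominator [h * h]. *)
Lemma tors2_lift n x a : lift x a -> tors2 n -> tors2 (x n).
Proof.
move=> lx [Nn [h [s [m [Ph ls Nm e]]]]]; split; first exact: liftN lx Nn.
have [w [lw ew]] := lift_br ls lx; have [v [lv ev]] := lift_br ls lw.
exists (h * h), (fun n => s (s n)), (s (x m) + t (w m) + v n); split.
- exact: prime_notM.
- exact: lift_mul.
- by apply: ND; [apply: ND|]; [exact/(liftN ls)/(liftN lx) | exact/Nt/(liftN lw) | exact: liftN lv Nn].
have -> : s (x n) = x (s n) + t (w n) by rewrite -ew // addrC subrK.
rewrite (liftD _ _ ls) (lift_t _ ls).
have -> : s (w n) = w (s n) + t (v n) by rewrite -ev // addrC subrK.
by rewrite e (lift_t _ lx) (lift_t _ lx) !(lift_t _ ls) !(lift_t _ lw) !tD addrA.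
Qed.

Lemma tors2_sat n s h : Nin n -> lift s h -> ~ P h -> tors2 (s n) -> tors2 n.
Proof.
move=> Nn ls Ph [_ [g [r [m [Pg lr Nm e]]]]]; split=> //.
exists (g * h), (fun n => r (s n)), m; split=> //; first exact: prime_notM.
exact: lift_mul.
Qed.

Lemma tors2_tt m : Nin m -> tors2 (t (t m)).
Proof.
move=> Nm; split; first exact/Nt/Nt; have [s ls] := lift_ex 1.
exists 1, s, (s m); split=> //; [by case: pP | exact: liftN ls Nm |].
by rewrite !(lift_t _ ls).
Qed.

Lemma tors2D n m : tors2 n -> tors2 m -> tors2 (n + m).
Proof.
move=> tn tm; have [Nn [h [s [u [Ph ls Nu e]]]]] := tn; have [Nm _] := tm.
apply: (tors2_sat _ ls Ph); first exact: ND.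
have [_ [g [r [v [Pg lr Nv e']]]]] := tors2_lift ls tm.
rewrite (liftD _ _ ls); split; first by apply: ND; exact: liftN ls _.
exists g, r, (r u + v); split=> //; first by apply: ND => //; exact: liftN lr Nu.
by rewrite (liftD _ _ lr) e e' !(lift_t _ lr) !tD.
Qed.

Lemma tors2N n : tors2 n -> tors2 (- n).
Proof.
move=> [Nn [h [s [m [Ph ls Nm e]]]]]; split; first exact: NN.
exists h, s, (- m); split=> //; first exact: NN.
by rewrite (liftNeg _ ls) e !tN.
Qed.

Lemma tors2B n m : tors2 n -> tors2 m -> tors2 (n - m).
Proof. by move=> tn tm; apply: tors2D => //; exact: tors2N. Qed.

Lemma tors2_sum n (F : 'I_n -> N) : (forall i, tors2 (F i)) -> tors2 (\sum_i F i).
Proof.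
move=> h; apply: big_ind => //; last exact: tors2D.
by rewrite -t0 -t0; apply: tors2_tt.
Qed.

Lemma tors2_q n : tors2 n -> tors (q n).
Proof.
move=> [Nn [h [s [m [Ph ls Nm e]]]]]; exists h; split=> //.
by rewrite -(lift_q ls) // e qt //; exact: Nt.
Qed.

(** Multiplication by [t] identifies [N / t N] with [t N / t^2 N], also after localization. *)
Lemma tors2_t n : Nin n -> (tors2 (t n) <-> tors (q n)).
Proof.
move=> Nn; split=> [[_ [h [s [m [Ph ls Nm]]]]]|[h [Ph hq]]].
  rewrite (lift_t _ ls) => e.
  have e' : s n = t m by apply/eqP; rewrite -subr_eq0; apply/eqP/t_inj; rewrite tB e subrr.
  by exists h; split=> //; rewrite -(lift_q ls) // e' qt.
have [s ls] := lift_ex h.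
have [|m [Nm e]] := q_ker (liftN ls Nn); first by rewrite (lift_q ls).
by split; [exact: Nt | exists h, s, m; split=> //; rewrite (lift_t _ ls) e].
Qed.

(** An operator with symbol 0 maps [N] into [t N]; division by [t], which is injective, followed by
    reduction induces a map of [E]. It is [S]-linear because the bracket of 0 with any symbol is
    0. *)
Lemma lift_zero z : lift z 0 -> exists ze : E -> E,
  [/\ forall e f, ze (e + f) = ze e + ze f, forall a e, ze (a *: e) = a *: ze e &
   forall n, Nin n -> exists m, [/\ Nin m, z n = t m & q m = ze (q n)]].
Proof.
move=> lz.
have div n : Nin n -> exists m, Nin m /\ z n = t m.
  by move=> Nn; apply: q_ker; [exact: liftN lz Nn | rewrite (lift_q lz) // scale0r].
have uniq n n' m m' : Nin n -> Nin n' -> Nin m -> Nin m' -> q n = q n' ->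
    z n = t m -> z n' = t m' -> q m = q m'.
  move=> Nn Nn' Nm Nm' eq e e'.
  have [|p [Np ep]] := q_ker (NB Nn Nn'); first by rewrite qB // eq subrr.
  apply/eqP; rewrite -subr_eq0 -qB //.
  have -> : m - m' = z p.
    apply/eqP; rewrite -subr_eq0; apply/eqP/t_inj.
    by rewrite !tB -(lift_t _ lz) -ep (liftB _ _ lz) e e' subrr.
  by rewrite (lift_q lz) // scale0r.
have /choice [ze hze] e : exists f, exists n m, [/\ Nin n, Nin m, q n = e, z n = t m & q m = f].
  have [n [Nn qn]] := q_surj e; have [m [Nm zm]] := div _ Nn.
  by exists (q m), n, m.
exists ze; split.
- move=> e f; have [n [m [Nn Nm qn zn <-]]] := hze e.
  have [n' [m' [Nn' Nm' qn' zn' <-]]] := hze f.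
  have [n2 [m2 [Nn2 Nm2 qn2 zn2 <-]]] := hze (e + f).
  rewrite -qD //; apply: (uniq n2 (n + n')) => //; do ?exact: ND.
    by rewrite qn2 qD // qn qn'.
  by rewrite (liftD _ _ lz) zn zn' tD.
- move=> a e; have [n [m [Nn Nm qn zn <-]]] := hze e.
  have [n2 [m2 [Nn2 Nm2 qn2 zn2 <-]]] := hze (a *: e).
  have [s ls] := lift_ex a; have [w [lw ew]] := lift_br lz ls.
  rewrite br0l in lw.
  have Nsm := liftN ls Nm; have Nw := liftN lw Nn.
  have -> : a *: q m = q (s m + w n) by rewrite qD // (lift_q ls) // (lift_q lw) // scale0r addr0.
  apply: (uniq n2 (s n)) => //; [exact: liftN ls Nn | exact: ND | |].
    by rewrite (lift_q ls) // qn2 qn.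
  by rewrite tD -ew // zn (lift_t _ ls) addrC subrK.
- move=> n Nn; have [m [Nm zm]] := div _ Nn; exists m; split=> //.
  have [n2 [m2 [Nn2 Nm2 qn2 zn2 <-]]] := hze (q n).
  exact: (uniq n n2).
Qed.

Section Trace.
Variable O : set S.
Hypothesis sO : subalg kS O.
Hypothesis OP : forall a, O a -> P a -> a = 0.
Hypothesis Ofin : finite_over P O setT.
Variables (n : nat) (b : nat -> E) (lv : nat -> nat) (bt : nat -> N).
Hypothesis b_indep : indep P O n b.
Hypothesis n_gt0 : (0 < n)%N.
Hypothesis b_flag : forall i, (i < n)%N -> flag P (lv i) (b i).
Hypothesis span_b : forall l e, flag P l e -> in_span P O n b lv l e.
Hypothesis Nbt : forall i, Nin (bt i).
Hypothesis qbt : forall i, q (bt i) = b i.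

Let O_alg x : alg P O x. Proof. exact: finite_alg pP sO Ofin. Qed.

(** [alg_inverse] inverts [h] only modulo [P]. The error [d] acts nilpotently on the localization of
    [E], so that a power of [c = h * y - d] gives an inverse valid up to torsion. *)
Lemma strong_inverse h : ~ P h -> exists g c, [/\ O c, ~ P c &
  forall e : E, tors ((h * g - c) *: e)].
Proof.
move=> Ph; have [y [c [Oc Pc Pyc]]] := alg_inverse charL pP sO (O_alg h) Ph.
have [s [sP fam]] := flag_family pP Efg (noeth_fg Sfg) .
have [M hM] := mon_tors Pmin sP.
pose d := h * y - c.
have dM m (e : E) : flag P m (d ^+ m *: e).
  elim: m e => [//|m IH] e; rewrite exprS -scalerA; apply: flagM => //.
have [Ix [w [wm [_ wg]]]] := fam M.
have [z ez] : exists z, c ^+ M = h * z + (- d) ^+ M.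
  have -> : c = h * y + (- d) by rewrite /d; ring.
  elim: M {hM wm wg w Ix} => [|m [z ez]]; first by exists 0; rewrite !expr0 mulr0 add0r.
  exists (y * (h * y + - d) ^+ m + (- d) * z); rewrite !exprS {1}mulrDl {2}ez; ring.
exists z, (c ^+ M); split; [exact: (subalgX _ sO) | exact: prime_notX |].
move=> e; rewrite ez opprD addrA subrr sub0r scaleNr; apply: torsN => //.
rewrite exprNn -scalerA; apply: torsZ.
have [cc ->] := wg _ (dM M e); apply: tors_sum => // i _; apply: torsZ => //.
exact: (hM M).
Qed.

Lemma common_denom (Q : nat -> S -> Prop) : (forall i, exists c, [/\ O c, ~ P c & Q i c]) ->
  (forall i c d, O c -> ~ P c -> O d -> ~ P d -> Q i c -> Q i (c * d)) ->
  exists c, [/\ O c, ~ P c & forall i, (i < n)%N -> Q i c].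
Proof.
move=> hQ QM; elim: n => [|m [c [Oc Pc Qc]]].
  by exists 1; split=> //; [exact: subalg1 sO | case: pP].
have [d [Od Pd Qd]] := hQ m; case: (sO) => _ _ OM.
exists (c * d); split; [exact: OM | exact: prime_notM |].
move=> i; rewrite ltnS leq_eqVlt => /orP [/eqP ->|lim]; last by apply: QM => //; exact: Qc.
by rewrite mulrC; exact: QM.
Qed.

(** The matrix of [x] on the lifted basis modulo [t^2]. Its part of order 0 consists of operators
    [z i j] lifting elements of [O], and these are zero as operators unless the level strictly
    rises. The coefficient [y i] of [t] is recorded through its coordinates [be i j] over [O]. *)
Definition normal_form x (al be : nat -> nat -> S) (z : nat -> nat -> N -> N) (y : nat -> N) :=
  [/\ forall i j, O (al i j) /\ O (be i j), forall i j, lift (z i j) (al i j),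
      forall i j, ~~ (lv i < lv j)%N -> al i j = 0 /\ forall m, z i j m = 0,
      forall i, Nin (y i) &
      forall i, (i < n)%N -> tors2 (x (bt i) - \sum_(j < n) z i j (bt j) - t (y i)) /\
        tors (q (y i) - \sum_(j < n) be i j *: b j)].

(** The difference of two lifts of [a] has symbol 0, so that its value at [m] is [t] times an
    element whose class is the image of the torsion element [q m] under a linear map. *)
Lemma lift_indep s s' a m : lift s a -> lift s' a -> Nin m -> tors (q m) ->
  tors2 (s m - s' m).
Proof.
move=> ls ls' Nm [h [Ph hm]].
have := lift_add ls (lift_opp ls'); rewrite subrr => lz.
have [ze [zeD zeZ hze]] := lift_zero lz.
have [p [Np -> qp]] := hze _ Nm; apply/tors2_t => //.
exists h; split=> //; rewrite qp -zeZ hm.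
by rewrite -[X in ze X](scale0r 0) zeZ scale0r.
Qed.

Lemma lift_sumop (T : Type) (r : seq T) (F : T -> N -> N) (a : T -> S) :
  (forall i, lift (F i) (a i)) -> lift (fun m => \sum_(i <- r) F i m) (\sum_(i <- r) a i).
Proof.
move=> lF; elim: r => [|i r IH].
  by rewrite big_nil (_ : (fun _ => _) = fun=> 0) //; apply/funext => m; rewrite big_nil.
rewrite big_cons (_ : (fun _ => _) = fun m => F i m + \sum_(j <- r) F j m).
  exact: lift_add.
by apply/funext => m; rewrite big_cons.
Qed.

(** Since [a] raises the flag, a multiple of it by some [c1] in [O] has strictly triangular
    coordinates over [O]. The remainders [X i] have torsion symbols, and a second factor [d] brings
    them into [t N], with coefficients of [t] that have coordinates over [O]. *)
Lemma normal_form_exists a : P a -> exists c x al be z y,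
  [/\ O c, ~ P c, lift x (c * a) & normal_form x al be z y].
Proof.
move=> Pa; case: (sO) => _ OD OM.
pose Q1 i c := (i < n)%N -> exists al : nat -> S, [/\ forall j, O (al j),
   forall j, (lv j < (lv i).+1)%N -> al j = 0 &
   tors (c *: (a *: b i) - \sum_(j < n) al j *: b j)].
have [||c1 [Oc1 Pc1 hc1]] := @common_denom Q1.
- move=> i; have [lin|nl] := ltnP i n; last first.
    by exists 1; split; [exact: (subalg1 sO) | by case: pP | by move=> lin; move: (leq_trans lin nl); rewrite ltnn].
  have [c [al [Oc Pc Oal al0 tal]]] := span_b (flagM Pa (b_flag lin)).
  by exists c; split=> // _; exists al.
- move=> i c d Oc Pc Od Pd h lin; have [al [Oal al0 tal]] := h lin.
  exists (fun j => d * al j); split=> [j|j /al0 ->|]; [exact: OM | exact: mulr0 |].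
  have -> : (c * d) *: (a *: b i) - \sum_(j < n) (d * al j) *: b j =
      d *: (c *: (a *: b i) - \sum_(j < n) al j *: b j).
    rewrite scalerBr scaler_sumr !scalerA; congr (_ *: _ - _); first by ring.
    by apply: eq_bigr => j _; rewrite scalerA.
  exact: torsZ.
have /choice [al hal] i : exists al : nat -> S, [/\ forall j, O (al j),
   forall j, (lv j < (lv i).+1)%N -> al j = 0 &
   (i < n)%N -> tors (c1 *: (a *: b i) - \sum_(j < n) al j *: b j)].
  have [lin|nl] := ltnP i n; first by have [//|al [h1 h2 h3]] := hc1 i lin; exists al.
  by exists (fun=> 0); split=> // _; exact: (subalg0 sO).
have [x1 lx1] := lift_ex (c1 * a).
have /choice [z1 hz1] (ij : nat * nat) : exists z, lift z (al ij.1 ij.2) /\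
    (~~ (lv ij.1 < lv ij.2)%N -> forall m, z m = 0).
  have [_ al0 _] := hal ij.1; case: (boolP (lv ij.1 < lv ij.2)%N) => [h|].
    by have [z lz] := lift_ex (al ij.1 ij.2); exists z.
  by rewrite -leqNgt => h; exists (fun=> 0); rewrite al0.
pose X i := x1 (bt i) - \sum_(j < n) z1 (i, j : nat) (bt j).
have NX i : Nin (X i).
  apply: NB; first exact: liftN lx1 _.
  by apply: N_sum => j; case: (hz1 (i, j : nat)) => lz _; exact: liftN lz _.
have tX i : (i < n)%N -> tors (q (X i)).
  move=> lin; rewrite /X qB; last 2 first.
  - exact: liftN lx1 _.
  - by apply: N_sum => j; case: (hz1 (i, j : nat)) => lz _; exact: liftN lz _.
  rewrite (lift_q lx1) // qbt q_sum; last first.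
    by move=> j; case: (hz1 (i, j : nat)) => lz _; exact: liftN lz _.
  have [_ _ /(_ lin)] := hal i; rewrite scalerA; congr tors; congr (_ - _).
  apply: eq_bigr => j _; case: (hz1 (i, j : nat)) => lz _.
  by rewrite (lift_q lz) // qbt.
pose Q2 i d := (i < n)%N -> exists y (be : nat -> S), [/\ Nin y, forall j, O (be j),
   forall s, lift s d -> tors2 (s (X i) - t y) & tors (q y - \sum_(j < n) be j *: b j)].
have [||d [Od Pd hd]] := @common_denom Q2.
- move=> i; have [lin|nl] := ltnP i n; last first.
    by exists 1; split; [exact: (subalg1 sO) | by case: pP | by move=> lin; move: (leq_trans lin nl); rewrite ltnn].
  have [h [Ph hX]] := tX _ lin; have [s ls] := lift_ex h.
  have [|m [Nm em]] := q_ker (liftN ls (NX i)); first by rewrite (lift_q ls).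
  (* The denominator [h] of [X i] need not be in [O]; it is replaced by [c], and [e] clears the
     coordinates of the quotient. *)
  have [g [c [Oc Pc hgc]]] := strong_inverse Ph.
  have [e [be [Oe Pe Obe _ tbe]]] := @span_b 0%N (g *: q m) I.
  have [r lr] := lift_ex (e * g).
  exists (e * c); split; [exact: OM | exact: prime_notM |] => _.
  exists (r m), be; split=> //; first exact: liftN lr Nm.
    move=> s' ls'; apply: (tors2_sat _ ls Ph).
      by apply: NB; [exact: liftN ls' _ | apply: Nt; exact: liftN lr Nm].
    have [w [lw ew]] := lift_br ls ls'.
    have -> : s (s' (X i) - t (r m)) = t (s' m + w (X i) - s (r m)).
      rewrite (liftB _ _ ls) (lift_t _ ls) tB tD -ew // em (lift_t _ ls').
      by rewrite [t (s' m) + _]addrC subrK.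
    have N1 := liftN ls' Nm; have N2 := liftN lw (NX i); have N3 := liftN ls (liftN lr Nm).
    apply/tors2_t; first by apply: NB => //; exact: ND.
    rewrite qB ?qD //; last exact: ND.
    rewrite (lift_q ls') // (lift_q lw) // (lift_q ls) ?(lift_q lr) //; last exact: liftN lr Nm.
    rewrite addrAC; apply: torsD => //; last by apply: torsZ => //; exact: tX.
    rewrite scalerA -scalerBl.
    have -> : e * c - h * (e * g) = - e * (h * g - c) by ring.
    by rewrite -scalerA; apply: torsZ.
  by rewrite (lift_q lr) // -scalerA.
- move=> i c e Oc Pc Oe Pe h lin; have [y [be [Ny Obe ty tbe]]] := h lin.
  have [r lr] := lift_ex e; have [s0 ls0] := lift_ex c.
  exists (r y), (fun j => e * be j); split; [exact: liftN lr Ny | by move=> j; exact: OM | |].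
    move=> s ls.
    have l2 := lift_mul lr ls0; rewrite mulrC in l2.
    have -> : s (X i) - t (r y) = (s (X i) - r (s0 (X i))) + r (s0 (X i) - t y).
      by rewrite (liftB _ _ lr) (lift_t _ lr) addrA subrK.
    apply: tors2D; first by apply: (lift_indep ls l2) => //; exact: tX.
    by apply: (tors2_lift lr); exact: ty.
  have -> : q (r y) - \sum_(j < n) (e * be j) *: b j = e *: (q y - \sum_(j < n) be j *: b j).
    rewrite (lift_q lr) // scalerBr scaler_sumr; congr (_ - _).
    by apply: eq_bigr => j _; rewrite scalerA.
  exact: torsZ.
have [s ls] := lift_ex d.
have /choice [y /choice [be hy]] i : exists y (be : nat -> S), [/\ Nin y, forall j, O (be j) &
   (i < n)%N -> tors2 (s (X i) - t y) /\ tors (q y - \sum_(j < n) be j *: b j)].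
  have [lin|nl] := ltnP i n.
    by have [//|y [be [h1 h2 h3 h4]]] := hd i lin; exists y, be; split=> // _; split=> //; exact: h3.
  by exists 0, (fun=> 0); split=> // _; exact: (subalg0 sO).
exists (d * c1), (fun m => s (x1 m)), (fun i j => d * al i j), be,
  (fun i j m => s (z1 (i, j) m)), y; split.
- exact: OM.
- exact: prime_notM.
- by rewrite -mulrA; exact: lift_mul.
split.
- move=> i j; split; last by case: (hy i).
  by apply: OM => //; case: (hal i).
- by move=> i j; apply: lift_mul => //; case: (hz1 (i, j)).
- move=> i j nij; split=> [|m]; last by case: (hz1 (i, j)) => _ /(_ nij) ->; exact: lift0 ls.
  by have [_ -> ] := hal i; rewrite ?mulr0 //; rewrite ltnS leqNgt.
- by move=> i; case: (hy i).
- move=> i lin; have [_ _ /(_ lin) [h1 h2]] := hy i; split=> //.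
  by move: h1; rewrite /X (liftB _ _ ls) (lift_sum _ ls).
Qed.

(** The operator [x] is moved past the entries [z' i j] of the row of [x']. The commutators add to
    the coefficient of [t] only terms of level above [lv i], because [z' i j] vanishes unless [lv j]
    is greater; hence [v] is determined modulo that level. *)
Lemma normal_form_comp x x' a a' al be z y al' be' z' y' i : (i < n)%N ->
  lift x a -> lift x' a' -> normal_form x al be z y -> normal_form x' al' be' z' y' ->
  exists v, [/\ Nin v,
    tors2 (x (x' (bt i)) - \sum_(k < n) \sum_(j < n) z' i j (z j k (bt k)) - t v) &
    in_span P O n b lv (lv i).+1
      (q v - \sum_(k < n) (\sum_(j < n) (al' i j * be j k + be' i j * al j k)) *: b k)].
Proof.
move=> lin lx lx' [OO lz z0 Ny hy] [OO' lz' z0' Ny' hy'].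
have Nx (j : nat) : Nin (x (bt j)) := liftN lx (Nbt j).
have Nz i j m : Nin m -> Nin (z i j m) := liftN (lz i j).
have Nz' i j m : Nin m -> Nin (z' i j m) := liftN (lz' i j).
have /choice [m1 hm1] (j : 'I_n) : exists m, [/\ Nin m,
    x (z' i j (bt j)) - z' i j (x (bt j)) = t m & in_span P O n b lv (lv i).+1 (q m)].
  case: (boolP (lv i < lv j)%N) => [lij|nij].
    have [w [lw ew]] := lift_br lx (lz' i j); exists (w (bt j)); split.
    - exact: liftN lw _.
    - exact: ew.
    - rewrite (lift_q lw) // qbt; apply: (in_span_le lij); apply: span_b.
      by apply: flagZ => //; exact: b_flag.
  have [_ e0] := z0' _ _ nij; exists 0; split=> //.
    by rewrite !e0 (lift0 lx) subrr t0.
  by rewrite q0; apply: (in_span_tors pP sO); exact: tors0.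
exists (\sum_(j < n) z' i j (y j) + \sum_j m1 j + x (y' i)).
have N1 : Nin (\sum_(j < n) z' i j (y j)) by apply: N_sum => j; apply: Nz'.
have N2 : Nin (\sum_j m1 j) by apply: N_sum => j; case: (hm1 j).
have N3 : Nin (x (y' i)) by apply: liftN lx _.
split; first by apply: ND => //; exact: ND.
  have [A1 _] := hy' _ lin; move/(tors2_lift lx): A1.
  rewrite !(liftB _ _ lx) (lift_t _ lx) (lift_sum _ lx) => A1.
  have A2 : tors2 (\sum_(j < n) z' i j (x (bt j) - \sum_(k < n) z j k (bt k) - t (y j))).
    by apply: tors2_sum => j; apply: (tors2_lift (lz' i j)); case: (hy _ (ltn_ord j)).
  have := tors2D A1 A2; congr tors2.
  under [X in _ + X = _]eq_bigr => j _ do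
    rewrite !(liftB _ _ (lz' i j)) (lift_t _ (lz' i j)) (lift_sum _ (lz' i j)).
  rewrite !big_split /= !sumrN !tD !t_sum.
  have -> : \sum_(j < n) x (z' i j (bt j)) =
      \sum_(j < n) z' i j (x (bt j)) + \sum_(j < n) t (m1 j).
    rewrite -big_split; apply: eq_bigr => j _ /=.
    by case: (hm1 j) => _ <- _; rewrite addrC subrK.
  rewrite [\sum_(k < n) \sum_(j < n) _]exchange_big /=.
  set u1 := x (x' _); set u2 := \sum_(j < n) z' i j (x _); set u3 := \sum_(j < n) t (m1 _).
  set u4 := t _; set u5 := \sum_(j < n) \sum_(k < n) _; set u6 := \sum_(j < n) t _.
  rewrite !opprD !addrA.
  rewrite [_ - u4 + u2]addrAC [_ - u3 + u2]addrAC subrK.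
  rewrite [_ - u4 - u5]addrAC [_ - u3 - u5]addrAC.
  by rewrite [_ - u4 - u6]addrAC [_ - u3 - u6]addrAC.
rewrite qD ?qD //; last exact: ND.
rewrite !q_sum; last 2 first.
- by move=> j; apply: Nz'.
- by move=> j; case: (hm1 j).
rewrite (lift_q lx) //.
under [X in _ - X]eq_bigr => k _ do rewrite scaler_suml.
rewrite exchange_big /=.
under [X in _ - X]eq_bigr => j _.
  under eq_bigr => k _ do rewrite scalerDl -!scalerA.
  rewrite big_split /= -!scaler_sumr; over.
rewrite big_split /=.
set U1 := \sum_(j < n) q _; set U2 := \sum_(j < n) q _.
set V1 := \sum_(j < n) _; set V2 := \sum_(j < n) _.
have -> : U1 + U2 + a *: q (y' i) - (V1 + V2) = U2 + ((U1 - V1) + (a *: q (y' i) - V2)).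
  by rewrite opprD addrACA -addrA [U1 + _]addrC -!addrA; congr (_ + _);
     rewrite addrCA [U1 + _]addrC -!addrA.
apply: (in_spanD pP sO).
  by apply: (in_span_sum pP sO) => j _; case: (hm1 j).
apply: (in_span_tors pP sO); apply: torsD => //.
  rewrite /U1 /V1 -sumrB; apply: tors_sum => // j _.
  rewrite (lift_q (lz' i j)) // -scalerBr; apply: torsZ.
  by case: (hy _ (ltn_ord j)).
have -> : a *: q (y' i) - V2 = a *: (q (y' i) - \sum_(j < n) be' i j *: b j) +
    \sum_(j < n) be' i j *: (a *: b j - \sum_(k < n) al j k *: b k).
  rewrite scalerBr scaler_sumr.
  under [X in _ = _ + X]eq_bigr do rewrite scalerBr.
  rewrite big_split /= sumrN addrA; congr (_ - _).
  have -> : \sum_(j < n) a *: (be' i j *: b j) = \sum_(j < n) be' i j *: (a *: b j).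
    by apply: eq_bigr => j _; rewrite !scalerA mulrC.
  by rewrite subrK.
apply: torsD => //; first by apply: torsZ; case: (hy' _ lin).
apply: tors_sum => // j _; apply: torsZ.
have [/tors2_q + _] := hy _ (ltn_ord j).
have Ns : Nin (\sum_(k < n) z j k (bt k)) by apply: N_sum => k; apply: Nz.
rewrite qB ?qB ?(qt (Ny _)) ?subr0 //; [|exact: NB|exact: Nt].
rewrite (lift_q lx) // qbt q_sum; last by move=> k; apply: Nz.
congr tors; congr (_ - _); apply: eq_bigr => k _.
by rewrite (lift_q (lz j k)) // qbt.
Qed.

(* Modulo [t], lifts of elements of [P] strictly raise the flag, so that the
   coefficient of [t] in their commutator has trace zero; but the commutator is
   [t] times a lift of [br f g], which after scaling acts on the graded pieces
   of the flag as a nonzero constant [C] of [O]. *)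
Lemma trace_contra f g : P f -> P g -> P (br f g).
Proof.
move=> Pf Pg; apply: contrapT => nPu.
case: (sO) => _ OD OM; case: (iP) => P0 PD PM.
(* With [y0 * g] in place of [g], the bracket is multiplied by [y0] modulo [P] and becomes an
   element of [O]. *)
have [y0 [c0 [Oc0 Pc0 Puc]]] := alg_inverse charL pP sO (O_alg _) nPu.
have [c1 [x [al [be [z [y [Oc1 Pc1 lx nf]]]]]]] := normal_form_exists Pf.
have [c2 [x' [al' [be' [z' [y' [Oc2 Pc2 lx' nf']]]]]]] := normal_form_exists (PM y0 _ Pg).
pose C := c1 * c2 * c0.
set u := br (c1 * f) (c2 * (y0 * g)).
have PuC : P (u - C).
  have -> : u - C = c1 * c2 * (br f g * y0 - c0) +
     (c1 * c2 * br f y0 + c1 * y0 * br f c2) * g + br c1 (c2 * (y0 * g)) * f.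
    by rewrite /u /C brMl !brMr; ring.
  by apply: (PD); [apply: (PD)|]; apply: (PM).
have PC : ~ P C by do 2?apply: prime_notM.
have OC : O C by do 2?apply: (OM).
have [w [lw ew]] := lift_br lx lx'.
(* As matrices, this is the sum of the commutator of [al'] with [be] and that of [be'] with [al], so
   that its trace is 0. *)
pose mu i k := \sum_(j < n) (al' i j * be j k + be' i j * al j k) -
   \sum_(j < n) (al i j * be' j k + be i j * al' j k).
have [OO lz z0 Ny hy] := nf; have [OO' lz' z0' Ny' hy'] := nf'.
have Nz i j m : Nin m -> Nin (z i j m) := liftN (lz i j).
have Nz' i j m : Nin m -> Nin (z' i j m) := liftN (lz' i j).
have Oo i j : O (al i j) by case: (OO i j).
have Ob i j : O (be i j) by case: (OO i j).
have Oo' i j : O (al' i j) by case: (OO' i j).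
have Ob' i j : O (be' i j) by case: (OO' i j).
have Omu i k : O (mu i k).
  apply: (OD); last apply: (subalgN sO);
    by apply: (subalg_sum _ sO) => j _; apply: (OD); apply: (OM).
have diag i : (i < n)%N -> mu i i = C.
  move=> lin.
  have [v [Nv tv sv]] := normal_form_comp lin lx lx' nf nf'.
  have [v' [Nv' tv' sv']] := normal_form_comp lin lx' lx nf' nf.
  pose Z k m := \sum_(j < n) (z' i j (z j k m) - z i j (z' j k m)).
  pose ga k := \sum_(j < n) (al' i j * al j k - al i j * al' j k).
  have lZ k : lift (Z k) (ga k).
    rewrite /Z /ga; apply: lift_sumop => j.
    by apply: lift_add; [apply: lift_mul | apply: lift_opp; apply: lift_mul].
  have NZ k : Nin (Z k (bt k)) by apply: liftN (lZ k) _.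
  have tE : tors2 (t (w (bt i)) - \sum_(k < n) Z k (bt k) - t (v - v')).
    have := tors2B tv tv'; rewrite -ew //; congr tors2.
    rewrite /Z tB.
    under [X in _ = _ - X - _]eq_bigr => k _ do rewrite sumrB.
    rewrite sumrB !opprD !opprK.
    set a1 := x _; set a2 := x' _; set a3 := \sum_(k < n) _; set a4 := \sum_(k < n) _.
    by rewrite -!addrA; congr (_ + _); rewrite [RHS]addrCA; congr (_ + _);
       rewrite [LHS]addrCA; congr (_ + _); rewrite addrCA.
  have Nw : Nin (w (bt i)) by apply: liftN lw _.
  have Nvv : Nin (v - v') by exact: NB.
  have NsZ : Nin (\sum_(k < n) Z k (bt k)) by apply: N_sum.
  (* The commutator of [x] and [x'] lies in [t N], so the matrices [al] and [al'] commute and each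
     [Z k] has symbol 0. Therefore [Z k] contributes to the coefficient of [t] only in levels above
     [lv i]. *)
  have ga0 k : (k < n)%N -> ga k = 0.
    apply: (b_indep (al := ga)).
      move=> j; apply: (subalg_sum _ sO) => l _; apply: (OD); last apply: (subalgN sO);
        exact: OM.
    have := tors2_q tE; rewrite qB; [|by apply: NB => //; exact: Nt|exact: Nt].
    rewrite qB // ?(qt Nw) ?(qt Nvv); [|exact: Nt].
    rewrite sub0r subr0 => /torsN; rewrite opprK q_sum //; congr tors.
    by apply: eq_bigr => k' _; rewrite (lift_q (lZ k')) // qbt.
  have /choice [m hm] (k : 'I_n) : exists m, [/\ Nin m, Z k (bt k) = t m &
      in_span P O n b lv (lv i).+1 (q m)].
    case: (boolP (lv i < lv k)%N) => [lik|nik].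
      have lzk := lZ k; rewrite ga0 // in lzk.
      have [ze [zeD zeZ hze]] := lift_zero lzk; have [m [Nm em qm]] := hze _ (Nbt k).
      exists m; split=> //; rewrite qm qbt; apply: (in_span_le lik); apply: span_b.
      by apply: flag_linear => //; exact: b_flag.
    exists 0; split=> //; last first.
      by rewrite q0; apply: (in_span_tors pP sO); exact: tors0.
    rewrite t0 /Z big1 // => j _.
    case: (boolP (lv i < lv j)%N) => [lij|nij]; last first.
      by case: (z0 _ _ nij) => _ ->; case: (z0' _ _ nij) => _ ->; rewrite subrr.
    have njk : ~~ (lv j < lv k)%N by apply: contra nik; exact: ltn_trans.
    case: (z0 _ _ njk) => _ ->; case: (z0' _ _ njk) => _ ->.
    by rewrite (lift0 (lz i j)) (lift0 (lz' i j)) subrr.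
  have Nm k : Nin (m k) by case: (hm k).
  have Nsm : Nin (\sum_(k < n) m k) by apply: N_sum.
  have tu : tors (u *: b i - \sum_(k < n) q (m k) - (q v - q v')).
    have e : \sum_(k < n) Z k (bt k) = t (\sum_(k < n) m k).
      by rewrite t_sum; apply: eq_bigr => k _; case: (hm k).
    move: tE; rewrite e -!tB => /tors2_t h.
    have := h (NB (NB Nw Nsm) Nvv).
    by rewrite qB ?qB ?qB //; [|exact: NB]; rewrite (lift_q lw) // qbt q_sum.
  have sC : in_span P O n b lv (lv i).+1 (C *: b i - \sum_(k < n) mu i k *: b k).
    have -> : \sum_(k < n) mu i k *: b k =
       \sum_(k < n) (\sum_(j < n) (al' i j * be j k + be' i j * al j k)) *: b k -
       \sum_(k < n) (\sum_(j < n) (al i j * be' j k + be i j * al' j k)) *: b k.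
      by rewrite -sumrB; apply: eq_bigr => k _; rewrite /mu scalerBl.
    set M1 := \sum_(k < n) _; set M2 := \sum_(k < n) _; set M3 := \sum_(k < n) q _ in tu.
    have -> : C *: b i - (M1 - M2) = - ((u - C) *: b i) +
       ((u *: b i - M3 - (q v - q v')) + M3 + (q v - M1) - (q v' - M2)).
      rewrite scalerBl opprB !opprD !opprK.
      set A := C *: b i; set B := u *: b i; set V := q v; set V' := q v'.
      have -> : B - M3 + (- V + V') + M3 + (V - M1) + (- V' + M2) = B - M1 + M2.
        rewrite !addrA.
        rewrite [_ - V + V']addrAC [_ + V' - V + M3]addrAC.
        rewrite [B - M3 + V' + M3]addrAC !subrK.
        by rewrite [B + V' - M1 - V']addrAC addrK.
      by rewrite [- B + A]addrC !addrA subrK addrAC.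
    apply: (in_spanD pP sO).
      apply: (in_spanN sO); apply: span_b; apply: flagM => //; exact: b_flag.
    apply: (in_spanD pP sO); last exact: (in_spanN sO sv').
    apply: (in_spanD pP sO) => //; apply: (in_spanD pP sO).
      exact: (in_span_tors pP sO).
    by apply: (in_span_sum pP sO) => k _; case: (hm k).
  have [d [nu [Od Pd Onu nu0 tnu]]] := sC.
  have := b_indep (al := fun k => d * ((k == i)%:R * C - mu i k) - nu k) _ _ lin.
  rewrite eqxx mul1r nu0 // subr0 => h.
  have : d * (C - mu i i) = 0.
    apply: h.
      move=> k; apply: (OD); last exact: (subalgN sO).
      apply: (OM) => //; apply: (OD); last exact: (subalgN sO).
      by apply: (OM) => //; case: eqP => _; [exact: (subalg1 sO) | exact: (subalg0 sO)].
    move: tnu; congr tors.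
    rewrite scalerBr scaler_sumr.
    under [RHS]eq_bigr => k _ do rewrite scalerBl mulrBr scalerBl.
    rewrite !big_split /= !sumrN; congr (_ - _ - _).
      rewrite (bigD1 (Ordinal lin)) //= eqxx mul1r scalerA big1 ?addr0 // => k.
      by rewrite -(inj_eq val_inj) /= => /negPf ->; rewrite mul0r mulr0 scale0r.
    by apply: eq_bigr => k _; rewrite scalerA.
  move=> e; have : P (d * (C - mu i i)) by rewrite e.
  case: pP => _ _ _ _ PP /PP [//|/(OP (OD _ _ OC (subalgN sO (Omu i i))))].
  by move/eqP; rewrite subr_eq0 => /eqP.
have : \sum_(i < n) mu i i = n%:R * C.
  by rewrite (eq_bigr (fun=> C)) => [|i _]; [rewrite sumr_const card_ord mulr_natl | exact: diag].
have -> : \sum_(i < n) mu i i = 0.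
  rewrite /mu sumrB; apply/eqP; rewrite subr_eq0; apply/eqP.
  under eq_bigr do rewrite big_split.
  under [RHS]eq_bigr do rewrite big_split.
  rewrite !big_split /= addrC; congr (_ + _).
    by rewrite exchange_big; apply: eq_bigr => i _; apply: eq_bigr => j _; rewrite mulrC.
  by rewrite exchange_big; apply: eq_bigr => i _; apply: eq_bigr => j _; rewrite mulrC.
move=> e; have : P (n%:R * C) by rewrite -e.
case: (pP) => _ _ _ _ PP /PP [|//] /(prime_nat charL kS pP) n0.
by move: n_gt0; rewrite n0.
Qed.

End Trace.

Theorem min_prime_involutive f g : P f -> P g -> P (br f g).
Proof.
have [ys [O [t1 _ _ alg1]]] := tower_extend gens pP (Tower0 kS P).
have sO := tower_subalg t1.
have OP a : O a -> P a -> a = 0 by exact: (tower_zero pP t1).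
have Ofin := finite_over_fg pP sO Sfg alg1.
have [n [b [lv [ib n0 hb sb]]]] := flagged_basis pP Efg (noeth_fg Sfg) Pmin sO OP Ofin.
have /choice [bt hbt] i := q_surj (b i).
apply: (@trace_contra O sO OP Ofin n b lv bt) => // i; by case: (hbt i).
Qed.

End Gabber.

(** * Isotropic primes *)

Definition derivation_along (L S R : comPzRingType) (k : L -> S) (rho : S -> R)
    (E : lmodType R) (d : S -> E) :=
  [/\ (forall f g, d (f + g) = d f + d g),
      (forall f g, d (f * g) = rho f *: d g + rho g *: d f) &
      (forall c, d (k c) = 0)].

Section SymplecticCertificate.
Variables (L : fieldType) (charL : [pchar L] =i pred0).
Variables (S : comPzRingType) (k : {rmorphism L -> S}).
Variables (n : nat) (D : 'I_(n + n) -> S -> S) (X : 'I_(n + n) -> S).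
Hypothesis D_der : forall i, derivation_along (R := S) k id (E := S^o) (D i).
Hypothesis DX : forall i j, D i (X j) = (i == j)%:R.
Variables (P : set S) (pP : prime_ideal P).

(* the Poisson bracket in the coordinates [X = (y, xi)] *)
Definition poisson (f g : S) : S :=
  \sum_(l < n) (D (rshift n l) f * D (lshift n l) g - D (lshift n l) f * D (rshift n l) g).

Hypothesis P_inv : forall f g, P f -> P g -> P (poisson f g).

(** The Poisson bracket as a bilinear form in the gradients; the sign is such that [xi] paired with
    [y] gives 1. *)
Definition sympl (R : pzRingType) : 'M[R]_(n + n) := block_mx 0 (- 1%:M) 1%:M 0.

Let DD i f g : D i (f + g) = D i f + D i g. Proof. by case: (D_der i). Qed.
Let DM i f g : D i (f * g) = f * D i g + g * D i f. Proof. by case: (D_der i). Qed.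
Let Dk i c : D i (k c) = 0. Proof. by case: (D_der i). Qed.
Let D0 i : D i 0 = 0.
Proof. by apply: (addrI (D i 0)); rewrite -DD !addr0. Qed.
Let Dsum i m (F : 'I_m -> S) : D i (\sum_j F j) = \sum_j D i (F j).
Proof. exact: (big_morph (D i) (DD i) (D0 i)). Qed.
Let DXn i f m : D i (f ^+ m.+1) = m.+1%:R * f ^+ m * D i f.
Proof.
elim: m => [|m IH]; first by rewrite expr1 expr0 !mul1r.
rewrite exprS DM IH -[in RHS]natr1 !exprS; ring.
Qed.

Section Residue.
Variables (K : fieldType) (phi : {rmorphism S -> K}).
Hypothesis phiP : forall a, phi a = 0 <-> P a.

Definition grad (f : S) : 'rV[K]_(n + n) := \row_i phi (D i f).

Lemma gradM f g : grad (f * g) = phi f *: grad g + phi g *: grad f.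
Proof. by apply/rowP => i; rewrite !mxE DM rmorphD !rmorphM. Qed.

Lemma grad_sum m (F : 'I_m -> S) : grad (\sum_j F j) = \sum_j grad (F j).
Proof. by apply/rowP => i; rewrite mxE Dsum rmorph_sum summxE; apply: eq_bigr => j _; rewrite mxE. Qed.

Lemma gradX f m : grad (f ^+ m.+1) = (m.+1%:R * phi f ^+ m) *: grad f.
Proof. by apply/rowP => i; rewrite !mxE DXn !rmorphM rmorph_nat rmorphXn. Qed.

Lemma poisson_grad f g : grad f *m sympl K *m (grad g)^T = (phi (poisson f g))%:M.
Proof.
rewrite /sympl -[grad f]hsubmxK -[grad g]hsubmxK mul_row_block tr_row_mx mul_row_col.
rewrite !mulmx0 addr0 add0r mulmx1 mulmxN mulmx1.
apply/matrixP => i j; rewrite !ord1 !mxE /= mulr1n /poisson rmorph_sum -big_split.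
by apply: eq_bigr => l _; rewrite !mxE rmorphB !rmorphM mulNr.
Qed.

Lemma grad_tower xs O m (V : 'M[K]_(m, n + n)) : tower k P xs O ->
  (forall x, x \in xs -> (grad x <= V)%MS) -> forall c, O c -> (grad c <= V)%MS.
Proof.
elim=> {xs O} [_ _ [c _ <-]|x xs O t IH tx hV _ [l [c [Oc ->]]]].
  by rewrite (_ : grad _ = 0) ?sub0mx //; apply/rowP => i; rewrite !mxE Dk rmorph0.
rewrite grad_sum; apply: summx_sub => i _; rewrite gradM.
apply: addmx_sub; apply: scalemx_sub; last first.
  by apply: IH => // y ys; apply: hV; rewrite inE ys orbT.
case: (i : nat) => [|j]; last by rewrite gradX; apply: scalemx_sub; apply: hV; exact: mem_head.
rewrite expr0 (_ : grad 1 = 0) ?sub0mx //; apply/rowP => i'.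
by rewrite !mxE -(rmorph1 k) Dk rmorph0.
Qed.

(** Implicit differentiation of a relation of minimal degree, whose derivative at [x] is outside [P]
    in characteristic zero. *)
Lemma grad_alg O x m (V : 'M[K]_(m, n + n)) : subalg k O -> alg P O x ->
  (forall c, O c -> (grad c <= V)%MS) -> (forall p, P p -> (grad p <= V)%MS) ->
  (grad x <= V)%MS.
Proof.
move=> sO ax OV PV; have [l [c [Oc Pc nPd _]]] := alg_min charL pP sO ax.
set f' := \sum_(i < l) _ in nPd.
have nz : phi f' != 0 by apply/eqP => /phiP.
rewrite -(scale1r (grad x)) -(mulVf nz) -scalerA; apply: scalemx_sub.
have -> : phi f' *: grad x = grad (\sum_(i < l.+1) c i * x ^+ i) -
    \sum_(i < l.+1) phi x ^+ i *: grad (c i).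
  apply/rowP => i; rewrite !mxE summxE Dsum rmorph_sum /f' rmorph_sum mulr_suml -sumrB.
  rewrite [RHS]big_ord_recl /= expr0 mulr1 !mxE expr0 mul1r subrr add0r.
  apply: eq_bigr => j _; rewrite /= /bump add1n !mxE DM DXn.
  by rewrite rmorphD !rmorphM !rmorphXn rmorph_nat addrK; ring.
apply: addmx_sub; first exact: PV.
by rewrite eqmx_opp; apply: summx_sub => i _; apply: scalemx_sub; exact: OV.
Qed.

Lemma max_gradients : exists r (p : 'I_r -> S), [/\ forall i, P (p i),
  row_free (\matrix_i grad (p i)) &
  forall f, P f -> (grad f <= \matrix_i grad (p i))%MS].
Proof.
pose Q r := `[< exists p : 'I_r -> S, (forall i, P (p i)) /\ row_free (\matrix_i grad (p i)) >].
have exQ : exists r, Q r.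
  exists 0%N; apply/asboolP; exists (fun=> 0); split; first by case.
  by rewrite /row_free; apply/eqP; apply/eqP; rewrite -leqn0 rank_leq_row.
have bQ r : Q r -> (r <= n + n)%N.
  by move=> /asboolP [p [_ /eqP <-]]; exact: rank_leq_col.
case: (ex_maxnP exQ bQ) => r /asboolP [p [Pp fp]] rmax; exists r, p; split=> // f Pf.
apply/negP => /negP nf.
suff : Q r.+1 by move/rmax; rewrite ltnn.
apply/asboolP; exists (fun i => if unlift ord0 i is Some j then p j else f); split.
  by move=> i; case: unlift.
set C := \matrix_i grad (p i) in fp nf *.
have -> : (\matrix_i grad (if unlift ord0 i is Some j then p j else f)) =
   col_mx (grad f) C :> 'M_(1 + r, n + n).
  apply/row_matrixP => i; rewrite rowK; have [j ->|->] := unliftP ord0 i.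
    have -> : lift ord0 j = @rshift 1 r j by exact: val_inj.
    by rewrite rowKd rowK.
  have -> : ord0 = @lshift 1 r ord0 by exact: val_inj.
  by rewrite rowKu row_id.
have : (C < grad f + C)%MS.
  by rewrite ltmxE addsmxSr addsmx_sub negb_and nf.
rewrite ltmxErank => /andP [_]; rewrite (eqP fp) => h.
move: h; rewrite (addsmxE (grad f) C) => h.
by rewrite /row_free eqn_leq rank_leq_row.
Qed.

Lemma sympl_unit : sympl K \in unitmx.
Proof.
suff /mulmx1_unit [] : sympl K *m - sympl K = 1%:M by [].
rewrite mulmxN /sympl mulmx_block !mulmx0 !mul0mx !addr0 !add0r mulmx1 mul1mx.
by rewrite opp_block_mx opprK !oppr0 -scalar_mx_block.
Qed.

Lemma gradX_delta i : grad (X i) = delta_mx 0 i.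
Proof. by apply/rowP => j; rewrite !mxE eqxx DX rmorph_nat eq_sym eq_sym. Qed.

Lemma isotropic_rank r (p : 'I_r -> S) : (forall i, P (p i)) ->
  row_free (\matrix_i grad (p i)) ->
  (\matrix_i grad (p i)) *m sympl K *m (\matrix_i grad (p i))^T = 0 /\ (r <= n)%N.
Proof.
move=> Pp fp; set C := \matrix_i grad (p i) in fp *.
have CJC : C *m sympl K *m C^T = 0.
  apply/matrixP => i j; rewrite [RHS]mxE.
  transitivity ((grad (p i) *m sympl K *m (grad (p j))^T) 0 0).
    rewrite -[grad (p i)](rowK (fun i => grad (p i))) -/C.
    rewrite -[grad (p j)](rowK (fun i => grad (p i))) -/C.
    rewrite !mxE; apply: eq_bigr => l _; rewrite !mxE; congr (_ * _).
    by apply: eq_bigr => l' _; rewrite !mxE.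
  by rewrite poisson_grad mxE mulr1n; apply/phiP; exact: P_inv.
split=> //.
have := mulmx0_rank_max CJC.
rewrite mxrank_tr mxrankMfree ?row_free_unit ?sympl_unit // (eqP fp).
lia.
Qed.

(* By dimension, the row space of [C] contains its symplectic orthogonal. *)
Lemma sympl_decomposition r (C : 'M[K]_(r, n + n)) :
  row_free C -> C *m sympl K *m C^T = 0 -> (n <= r)%N ->
  exists Xm (Ym : 'M[K]_(r, n + n)), sympl K = Xm *m C + C^T *m Ym.
Proof.
move=> fC CJC nr.
pose M := 1%:M - pinvmx C *m C.
have CM : C *m M = 0 by rewrite mulmxBr mulmx1 mulmxA mulmxVp // mul1mx subrr.
have JJ : (sympl K)^T = - sympl K.
  by rewrite /sympl tr_block_mx !trmx0 linearN /= !trmx1 opp_block_mx !oppr0 opprK.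
have JJ1 : sympl K *m sympl K = - 1%:M.
  rewrite /sympl mulmx_block !mulmx0 !mul0mx !addr0 !add0r mulmx1 mul1mx.
  by rewrite (@scalar_mx_block _ n n 1) opp_block_mx !oppr0.
have sub : (M^T <= C *m sympl K)%MS.
  have k1 : (M^T <= kermx C^T)%MS by rewrite sub_kermx -trmx_mul CM trmx0.
  have k2 : (C *m sympl K <= kermx C^T)%MS by rewrite sub_kermx CJC.
  apply: (submx_trans k1).
  rewrite -(geq_leqif (mxrank_leqif_sup k2)) mxrank_ker mxrank_tr.
  by rewrite mxrankMfree ?row_free_unit ?sympl_unit // (eqP fC); lia.
have /submxP [W eW] := sub.
exists (sympl K *m pinvmx C), W^T.
have eJ : sympl K = sympl K *m (pinvmx C *m C) + sympl K *m M.
  by rewrite -mulmxDr addrC subrK mulmx1.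
rewrite [LHS]eJ.
rewrite mulmxA; congr (_ + _).
have -> : M = (sympl K)^T *m C^T *m W^T.
  by rewrite -trmx_mul -trmx_mul -eW trmxK.
by rewrite JJ !mulmxA mulmxN JJ1 opprK mul1mx.
Qed.

Lemma common_denominator m l (B : 'M[K]_(m, l)) :
  (forall u, exists a b, ~ P b /\ u = phi a / phi b) ->
  exists h (A : 'M[S]_(m, l)), ~ P h /\ phi h *: B = map_mx phi A.
Proof.
move=> frac; pose T := ('I_m * 'I_l)%type.
have /choice [a /choice [b hab]] (t : T) := frac (B t.1 t.2).
exists (\prod_t b t), (\matrix_(i, j) (a (i, j) * \prod_(t | t != (i, j)) b t)); split.
  apply: (big_ind (fun x => ~ P x)); [by case: pP | by move=> *; exact: prime_notM |].
  by move=> t _; case: (hab t).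
apply/matrixP => i j; rewrite !mxE (bigD1 (i, j)) //= !rmorphM.
have [Pb ->] := hab (i, j).
have nz : phi (b (i, j)) != 0 by apply/eqP => /phiP.
by rewrite mulrAC mulrCA divff // mulr1.
Qed.

End Residue.

(** The coordinates are algebraic over the tower, so the gradients of [xs] and of the [p a] span the
    whole space: [n + n <= size xs + r], while [r <= n] by isotropy. If [size xs <= n], then
    [r = n], and clearing denominators in [sympl_decomposition] yields congruences stated in [S]
    alone, modulo [P]. *)
Lemma isotropic_certificate xs O : tower k P xs O -> (forall i, alg P O (X i)) ->
  (forall x, x \in xs -> exists i, x = X i) ->
  (n <= size xs)%N /\ ((size xs <= n)%N ->
  exists r h (p : 'I_r -> S) (U V : 'I_(n + n) -> 'I_r -> S), [/\ ~ P h, forall a, P (p a) &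
    forall i j, P (h * sympl S i j - \sum_a (U i a * D j (p a) + D i (p a) * V j a))]).
Proof.
move=> t algX xsX; have sO := tower_subalg t.
have [K [phi [phiP frac]]] := residue_field pP.
have [r [p [Pp fp maxp]]] := max_gradients phi.
have [CJC rn] := isotropic_rank phiP Pp fp.
set C := \matrix_i grad phi (p i) in fp maxp CJC.
pose G : 'M[K]_(size xs, n + n) := \matrix_i grad phi xs`_i.
have full : ((1%:M : 'M[K]_(n + n)) <= G + C)%MS.
  apply/row_subP => i; rewrite row1 -(gradX_delta phi i).
  apply: (grad_alg phiP sO (algX i)) => [c Oc|q Pq].
    apply: submx_trans (addsmxSl _ _); apply: (grad_tower t _ Oc) => x xx.
    have <- : row (Ordinal (etrans (index_mem x xs) xx)) G = grad phi x.
      by rewrite rowK /= nth_index.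
    exact: row_sub.
  by apply: submx_trans (addsmxSr _ _); exact: maxp.
have := mxrankS full; rewrite mxrank1 => dim.
have := mxrank_adds_leqif G C => /leqif_geq _.
have := leq_trans dim (mxrank_adds_leqif G C).1; rewrite (eqP fp) => dim2.
have := rank_leq_row G => dim3.
split=> [|mn]; first by lia.
have nr : (n <= r)%N by lia.
have [Xm [Ym e]] := sympl_decomposition fp CJC nr.
have [h [U [Ph hU]]] := common_denominator phiP Xm frac.
have [g [V [Pg gV]]] := common_denominator phiP Ym frac.
exists r, (h * g), p, (fun i a => g * U i a), (fun i a => h * V a i); split=> //.
  exact: prime_notM.
move=> i j; apply/phiP.
have hU' a : phi (U i a) = phi h * Xm i a by move/matrixP/(_ i a): hU; rewrite !mxE => <-.
have gV' a : phi (V a j) = phi g * Ym a j by move/matrixP/(_ a j): gV; rewrite !mxE => <-.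
have ej : phi (sympl S i j) = sympl K i j.
  rewrite /sympl; case: (split_ordP i) => i' ->; case: (split_ordP j) => j' ->;
    rewrite ?block_mxEul ?block_mxEur ?block_mxEdl ?block_mxEdr !mxE ?rmorphN ?rmorph0 //;
    by rewrite rmorphMn ?rmorph1.
rewrite rmorphB !rmorphM ej e [X in _ * X]mxE [(Xm *m C) i j]mxE [(C^T *m Ym) i j]mxE.
rewrite rmorph_sum mulrDr !mulr_sumr -big_split /= -sumrB big1 // => a _.
rewrite rmorphD !rmorphM hU' gV' !mxE; ring.
Qed.

End SymplecticCertificate.

(** * From the certificate to the vanishing of the symplectic form *)

Section Vanishing.
Variables (L : fieldType) (charL : [pchar L] =i pred0).
Variables (S R : comPzRingType) (k : {rmorphism L -> S}) (rho : {rmorphism S -> R}).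
Variables (n : nat) (D : 'I_(n + n) -> S -> S) (X : 'I_(n + n) -> S).
Hypothesis univ : forall (E : lmodType R) (d : S -> E),
  derivation_along k rho d -> forall f, d f = \sum_i rho (D i f) *: d (X i).
Variables (r : nat) (h : S) (p : 'I_r -> S) (U V : 'I_(n + n) -> 'I_r -> S).
Hypothesis p0 : forall a, rho (p a) = 0.
Hypothesis cert : forall i j,
  rho (h * sympl n S i j - \sum_a (U i a * D j (p a) + D i (p a) * V j a)) = 0.
Hypothesis h_unit : exists u, u * rho h = 1.

(** The contraction [T] of the symplectic matrix with the values [B i j] of [b] at the coordinates
    is twice the required sum, by antisymmetry. By the certificate, [rho h *: T] is a combination of
    sums [\sum_i rho (D i (p a)) *: B i j], which are values of [b] at [rho (p a) = 0], and of their
    transposes. *)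
Lemma closed_canonical : closed_1form (fun c => rho (k c))
  (fun i : 'I_n => (rho (X (rshift n i)), rho (X (lshift n i)))).
Proof.
move=> E b [balt bDl bDr bMl bk].
have bC f g : b f g = - b g f.
  have := balt (f + g); rewrite bDl !bDr !balt addr0 add0r => /eqP.
  by rewrite addr_eq0 => /eqP.
have b0 g : b 0 g = 0 by apply: (addrI (b 0 g)); rewrite -bDl !addr0.
have der g : derivation_along k rho (fun f => b (rho f) g).
  split=> [f f'|f f'|c]; [by rewrite rmorphD bDl | by rewrite rmorphM bMl | exact: bk].
pose B i j := b (rho (X i)) (rho (X j)).
have Cb a j : \sum_i rho (D i (p a)) *: B i j = 0.
  by rewrite -(univ (der (rho (X j)))) p0 b0.
have Cb' a i : \sum_j rho (D j (p a)) *: B i j = 0.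
  apply/eqP; rewrite -oppr_eq0 -sumrN; apply/eqP; rewrite -[RHS](Cb a i).
  by apply: eq_bigr => j _; rewrite -scalerN; congr (_ *: _); symmetry; exact: bC.
pose T := \sum_i \sum_j rho (sympl n S i j) *: B i j.
have hT : rho h *: T = 0.
  rewrite /T scaler_sumr.
  under eq_bigr => i _.
    rewrite scaler_sumr.
    under eq_bigr => j _.
      rewrite scalerA -rmorphM.
      have -> : rho (h * sympl n S i j) =
          \sum_a (rho (U i a) * rho (D j (p a)) + rho (D i (p a)) * rho (V j a)).
        apply/eqP; rewrite -subr_eq0; apply/eqP; rewrite -[RHS](cert i j) rmorphB.
        by rewrite rmorph_sum; congr (_ - _); apply: eq_bigr => a _; rewrite rmorphD !rmorphM.
      rewrite scaler_suml.
      under eq_bigr => a _ do rewrite scalerDl -scalerA [rho (D i _) * _]mulrC -scalerA.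
      rewrite big_split; over.
    rewrite big_split /=; over.
  rewrite big_split /=.
  have -> : \sum_i \sum_j \sum_a rho (U i a) *: (rho (D j (p a)) *: B i j) = 0.
    rewrite big1 // => i _; rewrite exchange_big big1 // => a _.
    by rewrite -scaler_sumr Cb' scaler0.
  have -> : \sum_i \sum_j \sum_a rho (V j a) *: (rho (D i (p a)) *: B i j) = 0.
    rewrite exchange_big big1 // => j _; rewrite exchange_big big1 // => a _.
    by rewrite -scaler_sumr Cb scaler0.
  by rewrite addr0.
have T0 : T = 0.
  by have [u hu] := h_unit; rewrite -(scale1r T) -hu -scalerA hT scaler0.
set W := \sum_i _.
have eT : T = 2%:R *: W.
  rewrite /T /W big_split_ord /= -[2%:R]/(1 + 1)%R scalerDl scale1r.
  rewrite [in RHS]addrC; congr (_ + _); apply: eq_bigr => l _; rewrite big_split_ord /= /sympl.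
    rewrite [X in X + _]big1 ?add0r => [|j _]; last by rewrite block_mxEul mxE rmorph0 scale0r.
    rewrite (bigD1 l) //= big1 ?addr0 => [|j jl]; last first.
      by rewrite block_mxEur !mxE eq_sym (negPf jl) oppr0 rmorph0 scale0r.
    by rewrite block_mxEur !mxE eqxx rmorphN rmorph1 scaleN1r /B -bC.
  rewrite [X in _ + X]big1 ?addr0 => [|j _]; last by rewrite block_mxEdr mxE rmorph0 scale0r.
  rewrite (bigD1 l) //= big1 ?addr0 => [|j jl]; last first.
    by rewrite block_mxEdl !mxE eq_sym (negPf jl) rmorph0 scale0r.
  by rewrite block_mxEdl !mxE eqxx rmorph1 scale1r.
have two : (2%:R : L) != 0 by move/(pcharf0P L): charL => ->.
rewrite -(scale1r W) -(rmorph1 rho) -(rmorph1 k) -(mulVf two) !rmorphM -scalerA.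
by rewrite !rmorph_nat -eT T0 scaler0.
Qed.

End Vanishing.

(** * Affine schemes and coherent modules *)

Lemma opens_ext (X : topologicalType) (U V : opens X) : (forall x, U x <-> V x) -> U = V.
Proof.
case: U V => [U oU] [V oV] /= UV.
have e : U = V by apply/seteqP; split => x /UV.
by move: oU; rewrite e => oU; rewrite (Prop_irrelevance oU oV).
Qed.

Lemma sheaf_eq (X : topologicalType) (F : opens X -> Type)
    (r : forall U V : opens X, V `<=` U -> F U -> F V) :
  presheaf_axiom r -> sheaf_axiom r -> forall (U : opens X) (s t : F U),
  (forall x, U x -> exists (V : opens X) (h : V `<=` U), V x /\ r U V h s = r U V h t) -> s = t.
Proof.
move=> [_ rr] sh U s t st.
pose I := {V : opens X | exists h : V `<=` U, r U V h s = r U V h t}.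
pose V (i : I) := sval i.
have hV i : V i `<=` U by have [h _] := svalP i.
have cV x : U x -> exists i, V i x.
  by move=> /st [W [h [Wx e]]]; exists (exist _ W (ex_intro _ h e)).
have eV i : r U (V i) (hV i) s = r U (V i) (hV i) t.
  move: (hV i); rewrite /V; case: i => W [h e] /= h'.
  by rewrite (Prop_irrelevance h' h).
have [|u [_ uU]] := sh I U V hV cV (fun i => r U (V i) (hV i) s).
  move=> i j W hi hj.
  have h : W `<=` U by exact: subset_trans hi (hV i).
  by rewrite -(rr _ _ _ (hV i) hi h) -(rr _ _ _ (hV j) hj h).
by rewrite -(uU s) // -(uU t).
Qed.

Section Scheme.
Variables (L : fieldType) (X : ringedSpace L).
Implicit Types (U V W : opens X) (x : X).

Lemma resE U V (h h' : V `<=` U) (f : O U) : res h f = res h' f.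
Proof. by rewrite (Prop_irrelevance h h'). Qed.

Lemma res_id U (h : U `<=` U) (f : O U) : res h f = f.
Proof. by case: (O_presheaf X) => /(_ U h f). Qed.

Lemma res_res U V W (hVU : V `<=` U) (hWV : W `<=` V) (f : O U) :
  res hWV (res hVU f) = res (subset_trans hWV hVU) f.
Proof. by case: (O_presheaf X) => _ /(_ U V W hVU hWV (subset_trans hWV hVU) f) ->. Qed.

Lemma O_eq U (s t : O U) :
  (forall x, U x -> exists V (h : V `<=` U), V x /\ res h s = res h t) -> s = t.
Proof. exact: (sheaf_eq (O_presheaf X) (O_sheaf (r := X))). Qed.

Lemma unit_at_in U (f : O U) x : unit_at f x -> U x.
Proof. by move=> [V [h [/h]]]. Qed.

Lemma unit_at_res U V (h : V `<=` U) (f : O U) x : V x -> unit_at (res h f) x <-> unit_at f x.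
Proof.
move=> Vx; split=> [[W [k [Wx [g e]]]]|[W [k [Wx [g e]]]]].
  by exists W, (subset_trans k h); split=> //; exists g; rewrite -res_res.
exists (opensI V W), (@opensIl _ V W); split; first by split.
exists (res (@opensIr _ V W) g).
have -> : res (@opensIl _ V W) (res h f) = res (@opensIr _ V W) (res k f).
  by rewrite !res_res; exact: resE.
by rewrite -rmorphM e rmorph1.
Qed.

Lemma unit_atM U (f g : O U) x : unit_at (f * g) x <-> unit_at f x /\ unit_at g x.
Proof.
split=> [[W [k [Wx [a e]]]]|[[V [h [Vx [a ea]]]] [W [k [Wx [b eb]]]]]].
  split; exists W, k; split=> //.
    by exists (a * res k g); rewrite -e rmorphM; ring.
  by exists (a * res k f); rewrite -e rmorphM; ring.
have hf : res (@opensIl _ V W) a * res (subset_trans (@opensIl _ V W) h) f = 1.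
  by rewrite -res_res -rmorphM ea rmorph1.
have hg : res (@opensIr _ V W) b * res (subset_trans (@opensIl _ V W) h) g = 1.
  rewrite (resE _ (subset_trans (@opensIr _ V W) k)) -res_res -rmorphM eb rmorph1 //.
exists (opensI V W), (subset_trans (@opensIl _ V W) h); split; first by split.
exists (res (@opensIl _ V W) a * res (@opensIr _ V W) b).
by rewrite rmorphM mulrACA hf hg mulr1.
Qed.

Lemma unit_at_inv U (f g : O U) x : U x -> g * f = 1 -> unit_at f x.
Proof. by move=> Ux e; exists U, (@subset_refl _ U); split => //; exists g; rewrite res_id. Qed.

Lemma unit_at1 U x : U x -> unit_at (1 : O U) x.
Proof. by move=> Ux; apply: (@unit_at_inv _ _ 1) => //; rewrite mulr1. Qed.

Lemma unit_atX U (f : O U) n x : unit_at f x -> unit_at (f ^+ n) x.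
Proof.
move=> uf; elim: n => [|n IH]; first by rewrite expr0; exact/unit_at1/(unit_at_in uf).
by rewrite exprS unit_atM.
Qed.

Lemma unit_at_prod U (I : finType) (f : I -> O U) x : U x -> (forall i, unit_at (f i) x) ->
  unit_at (\prod_i f i) x.
Proof.
move=> Ux uf; apply: (big_ind (fun g => unit_at g x)) => //; first exact: unit_at1.
by move=> g h ug uh; rewrite unit_atM.
Qed.

(** Inverses are unique, so that local ones agree on overlaps and glue. *)
Lemma unit_inverse U (f : O U) : (forall x, U x -> unit_at f x) -> exists g, g * f = 1.
Proof.
move=> uf.
pose I := {V : opens X | exists h : V `<=` U, exists g, g * res h f = 1}.
pose V (i : I) := sval i.
have hV i : V i `<=` U by have [h _] := svalP i.
have hs' i : {g | g * res (hV i) f = 1}.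
  apply: cid; move: (hV i); rewrite /V; case: i => W [h [g e]] /= h'.
  by exists g; rewrite (resE h' h).
pose s i := sval (hs' i); have hs i : s i * res (hV i) f = 1 := svalP (hs' i).
have [||g [hg _]] := @O_sheaf L X I U V hV _ s.
- by move=> x /uf [W [h [Wx e]]]; exists (exist _ W (ex_intro _ h e)).
- move=> i j W hi hj.
  have e i' (h' : W `<=` V i') : res h' (s i') * res (subset_trans hi (hV i)) f = 1.
    by rewrite (resE _ (subset_trans h' (hV i'))) -res_res -rmorphM hs rmorph1.
  by rewrite -[LHS]mulr1 -(e j hj) mulrCA e mulr1.
exists g; apply: O_eq => x /uf [W [h [Wx [a e]]]].
pose i : I := exist _ W (ex_intro _ h (ex_intro _ a e)).
exists W, h; split=> //; rewrite rmorphM rmorph1 -(hs i) /= -(hg i).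
by congr (_ * _); exact: resE.
Qed.

(** A property of [W] rather than an equality with [basic_open f]: one open set is often principal
    for several functions or in several affine sets, and sections need not be transported. *)
Definition isD U (f : O U) W := forall x, W x <-> unit_at f x.

Lemma isD_basic U (f : O U) : isD f (basic_open f).
Proof. by []. Qed.

Lemma isD_eq U (f : O U) W : isD f W -> W = basic_open f.
Proof. by move=> fW; apply: opens_ext => x; exact: fW. Qed.

Lemma isD_sub U (f : O U) W : isD f W -> W `<=` U.
Proof. by move=> fW x /fW /unit_at_in. Qed.

Lemma isD_unit U (f : O U) W (h : W `<=` U) : isD f W -> exists g, g * res h f = 1.
Proof. by move=> fW; apply: unit_inverse => x Wx; rewrite unit_at_res //; exact/fW. Qed.

Lemma isD_inter U V (h : V `<=` U) (f : O U) W : isD f W -> isD (res h f) (opensI V W).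
Proof.
move=> fW x; split=> [[Vx /fW]|uf]; first by rewrite unit_at_res.
have Vx := unit_at_in uf; split=> //; apply/fW; by rewrite unit_at_res in uf.
Qed.

Lemma isD_mul U (f g : O U) W W' : isD f W -> isD g W' -> isD (f * g) (opensI W W').
Proof.
move=> fW gW x; rewrite unit_atM -(fW x) -(gW x); split=> [[]|[]] //.
Qed.

Hypothesis lr : locally_ringed X.

Lemma point_prime U x : U x -> prime_ideal [set f : O U | ~ unit_at f x].
Proof.
move=> Ux; have [n0 addu] := lr Ux; split=> //=.
- by move=> n1; apply: n1; exact: unit_at1.
- by move=> a b na nb /addu [].
- by move=> a b nb /unit_atM [].
- move=> a b nab; apply: contrapT => /not_orP [/contrapT ua /contrapT ub].
  by apply: nab; apply/unit_atM.
Qed.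

Section Affine.
Variables (U : opens X) (aU : affine U).

Lemma affine_point P : prime_ideal P -> exists x, U x /\ forall f : O U, P f <-> ~ unit_at f x.
Proof. by case: aU => h _ _ _ /h [x [hx _]]; exists x. Qed.

Lemma affine_basis V x : V `<=` U -> V x -> exists (f : O U), unit_at f x /\ basic_open f `<=` V.
Proof. by case: aU => _ h _ _; exact: h. Qed.

Lemma affine_frac (f : O U) W (h : W `<=` U) (s : O W) : isD f W ->
  exists n a, res h a = s * res h f ^+ n.
Proof.
move=> fW; have e := isD_eq fW; subst W.
case: aU => _ _ fr _; have [n [a ea]] := fr f s; exists n, a.
by rewrite (resE h (@basic_open_sub _ _ _ f)) ea (resE h (@basic_open_sub _ _ _ f)).
Qed.

Lemma affine_zero (f : O U) W (h : W `<=` U) (a : O U) : isD f W -> res h a = 0 ->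
  exists n, f ^+ n * a = 0.
Proof.
move=> fW; have e := isD_eq fW; subst W.
rewrite (resE h (@basic_open_sub _ _ _ f)).
by case: aU => _ _ _; apply.
Qed.

(** If [I] contained no power of [f], [krull] would give a prime over [I] without [f], that is, a
    point where [f] is a unit and no element of [I] is. *)
Lemma affine_ideal_power (I : set (O U)) f : ideal I ->
  (forall x, unit_at f x -> exists a, I a /\ unit_at a x) -> exists n, I (f ^+ n).
Proof.
move=> iI hI; apply: contrapT => /forallNP nI.
have [||a Ia [n e]|Q [pQ IQ QM]] := @krull _ I [set a | exists n, a = f ^+ n] iI.
- by exists 0%N.
- by move=> _ _ [n ->] [m ->]; exists (n + m)%N; rewrite exprD.
- by apply: (nI n); rewrite -e.
have [x [Ux Qx]] := affine_point pQ.
have [|a [Ia ua]] := hI x.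
  by apply: contrapT => /Qx /QM; apply; exists 1%N.
by move/IQ/Qx: Ia.
Qed.

Lemma affine_ideal1 (I : set (O U)) : ideal I ->
  (forall x, U x -> exists a, I a /\ unit_at a x) -> I 1.
Proof.
move=> iI hI; have [|n] := @affine_ideal_power I 1 iI; last by rewrite expr1n.
by move=> x /unit_at_in /hI.
Qed.

Lemma affine_cover (F : set (O U)) : (forall x, U x -> exists f, F f /\ unit_at f x) ->
  exists n (f : 'I_n -> O U), (forall i, F (f i)) /\
    forall x, U x -> exists i, unit_at (f i) x.
Proof.
move=> hF.
pose I := [set a | exists n (f c : 'I_n -> O U), (forall i, F (f i)) /\ a = \sum_i c i * f i].
have iI : ideal I.
  split.
  - by exists 0%N, (fun=> 0), (fun=> 0); rewrite big_ord0; split=> // -[].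
  - move=> _ _ [n [f [c [Ff ->]]]] [m [g [d [Fg ->]]]].
    exists (n + m)%N, (fun i => match split i with inl j => f j | inr j => g j end),
      (fun i => match split i with inl j => c j | inr j => d j end); split.
      by move=> i; case: split.
    rewrite big_split_ord; congr (_ + _); apply: eq_bigr => i _.
      by rewrite (unsplitK (inl _ i)).
    by rewrite (unsplitK (inr _ i)).
  - move=> a _ [n [f [c [Ff ->]]]]; exists n, f, (fun i => a * c i); split=> //.
    by rewrite mulr_sumr; apply: eq_bigr => i _; rewrite mulrA.
have [|n [f [c [Ff e]]]] := affine_ideal1 iI.
  move=> x /hF [f [Ff uf]]; exists f; split=> //.
  by exists 1%N, (fun=> f), (fun=> 1); rewrite big_ord1 mul1r.
exists n, f; split=> // x Ux; apply: contrapT => /forallNP nf.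
have iP := prime_ideal_ideal (point_prime Ux).
have : [set f : O U | ~ unit_at f x] 1.
  by rewrite e; apply: ideal_sum => // i _; case: (iP) => _ _; apply; exact: nf.
by apply; exact: unit_at1.
Qed.

(** Functions on [W] are quotients by powers of [f], and each clause reduces to the one for [U] by
    clearing denominators; a principal set [basic_open s] of [W] is cut out in [U] by [a * f], where
    [a] is a numerator of [s]. *)
Lemma affine_isD (f : O U) W : isD f W -> affine W.
Proof.
move=> fW; have h := isD_sub fW.
have [fi efi] := isD_unit h fW.
have frac s : exists a e, res h a = s * e /\ exists e', e' * e = 1.
  have [n [a ea]] := affine_frac h s fW; exists a, (res h f ^+ n); split=> //.
  by exists (fi ^+ n); rewrite -exprMn efi expr1n.
split.
- move=> p pp; pose P := [set a : O U | p (res h a)].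
  have pP : prime_ideal P.
    case: pp => p0 p1 pD pM pPr; split=> [||a b|a b|a b]; rewrite /P /=.
    + by rewrite rmorph0.
    + by rewrite rmorph1.
    + by rewrite rmorphD; exact: pD.
    + by rewrite rmorphM; exact: pM.
    + by rewrite rmorphM => /pPr.
  have [x [Ux Px]] := affine_point pP.
  have Wx : W x.
    apply/fW; apply: contrapT => /Px pf; case: pp => p0 p1 pD pM pPr; apply: p1.
    by rewrite -efi; exact: pM.
  exists x; split.
    split=> // s; have [a [e [ea [e' ee]]]] := frac s.
    have -> : p s <-> P a.
      case: pp => p0 p1 pD pM pPr; rewrite /P /= ea; split=> [ps|/pPr [//|pe]].
        by rewrite mulrC; exact: pM.
      by case: p1; rewrite -ee; exact: pM.
    rewrite Px -(unit_at_res h a Wx) ea unit_atM.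
    split=> [nu us|nu [//]]; apply: nu; split=> //; exact: (unit_at_inv Wx ee).
  move=> y [Wy hy]; case: aU => /(_ P pP) [x0 [_ ux0]] _ _ _.
  rewrite -(ux0 x) //; apply: ux0; split; first exact: (h _ Wy).
  by move=> g; rewrite /P /= hy unit_at_res.
- move=> V x VW Vx; have [g [ug gV]] := affine_basis (subset_trans VW h) Vx.
  exists (res h g); split; first by rewrite unit_at_res //; exact: VW.
  move=> y /= uy; apply: gV; move: (uy); rewrite /= unit_at_res //; exact: unit_at_in uy.
- move=> s t; have [a [e [ea [e' ee]]]] := frac s.
  have aD : isD (a * f) (basic_open s).
    move=> x; rewrite unit_atM; split=> [us|[ua uf]].
      have Wx := unit_at_in us; split; last exact/fW.
      rewrite -(unit_at_res h) // ea unit_atM; split=> //; exact: (unit_at_inv Wx ee).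
    have Wx : W x by apply/fW.
    by move: ua; rewrite -(unit_at_res h) // ea unit_atM => -[].
  have hs : basic_open s `<=` W := @basic_open_sub _ _ _ s.
  have [n [b eb]] := affine_frac (subset_trans hs h) t aD.
  exists n, (res h b * (e' * fi) ^+ n); rewrite rmorphM res_res (resE _ (subset_trans hs h)) eb rmorphXn -mulrA -exprMn -res_res.
  rewrite (resE _ hs) [res (@basic_open_sub _ _ _ s) s](resE _ hs).
  congr (_ * _ ^+ n); rewrite -rmorphM; congr (res _ _).
  rewrite rmorphM ea.
  have -> : s * e * res h f * (e' * fi) = s * (e' * e) * (fi * res h f) by ring.
  by rewrite ee efi !mulr1.
- move=> s c ec; have [a [e [ea [e' ee]]]] := frac s; have [b [d [eb [d' de]]]] := frac c.
  have aD : isD (a * f) (basic_open s).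
    move=> x; rewrite unit_atM; split=> [us|[ua uf]].
      have Wx := unit_at_in us; split; last exact/fW.
      rewrite -(unit_at_res h) // ea unit_atM; split=> //; exact: (unit_at_inv Wx ee).
    have Wx : W x by apply/fW.
    by move: ua; rewrite -(unit_at_res h) // ea unit_atM => -[].
  have hs : basic_open s `<=` W := @basic_open_sub _ _ _ s.
  have [|n en] := @affine_zero _ _ (subset_trans hs h) b aD.
    by rewrite -res_res eb rmorphM (resE hs (@basic_open_sub _ _ _ s)) ec mul0r.
  exists n; move/(congr1 (res h)): en; rewrite rmorph0 rmorphM rmorphXn rmorphM ea eb => en.
  have -> : s ^+ n * c = (e' * fi) ^+ n * d' * ((s * e * res h f) ^+ n * (c * d)).
    have -> : (e' * fi) ^+ n * d' * ((s * e * res h f) ^+ n * (c * d)) =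
       (s * (e' * e) * (fi * res h f)) ^+ n * c * (d' * d) by rewrite !exprMn; ring.
    by rewrite ee efi de !mulr1.
  by rewrite en mulr0.
Qed.

End Affine.

(** * Coherent modules over affine open sets *)

Section Coherent.
Variables (E : Omodule X) (cE : coherent_module E).

Lemma mresE U V (h h' : V `<=` U) (e : E U) : mres h e = mres h' e.
Proof. by rewrite (Prop_irrelevance h h'). Qed.

Lemma mres_res U V W (hVU : V `<=` U) (hWV : W `<=` V) (e : E U) :
  mres hWV (mres hVU e) = mres (subset_trans hWV hVU) e.
Proof. by case: (m_presheaf E) => _ /(_ U V W hVU hWV (subset_trans hWV hVU) e) ->. Qed.

Lemma mres0 U V (h : V `<=` U) : mres h (0 : E U) = 0.
Proof. by apply: (addrI (mres h (0 : E U))); rewrite -mresD !addr0. Qed.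

Lemma mresN U V (h : V `<=` U) (e : E U) : mres h (- e) = - mres h e.
Proof. by apply: (addrI (mres h e)); rewrite -mresD !subrr mres0. Qed.

Lemma mresB U V (h : V `<=` U) (e f : E U) : mres h (e - f) = mres h e - mres h f.
Proof. by rewrite mresD mresN. Qed.

Lemma mres_sum U V (h : V `<=` U) n (F : 'I_n -> E U) :
  mres h (\sum_i F i) = \sum_i mres h (F i).
Proof. by apply: (big_morph (mres h)) => [x y|]; [exact: mresD | exact: mres0]. Qed.

Lemma mresZO U V (h : V `<=` U) (f : O U) (e : E U) : mres h (f *: e) = res h f *: mres h e.
Proof. exact: mresZ. Qed.

Lemma m_eq U (s t : E U) :
  (forall x, U x -> exists V (h : V `<=` U), V x /\ mres h s = mres h t) -> s = t.
Proof. exact: (sheaf_eq (m_presheaf E) (@m_sheaf _ _ _ E)). Qed.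

(** The multipliers [a] for which [a * r] is a combination of the [rel j] over [G] form an ideal
    without common zero in [W], and such an ideal contains a power of [f]. *)
Lemma relation_ideal G (aG : affine G) f W (h : W `<=` G) n (r : 'I_n -> O G) q
    (rel : 'I_q -> 'I_n -> O G) : isD f W ->
  (forall x, W x -> exists W' (k : W' `<=` W), W' x /\ exists c : 'I_q -> O W',
     forall i, res k (res h (r i)) = \sum_j c j * res k (res h (rel j i))) ->
  exists m (c : 'I_q -> O G), forall i, f ^+ m * r i = \sum_j c j * rel j i.
Proof.
move=> fW hr.
pose I := [set a | exists c : 'I_q -> O G, forall i, a * r i = \sum_j c j * rel j i].
have iI : ideal I.
  split.
  - by exists (fun=> 0) => i; rewrite mul0r big1 // => j _; rewrite mul0r.
  - move=> a b [c hc] [d hd]; exists (fun j => c j + d j) => i.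
    by rewrite mulrDl hc hd -big_split; apply: eq_bigr => j _; rewrite mulrDl.
  - move=> a b [c hc]; exists (fun j => a * c j) => i.
    by rewrite -mulrA hc mulr_sumr; apply: eq_bigr => j _; rewrite mulrA.
apply: (affine_ideal_power aG iI) => x /fW Wx.
have [W' [k [W'x [c hc]]]] := hr _ Wx.
have [g [ug gW']] := affine_basis aG (subset_trans k h) W'x.
have kG := @basic_open_sub _ _ _ g.
have /choice [e /choice [c' hc']] j := affine_frac aG kG (res gW' (c j)) (isD_basic g).
pose M := (\sum_j e j)%N.
have leM j : (e j <= M)%N by rewrite /M (bigD1 j) //= leq_addr.
pose c2 j := g ^+ (M - e j) * c' j.
have ec2 j : res kG (c2 j) = res kG g ^+ M * res gW' (c j).
  rewrite /c2 rmorphM rmorphXn hc' mulrCA -exprD mulrC; congr (_ ^+ _ * _).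
  by rewrite subnK.
have /choice [m hm] i : exists m, g ^+ m * (g ^+ M * r i - \sum_j c2 j * rel j i) = 0.
  apply: (affine_zero aG (h := kG) (isD_basic g)).
  rewrite rmorphB rmorphM rmorphXn rmorph_sum.
  have := congr1 (res gW') (hc i); rewrite !res_res (resE _ kG) => ->.
  rewrite rmorph_sum mulr_sumr -sumrB big1 // => j _.
  by rewrite (rmorphM (res gW')) (rmorphM (res kG) (c2 j)) ec2 !res_res (resE _ kG) mulrA subrr.
pose N := (\sum_i m i)%N.
have leN i : (m i <= N)%N by rewrite /N (bigD1 i) //= leq_addr.
exists (g ^+ (N + M)); split; last exact: unit_atX.
exists (fun j => g ^+ N * c2 j) => i; apply/eqP; rewrite -subr_eq0.
have -> : \sum_j g ^+ N * c2 j * rel j i = g ^+ N * \sum_j c2 j * rel j i.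
  by rewrite mulr_sumr; apply: eq_bigr => j _; rewrite mulrA.
by rewrite exprD -mulrA -mulrBr -(subnK (leN i)) exprD -mulrA hm mulr0.
Qed.

Lemma affine_uniform U (aU : affine U) (T : O U -> nat -> Prop) :
  (forall x, U x -> exists g n, unit_at g x /\ T g n) ->
  (forall g n m, (n <= m)%N -> T g n -> T g m) ->
  exists k (g : 'I_k -> O U) N, (forall i, T (g i) N) /\
    forall x, U x -> exists i, unit_at (g i) x.
Proof.
move=> hT mono.
have [x Ux|k [g [Tg cg]]] := affine_cover aU (F := [set g | exists n, T g n]).
  by have [g [n [ug Tg]]] := hT _ Ux; exists g; split=> //; exists n.
have /choice [n hn] := Tg; exists k, g, (\sum_i n i)%N; split=> // i.
by apply: mono (hn i); rewrite (bigD1 i) //= leq_addr.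
Qed.

(** Near a point, [e] is a combination of local generators, and its vanishing on [W] is a relation
    between them. Relations being locally of finite type, [relation_ideal] shows that a power of [f]
    kills [e] on a principal neighbourhood; finitely many of these cover [U]. *)
Lemma coherent_zero U (aU : affine U) f W (h : W `<=` U) (e : E U) : isD f W ->
  mres h e = 0 -> exists n, f ^+ n *: e = 0.
Proof.
move=> fW eW0.
pose T (g : O U) n := mres (@basic_open_sub _ _ _ g) (f ^+ n *: e) = 0.
have [x Ux|g n m nm|k [g [N [Tg cg]]]] := affine_uniform aU (T := T).
- have [ft rl] := cE; have [V [n [m [Vx _ span]]]] := ft x.
  have [W1 [k1 [k2 [W1x [r er]]]]] :=
    span _ (@opensIr _ U V) (mres (@opensIl _ U V) e) Logic.I x (conj Ux Vx).
  have [V' [hV' [q [rel [V'x relP relgen]]]]] := rl V n m (fun=> Logic.I) x Vx.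
  have sub : opensI W1 V' `<=` U by move=> y [/k1 []].
  have [g [ug gs]] := affine_basis aU sub (conj W1x V'x).
  pose G := basic_open g; have kG : G `<=` U := @basic_open_sub _ _ _ g.
  have GW1 : G `<=` W1 by move=> y /gs [].
  have GV' : G `<=` V' by move=> y /gs [].
  have GV : G `<=` V := subset_trans GV' hV'.
  have aG : affine G := affine_isD aU (isD_basic g).
  have eG : mres kG e = \sum_i res GW1 (r i) *: mres GV (m i).
    have := congr1 (mres GW1) er; rewrite !mres_res (mresE _ kG) => ->.
    rewrite mres_sum; apply: eq_bigr => i _; rewrite mresZO mres_res; congr (_ *: _).
    exact: mresE.
  pose WG := opensI G W; have WGG : WG `<=` G := @opensIl _ G W.
  have fWG : isD (res kG f) WG := isD_inter kG fW.
  have WGW : WG `<=` W := @opensIr _ G W.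
  have [|M [c hc]] := @relation_ideal G aG (res kG f) WG WGG n (fun i => res GW1 (r i)) q
      (fun j i => res GV' (rel j i)) fWG.
    move=> y WGy.
    have [|W' [k [k' [W'y [c hc]]]]] := relgen WG (subset_trans WGG GV) (subset_trans WGG GV')
        (fun i => res WGG (res GW1 (r i))) _ y WGy.
      rewrite /relation; transitivity (mres WGG (\sum_i res GW1 (r i) *: mres GV (m i))).
        rewrite mres_sum; by apply: eq_bigr => i _; rewrite mresZO mres_res.
      by rewrite -eG mres_res (mresE _ (subset_trans WGW h)) -mres_res eW0 mres0.
    exists W', k; split=> //; exists c => i; rewrite hc; apply: eq_bigr => j _.
    by rewrite !res_res; congr (_ * _); exact: resE.
  exists g, M; split=> //; rewrite /T (mresE _ kG) mresZO eG rmorphXn scaler_sumr.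
  under eq_bigr => i _ do rewrite scalerA hc scaler_suml.
  rewrite exchange_big big1 //= => j _.
  under eq_bigr => i _ do rewrite -scalerA.
  rewrite -scaler_sumr.
  have := congr1 (mres GV') (relP j); rewrite mres0 mres_sum => rj.
  rewrite (eq_bigr (fun i => mres GV' (rel j i *: mres hV' (m i)))).
    by rewrite rj scaler0.
  move=> i _; rewrite mresZO mres_res; congr (_ *: _); exact: mresE.
- by move=> Tn; rewrite /T -(subnK nm) exprD -scalerA mresZO Tn scaler0.
- exists N; apply: m_eq => x /cg [i ui].
  exists (basic_open (g i)), (@basic_open_sub _ _ _ (g i)); split=> //.
  by rewrite mres0; exact: Tg.
Qed.

(** Over small principal sets, [t] times a power of [f] extends as a combination of local
    generators. Two extensions differ on an overlap by a section that vanishes where [f] is a unit,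
    so by [coherent_zero] a further power of [f] makes them agree and glue. *)
Lemma coherent_frac U (aU : affine U) f W (h : W `<=` U) (t : E W) : isD f W ->
  exists n e, mres h e = res h f ^+ n *: t.
Proof.
move=> fW.
have aW : affine W := affine_isD aU fW.
pose T (g : O U) n := exists e : E (basic_open g), mres (@opensIl _ (basic_open g) W) e =
   res (subset_trans (@opensIr _ (basic_open g) W) h) f ^+ n *: mres (@opensIr _ (basic_open g) W) t.
have [x Ux|g n m nm|k [g [N [Tg cg]]]] := affine_uniform aU (T := T).
- have [ft _] := cE; have [V [n [m [Vx _ span]]]] := ft x.
  have [g [ug gs]] := affine_basis aU (@opensIl _ U V) (conj Ux Vx).
  pose G := basic_open g; have kG : G `<=` U := @basic_open_sub _ _ _ g.
  have GV : G `<=` V by move=> y /gs [].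
  have aG : affine G := affine_isD aU (isD_basic g).
  pose WG := opensI G W; have WGG : WG `<=` G := @opensIl _ G W.
  have WGW : WG `<=` W := @opensIr _ G W.
  have fWG : isD (res kG f) WG := isD_inter kG fW.
  have aWG : affine WG := affine_isD aG fWG.
  pose tG := mres WGW t; pose mG i := mres (subset_trans WGG GV) (m i).
  pose I := [set a : O G | exists r : 'I_n -> O G, res WGG a *: tG = \sum_i res WGG (r i) *: mG i].
  have iI : ideal I.
    split.
    + by exists (fun=> 0); rewrite rmorph0 scale0r big1 // => i _ /=; rewrite ?rmorph0 ?scale0r.
    + move=> a b [r hr] [s hs]; exists (fun i => r i + s i).
      rewrite rmorphD scalerDl hr hs -big_split; apply: eq_bigr => i _.
      by rewrite rmorphD scalerDl.
    + move=> a b [r hr]; exists (fun i => a * r i).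
      rewrite rmorphM -scalerA hr scaler_sumr; apply: eq_bigr => i _.
      by rewrite rmorphM scalerA.
  have [y uy|M [r hr]] := affine_ideal_power aG iI (f := res kG f).
    have WGy : WG y by apply/fWG.
    have [W' [k1 [k2 [W'y [r er]]]]] :=
      span _ (subset_trans WGG GV) tG Logic.I y WGy.
    have [h0 [uh hW']] := affine_basis aG (subset_trans k1 WGG) W'y.
    pose H := basic_open h0; have kH : H `<=` G := @basic_open_sub _ _ _ h0.
    have HWG : H `<=` WG := subset_trans hW' k1.
    have /choice [e /choice [r' hr']] i := affine_frac aG kH (res hW' (r i)) (isD_basic h0).
    pose M := (\sum_j e j)%N.
    have leM j : (e j <= M)%N by rewrite /M (bigD1 j) //= leq_addr.
    pose r2 j := h0 ^+ (M - e j) * r' j.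
    have er2 j : res kH (r2 j) = res kH h0 ^+ M * res hW' (r j).
      rewrite /r2 rmorphM rmorphXn hr' mulrCA -exprD mulrC; congr (_ ^+ _ * _).
      by rewrite subnK.
    have hD : isD (res WGG h0) H.
      move=> z; split=> [Hz|uz]; first by rewrite unit_at_res //; exact: HWG.
      by move: (uz); rewrite unit_at_res //; exact: unit_at_in uz.
    have [|p hp] := coherent_zero aWG (h := HWG)
        (e := res WGG (h0 ^+ M) *: tG - \sum_i res WGG (r2 i) *: mG i) hD.
      rewrite mresB mresZO mres_sum.
      have et : mres HWG tG = \sum_i res hW' (r i) *: mres HWG (mG i).
        have := congr1 (mres hW') er; rewrite !mres_res mres_sum (mresE _ (subset_trans HWG WGW)) => ->.
        apply: eq_bigr => i _; rewrite mresZO !mres_res; congr (_ *: _); exact: mresE.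
      rewrite et scaler_sumr -sumrB big1 // => i _.
      rewrite mresZO !res_res scalerA -scalerBl (resE _ kH) [res _ (r2 i)](resE _ kH) er2.
      by rewrite rmorphXn subrr scale0r.
    exists (h0 ^+ (p + M)); split; last exact: unit_atX.
    exists (fun i => h0 ^+ p * r2 i).
    apply/eqP; rewrite -subr_eq0; apply/eqP; rewrite -[RHS]hp scalerBr scalerA scaler_sumr.
    rewrite exprD !rmorphM rmorphXn; congr (_ - _); apply: eq_bigr => i _.
    by rewrite rmorphM rmorphXn scalerA.
  exists g, M; split=> //; exists (\sum_i r i *: mres GV (m i)).
  rewrite mres_sum.
  have -> : res (subset_trans (@opensIr _ G W) h) f ^+ M = res WGG (res kG f ^+ M).
    by rewrite rmorphXn res_res; congr (_ ^+ _); exact: resE.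
  rewrite [mres _ t](mresE _ WGW) -/tG; apply: etrans (esym hr).
  by apply: eq_bigr => i _; rewrite mresZO mres_res; congr (_ *: _); [exact: resE | exact: mresE].
- move=> [e he]; exists (res (@basic_open_sub _ _ _ g) f ^+ (m - n) *: e).
  rewrite mresZO he rmorphXn res_res scalerA (resE _ (subset_trans (@opensIr _ (basic_open g) W) h)).
  by rewrite -exprD subnK.
pose V i := basic_open (g i); pose hV i : V i `<=` U := @basic_open_sub _ _ _ (g i).
have he' i := cid (Tg i); pose e i := sval (he' i).
have he i : mres (@opensIl _ (V i) W) (e i) = res (subset_trans (@opensIr _ (V i) W) h) f ^+ N *:
  mres (@opensIr _ (V i) W) t := svalP (he' i).
have /choice [n1 hn1] (ij : 'I_k * 'I_k) : exists n, let Vij := opensI (V ij.1) (V ij.2) in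
    forall W' (h1 : W' `<=` V ij.1) (h2 : W' `<=` V ij.2) (k1 : W' `<=` U),
      res k1 f ^+ n *: (mres h1 (e ij.1) - mres h2 (e ij.2)) = 0.
  case: ij => i j /=; pose Vij := opensI (V i) (V j).
  have k1 : Vij `<=` V i := @opensIl _ (V i) (V j).
  have k2 : Vij `<=` V j := @opensIr _ (V i) (V j).
  have aV : affine Vij by apply: (affine_isD aU (isD_mul (isD_basic (g i)) (isD_basic (g j)))).
  have kU : Vij `<=` U := subset_trans k1 (hV i).
  have [|n hn] := coherent_zero aV (h := @opensIl _ Vij W)
     (e := mres k1 (e i) - mres k2 (e j)) (isD_inter kU fW).
    have l1 : opensI Vij W `<=` opensI (V i) W by move=> z [/k1].
    have l2 : opensI Vij W `<=` opensI (V j) W by move=> z [/k2].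
    have := congr1 (mres l1) (he i); have := congr1 (mres l2) (he j).
    rewrite !mresZO !rmorphXn !res_res !mres_res.
    rewrite (mresE _ (subset_trans (@opensIl _ Vij W) k2)) -mres_res => e2.
    rewrite (mresE _ (subset_trans (@opensIl _ Vij W) k1)) -mres_res => e1.
    rewrite mresB e1 e2; apply/eqP; rewrite subr_eq0; apply/eqP; congr (_ ^+ _ *: _).
      exact: resE.
    exact: mresE.
  exists n => W' h1 h2 h3.
  have kW : W' `<=` Vij by move=> z W'z; split; [exact: h1 | exact: h2].
  have := congr1 (mres kW) hn; rewrite mres0 mresZO mresB rmorphXn !mres_res res_res => <-.
  by congr (_ ^+ _ *: (_ - _)); [exact: resE | exact: mresE | exact: mresE].
pose N2 := (\sum_ij n1 ij)%N.
have leN ij : (n1 ij <= N2)%N by rewrite /N2 (bigD1 ij) //= leq_addr.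
have [|i j W' hi hj|u [hu _]] := @m_sheaf _ _ _ E 'I_k U V hV _ (fun i => res (hV i) f ^+ N2 *: e i).
- by move=> x /cg.
- have k1 : W' `<=` U := subset_trans hi (hV i).
  rewrite !mresZO !rmorphXn !res_res (resE _ k1) (resE (subset_trans hj _) k1).
  apply/eqP; rewrite -subr_eq0 -scalerBr -(subnK (leN (i, j))) exprD -scalerA.
  by rewrite (hn1 (i, j) W' hi hj k1) scaler0.
- exists (N2 + N)%N, u; apply: m_eq => x Wx; have [i ui] := cg _ (h _ Wx).
  exists (opensI (V i) W), (@opensIr _ (V i) W); split; first by split.
  have := congr1 (mres (@opensIl _ (V i) W)) (hu i).
  rewrite !mresZO he !mres_res !rmorphXn !res_res scalerA => e1.
  rewrite (mresE _ (subset_trans (@opensIl _ (V i) W) (hV i))) e1 exprD.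
  by congr (_ ^+ _ * _ ^+ _ *: _); exact: resE.
Qed.

Definition submodule U (H : set (E U)) := [/\ H 0, (forall e f, H e -> H f -> H (e + f)) &
  (forall (a : O U) e, H e -> H (a *: e))].

Lemma coherent_fg U (aU : affine U) :
  exists n (v : 'I_n -> E U), forall e, exists c : 'I_n -> O U, e = \sum_i c i *: v i.
Proof.
(* Generation is phrased through submodules, so that generators found locally can be concatenated
   without reindexing coefficients. *)
suff [s hs] : exists s : seq (E U), forall H, submodule H -> (forall e, e \in s -> H e) ->
    forall e, H e.
  exists (size s), (fun i => s`_i).
  apply: (hs [set e | exists c : 'I_(size s) -> O U, e = \sum_(i < size s) c i *: s`_i]).
    split.
    - by exists (fun=> 0); rewrite big1 // => i _; rewrite scale0r.
    - move=> _ _ [c ->] [d ->]; exists (fun i => c i + d i).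
      by rewrite -big_split; apply: eq_bigr => i _; rewrite scalerDl.
    - move=> a _ [c ->]; exists (fun i => a * c i).
      by rewrite scaler_sumr; apply: eq_bigr => i _; rewrite scalerA.
  move=> e es; have es' : (index e s < size s)%N by rewrite index_mem.
  exists (fun i => (i == Ordinal es')%:R).
  rewrite (bigD1 (Ordinal es')) //= eqxx scale1r nth_index // big1 ?addr0 //.
  by move=> i /negPf ->; rewrite scale0r.
pose T (g : O U) (s : seq (E U)) := forall e, forall H, submodule H ->
  (forall v, v \in s -> H v) -> exists n, H (g ^+ n *: e).
have key x : U x -> exists g s, unit_at g x /\ T g s.
  move=> Ux; have [ft _] := cE; have [V [n [m [Vx _ span]]]] := ft x.
  have [g [ug gs]] := affine_basis aU (@opensIl _ U V) (conj Ux Vx).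
  pose G := basic_open g; have kG : G `<=` U := @basic_open_sub _ _ _ g.
  have GV : G `<=` V by move=> y /gs [].
  have /choice [a /choice [v hv]] i := coherent_frac aU kG (mres GV (m i)) (isD_basic g).
  pose M := (\sum_j a j)%N.
  have leM j : (a j <= M)%N by rewrite /M (bigD1 j) //= leq_addr.
  pose w i := g ^+ (M - a i) *: v i.
  have hw i : mres kG (w i) = res kG g ^+ M *: mres GV (m i).
    by rewrite /w mresZO hv scalerA rmorphXn -exprD subnK.
  exists g, (codom w); split=> // e H [H0 HD HZ] wH.
  pose I := [set b : O U | H (b *: e)].
  have iI : ideal I.
    split=> [|b c Hb Hc|b c Hc]; rewrite /I /=; first by rewrite scale0r.
    - by rewrite scalerDl; exact: HD.
    - by rewrite -scalerA; exact: HZ.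
  apply: (affine_ideal_power aU iI) => y uy.
  have [W' [k1 [k2 [W'y [r er]]]]] := span _ GV (mres kG e) Logic.I y uy.
  have [h0 [uh hW']] := affine_basis aU (subset_trans k1 kG) W'y.
  pose Q := basic_open h0; have kQ : Q `<=` U := @basic_open_sub _ _ _ h0.
  have /choice [b /choice [r' hr']] i := affine_frac aU kQ (res hW' (r i)) (isD_basic h0).
  pose B := (\sum_j b j)%N.
  have leB j : (b j <= B)%N by rewrite /B (bigD1 j) //= leq_addr.
  pose r2 j := h0 ^+ (B - b j) * r' j.
  have er2 j : res kQ (r2 j) = res kQ h0 ^+ B * res hW' (r j).
    rewrite /r2 rmorphM rmorphXn hr' mulrCA -exprD mulrC; congr (_ ^+ _ * _).
    by rewrite subnK.
  have [|p hp] := coherent_zero aU (h := kQ)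
    (e := (g ^+ M * h0 ^+ B) *: e - \sum_i r2 i *: w i) (isD_basic h0).
    rewrite mresB mresZO mres_sum rmorphM !rmorphXn.
    have := congr1 (mres hW') er; rewrite !mres_res mres_sum (mresE _ kQ) => ->.
    rewrite scaler_sumr -sumrB big1 // => i _.
    have GQ : Q `<=` G := subset_trans hW' k1.
    have := congr1 (mres GQ) (hw i); rewrite mresZO !mres_res (mresE _ kQ) rmorphXn res_res.
    rewrite (resE (subset_trans GQ kG) kQ) => ew.
    rewrite (mresZO kQ (r2 i)) ew er2 (mresZO hW') !mres_res !scalerA.
    rewrite (mresE _ (subset_trans GQ GV)) -scalerBl.
    by rewrite (_ : _ - _ = 0) ?scale0r //; ring.
  exists (h0 ^+ p * (g ^+ M * h0 ^+ B)); split; last first.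
    by rewrite !unit_atM; split; [exact: unit_atX | split; exact: unit_atX].
  rewrite /I /= -scalerA; move: hp; rewrite scalerBr => /eqP; rewrite subr_eq0 => /eqP ->.
  apply: (HZ); apply: big_ind => // i _; apply: (HZ); apply: wH; exact: codom_f.
have [x Ux|k [g [Tg cg]]] := affine_cover aU (F := [set g | exists s, T g s]).
  by have [g [s [ug Ts]]] := key _ Ux; exists g; split=> //; exists s.
have /choice [s hs] := Tg.
exists (flatten [seq s i | i <- enum 'I_k]) => H [H0 HD HZ] sH e.
pose I := [set b : O U | H (b *: e)].
have iI : ideal I.
  split=> [|b c Hb Hc|b c Hc]; rewrite /I /=; first by rewrite scale0r.
  - by rewrite scalerDl; exact: HD.
  - by rewrite -scalerA; exact: HZ.
rewrite -[e]scale1r; apply: (affine_ideal1 aU iI) => x /cg [i ui].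
have [||n hn] := hs i e H; first by split.
  move=> v vs; apply: sH; apply/flatten_mapP; exists i => //; exact: mem_enum.
by exists (g i ^+ n); split=> //; exact: unit_atX.
Qed.

(** For the converse, each of the finitely many generators has an annihilator that is a unit at [x]
    if its germ vanishes, and the product of these annihilates the module. In the other direction, a
    section near [x] is the quotient of a global one by a unit. *)
Lemma support_ann U (aU : affine U) x : U x ->
  (support E x <-> forall f, ann (E U) f -> ~ unit_at f x).
Proof.
move=> Ux; split=> [[V [m [Vx hm]]] f ff uf|hann].
  have [g [ug gs]] := affine_basis aU (@opensIl _ U V) (conj Ux Vx).
  pose G := basic_open g; have kG : G `<=` U := @basic_open_sub _ _ _ g.
  have GV : G `<=` V by move=> y /gs [].
  have [n [e he]] := coherent_frac aU kG (mres GV m) (isD_basic g).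
  pose Q := opensI G (basic_open f).
  have QG : Q `<=` G := @opensIl _ G (basic_open f).
  have QU : Q `<=` U := subset_trans QG kG.
  apply: (hm Q (subset_trans QG GV)); first by split.
  have [|g' eg] := @unit_inverse Q (res QU (f * g ^+ n)).
    move=> y [Gy fy]; rewrite unit_at_res // unit_atM; split=> //; exact: unit_atX.
  rewrite -[LHS]scale1r -eg -scalerA rmorphM -scalerA rmorphXn.
  have := congr1 (mres QG) he; rewrite mresZO !mres_res rmorphXn res_res.
  rewrite (resE _ QU) (mresE _ QU) => <-.
  by rewrite -mresZO ff mres0 scaler0.
apply: contrapT => ns.
have [n [v hv]] := coherent_fg aU.
have /choice [g hg] i : exists g : O U, unit_at g x /\ g *: v i = 0.
  have [V [h [Vx e0]]] : exists V (h : V `<=` U), V x /\ mres h (v i) = 0.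
    apply: contrapT => no; apply: ns; exists U, (v i); split=> // V h Vx e0.
    by apply: no; exists V, h.
  have [f [uf fV]] := affine_basis aU h Vx.
  have [|m hm] := coherent_zero aU (h := @basic_open_sub _ _ _ f) (e := v i) (isD_basic f).
    by rewrite (mresE _ (subset_trans fV h)) -mres_res e0 mres0.
  by exists (f ^+ m); split=> //; exact: unit_atX.
apply: (hann (\prod_i g i)).
  move=> e; have [c ->] := hv e; rewrite scaler_sumr big1 // => i _.
  rewrite scalerA (bigD1 i) //= mulrC mulrCA mulrC -mulrA mulrCA.
  by rewrite -scalerA -scalerA; case: (hg i) => _ ->; rewrite !scaler0.
by apply: unit_at_prod => // i; case: (hg i).
Qed.

Lemma support_closed : closed (support E).
Proof.
rewrite -openC openE => x /= ns; rewrite /interior nbhsE.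
have [ft _] := cE; have [V [n [m [Vx _ span]]]] := ft x.
have [W [h [Wx hW]]] : exists W (h : W `<=` V), W x /\ forall i, mres h (m i) = 0.
  elim: n m {span} => [|n IH] m; first by exists V, (@subset_refl _ V); split => // -[].
  have [W [h [Wx hW]]] := IH (fun i => m (lift ord0 i)).
  have [W' [h' [W'x hW']]] : exists W (h : W `<=` V), W x /\ mres h (m ord0) = 0.
    apply: contrapT => no; apply: ns; exists V, (m ord0); split=> // W0 h0 W0x e0.
    by apply: no; exists W0, h0.
  exists (opensI W W'), (subset_trans (@opensIl _ W W') h); split; first by split.
  move=> i; case: (unliftP ord0 i) => [j ->|->]; first by rewrite -mres_res hW mres0.
  by rewrite (mresE _ (subset_trans (@opensIr _ W W') h')) -mres_res hW' mres0.
exists W; first by split => //; exact: oset_open.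
move=> y Wy [U [s [Uy hs]]].
have [W' [k [k' [W'y [r er]]]]] := span (opensI W U) (subset_trans (@opensIl _ W U) h)
   (mres (@opensIr _ W U) s) Logic.I y (conj Wy Uy).
apply: (hs W' (subset_trans k (@opensIr _ W U)) W'y).
rewrite -mres_res er big1 // => i _.
rewrite (mresE _ (subset_trans (subset_trans k (@opensIl _ W U)) h)) -mres_res hW mres0.
exact: scaler0.
Qed.

End Coherent.
End Scheme.

(** * Local coordinates *)

(** Formal smoothness and the universal property of the symmetric algebra are both applied to rings
    of this kind. *)
Record subring (A : comPzRingType) := Subring {
  subring_set :> A -> Prop;
  subring1 : subring_set 1;
  subringB : forall a b, subring_set a -> subring_set b -> subring_set (a - b);
  subringM : forall a b, subring_set a -> subring_set b -> subring_set (a * b) }.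

Section SubringType.
Variables (A : comPzRingType) (S : subring A).

Record subring_sort := InSubring { sub_val : A; sub_valP : S sub_val }.

Lemma sub_val_inj : injective sub_val.
Proof. by case=> [a Sa] [b Sb] /= e; subst b; rewrite (Prop_irrelevance Sa Sb). Qed.

Lemma subring0 : S 0.
Proof. by rewrite -(subrr 1); apply: subringB; exact: subring1. Qed.

Lemma subringN a : S a -> S (- a).
Proof. by move=> Sa; rewrite -[- a]add0r; apply: subringB => //; exact: subring0. Qed.

Lemma subringD a b : S a -> S b -> S (a + b).
Proof. by move=> Sa Sb; rewrite -[b]opprK; apply: subringB => //; exact: subringN. Qed.

Let add x y := InSubring (subringD (sub_valP x) (sub_valP y)).
Let opp x := InSubring (subringN (sub_valP x)).
Let mul x y := InSubring (subringM (sub_valP x) (sub_valP y)).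
Let zero := InSubring subring0.
Let one := InSubring (subring1 S).

Let addA : associative add. Proof. by move=> x y z; apply: sub_val_inj; rewrite /= addrA. Qed.
Let addC : commutative add. Proof. by move=> x y; apply: sub_val_inj; rewrite /= addrC. Qed.
Let add0 : left_id zero add. Proof. by move=> x; apply: sub_val_inj; rewrite /= add0r. Qed.
Let addN : left_inverse zero opp add. Proof. by move=> x; apply: sub_val_inj; rewrite /= addNr. Qed.
Let mulA : associative mul. Proof. by move=> x y z; apply: sub_val_inj; rewrite /= mulrA. Qed.
Let mulC : commutative mul. Proof. by move=> x y; apply: sub_val_inj; rewrite /= mulrC. Qed.
Let mul1 : left_id one mul. Proof. by move=> x; apply: sub_val_inj; rewrite /= mul1r. Qed.
Let mulDl : left_distributive mul add.
Proof. by move=> x y z; apply: sub_val_inj; rewrite /= mulrDl. Qed.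

HB.instance Definition _ := gen_eqMixin subring_sort.
HB.instance Definition _ := gen_choiceMixin subring_sort.
HB.instance Definition _ := GRing.isZmodule.Build subring_sort addA addC add0 addN.
HB.instance Definition _ := GRing.Zmodule_isComPzRing.Build subring_sort mulA mulC mul1 mulDl.

Fact sub_val_zmod : zmod_morphism sub_val. Proof. by []. Qed.
Fact sub_val_monoid : monoid_morphism sub_val. Proof. by []. Qed.
HB.instance Definition _ := GRing.isZmodMorphism.Build subring_sort A sub_val sub_val_zmod.
HB.instance Definition _ := GRing.isMonoidMorphism.Build subring_sort A sub_val sub_val_monoid.

Section Factor.
Variables (B : comPzRingType) (f : {rmorphism B -> A}) (fS : forall b, S (f b)).
Definition to_subring b := InSubring (fS b).
Fact to_subring_zmod : zmod_morphism to_subring.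
Proof. by move=> x y; apply: sub_val_inj; rewrite /= rmorphB. Qed.
Fact to_subring_monoid : monoid_morphism to_subring.
Proof. by split=> [|x y]; apply: sub_val_inj; rewrite /= ?rmorph1 ?rmorphM. Qed.
HB.instance Definition _ := GRing.isZmodMorphism.Build B subring_sort to_subring to_subring_zmod.
HB.instance Definition _ := GRing.isMonoidMorphism.Build B subring_sort to_subring to_subring_monoid.
End Factor.
End SubringType.

(* [A (+) A^n] with [A^n] an ideal of square zero *)
Section SquareZero.
Variables (A : comPzRingType) (n : nat).

Record sqzero := SqZero { sq_base : A; sq_nil : 'I_n -> A }.

Lemma sqzero_eq x y : sq_base x = sq_base y -> (forall i, sq_nil x i = sq_nil y i) -> x = y.
Proof. by case: x y => [a u] [b v] /= -> /funext ->. Qed.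

Let add x y := SqZero (sq_base x + sq_base y) (fun i => sq_nil x i + sq_nil y i).
Let opp x := SqZero (- sq_base x) (fun i => - sq_nil x i).
Let mul x y := SqZero (sq_base x * sq_base y)
  (fun i => sq_base x * sq_nil y i + sq_base y * sq_nil x i).
Let zero := SqZero 0 (fun _ => 0).
Let one := SqZero 1 (fun _ => 0).

Let addA : associative add. Proof. by move=> x y z; apply: sqzero_eq => [|i] /=; rewrite addrA. Qed.
Let addC : commutative add. Proof. by move=> x y; apply: sqzero_eq => [|i] /=; rewrite addrC. Qed.
Let add0 : left_id zero add. Proof. by move=> x; apply: sqzero_eq => [|i] /=; rewrite add0r. Qed.
Let addN : left_inverse zero opp add. Proof. by move=> x; apply: sqzero_eq => [|i] /=; rewrite addNr. Qed.
Let mulA : associative mul. Proof. by move=> x y z; apply: sqzero_eq => [|i] /=; ring. Qed.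
Let mulC : commutative mul. Proof. by move=> x y; apply: sqzero_eq => [|i] /=; ring. Qed.
Let mul1 : left_id one mul. Proof. by move=> x; apply: sqzero_eq => [|i] /=; ring. Qed.
Let mulDl : left_distributive mul add.
Proof. by move=> x y z; apply: sqzero_eq => [|i] /=; ring. Qed.

HB.instance Definition _ := gen_eqMixin sqzero.
HB.instance Definition _ := gen_choiceMixin sqzero.
HB.instance Definition _ := GRing.isZmodule.Build sqzero addA addC add0 addN.
HB.instance Definition _ := GRing.Zmodule_isComPzRing.Build sqzero mulA mulC mul1 mulDl.

Fact sq_base_zmod : zmod_morphism sq_base. Proof. by []. Qed.
Fact sq_base_monoid : monoid_morphism sq_base. Proof. by []. Qed.
HB.instance Definition _ := GRing.isZmodMorphism.Build sqzero A sq_base sq_base_zmod.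
HB.instance Definition _ := GRing.isMonoidMorphism.Build sqzero A sq_base sq_base_monoid.

Definition sq_const a := SqZero a (fun _ => 0).
Fact sq_const_zmod : zmod_morphism sq_const.
Proof. by move=> x y; apply: sqzero_eq => //= i; rewrite subr0. Qed.
Fact sq_const_monoid : monoid_morphism sq_const.
Proof. by split=> // x y; apply: sqzero_eq => //= i; rewrite !mulr0 addr0. Qed.
HB.instance Definition _ := GRing.isZmodMorphism.Build A sqzero sq_const sq_const_zmod.
HB.instance Definition _ := GRing.isMonoidMorphism.Build A sqzero sq_const sq_const_monoid.
End SquareZero.

Definition lderivation (L A : comPzRingType) (k : L -> A) (D : A -> A) :=
  derivation_along (R := A) k id (E := A^o) D.

Section Frame.
Variables (L A : comPzRingType) (k : {rmorphism L -> A}).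

(* A generating system of derivations with as dual functions the [y] and [g];
   only the part [y], [d] is required to be a dual basis. *)
Definition frame n m (y : 'I_n -> A) (d : 'I_n -> A -> A) (g : 'I_m -> A) (D : 'I_m -> A -> A) :=
  [/\ (forall i, lderivation k (d i)) /\ (forall j, lderivation k (D j)),
      (forall i j, d i (y j) = (i == j)%:R),
      (forall l j, D l (y j) = 0) &
      (forall (R : comPzRingType) (rho : {rmorphism A -> R}) (E : lmodType R) (b : A -> E),
         derivation_along k rho b ->
         forall f, b f = \sum_i rho (d i f) *: b (y i) + \sum_l rho (D l f) *: b (g l))].

Hypothesis fs : forall (C B : comPzRingType) (c : {rmorphism L -> C}) (q : {rmorphism C -> B}),
    (forall b, exists a, q a = b) ->
    (forall a a', q a = 0 -> q a' = 0 -> a * a' = 0) ->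
  forall phi : {rmorphism A -> B}, (forall x, phi (k x) = q (c x)) ->
  exists psi : {rmorphism A -> C}, (forall x, psi (k x) = c x) /\ (forall f, q (psi f) = phi f).

(** The subring generated over [L] by the pairs of the i-th generator and the i-th unit vector: the
    image of the polynomial ring under evaluation together with the partial derivatives. *)
Definition sq_gen (gens : seq A) (x : sqzero A (size gens)) : Prop :=
  forall S : set (sqzero A (size gens)), (forall c, S (sq_const _ (k c))) ->
    (forall i : 'I_(size gens), S (SqZero (gens`_i) (fun j => (j == i)%:R))) ->
    (forall a b, S a -> S b -> S (a - b)) -> (forall a b, S a -> S b -> S (a * b)) -> S x.

Arguments sq_gen : clear implicits.

Lemma sq_gen1 gens : sq_gen gens 1.
Proof. by move=> S /(_ 1); rewrite !rmorph1. Qed.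
Lemma sq_genB gens a b : sq_gen gens a -> sq_gen gens b -> sq_gen gens (a - b).
Proof. by move=> ga gb S h1 h2 h3 h4; apply: (h3); [exact: ga | exact: gb]. Qed.
Lemma sq_genM gens a b : sq_gen gens a -> sq_gen gens b -> sq_gen gens (a * b).
Proof. by move=> ga gb S h1 h2 h3 h4; apply: (h4); [exact: ga | exact: gb]. Qed.

(** The projection of [C] onto [A] has a kernel of square zero, so formal smoothness gives a section
    [psi], whose nilpotent components are the derivations [D]. The formula for [b], with nilpotent
    components as coefficients, is true for the generators of [C] and stable under the ring
    operations, hence holds at [psi f]. *)
Lemma smooth_frame gens : fg_alg k gens -> exists D,
  frame (n := 0) (fun=> 0) (fun=> id) (fun i : 'I_(size gens) => gens`_i) D.
Proof.
move=> fg; pose N := size gens.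
pose C := Subring (@sq_gen1 gens) (@sq_genB gens) (@sq_genM gens).
have kC c : C (sq_const N (k c)) by move=> S.
pose c : {rmorphism L -> subring_sort C} := to_subring (f := [the {rmorphism L -> sqzero A N} of sq_const N \o k]) kC.
pose q : {rmorphism subring_sort C -> A} := [the {rmorphism subring_sort C -> A} of @sq_base A N \o @sub_val _ C].
have qs b : exists a, q a = b.
  pose S := [set b | exists a, q a = b].
  apply: (fg S) => [x|a ag|_ _ [a <-] [a' <-]|_ _ [a <-] [a' <-]]; rewrite /S /=.
  - by exists (c x).
  - have ia : (index a gens < N)%N by rewrite index_mem.
    have Ca : C (SqZero a (fun j => (j == Ordinal ia)%:R)).
      by move=> T h1 h2 _ _; have := h2 (Ordinal ia); rewrite /= nth_index.
    by exists (InSubring Ca).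
  - by exists (a + a'); rewrite rmorphD.
  - by exists (a * a'); rewrite rmorphM.
have qn (a a' : subring_sort C) : q a = 0 -> q a' = 0 -> a * a' = 0.
  move=> /= a0 a'0; apply: sub_val_inj; apply: sqzero_eq => [|i] /=; rewrite a0 a'0 !mul0r //.
  by rewrite addr0.
have [|psi [psik psiq]] := fs (c := c) qs qn (phi := [the {rmorphism A -> A} of idfun]).
  by [].
pose D i f := sq_nil (sub_val (psi f)) i.
have Db f : sq_base (sub_val (psi f)) = f by exact: psiq.
exists D; split=> [|[] //|l []//|R rho E b [bD bM bk] f].
  split=> [[]//|j]; split=> [f g|f g|x]; rewrite /D.
  - by rewrite rmorphD.
  - by rewrite rmorphM /= !Db.
  - by rewrite psik.
rewrite big_ord0 add0r.
have b0 : b 0 = 0 by rewrite -(rmorph0 k) bk.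
have bB u v : b (u - v) = b u - b v.
  by apply: (addIr (b v)); rewrite -bD !subrK.
have := sub_valP (psi f) (fun x => b (sq_base x) = \sum_l rho (sq_nil x l) *: b gens`_l).
rewrite Db; apply=> [x|i|u v /= eu ev|u v /= eu ev].
- by rewrite /= bk big1 // => i _; rewrite rmorph0 scale0r.
- rewrite /= (bigD1 i) //= eqxx rmorph1 scale1r big1 ?addr0 // => j /negPf ->.
  by rewrite rmorph0 scale0r.
- rewrite bB eu ev -sumrB; apply: eq_bigr => l _; by rewrite rmorphB scalerBl.
- rewrite bM eu ev !scaler_sumr -big_split; apply: eq_bigr => l _ /=.
  by rewrite rmorphD !rmorphM scalerDl !scalerA.
Qed.

End Frame.

Lemma mk_rmorphism (A B : pzRingType) (f : A -> B) : zmod_morphism f -> monoid_morphism f ->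
  exists g : {rmorphism A -> B}, g =1 f.
Proof.
move=> zf mf.
pose g : {rmorphism A -> B} := HB.pack_for {rmorphism A -> B} f
  (GRing.isZmodMorphism.Build A B f zf) (GRing.isMonoidMorphism.Build A B f mf).
by exists g.
Qed.

(** * Localization of ring maps, of smoothness and of finite generation *)

Section Localization.
Variables (L : fieldType) (X : ringedSpace L) (lr : locally_ringed X).
Implicit Types (U V W : opens X).

Lemma loc_ext U (aU : affine U) f W (h : W `<=` U) (C : comPzRingType)
    (phi : {rmorphism O U -> C}) : isD f W -> (exists c, c * phi f = 1) ->
  exists psi : {rmorphism O W -> C}, forall a, psi (res h a) = phi a.
Proof.
move=> fW [c hc].
have cn n : c ^+ n * phi f ^+ n = 1 by rewrite -exprMn hc expr1n.
pose R s t := exists n a, res h a = s * res h f ^+ n /\ t = phi a * c ^+ n.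
have Ru s t t' : R s t -> R s t' -> t = t'.
  move=> [n [a [ea ->]]] [m [b [eb ->]]].
  have [|N eN] := affine_zero aU (h := h) (a := f ^+ m * a - f ^+ n * b) fW.
    by rewrite rmorphB !rmorphM !rmorphXn ea eb; ring.
  have : c ^+ N * (c ^+ m * c ^+ n) * phi (f ^+ N * (f ^+ m * a - f ^+ n * b)) = 0.
    by rewrite eN rmorph0 mulr0.
  rewrite rmorphM rmorphB !rmorphM !rmorphXn.
  have -> : c ^+ N * (c ^+ m * c ^+ n) * (phi f ^+ N * (phi f ^+ m * phi a - phi f ^+ n * phi b))
   = (c ^+ N * phi f ^+ N) * ((c ^+ m * phi f ^+ m) * (phi a * c ^+ n) - (c ^+ n * phi f ^+ n) * (phi b * c ^+ m)) by ring.
  by rewrite !cn !mul1r => /eqP; rewrite subr_eq0 => /eqP.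
have /choice [psi hpsi] s : exists t, R s t.
  by have [n [a ea]] := affine_frac aU h s fW; exists (phi a * c ^+ n), n, a.
have psiE n a s : res h a = s * res h f ^+ n -> psi s = phi a * c ^+ n.
  by move=> e; apply: Ru (hpsi s) _; exists n, a.
have psir a : psi (res h a) = phi a.
  by rewrite (@psiE 0%N a) ?expr0 ?mulr1.
have [||g hg] := @mk_rmorphism _ _ psi.
- move=> s t; have [n [a [ea ->]]] := hpsi s; have [m [b [eb ->]]] := hpsi t.
  rewrite (@psiE (n + m)%N (f ^+ m * a - f ^+ n * b)).
    rewrite rmorphB !rmorphM !rmorphXn exprD.
    rewrite mulrBl; congr (_ - _).
      by transitivity (phi a * c ^+ n * (c ^+ m * phi f ^+ m)); [ring | rewrite cn mulr1].
    by transitivity (phi b * c ^+ m * (c ^+ n * phi f ^+ n)); [ring | rewrite cn mulr1].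
  by rewrite rmorphB !rmorphM !rmorphXn ea eb exprD; ring.
- split=> [|s t]; first by rewrite -(rmorph1 (res h)) psir rmorph1.
  have [n [a [ea ->]]] := hpsi s; have [m [b [eb ->]]] := hpsi t.
  rewrite (@psiE (n + m)%N (a * b)); first by rewrite rmorphM exprD; ring.
  by rewrite rmorphM ea eb exprD; ring.
by exists g => a; rewrite hg.
Qed.

Lemma loc_ext_unique U (aU : affine U) (f : O U) W (h : W `<=` U) (C : comPzRingType)
    (p p' : {rmorphism O W -> C}) : isD f W ->
  (forall a, p (res h a) = p' (res h a)) -> p =1 p'.
Proof.
move=> fW e s; have [n [a ea]] := affine_frac aU h s fW.
have [g hg] := isD_unit h fW.
have := e a; rewrite ea !rmorphM !rmorphXn -(e f) => /(congr1 (fun z => z * p (g ^+ n))).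
by rewrite -!mulrA rmorphXn -exprMn -rmorphM mulrC [_ * g]mulrC hg rmorph1 expr1n mul1r mulr1.
Qed.

Lemma formally_smooth_isD U (aU : affine U) (f : O U) W : isD f W -> formally_smooth U -> formally_smooth W.
Proof.
move=> fW fs C B c q qs qn phi phik; have h := isD_sub fW.
have [|psi [psik psiq]] := fs C B c q qs qn [the {rmorphism O U -> B} of phi \o res h].
  by move=> k /=; rewrite res_cst phik.
have [g hg] := isD_unit h fW; have [d hd] := qs (phi g).
have [|psi' hpsi'] := loc_ext aU h (phi := psi) fW.
  (* The lift [d] inverts [psi f] up to [nu], whose square is 0; the factor [1 - nu] corrects it. *)
  pose nu := d * psi f - 1.
  have nu0 : q nu = 0 by rewrite rmorphB rmorphM rmorph1 psiq hd /= -rmorphM hg rmorph1 subrr.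
  have nu2 := qn nu nu nu0 nu0.
  exists (d * (1 - nu)).
  have -> : d * (1 - nu) * psi f = (1 + nu) * (1 - nu) by rewrite /nu; ring.
  transitivity (1 - nu * nu); first by ring.
  by rewrite nu2 subr0.
exists psi'; split=> [k|s]; first by rewrite -(res_cst h) hpsi'.
apply: (loc_ext_unique aU (h := h) (p := [the {rmorphism O W -> B} of q \o psi']) fW) => a /=.
by rewrite hpsi' psiq.
Qed.

Lemma fg_isD U (aU : affine U) (f : O U) W : isD f W -> finitely_generated_algebra U ->
  finitely_generated_algebra W.
Proof.
move=> fW [gens fg]; have h := isD_sub fW; have [g hg] := isD_unit h fW.
exists (g :: map (res h) gens) => S Sk Sg SD SM s.
have Sr a : S (res h a).
  apply: (fg (fun a => S (res h a))) => [c|b bg|u v Su Sv|u v Su Sv].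
  - by rewrite res_cst.
  - by apply: (Sg); rewrite inE map_f ?orbT.
  - by rewrite rmorphD; exact: SD.
  - by rewrite rmorphM; exact: SM.
have [n [a ea]] := affine_frac aU h s fW.
have -> : s = res h a * g ^+ n by rewrite ea -mulrA -exprMn [_ * g]mulrC hg expr1n mulr1.
apply: (SM) => //; elim: n {ea} => [|n IH].
  by rewrite expr0 -(rmorph1 (res h)).
by rewrite exprS; apply: (SM) => //; apply: (Sg); rewrite inE eqxx.
Qed.

Lemma isD_trans U (aU : affine U) (f : O U) V (h : V `<=` U) (g : O V) W : isD f V -> isD (g : O V) W ->
  exists a : O U, isD a W.
Proof.
move=> fV gW; have [n [a ea]] := affine_frac aU h g fV.
exists (a * f) => x; rewrite gW unit_atM; split=> [ug|[ua uf]].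
  have Vx := unit_at_in ug; have uf : unit_at f x by exact/fV.
  split=> //; rewrite -(unit_at_res h a Vx) ea unit_atM; split=> //.
  by apply: unit_atX; rewrite unit_at_res.
have Vx : V x by exact/fV.
by move: ua; rewrite -(unit_at_res h a Vx) ea unit_atM => -[].
Qed.

Lemma common_isD U U' (aU : affine U) (aU' : affine U') x : U x -> U' x ->
  exists W f f', [/\ W x, isD (f : O U) W & isD (f' : O U') W].
Proof.
move=> Ux U'x.
have [f [uf fs]] := affine_basis aU (@opensIl _ U U') (conj Ux U'x).
have fU' : basic_open f `<=` U' by move=> y /fs [].
have [g [ug gs]] := affine_basis aU' fU' uf.
have [a aD] := isD_trans aU (@basic_open_sub _ _ _ f) (isD_basic f) (isD_inter fU' (isD_basic g)).
exists (basic_open g), a, g; split=> // y.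
by rewrite -aD; split=> [gy|[]] //; split=> //; exact: gs.
Qed.

End Localization.

(** * Extension of a derivation of global sections to a vector field *)

Section ExtendDerivation.
Variables (L : fieldType) (X : ringedSpace L) (lr : locally_ringed X).
Implicit Types (V W : opens X).
Variables (U : opens X) (aU : affine U) (D : O U -> O U) (derD : lderivation (cst U) D).

Let DD f g : D (f + g) = D f + D g. Proof. by case: derD => h _ _; exact: h. Qed.
Let DM f g : D (f * g) = f * D g + g * D f. Proof. by case: derD => _ h _; exact: h. Qed.
Let Dk c : D (cst U c) = 0. Proof. by case: derD => _ _ h; exact: h. Qed.
Let D1 : D 1 = 0. Proof. by rewrite -(rmorph1 (cst U)) Dk. Qed.
Let D0 : D 0 = 0. Proof. by have := Dk 0; rewrite rmorph0. Qed.
Let DB f g : D (f - g) = D f - D g.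
Proof. by apply: (addIr (D g)); rewrite -DD !subrK. Qed.

(** On small principal sets [f ^+ n * a = 0]; differentiating and multiplying by [f] gives
    [f ^+ n.+1 * D a = 0]. *)
Lemma derivation_local W (h : W `<=` U) a : res h a = 0 -> res h (D a) = 0.
Proof.
move=> a0; apply: O_eq => x Wx; have [f [uf fW]] := affine_basis aU h Wx.
exists (basic_open f), fW; split=> //; rewrite rmorph0.
have kU : basic_open f `<=` U := @basic_open_sub _ _ _ f.
have [|n en] := affine_zero aU (h := kU) (a := a) (isD_basic f).
  by rewrite (resE _ (subset_trans fW h)) -res_res a0 rmorph0.
have := congr1 (fun z => f * D z) en; rewrite DM D0 mulr0 => e.
have e' : f ^+ n.+1 * D a = 0.
  rewrite mulrDr [X in _ + X](_ : _ = 0) ?addr0 in e; first by rewrite exprS -mulrA.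
  case: (n) en => [|m] en; first by rewrite expr0 D1 !mulr0.
  have DX j : D (f ^+ j.+1) = f ^+ j * D f *+ j.+1.
    elim: j => [|j IH]; first by rewrite expr1 expr0 mul1r.
    by rewrite exprS DM IH exprS [RHS]mulrS mulrnAr mulrA addrC mulrC mulrA.
  transitivity (f ^+ m.+1 * a * D f *+ m.+1); last by rewrite en mul0r mul0rn.
  by rewrite DX !mulrnAr; congr (_ *+ _); rewrite exprS; ring.
have [g hg] := isD_unit kU (isD_basic f).
have := congr1 (fun z => g ^+ n.+1 * res kU z) e'.
rewrite rmorph0 mulr0 rmorphM rmorphXn mulrA -exprMn hg expr1n mul1r => e2.
by rewrite res_res (resE _ kU).
Qed.

(** On [W], [f] is the quotient of [a] by the unit [b], and [t] obeys the quotient rule, written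
    without division as the Leibniz rule for [b * f]. *)
Definition local_quot V (f t : O V) W (h : W `<=` V) (k : W `<=` U) a b :=
  [/\ exists c, c * res k b = 1, res k a = res k b * res h f &
      res k (D a) = res k (D b) * res h f + res k b * res h t].

Definition extends_to V (f t : O V) := forall x, V x -> exists W (h : W `<=` V) (k : W `<=` U) a b,
  W x /\ local_quot f t h k a b.

Lemma local_quot_res V (f t : O V) W (h : W `<=` V) (k : W `<=` U) a b W' (l : W' `<=` W) h' k' :
  local_quot f t h k a b -> local_quot f t (W := W') h' k' a b.
Proof.
move=> [[c hc] ea eD].
rewrite /local_quot !(resE h' (subset_trans l h)) !(resE k' (subset_trans l k)) -!res_res.
split; [by exists (res l c); rewrite -rmorphM hc rmorph1 | by rewrite ea rmorphM |].
by rewrite eD rmorphD !rmorphM.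
Qed.

Lemma local_quot_eq V (f t : O V) W (h : W `<=` V) (k : W `<=` U) a b a' b' :
  local_quot f t h k a b -> res k a' = res k b' * res h f ->
  res k (D a') = res k (D b') * res h f + res k b' * res h t.
Proof.
move=> [[c hc] ea eD] ea'.
have := @derivation_local W k (b * a' - b' * a).
rewrite rmorphB !rmorphM ea ea' => /(_ _)/wrap [|e]; first by ring.
move: e; rewrite DB !DM rmorphB !rmorphD !rmorphM eD ea ea' => e.
apply/eqP; rewrite -subr_eq0; apply/eqP; rewrite -[LHS]mul1r -hc -[RHS](mulr0 c) -[X in _ = _ * X]e.
ring.
Qed.

Lemma extends_to_unique V (f t t' : O V) : extends_to f t -> extends_to f t' -> t = t'.
Proof.
move=> ht ht'; apply: O_eq => x Vx.
have [W [h [k [a [b [Wx q]]]]]] := ht x Vx; have [W' [h' [k' [a' [b' [W'x q']]]]]] := ht' x Vx.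
pose Q := opensI W W'; pose l : Q `<=` W := @opensIl _ W W'; pose l' : Q `<=` W' := @opensIr _ W W'.
pose hQ := subset_trans l h; pose kQ := subset_trans l k.
have qQ := local_quot_res l hQ kQ q; have [[c hc] ea eD] := local_quot_res l' hQ kQ q'.
have := local_quot_eq qQ ea; rewrite eD => /addrI /(congr1 (fun z => c * z)).
by rewrite !mulrA hc !mul1r => e; exists Q, hQ; split.
Qed.

Lemma local_quot_of_frac V (f : O V) W (h : W `<=` V) (k : W `<=` U) a b c (t : O W) :
  c * res k b = 1 -> res k a = res k b * res h f ->
  t = c * (res k (D a) - res k (D b) * res h f) ->
  local_quot (res h f) t (@subset_refl _ W) k a b.
Proof.
move=> hc ea ->; split; [by exists c | by rewrite res_id |].
rewrite !res_id mulrA [res k b * c]mulrC hc mul1r; ring.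
Qed.

Lemma extends_to_res V1 (f1 t1 : O V1) V2 (l : V2 `<=` V1) :
  extends_to f1 t1 -> extends_to (res l f1) (res l t1).
Proof.
move=> e x Vx; have [Q [h [k [a [b [Qx q]]]]]] := e x (l x Vx).
pose Q' := opensI V2 Q; pose h' : Q' `<=` V2 := @opensIl _ V2 Q.
have l' : Q' `<=` Q := @opensIr _ V2 Q.
exists Q', h', (subset_trans l' k), a, b; split=> //.
have := local_quot_res l' (subset_trans h' l) (subset_trans l' k) q.
by rewrite /local_quot !res_res.
Qed.

Lemma extends_to_ex V (VU : V `<=` U) (f : O V) : exists t, extends_to f t.
Proof.
have loc x : V x -> exists W (h : W `<=` V) (k : W `<=` U) a b (t : O W),
    W x /\ local_quot (res h f) t (@subset_refl _ W) k a b.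
  move=> Vx; have [g [ug gV]] := affine_basis aU VU Vx.
  have kU : basic_open g `<=` U := @basic_open_sub _ _ _ g.
  have [n [a ea]] := affine_frac aU kU (res gV f) (isD_basic g).
  have [c hc] := isD_unit kU (isD_basic g).
  exists (basic_open g), gV, kU, a, (g ^+ n), (c ^+ n * (res kU (D a) - res kU (D (g ^+ n)) * res gV f)).
  split=> //; apply: (local_quot_of_frac (c := c ^+ n)) => //.
    by rewrite rmorphXn -exprMn hc expr1n.
  by rewrite ea mulrC rmorphXn.
pose I := {x | V x}.
have /choice [W hW] (i : I) := loc (sval i) (svalP i).
have hWV i : W i `<=` V by have [h _] := hW i.
have ht i : {t : O (W i) | extends_to (res (hWV i) f) t}.
  apply: cid; have [h [k [a [b [t [Wx q]]]]]] := hW i.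
  exists t => x Wx'; exists (W i), (@subset_refl _ (W i)), k, a, b; split=> //.
  by rewrite (resE _ h).
pose t i := sval (ht i).
have [|i j W' hi hj|s [hs _]] := @O_sheaf L X I V W hWV _ t.
- move=> x Vx; exists (exist _ x Vx).
  by have [h [k [a [b [t0 [Wx q]]]]]] := hW (exist _ x Vx).
- apply: (@extends_to_unique W' (res (subset_trans hi (hWV i)) f)).
    by rewrite -res_res; apply: extends_to_res; exact: (svalP (ht i)).
  by rewrite (resE _ (subset_trans hj (hWV j))) -res_res; apply: extends_to_res; exact: (svalP (ht j)).
exists s => x Vx; pose i : I := exist _ x Vx.
have Wx : W i x by have [h [k [a [b [t0 [Wx q]]]]]] := hW i.
have [Q [h [k [a [b [Qx q]]]]]] := svalP (ht i) x Wx.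
exists Q, (subset_trans h (hWV i)), k, a, b; split=> //.
move: q; rewrite /local_quot -!res_res (hs i) //.
Qed.

Lemma extends_to_op V (f t g s : O V) u v : extends_to f t -> extends_to g s ->
  (forall W (h : W `<=` V) (k : W `<=` U) a b a' b', local_quot f t h k a b -> local_quot g s h k a' b' ->
     exists a'' b'', local_quot u v h k a'' b'') ->
  extends_to u v.
Proof.
move=> ef eg op x Vx; have [Q [h [k [a [b [Qx q]]]]]] := ef x Vx.
have [Q' [h' [k' [a' [b' [Qx' q']]]]]] := eg x Vx.
pose Q2 := opensI Q Q'; have l : Q2 `<=` Q := @opensIl _ Q Q'; have l' : Q2 `<=` Q' := @opensIr _ Q Q'.
have [a2 [b2 q2]] := op Q2 (subset_trans l h) (subset_trans l k) a b a' b'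
  (local_quot_res l _ _ q) (local_quot_res l' _ _ q').
by exists Q2, (subset_trans l h), (subset_trans l k), a2, b2.
Qed.

Lemma extends_toD V (f t g s : O V) : extends_to f t -> extends_to g s -> extends_to (f + g) (t + s).
Proof.
move=> ef eg; apply: (extends_to_op ef eg) => W h k a b a' b' [[c hc] ea eD] [[c' hc'] ea' eD'].
exists (a * b' + a' * b), (b * b'); split.
- by exists (c * c'); rewrite rmorphM mulrACA hc hc' mulr1.
- by rewrite !rmorphD !rmorphM ea ea'; ring.
- by rewrite DD !DM !rmorphD !rmorphM ea ea' eD eD'; ring.
Qed.

Lemma extends_toM V (f t g s : O V) : extends_to f t -> extends_to g s ->
  extends_to (f * g) (t * g + f * s).
Proof.
move=> ef eg; apply: (extends_to_op ef eg) => W h k a b a' b' [[c hc] ea eD] [[c' hc'] ea' eD'].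
exists (a * a'), (b * b'); split.
- by exists (c * c'); rewrite rmorphM mulrACA hc hc' mulr1.
- by rewrite !rmorphM ea ea'; ring.
- by rewrite !DM !rmorphD !rmorphM ea ea' eD eD'; ring.
Qed.

Lemma extends_to_fun V (h : V `<=` U) a : extends_to (res h a) (res h (D a)).
Proof.
move=> x Vx; exists V, (@subset_refl _ V), h, a, 1; split=> //; split.
- by exists 1; rewrite rmorph1 mulr1.
- by rewrite res_id rmorph1 mul1r.
- by rewrite !res_id D1 rmorph0 mul0r add0r rmorph1 mul1r.
Qed.

Lemma vfield_of_derivation : exists v : vfield U, forall a, dop_app (sval v) a = D a.
Proof.
pose F V (VU : V `<=` U) f := sval (cid (extends_to_ex VU f)).
have FP V (VU : V `<=` U) f : extends_to f (F V VU f) := svalP (cid (extends_to_ex VU f)).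
have Fu V (VU : V `<=` U) f t : extends_to f t -> F V VU f = t := extends_to_unique (FP V VU f).
have FM V (VU : V `<=` U) f g : F V VU (f * g) = F V VU f * g + f * F V VU g.
  by apply: Fu; apply: extends_toM; exact: FP.
have Fl V (h : V `<=` U) c f g : F V h (cst V c * f + g) = cst V c * F V h f + F V h g.
  apply: Fu; apply: extends_toD; last exact: FP.
  have := extends_toM (extends_to_fun h (cst U c)) (FP V h f).
  by rewrite Dk rmorph0 mul0r add0r res_cst.
have Fr V W (hV : V `<=` U) (hW : W `<=` U) (h : W `<=` V) f : res h (F V hV f) = F W hW (res h f).
  by symmetry; apply: Fu; apply: extends_to_res; exact: FP.
have Fo x : U x -> exists V k, V x /\ forall W (h : W `<=` U), W `<=` V -> dord k (F W h).
  move=> Ux; exists U, 2%N; split=> // W h _ a b z /=; rewrite !FM; ring.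
pose v : dop U := Dop Fl Fr Fo.
have dv : derivation v by move=> V h f g; exact: FM.
exists (exist _ v dv) => a; rewrite /dop_app /=; apply: Fu.
by have := extends_to_fun (@subset_refl _ U) a; rewrite !res_id.
Qed.

End ExtendDerivation.

(** * Elimination in a generating system of derivations *)

Section FrameStep.
Variables (L A : comPzRingType) (k : {rmorphism L -> A}).

Lemma comb_derivation (R : comPzRingType) (rho : {rmorphism A -> R}) (E : lmodType R) n
    (d : 'I_n -> A -> A) (e : 'I_n -> E) : (forall i, lderivation k (d i)) ->
  derivation_along k rho (fun f => \sum_i rho (d i f) *: e i).
Proof.
move=> der; split=> [f g|f g|c].
- by rewrite -big_split; apply: eq_bigr => i _; case: (der i) => -> _ _; rewrite rmorphD scalerDl.
- rewrite !scaler_sumr -big_split; apply: eq_bigr => i _; case: (der i) => _ -> _ /=.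
  by rewrite rmorphD !rmorphM scalerDl !scalerA.
- by rewrite big1 // => i _; case: (der i) => _ _ ->; rewrite rmorph0 scale0r.
Qed.

Lemma derivationD (R : comPzRingType) (rho : {rmorphism A -> R}) (E : lmodType R) (b b' : A -> E) :
  derivation_along k rho b -> derivation_along k rho b' -> derivation_along k rho (fun f => b f + b' f).
Proof.
move=> [bD bM bk] [bD' bM' bk']; split=> [f g|f g|c]; rewrite ?bD ?bD' ?bM ?bM' ?bk ?bk' ?addr0 //.
  by rewrite addrACA.
by rewrite addrACA -!scalerDr.
Qed.

Lemma lderivationZD a D D' : lderivation k D -> lderivation k D' ->
  lderivation k (fun f => D f + a * D' f).
Proof.
move=> [h1 h2 h3] [h1' h2' h3']; split=> [f g|f g|c]; rewrite ?h1 ?h1' ?h2 ?h2' ?h3 ?h3'.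
- by rewrite mulrDr; ring.
- by rewrite /GRing.scale /=; ring.
- by rewrite mulr0 addr0.
Qed.

(** Gaussian elimination with pivot [D l (g j)]: [g j] becomes a coordinate, its derivation is [D l]
    divided by the pivot, and multiples of [D l] are subtracted from the other derivations so that
    they kill [g j]. *)
Lemma frame_step n m (y : 'I_n -> A) d (g : 'I_m.+1 -> A) D j l u :
  frame k y d g D -> u * D l (g j) = 1 ->
  exists y' d' D', frame (n := n.+1) k y' d' (fun i => g (lift l i)) D'.
Proof.
move=> [[dd dD] dy Dy univ] hu.
pose y' (i : 'I_n.+1) := if unlift ord0 i is Some i' then y i' else g j.
pose d' (i : 'I_n.+1) f := if unlift ord0 i is Some i' then d i' f + (- (u * d i' (g j))) * D l f
   else 0 + u * D l f.
pose D' i f := D (lift l i) f + (- (u * D (lift l i) (g j))) * D l f.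
have der0 : lderivation k (fun _ : A => 0 : A).
  by split=> *; rewrite ?addr0 // ?scaler0 ?addr0.
exists y', d', D'; split.
- split=> i; last exact: lderivationZD.
  by rewrite /d'; case: (unliftP ord0 i) => [i' _|_]; exact: lderivationZD.
- move=> i i'; rewrite /d' /y'; case: (unliftP ord0 i) => [a ->|->];
    case: (unliftP ord0 i') => [a' ->|->].
  + by rewrite dy Dy mulr0 addr0 (inj_eq lift_inj).
  + rewrite -[X in _ = (X == _)%:R]/(lift ord0 a) eq_sym (negPf (neq_lift _ _)).
    have -> : d a (g j) + - (u * d a (g j)) * D l (g j) = d a (g j) * (1 - u * D l (g j)) by ring.
    by rewrite hu subrr mulr0.
  + by rewrite Dy mulr0 addr0 (negPf (neq_lift _ _)).
  + by rewrite add0r hu eqxx.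
- move=> i i'; rewrite /D' /y'; case: (unliftP ord0 i') => [a' _|_].
    by rewrite !Dy mulr0 addr0.
  have -> : D (lift l i) (g j) + - (u * D (lift l i) (g j)) * D l (g j) =
     D (lift l i) (g j) * (1 - u * D l (g j)) by ring.
  by rewrite hu subrr mulr0.
- move=> R rho E b db f.
  rewrite (univ R rho E b db f) [in RHS]big_ord_recl [in LHS](bigD1_ord l) //=.
  rewrite /y' /d' unlift_none.
  under [X in _ = _ + X + _]eq_bigr => i _ do rewrite liftK rmorphD scalerDl.
  rewrite (univ R rho E b db (g j)) (bigD1_ord l) //= add0r.
  under [X in _ = _ + X]eq_bigr => i _ do rewrite rmorphD scalerDl.
  rewrite !big_split /= [in RHS]scalerDr [in RHS]scalerDr !scaler_sumr.
  rewrite scalerA -rmorphM -mulrA [D l f * _]mulrC mulrA hu mul1r.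
  set a := \sum_i _; set c := _ *: _; set e := \sum_i _; set a1 := \sum_i _; set e1 := \sum_i _.
  set a2 := \sum_i _; set e2 := \sum_i _.
  have ha : a1 + a2 = 0.
    rewrite -big_split big1 // => i _ /=; rewrite scalerA -scalerDl -rmorphM -rmorphD.
    by rewrite (_ : _ + _ = 0) ?rmorph0 ?scale0r //; ring.
  have he : e1 + e2 = 0.
    rewrite -big_split big1 // => i _ /=; rewrite scalerA -scalerDl -rmorphM -rmorphD.
    by rewrite (_ : _ + _ = 0) ?rmorph0 ?scale0r //; ring.
  rewrite (_ : a1 + (c + e1) + (a + a2) + (e + e2) = (a + (c + e)) + (a1 + a2) + (e1 + e2)).
    by rewrite ha he !addr0.
  by rewrite !addrA (ACl (4*2*6*1*5*3*7)).
Qed.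

(** The differentials of the [y i] form a basis of the Kaehler differentials. This is expressed
    through derivations into modules over any [A]-algebra [R], because it is applied to residue
    fields and to quotients. *)
Definition dual_system n (y : 'I_n -> A) (d : 'I_n -> A -> A) :=
  [/\ (forall i, lderivation k (d i)), (forall i j, d i (y j) = (i == j)%:R) &
      (forall (R : comPzRingType) (rho : {rmorphism A -> R}) (E : lmodType R) (b : A -> E),
         derivation_along k rho b -> forall f, b f = \sum_i rho (d i f) *: b (y i))].

Lemma dual_frame n m (y : 'I_n -> A) d (g : 'I_m -> A) D :
  frame k y d g D -> (forall l f, D l f = 0) -> dual_system y d.
Proof.
move=> [[dd _] dy _ univ] D0; split=> // R rho E b db f.
rewrite (univ R rho E b db f) [X in _ + X]big1 ?addr0 // => l _.
by rewrite D0 rmorph0 scale0r.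
Qed.

(** The universal formula, applied to each [D i], says that the matrix [e] of the [D i (g j)] fixes
    the column of the [D i f]; multiplying by the adjugate of [1 - e] gives the claim. *)
Lemma frame_det n m (y : 'I_n -> A) d (g : 'I_m -> A) D :
  frame k y d g D -> forall l f, \det (1%:M - \matrix_(i, j) D i (g j)) * D l f = 0.
Proof.
move=> [[_ dD] _ Dy univ] l f; set e := (\matrix_(_, _) _).
pose v : 'cV[A]_m := \col_i D i f.
have ev : e *m v = v.
  apply/matrixP => i z; rewrite !mxE.
  rewrite (univ A [the {rmorphism A -> A} of idfun] A^o (D i) (dD i) f).
  rewrite [X in _ = X + _]big1 ?add0r; last by move=> a _; rewrite Dy scaler0.
  by apply: eq_bigr => a _; rewrite !mxE mulrC.
have : \adj (1%:M - e) *m ((1%:M - e) *m v) = 0.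
  by rewrite mulmxBl mul1mx ev subrr mulmx0.
by rewrite mulmxA mul_adj_mx mul_scalar_mx => /matrixP/(_ l 0); rewrite !mxE.
Qed.

End FrameStep.

Section LocalCoordinates.
Variables (L : fieldType) (X : ringedSpace L) (lr : locally_ringed X).
Implicit Types (U V W : opens X).

Lemma vfield_lderivation U (v : vfield U) V (h : V `<=` U) :
  lderivation (cst V) (dfam (sval v) h).
Proof.
have lin := dfam_linear (sval v) h.
have dD f g : dfam (sval v) h (f + g) = dfam (sval v) h f + dfam (sval v) h g.
  by have := lin 1 f g; rewrite rmorph1 !mul1r.
have dM f g : dfam (sval v) h (f * g) = f * dfam (sval v) h g + g * dfam (sval v) h f.
  by rewrite (svalP v V h) addrC [_ * g]mulrC.
have d0 : dfam (sval v) h 0 = 0 by apply: (addrI (dfam (sval v) h 0)); rewrite -dD !addr0.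
have d1 : dfam (sval v) h 1 = 0.
  by apply: (addrI (dfam (sval v) h 1)); rewrite addr0 -[in RHS](mulr1 1) dM !mul1r.
split=> // c; have := lin c 1 0; rewrite addr0 mulr1 => ->.
by rewrite d0 d1 mulr0 addr0.
Qed.

Lemma derivation_isD_eq U (aU : affine U) (f : O U) W (h : W `<=` U) (R : comPzRingType)
    (rho : {rmorphism O W -> R}) (E : lmodType R) (b b' : O W -> E) : isD f W ->
  derivation_along (cst W) rho b -> derivation_along (cst W) rho b' ->
  (forall a, b (res h a) = b' (res h a)) -> b =1 b'.
Proof.
move=> fW [_ bM _] [_ bM' _] e s; have [n [a ea]] := affine_frac aU h s fW.
have [g hg] := isD_unit h fW.
have := e a; rewrite ea bM bM' -rmorphXn e => /addrI.
move/(congr1 (fun z => rho (g ^+ n) *: z)); rewrite !scalerA -!rmorphM.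
by rewrite (rmorphXn (res h)) -exprMn hg expr1n rmorph1 !scale1r.
Qed.

Lemma derivation_isD U (aU : affine U) W (h : W `<=` U) D : lderivation (cst U) D ->
  exists D', lderivation (cst W) D' /\ forall a, D' (res h a) = res h (D a).
Proof.
move=> dD; have [v hv] := vfield_of_derivation aU dD.
exists (dfam (sval v) h); split; first exact: vfield_lderivation.
by move=> a; rewrite -hv /dop_app (dfam_res _ (@subset_refl _ U) h).
Qed.

Lemma frame_isD U (aU : affine U) (f : O U) W (h : W `<=` U) n m y d g D : isD f W ->
  frame (n := n) (m := m) (cst U) y d g D -> exists d' D',
    [/\ frame (cst W) (fun i => res h (y i)) d' (fun i => res h (g i)) D',
      (forall i a, d' i (res h a) = res h (d i a)) &
      (forall i a, D' i (res h a) = res h (D i a))].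
Proof.
move=> fW [[dd dD] dy Dy univ].
have /choice [d' hd'] i := derivation_isD aU h (dd i).
have /choice [D' hD'] i := derivation_isD aU h (dD i).
have ed i := (hd' i).1; have eD i := (hD' i).1.
exists d', D'; split=> [|i a|i a]; [|exact: (hd' i).2|exact: (hD' i).2].
split=> // [i j|i j|R rho E b db s].
- by rewrite (hd' i).2 dy rmorph_nat.
- by rewrite (hD' i).2 Dy rmorph0.
have db' : derivation_along (cst W) rho (fun s => \sum_i rho (d' i s) *: b (res h (y i))
    + \sum_l rho (D' l s) *: b (res h (g l))).
  by apply: derivationD; exact: comb_derivation.
apply: (derivation_isD_eq aU (h := h) fW db db') => a.
have dba : derivation_along (cst U) [the {rmorphism O U -> R} of rho \o res h] (fun a => b (res h a)).
  case: db => bD bM bk; split=> [u v|u v|c]; first by rewrite rmorphD bD.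
    by rewrite rmorphM bM.
  by rewrite res_cst bk.
rewrite (univ R _ E _ dba) /=; congr (_ + _); apply: eq_bigr => i _.
  by rewrite (hd' i).2.
by rewrite (hD' i).2.
Qed.

(** Induction on the number of generators not yet used as coordinates. If some [D l (g j)] is a unit
    at [x], it serves as pivot. Otherwise all of them vanish in the residue field, [1 - e] is
    invertible near [x], and the remaining derivations vanish there by [frame_det]. *)
Lemma dual_system_near U (aU : affine U) x : U x -> finitely_generated_algebra U ->
  forall n m y d g D, frame (n := n) (m := m) (cst U) y d g D ->
  exists W n' y' d', [/\ W x, affine W, finitely_generated_algebra W &
    dual_system (n := n') (cst W) y' d'].
Proof.
move=> Ux fgU n m; elim: m n U aU Ux fgU => [|m IH] n U aU Ux fgU y d g D fr.
  by exists U, n, y, d; split=> //; apply: (dual_frame fr) => -[].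
have [[l [j ul]]|nu] := pselect (exists l j, unit_at (D l (g j)) x).
  pose W := basic_open (D l (g j)); have h : W `<=` U := @basic_open_sub _ _ _ _.
  have fW : isD (D l (g j)) W := isD_basic _.
  have [d' [D' [fr' hd' hD']]] := frame_isD aU h fW fr.
  have [u hu] := isD_unit h fW.
  have [|y2 [d2 [D2 fr2]]] := frame_step fr' (l := l) (j := j) (u := u); first by rewrite hD'.
  by apply: (IH _ W _ _ _ _ _ _ _ fr2); [exact: affine_isD fW | | exact: fg_isD fW fgU].
set e := (\matrix_(i, j) D i (g j)).
pose u := \det (1%:M - e).
have uu : unit_at u x.
  have [K [phi [hphi _]]] := residue_field (point_prime lr Ux).
  apply: contrapT => /hphi; rewrite /u -det_map_mx.
  have -> : map_mx phi (1%:M - e) = 1%:M.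
    apply/matrixP => a b; rewrite !mxE rmorphB rmorph_nat.
    by rewrite (_ : phi (D a (g b)) = 0) ?subr0 //; apply/hphi => ug; apply: nu; exists a, b.
  by rewrite det1 => /eqP; rewrite oner_eq0.
pose W := basic_open u; have h : W `<=` U := @basic_open_sub _ _ _ _.
have fW : isD u W := isD_basic _.
have [d' [D' [fr' hd' hD']]] := frame_isD aU h fW fr.
exists W, n, (fun i => res h (y i)), d'; split=> //; [exact: affine_isD fW | exact: fg_isD fW fgU |].
apply: (dual_frame fr') => l; have [[_ dD'] _ _ _] := fr'.
have d0 : lderivation (cst W) (fun _ : O W => 0 : O W).
  by split=> *; rewrite ?addr0 // ?scaler0 ?addr0.
apply: (derivation_isD_eq aU (h := h) (rho := [the {rmorphism O W -> O W} of idfun]) fW (dD' l) d0) => a.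
rewrite hD'; have [v hv] := isD_unit h fW.
by rewrite -[LHS]mul1r -hv -mulrA -rmorphM (frame_det fr) rmorph0 mulr0.
Qed.

Lemma coordinates_of_dual U (aU : affine U) n y D : dual_system (n := n) (cst U) y D ->
  exists d : 'I_n -> vfield U, (forall i a, dop_app (sval (d i)) a = D i a) /\ coordinates y d.
Proof.
move=> [dD Dy univ].
have /choice [d hd] i := vfield_of_derivation aU (dD i).
exists d; split=> //; split=> [i j|V h v]; first by rewrite hd.
apply: dopP => W k f.
have sumE n' (F : 'I_n' -> dop V) : dfam (\sum_i F i) k f = \sum_i dfam (F i) k f.
  by apply: (big_morph (fun P : dop V => dfam P k f)).
rewrite sumE /=.
pose l := subset_trans k h.
apply: O_eq => x Wx; have [g [ug gW]] := affine_basis aU l Wx.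
pose Q := basic_open g; have hQ : Q `<=` U := @basic_open_sub _ _ _ _.
exists Q, gW; split=> //; rewrite rmorph_sum.
pose kQ := subset_trans gW k.
rewrite (dfam_res _ _ kQ).
have db' : derivation_along (cst Q) [the {rmorphism O Q -> O Q} of idfun] (E := (O Q)^o)
   (fun s => \sum_i dfam (sval (d i)) hQ s *: (dfam (sval v) kQ (res hQ (y i)) : (O Q)^o)).
  apply: (comb_derivation [the {rmorphism O Q -> O Q} of idfun] (E := (O Q)^o)) => i.
  exact: vfield_lderivation.
have e := derivation_isD_eq aU (h := hQ) (rho := [the {rmorphism O Q -> O Q} of idfun]) (isD_basic g)
  (vfield_lderivation v kQ) db'.
rewrite e => [|a].
  apply: eq_bigr => i _; rewrite rmorphM (dfam_res _ _ hQ) mulrC; congr (_ * _).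
  rewrite res_res /dop_app (dfam_res _ _ kQ) res_res; congr (dfam _ _ _); exact: resE.
have dba : derivation_along (cst U) (res hQ) (E := (O Q)^o) (fun a => dfam (sval v) kQ (res hQ a)).
  have [bD bM bk] := vfield_lderivation v kQ; split=> [u w|u w|c]; first by rewrite rmorphD bD.
    by rewrite rmorphM bM.
  by rewrite res_cst bk.
rewrite (univ _ _ _ _ dba); apply: eq_bigr => i _; rewrite -hd /dop_app (dfam_res _ _ hQ).
by [].
Qed.

Theorem local_coordinates : scheme X -> finite_type X -> locally_formally_smooth X ->
  forall x, exists U n (y : 'I_n -> O U) (d : 'I_n -> vfield U),
  [/\ U x, affine U, finitely_generated_algebra U, coordinates y d &
      dual_system (cst U) y (fun i => dop_app (sval (d i)))].
Proof.
move=> _ [N [F [cF hF]]] sm x.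
have [U1 [U1x aU1 fs1]] := sm x; have [i U2x] := cF x; have [aU2 fg2] := hF i.
have [W [f [f' [Wx fW fW']]]] := common_isD aU1 aU2 U1x U2x.
have aW := affine_isD aU1 fW; have fsW := formally_smooth_isD aU1 fW fs1.
have [gens fgW] := fg_isD aU2 fW' fg2.
have [D fr] := smooth_frame fsW fgW.
have [|Q [n [y [d [Qx aQ fgQ ds]]]]] := dual_system_near aW Wx _ fr; first by exists gens.
have [v [hv co]] := coordinates_of_dual aQ ds.
exists Q, n, y, v; split=> //; rewrite (_ : (fun i => _) = d) //.
by apply/funext => j; apply/funext => a; rewrite hv.
Qed.

End LocalCoordinates.

(** * Extension of derivations to residue fields *)

Section ExtendToResidueField.
Variables (L : fieldType) (charL : [pchar L] =i pred0).
Variables (A : comPzRingType) (k : {rmorphism L -> A}) (K : fieldType) (phi : {rmorphism A -> K}).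

(* graphs of [L]-derivations from subrings of [K] to [K] *)
Definition dgraph (H : K -> K -> Prop) := [/\ (forall c, H (phi (k c)) 0),
  (forall a u b v, H a u -> H b v -> H (a + b) (u + v)),
  (forall a u b v, H a u -> H b v -> H (a * b) (a * v + b * u)) &
  (forall u, H 0 u -> u = 0)].

Definition poly_in (H : K -> K -> Prop) (h w : {poly K}) := forall i, H h`_i w`_i.

(** The extension to the ring generated by [g] that maps [g] to [c]: the coefficients of [w] are the
    derivatives of those of [h]. *)
Definition dadj (H : K -> K -> Prop) g c a u := exists h w : {poly K},
  [/\ poly_in H h w, a = h.[g] & u = w.[g] + h^`().[g] * c].

Section Adjoin.
Variables (H : K -> K -> Prop) (dH : dgraph H).

Let H0 : H 0 0. Proof. by case: dH => /(_ 0); rewrite !rmorph0. Qed.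
Let H1 : H 1 0. Proof. by case: dH => /(_ 1); rewrite !rmorph1. Qed.
Let HD a u b v : H a u -> H b v -> H (a + b) (u + v). Proof. by case: dH => _ h _ _; exact: h. Qed.
Let HM a u b v : H a u -> H b v -> H (a * b) (a * v + b * u).
Proof. by case: dH => _ _ h _; exact: h. Qed.
Let HN a u : H a u -> H (- a) (- u).
Proof.
have : H (-1) 0 by case: dH => /(_ (-1)); rewrite !rmorphN !rmorph1.
by move=> h Ha; have := HM h Ha; rewrite mulr0 addr0 !mulN1r.
Qed.
Let HF u : H 0 u -> u = 0. Proof. by case: dH => _ _ _; apply. Qed.

Lemma dgraph_fun a u v : H a u -> H a v -> u = v.
Proof.
move=> hu /HN hv; apply/eqP; rewrite -subr_eq0; apply/eqP; apply: HF.
by rewrite -(subrr a); exact: HD.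
Qed.

Lemma dgraph_sum (I : Type) (r : seq I) (F G : I -> K) : (forall i, H (F i) (G i)) ->
  H (\sum_(i <- r) F i) (\sum_(i <- r) G i).
Proof. by move=> FG; elim/big_rec2: _ => // i a u _; exact: HD. Qed.

Lemma dgraph_nat a u n : H a u -> H (a *+ n) (u *+ n).
Proof. by move=> h; elim: n => [//|n IH]; rewrite !mulrS; exact: HD. Qed.

Lemma poly_inD h w h' w' : poly_in H h w -> poly_in H h' w' -> poly_in H (h + h') (w + w').
Proof. by move=> a b i; rewrite !coefD; exact: HD. Qed.

Lemma poly_inN h w : poly_in H h w -> poly_in H (- h) (- w).
Proof. by move=> a i; rewrite !coefN; exact: HN. Qed.

Lemma poly_inM h w h' w' : poly_in H h w -> poly_in H h' w' ->
  poly_in H (h * h') (h * w' + h' * w).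
Proof.
move=> a b i; rewrite coefD !(coefM h) (coefMr h') -big_split /=.
by apply: dgraph_sum => j; exact: HM.
Qed.

Lemma poly_inC a u : H a u -> poly_in H a%:P u%:P.
Proof. by move=> h i; rewrite !coefC; case: eqP. Qed.

Lemma poly_inX : poly_in H 'X 0.
Proof. by move=> i; rewrite coefX coef0; case: eqP. Qed.

Lemma poly_in_deriv h w : poly_in H h w -> poly_in H h^`() w^`().
Proof. by move=> a i; rewrite !coef_deriv; exact: dgraph_nat. Qed.

Lemma poly_inXn n : poly_in H 'X^n 0.
Proof.
elim: n => [|n IH]; first by rewrite expr0; exact: poly_inC.
by have := poly_inM poly_inX IH; rewrite !mulr0 addr0 -exprS.
Qed.

Lemma sub_dadj g c a u : H a u -> dadj H g c a u.
Proof.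
move=> h; exists a%:P, u%:P; split; first exact: poly_inC.
  by rewrite hornerC.
by rewrite derivC horner0 mul0r addr0 hornerC.
Qed.

Lemma mem_dadj g c : dadj H g c g c.
Proof.
exists 'X, 0; split; first exact: poly_inX; first by rewrite hornerX.
by rewrite derivX horner0 -polyC1 hornerC add0r mul1r.
Qed.

Lemma dadj_dgraph g c :
  (forall h w, poly_in H h w -> h.[g] = 0 -> w.[g] + h^`().[g] * c = 0) -> dgraph (dadj H g c).
Proof.
move=> fn; split=> [x|_ _ _ _ [h [w [hw -> ->]]] [h' [w' [hw' -> ->]]]
  |_ _ _ _ [h [w [hw -> ->]]] [h' [w' [hw' -> ->]]]|u [h [w [hw /esym h0 ->]]]].
- by apply: sub_dadj; case: dH.
- exists (h + h'), (w + w'); split; [exact: poly_inD | by rewrite hornerD |].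
  by rewrite derivD !hornerD; ring.
- exists (h * h'), (h * w' + h' * w); split; [exact: poly_inM | by rewrite hornerM |].
  by rewrite derivM !(hornerD, hornerM); ring.
- exact: fn.
Qed.

Lemma dadj_trans g c : (forall h w, poly_in H h w -> h.[g] = 0 -> h = 0) -> dgraph (dadj H g c).
Proof.
move=> tr; apply: dadj_dgraph => h w hw h0.
have e := tr h w hw h0; have -> : w = 0.
  by apply/polyP => i; have := hw i; rewrite e !coef0 => /HF.
by rewrite e deriv0 !horner0 mul0r addr0.
Qed.

(* The value of the derivation at [g] is forced by a minimal relation [f]. *)
Lemma dadj_alg g f v : poly_in H f v -> f != 0 -> f.[g] = 0 ->
  (forall h w, poly_in H h w -> h != 0 -> h.[g] = 0 -> (size f <= size h)%N) ->
  exists c, dgraph (dadj H g c).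
Proof.
move=> fv f0 fg fmin.
have sf : (1 < size f)%N.
  rewrite ltnNge; apply/negP => sf; move: fg f0.
  by rewrite (size1_polyC sf) hornerC => ->; rewrite polyC0 eqxx.
have f'0 : f^`().[g] != 0.
  apply/eqP => f'g; have f'n : f^`() != 0.
    apply/eqP => /polyP /(_ (size f).-2); rewrite coef_deriv coef0.
    have -> : (size f).-2.+1 = (size f).-1 by case: (size f) sf => [|[]].
    move/eqP; rewrite -mulr_natr mulf_eq0 -/(lead_coef f) lead_coef_eq0 (negPf f0) /=.
    rewrite -(rmorph_nat [the {rmorphism L -> K} of phi \o k]) fmorph_eq0.
    by rewrite ((pcharf0P L).1 charL) => /eqP e; move: sf; case: (size f) e => [|[]].
  have := fmin _ _ (poly_in_deriv fv) f'n f'g.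
  by rewrite leqNgt lt_size_deriv.
pose c := - v.[g] / f^`().[g]; exists c; apply: dadj_dgraph.
have vc : v.[g] + f^`().[g] * c = 0 by rewrite /c mulrC divfK // subrr.
move=> h w; have [N] := ubnP (size h); elim: N h w => // N IH h w sN hw hg.
have [h0|h0] := eqVneq h 0.
  have -> : w = 0 by apply/polyP => i; have := hw i; rewrite h0 !coef0 => /HF.
  by rewrite h0 deriv0 !horner0 mul0r addr0.
have sfh := fmin h w hw h0 hg.
pose a := lead_coef f; pose b := lead_coef h; pose d := (size h - size f)%N.
have ha : H a v`_(size f).-1 := fv _; have hb : H b w`_(size h).-1 := hw _.
set alpha := v`_ _ in ha; set beta := w`_ _ in hb.
(* Pseudo-division: the leading terms of [h] and [f] cancel. The polynomial [w2] collects the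
   derivatives of the coefficients of [h2], and the factor [a] is cancelled in [K] at the end. *)
pose h2 := a%:P * h - b%:P * ('X^d * f).
pose w2 := (a%:P * w + h * alpha%:P) - (b%:P * ('X^d * v + f * 0) + ('X^d * f) * beta%:P).
have hw2 : poly_in H h2 w2.
  apply: poly_inD; first by apply: poly_inM => //; exact: poly_inC.
  apply: poly_inN; apply: poly_inM; first exact: poly_inC.
  by apply: poly_inM => //; exact: poly_inXn.
have s2 : (size h2 < N)%N.
  apply: leq_trans (_ : size h <= N)%N; last by rewrite -ltnS.
  have sb (p : {poly K}) : (size p <= size h)%N -> p`_(size h).-1 = 0 -> (size p < size h)%N.
    move=> sp p0; rewrite ltn_neqAle sp andbT; apply/eqP => e.
    have : lead_coef p = 0 by rewrite /lead_coef e.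
    by move/eqP; rewrite lead_coef_eq0 -size_poly_eq0 e size_poly_eq0 (negPf h0).
  apply: sb.
    apply: leq_trans (size_polyD _ _) _; rewrite geq_max size_polyN.
    rewrite !mul_polyC !(leq_trans (size_scale_leq _ _)) //.
    by rewrite size_monicM ?monicXn // size_polyXn addSn /= subnK.
  rewrite coefB !coefCM -/(lead_coef h) -/b coefXnM.
  have -> : ((size h).-1 < d)%N = false by rewrite /d; move: sf sfh; clear; lia.
  have -> : ((size h).-1 - d)%N = (size f).-1 by rewrite /d; move: sf sfh; clear; lia.
  by rewrite -/(lead_coef f) -/a mulrC subrr.
have h2g : h2.[g] = 0 by rewrite !(hornerD, hornerN, hornerM) hg fg !mulr0 subrr.
have := IH h2 w2 s2 hw2 h2g.
rewrite /h2 /w2 !(derivB, derivM, derivC, mul0r, add0r).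
rewrite !(hornerD, hornerN, hornerM, hornerC) hg fg => e.
have an : a != 0 by rewrite lead_coef_eq0.
apply: (mulfI an); rewrite mulr0 -[RHS]e.
have -> : v.[g] = - (f^`().[g] * c) by apply/eqP; rewrite -addr_eq0 vc.
ring.
Qed.

Lemma dadj_ex g : exists c, dgraph (dadj H g c).
Proof.
have [tr|/existsNP [f /existsNP [v /not_implyP [fv /not_implyP [fg /eqP f0]]]]] :=
    pselect (forall h w, poly_in H h w -> h.[g] = 0 -> h = 0).
  by exists 0; exact: dadj_trans.
have [N] := ubnP (size f); elim: N f v fv fg f0 => // N IH f v fv fg f0 sN.
have [fmin|] := pselect (forall h w, poly_in H h w -> h != 0 -> h.[g] = 0 -> (size f <= size h)%N).
  exact: dadj_alg fv f0 fg fmin.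
move=> /existsNP [h /existsNP [w /not_implyP [hw /not_implyP [h0 /not_implyP [hg /negP]]]]].
by rewrite -ltnNge => lt; apply: (IH h w) => //; exact: leq_trans lt _.
Qed.

End Adjoin.

Variables (P : set A) (pP : prime_ideal P) (phiP : forall a, phi a = 0 <-> P a).

Lemma dgraph_tower xs O (c : nat -> K) : tower k P xs O -> exists H, [/\ dgraph H,
  forall a u, H a u -> exists2 o, O o & a = phi o &
  forall i, (i < size xs)%N -> H (phi xs`_i) (c i)].
Proof.
move=> t; elim: t c => {xs O} [|x xs O tO IH tx] c.
  exists (fun a u => (exists c, a = phi (k c)) /\ u = 0); split=> //; first split.
  - by move=> c'; split=> //; exists c'.
  - by move=> a u b v [[c1 ->] ->] [[c2 ->] ->]; split; rewrite ?addr0 //; exists (c1 + c2); rewrite !rmorphD.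
  - move=> a u b v [[c1 ->] ->] [[c2 ->] ->]; split; last by rewrite !mulr0 addr0.
    by exists (c1 * c2); rewrite !rmorphM.
  - by move=> u [].
  - by move=> a u [[c' ->] _]; exists (k c') => //; exists c'.
have [H [dH HO Hc]] := IH (fun i => c i.+1).
have lift_poly h w : poly_in H h w -> exists o : nat -> A, (forall i, O (o i)) /\
    forall i, h`_i = phi (o i).
  move=> hw; have /choice [o ho] i : exists o, O o /\ h`_i = phi o.
    by have [o Oo e] := HO _ _ (hw i); exists o.
  by exists o; split=> i; case: (ho i).
exists (dadj H (phi x) (c 0%N)); split.
- apply: dadj_trans => // h w hw h0.
  have [o [Oo ho]] := lift_poly h w hw.
  have hx : P (\sum_(i < size h) o i * x ^+ i).
    apply/phiP; rewrite -[RHS]h0 horner_coef rmorph_sum; apply: eq_bigr => i _.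
    by rewrite rmorphM rmorphXn ho.
  apply/polyP => i; rewrite coef0; have [lt|ge] := ltnP i (size h); last by rewrite nth_default.
  by rewrite ho; apply/phiP; exact: (tx _ _ Oo hx).
- move=> a u [h [w [hw -> _]]]; have [o [Oo ho]] := lift_poly h w hw.
  exists (\sum_(i < size h) o i * x ^+ i); first by exists (size h), o.
  by rewrite horner_coef rmorph_sum; apply: eq_bigr => i _; rewrite rmorphM rmorphXn ho.
- case=> [_|i lt] /=; first exact: mem_dadj.
  by apply: sub_dadj => //; exact: Hc.
Qed.

Lemma dgraph_seq (gs : seq A) H : dgraph H -> exists H', [/\ dgraph H',
  forall a u, H a u -> H' a u & forall g, g \in gs -> exists u, H' (phi g) u].
Proof.
elim: gs => [|g gs IH] dH; first by exists H; split.
have [H' [dH' sub all]] := IH dH; have [c dc] := dadj_ex dH' (phi g).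
exists (dadj H' (phi g) c); split=> // [a u /sub|z].
  exact: sub_dadj.
rewrite inE => /predU1P [->|/all [u hu]]; first by exists c; exact: mem_dadj.
by exists u; exact: sub_dadj.
Qed.

Lemma derivation_tower gens xs O (c : nat -> K) : fg_alg k gens -> tower k P xs O ->
  exists b : A -> K, derivation_along (E := K^o) k phi b /\
    forall i, (i < size xs)%N -> b xs`_i = c i.
Proof.
move=> fg t; have [H0 [dH0 _ Hc]] := dgraph_tower c t.
have [H [dH sub gH]] := dgraph_seq gens dH0.
have [Hk HD HM HF] := dH.
have /choice [b hb] a : exists u, H (phi a) u.
  apply: (fg (fun a => exists u, H (phi a) u)) => //.
  - by move=> x; exists 0.
  - by move=> u v [a1 h1] [a2 h2]; exists (a1 + a2); rewrite rmorphD; exact: HD.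
  - by move=> u v [a1 h1] [a2 h2]; eexists; rewrite rmorphM; apply: HM; eassumption.
exists b; split=> [|i lt]; last by apply: (dgraph_fun dH (hb _)); apply: sub; exact: Hc.
split=> [f g|f g|x].
- by apply: (dgraph_fun dH (hb _)); rewrite rmorphD; exact: HD.
- by apply: (dgraph_fun dH (hb _)); rewrite rmorphM; exact: HM.
- by apply: (dgraph_fun dH (hb _)).
Qed.

(** There are derivations [b j] to [K] dual to the tower, and each is determined by its values at
    the [n] functions [y]. The identity matrix of size [size xs] therefore factors through dimension
    [n]. *)
Lemma tower_bound gens n (y : 'I_n -> A) d xs O : fg_alg k gens -> dual_system k y d ->
  tower k P xs O -> (size xs <= n)%N.
Proof.
move=> fg [_ _ univ] t.
have /choice [b hb] (j : nat) : exists b : A -> K, derivation_along (E := K^o) k phi b /\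
    forall i, (i < size xs)%N -> b xs`_i = (i == j)%:R.
  exact: (derivation_tower (fun i => (i == j)%:R) fg t).
apply: (@mulmx1_min _ _ _ (\matrix_(i < size xs, l < n) phi (d l xs`_i)) (\matrix_(l < n, j < size xs) b j (y l))).
apply/matrixP => i j; rewrite !mxE; transitivity (b j xs`_i); last exact: (hb j).2.
rewrite (univ _ _ _ _ (hb j).1).
by apply: eq_bigr => l _; rewrite !mxE.
Qed.

End ExtendToResidueField.

(** * Functions on the cotangent bundle *)

Section VfieldCombination.
Variables (L : fieldType) (Y : ringedSpace L) (T : cotangentBundle Y) (U : opens Y).
Notation pi := (proj T).

Lemma vfield_comb m (f : 'I_m -> O U) (d : 'I_m -> vfield U) : exists w : vfield U,
  sval w = \sum_i dop_fun (f i) * sval (d i) /\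
  taut T w = \sum_i pull pi U (f i) * taut T (d i).
Proof.
elim: m f d => [|m IH] f d.
  have d0 : derivation (0 : dop U) by move=> V h a b /=; rewrite mul0r mulr0 addr0.
  exists (exist _ _ d0); rewrite !big_ord0; split=> //.
  apply: (addrI (taut T (exist _ _ d0))); rewrite addr0; symmetry.
  by apply: tautD; rewrite /= addr0.
have [w [ew tw]] := IH (fun i => f (widen_ord (leqnSn m) i)) (fun i => d (widen_ord (leqnSn m) i)).
have df : derivation (dop_fun (f ord_max) * sval (d ord_max)).
  by move=> V h a b /=; rewrite (svalP (d ord_max) V h); ring.
pose v : vfield U := exist _ _ df.
have ds : derivation (sval w + sval v).
  by move=> V h a b /=; rewrite (svalP w V h) (svalP (d ord_max) V h); ring.
exists (exist _ _ ds); rewrite !big_ord_recr /= -ew -tw; split=> //.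
rewrite (@tautD _ _ T _ w v) //; congr (_ + _); exact: tautZ.
Qed.

End VfieldCombination.

Section CotangentCoordinates.
Variables (L : fieldType) (Y : ringedSpace L) (T : cotangentBundle Y).
Notation pi := (proj T).
Variables (U : opens Y) (aU : affine U) (n : nat) (y : 'I_n -> O U) (d : 'I_n -> vfield U).
Hypothesis co : coordinates y d.
Hypothesis ds : dual_system (cst U) y (fun i => dop_app (sval (d i))).
Notation S := (O (minv pi U)).
Notation pl := (pull pi U).
Notation kS := (cst (minv pi U)).

Lemma cot_ex (C : comPzRingType) (phi : {rmorphism O U -> C}) (tau : vfield U -> C) :
  (forall u v w : vfield U, sval w = sval u + sval v -> tau w = tau u + tau v) ->
  (forall f (v w : vfield U), sval w = dop_fun f * sval v -> tau w = phi f * tau v) ->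
  exists psi : {rmorphism S -> C}, (forall f, psi (pl f) = phi f) /\ (forall v, psi (taut T v) = tau v).
Proof. by move=> h1 h2; case: (cot_sym T aU h1 h2). Qed.

Lemma cot_eq (C : comPzRingType) (psi psi' : {rmorphism S -> C}) :
  (forall f, psi (pl f) = psi' (pl f)) -> (forall v, psi (taut T v) = psi' (taut T v)) -> psi =1 psi'.
Proof.
move=> h1 h2; pose tau v := psi (taut T v).
have [u v w e|f v w e|_ un] := @cot_sym _ _ T U aU C [the {rmorphism O U -> C} of psi \o pl] tau.
- by rewrite /tau (tautD T e) rmorphD.
- by rewrite /tau (tautZ T e) rmorphM.
- by apply: un; split=> // [f|v]; rewrite -?h1 -?h2.
Qed.

Lemma taut_coordinates (v : vfield U) :
  taut T v = \sum_i pl (dop_app (sval v) (y i)) * taut T (d i).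
Proof.
have [w [ew <-]] := vfield_comb T (fun i => dop_app (sval v) (y i)) d.
have <- : v = w; last by [].
case: v w ew => v dv [w dw] /= ew.
have e : v = w.
  case: co => _ /(_ U (@subset_refl _ U) (exist _ v dv)) /= ev.
  rewrite ew [LHS]ev; apply: eq_bigr => i _; rewrite res_id; congr (_ * _).
  by apply: dopP => V h f /=; rewrite (Prop_irrelevance (subset_trans h _) h).
by move: dw; rewrite -e => dw; rewrite (Prop_irrelevance dv dw).
Qed.

(** The universal property maps [S] to the subring [C], and by uniqueness this map followed by the
    inclusion is the identity. *)
Lemma cot_generated (Q : S -> Prop) : (forall a, Q (pl a)) -> (forall i, Q (taut T (d i))) ->
  (forall s t, Q s -> Q t -> Q (s + t)) -> (forall s t, Q s -> Q t -> Q (s * t)) -> forall s, Q s.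
Proof.
move=> Qp Qt QD QM.
have Q1 : Q 1 by rewrite -(rmorph1 pl).
have QB s t : Q s -> Q t -> Q (s - t).
  move=> Qs Qt'; apply: QD => //; rewrite -mulN1r -(rmorph1 pl) -rmorphN; exact: QM.
pose C := Subring Q1 QB QM.
have Qv v : C (taut T v).
  rewrite taut_coordinates; apply: big_ind => //=; first by rewrite -(rmorph0 pl).
  by move=> i _; apply: (QM).
pose phi : {rmorphism O U -> subring_sort C} := to_subring (S := C) Qp.
have [||psi [psi1 psi2]] := @cot_ex (subring_sort C) phi (fun v => InSubring (Qv v)).
- by move=> u v w e; apply: sub_val_inj => /=; exact: tautD.
- by move=> f v w e; apply: sub_val_inj => /=; exact: tautZ.
have e : [the {rmorphism S -> S} of @sub_val _ C \o psi] =1 [the {rmorphism S -> S} of idfun].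
  by apply: cot_eq => [f|v] /=; rewrite ?psi1 ?psi2.
by move=> s; rewrite -[s]/(idfun s) -e; exact: (sub_valP (psi s)).
Qed.

Lemma cot_fg : finitely_generated_algebra U -> exists gens, fg_alg kS gens.
Proof.
move=> [gens fg]; exists (map pl gens ++ [seq taut T (d i) | i <- enum 'I_n]) => Q Qk Qg QD QM.
apply: cot_generated => //; last by move=> i; apply: Qg; rewrite mem_cat map_f ?orbT // mem_enum.
apply: (fg (fun a => Q (pl a))) => [c|a ag|a b|a b].
- by rewrite pull_cst.
- by apply: Qg; rewrite mem_cat map_f.
- by rewrite rmorphD; exact: QD.
- by rewrite rmorphM; exact: QM.
Qed.

Definition cot_coord (i : 'I_(n + n)) : S :=
  match split i with inl j => pl (y j) | inr j => taut T (d j) end.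

Lemma cot_coord_l i : cot_coord (lshift n i) = pl (y i).
Proof. by rewrite /cot_coord (unsplitK (inl _ i)). Qed.

Lemma cot_coord_r i : cot_coord (rshift n i) = taut T (d i).
Proof. by rewrite /cot_coord (unsplitK (inr _ i)). Qed.

Let dc i := dop_app (sval (d i)).
Let dcD i a b : dc i (a + b) = dc i a + dc i b.
Proof. by case: ds => /(_ i) [h _ _] _ _; exact: h. Qed.
Let dcM i a b : dc i (a * b) = a * dc i b + b * dc i a.
Proof. by case: ds => /(_ i) [_ h _] _ _; exact: h. Qed.
Let dck i c : dc i (cst U c) = 0.
Proof. by case: ds => /(_ i) [_ _ h] _ _; exact: h. Qed.

(** The partial derivatives are the nilpotent components of a ring map from [S] to its square-zero
    extension, given by the universal property. For [taut v], which is the sum of the [v(y_l) xi_l],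
    [nilt] differentiates the coefficients in the base directions and is [v(y_j)] in the direction
    of [xi_j]. *)
Lemma cot_dual : exists D, dual_system kS cot_coord D.
Proof.
pose C := sqzero S (n + n).
pose nilp a (i : 'I_(n + n)) : S := match split i with inl j => pl (dc j a) | inr _ => 0 end.
pose nilt (v : vfield U) (i : 'I_(n + n)) : S := match split i with
  | inl j => \sum_l pl (dc j (dop_app (sval v) (y l))) * taut T (d l)
  | inr j => pl (dop_app (sval v) (y j)) end.
pose phi0 a : C := SqZero (pl a) (nilp a).
have d0 j : dc j 0 = 0 by apply: (addrI (dc j 0)); rewrite -dcD !addr0.
have [||phi hphi] := @mk_rmorphism _ _ phi0.
- move=> a b; apply: sqzero_eq => [|i] /=; first by rewrite rmorphB.
  rewrite /nilp; case: split => j; last by rewrite subr0.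
  by rewrite -rmorphB; congr (pl _); apply: (addIr (dc j b)); rewrite -dcD !subrK.
- split=> [|a b].
    apply: sqzero_eq => [|i] /=; first by rewrite rmorph1.
    by rewrite /nilp; case: split => // j; rewrite -(rmorph1 (cst U)) dck rmorph0.
  apply: sqzero_eq => [|i] /=; first by rewrite rmorphM.
  rewrite /nilp; case: split => j; last by rewrite !mulr0 addr0.
  by rewrite dcM rmorphD !rmorphM.
pose tau v : C := SqZero (taut T v) (nilt v).
have [u v w e|f v w e|psi [psi1 psi2]] := @cot_ex C phi tau.
- apply: sqzero_eq => [|i] /=; first exact: tautD.
  rewrite /nilt e; case: split => j; last by rewrite -rmorphD.
  by rewrite -big_split; apply: eq_bigr => l _; rewrite /= -mulrDl -rmorphD -dcD.
- apply: sqzero_eq => [|i]; rewrite hphi /=; first exact: tautZ.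
  have ew l : dop_app (sval w) (y l) = f * dop_app (sval v) (y l).
    by rewrite e /dop_app /= res_id.
  rewrite /nilt /nilp; case: split => j; last by rewrite ew rmorphM mulr0 addr0.
  rewrite (taut_coordinates v) mulr_sumr mulr_suml -big_split; apply: eq_bigr => l _ /=.
  by rewrite ew dcM rmorphD !rmorphM; ring.
have base s : sq_base (psi s) = s.
  have e : [the {rmorphism S -> S} of @sq_base S (n + n) \o psi] =1 [the {rmorphism S -> S} of idfun].
    by apply: cot_eq => [f|v] /=; rewrite ?psi1 ?psi2 ?hphi.
  exact: e.
pose D i s := sq_nil (psi s) i.
have Dp i a : D i (pl a) = nilp a i by rewrite /D psi1 hphi.
have Dt i v : D i (taut T v) = nilt v i by rewrite /D psi2.
have dD i : lderivation kS (D i).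
  split=> [s t|s t|c]; rewrite /D; first by rewrite rmorphD.
    by rewrite rmorphM /= !base.
  rewrite -[sq_nil _ _]/(D i _) -(pull_cst pi U) Dp /nilp; case: split => // j.
  by rewrite dck rmorph0.
have DX i j : D i (cot_coord j) = (i == j)%:R.
  case: ds => _ dy _.
  case: (split_ordP j) => j' ->; rewrite ?cot_coord_l ?cot_coord_r ?Dp ?Dt /nilp /nilt.
    case: split_ordP => i' ->; last by rewrite eq_rlshift.
    by rewrite /dc dy rmorph_nat eq_lshift.
  case: split_ordP => i' ->; last by rewrite dy rmorph_nat eq_rshift eq_sym.
  rewrite eq_lrshift big1 // => l _; rewrite dy.
  by case: eqP; rewrite -?(rmorph1 (cst U)) ?dck ?d0 rmorph0 mul0r.
exists D; split=> // R rho E b db s.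
have [cD cM ck] := comb_derivation rho (fun i => b (cot_coord i)) dD.
have [bD bM bk] := db.
apply: (cot_generated (Q := fun s => b s = \sum_i rho (D i s) *: b (cot_coord i))) => [a|j|s1 s2 e1 e2|s1 s2 e1 e2].
- have dba : derivation_along (cst U) [the {rmorphism O U -> R} of rho \o pl] (fun a => b (pl a)).
    split=> [a1 a2|a1 a2|c]; first by rewrite rmorphD bD.
      by rewrite rmorphM bM.
    by rewrite pull_cst bk.
  case: ds => _ _ univ; rewrite (univ _ _ _ _ dba) big_split_ord /= [X in _ = _ + X]big1 ?addr0 => [|i _].
    by apply: eq_bigr => i _; rewrite cot_coord_l Dp /nilp (unsplitK (inl _ i)).
  by rewrite Dp /nilp (unsplitK (inr _ i)) rmorph0 scale0r.
- rewrite -cot_coord_r (bigD1 (rshift n j)) //= DX eqxx rmorph1 scale1r big1 ?addr0 // => i /negPf ij.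
  by rewrite DX ij rmorph0 scale0r.
- by rewrite cD bD e1 e2.
- by rewrite cM bM e1 e2.
Qed.

Lemma cot_dual_pull D i a : dual_system kS cot_coord D ->
  D (lshift n i) (pl a) = pl (dc i a) /\ D (rshift n i) (pl a) = 0.
Proof.
move=> [dD DX _]; case: ds => _ _ univ.
have dba j : derivation_along (cst U) pl (fun a => D j (pl a) : S^o).
  case: (dD j) => bD bM bk; split=> [a1 a2|a1 a2|c]; first by rewrite rmorphD bD.
    by rewrite rmorphM bM.
  by rewrite pull_cst bk.
rewrite !(univ _ _ _ _ (dba _)); split.
  rewrite (bigD1 i) //= -cot_coord_l DX eqxx big1 ?addr0 => [|j /negPf ji].
    by rewrite /GRing.scale /= mulr1.
  by rewrite -cot_coord_l DX eq_lshift eq_sym ji scaler0.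
by rewrite big1 // => j _; rewrite -cot_coord_l DX eq_rlshift scaler0.
Qed.

(** The commutator is a derivation that kills every [y l], and coordinates express a derivation
    through its values there. *)
Lemma coordinates_commute i j : sval (d i) * sval (d j) = sval (d j) * sval (d i).
Proof.
pose b := sval (d i) * sval (d j) - sval (d j) * sval (d i).
have db : derivation b.
  move=> V h f g; rewrite /b /= !(svalP (d _) V h).
  have dD l u v : dfam (sval (d l)) h (u + v) = dfam (sval (d l)) h u + dfam (sval (d l)) h v.
    by have := dfam_linear (sval (d l)) h 1 u v; rewrite rmorph1 !mul1r.
  by rewrite !dD !(svalP (d _) V h); ring.
apply/eqP; rewrite -subr_eq0 -/b; apply/eqP.
case: co => dy /(_ U (@subset_refl _ U) (exist _ b db)) /= ->.
rewrite big1 // => l _; rewrite res_id.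
have bl : dop_app b (y l) = 0.
  rewrite /dop_app /= -!/(dop_app _ _) !dy.
  have d0 i' : dop_app (sval (d i')) 0 = 0.
    by have := dcD i' 0 0; rewrite !addr0 => e; apply: (addrI (dop_app (sval (d i')) 0)); rewrite addr0.
  have d1 i' (c : bool) : dop_app (sval (d i')) c%:R = 0.
    by case: c => //; rewrite -(rmorph1 (cst U)); exact: dck.
  by rewrite !d1 subr0.
rewrite -[X in dop_fun X]/(dop_app b (y l)) bl.
by apply: dopP => V h f /=; rewrite rmorph0 mul0r.
Qed.

End CotangentCoordinates.

(** * The Rees module *)

Lemma vfield_order (L : fieldType) (Y : ringedSpace L) (U : opens Y) (v : vfield U) :
  order_le 1 (sval v).
Proof. by move=> V h a b x /=; rewrite !(svalP v V h); ring. Qed.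

(** * Formal properties of the Poisson bracket *)

Section PoissonBracket.
Variables (L S : comPzRingType) (k : {rmorphism L -> S}) (n : nat) (D : 'I_(n + n) -> S -> S).
Hypothesis dD : forall i, lderivation k (D i).

Let DD i a b : D i (a + b) = D i a + D i b. Proof. by case: (dD i). Qed.
Let DM i a b : D i (a * b) = a * D i b + b * D i a. Proof. by case: (dD i). Qed.
Let D0 i : D i 0 = 0. Proof. by apply: (addrI (D i 0)); rewrite -DD !addr0. Qed.

Lemma poissonC a b : poisson D a b = - poisson D b a.
Proof. by rewrite -sumrN; apply: eq_bigr => l _; ring. Qed.

Lemma poissonDl a b c : poisson D (a + b) c = poisson D a c + poisson D b c.
Proof. by rewrite -big_split; apply: eq_bigr => l _ /=; rewrite !DD; ring. Qed.

Lemma poissonMl a b c : poisson D (a * b) c = a * poisson D b c + b * poisson D a c.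
Proof.
by rewrite !mulr_sumr -big_split; apply: eq_bigr => l _ /=; rewrite !DM; ring.
Qed.

Lemma poisson0l c : poisson D 0 c = 0.
Proof. by rewrite /poisson big1 // => l _; rewrite !D0; ring. Qed.

Lemma poissonNl a c : poisson D (- a) c = - poisson D a c.
Proof. by apply: (addrI (poisson D a c)); rewrite -poissonDl !subrr poisson0l. Qed.

Lemma poissonMr a b c : poisson D c (a * b) = a * poisson D c b + b * poisson D c a.
Proof. by rewrite poissonC poissonMl opprD -!mulrN -!poissonC. Qed.

Lemma poisson0r c : poisson D c 0 = 0.
Proof. by rewrite poissonC poisson0l oppr0. Qed.

End PoissonBracket.

(** Entry [i] stands for the component of degree [k0 + i], and [shift] is multiplication by the Rees
    parameter. Finiteness and membership in the filtration are imposed by [rees_in]. *)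
Definition rees (V : Type) := nat -> V.

Section ReesZmod.
Variable V : zmodType.
Implicit Types m : rees V.
Let add m m' : rees V := fun i => m i + m' i.
Let opp m : rees V := fun i => - m i.
Let zero : rees V := fun _ => 0.
Let addA : associative add. Proof. by move=> a b c; apply/funext => i; rewrite /add addrA. Qed.
Let addC : commutative add. Proof. by move=> a b; apply/funext => i; rewrite /add addrC. Qed.
Let add0 : left_id zero add. Proof. by move=> a; apply/funext => i; rewrite /add add0r. Qed.
Let addN : left_inverse zero opp add. Proof. by move=> a; apply/funext => i; rewrite /add addNr. Qed.
HB.instance Definition _ := gen_eqMixin (rees V).
HB.instance Definition _ := gen_choiceMixin (rees V).
HB.instance Definition _ := GRing.isZmodule.Build (rees V) addA addC add0 addN.

Lemma reesD m m' i : (m + m') i = m i + m' i. Proof. by []. Qed.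
Lemma reesN m i : (- m) i = - m i. Proof. by []. Qed.
Lemma rees_sum (I : Type) (r : seq I) (F : I -> rees V) i : (\sum_(j <- r) F j) i = \sum_(j <- r) F j i.
Proof. by apply: (big_morph (fun m : rees V => m i)). Qed.

Definition shift m : rees V := fun i => if i is j.+1 then m j else 0.

Lemma shiftD m m' : shift (m + m') = shift m + shift m'.
Proof. by apply/funext => -[|i]; rewrite reesD //= addr0. Qed.

Lemma shift_inj m : shift m = 0 -> m = 0.
Proof. by move=> e; apply/funext => i; have := congr1 (fun z : rees V => z i.+1) e. Qed.

Definition single i (x : V) : rees V := fun j => if j == i then x else 0.

End ReesZmod.

Section Rees.
Variables (L : fieldType) (Y : ringedSpace L) (T : cotangentBundle Y) (M : Dmodule Y).
Notation pi := (proj T).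
Variables (U : opens Y) (aU : affine U) (n : nat) (y : 'I_n -> O U) (d : 'I_n -> vfield U).
Hypothesis co : coordinates y d.
Hypothesis ds : dual_system (cst U) y (fun i => dop_app (sval (d i))).
Notation S := (O (minv pi U)).
Notation pl := (pull pi U).
Notation kS := (cst (minv pi U)).
Variable D : 'I_(n + n) -> S -> S.
Hypothesis hD : dual_system kS (cot_coord T y d) D.
Notation N := (rees (M U)).

Definition act_fun (f : O U) (m : N) : N := fun i => O_act f (m i).
Definition act_vf (v : vfield U) (m : N) : N := shift (fun i => (sval v : Dsheaf U) *: m i).

(** Operators of the Rees algebra with their symbols, vector fields having degree 1. It is a
    relation because a symbol has many lifts, depending on the expression by which it is written. *)
Inductive rees_lift : (N -> N) -> S -> Prop :=
| Lift_fun f : rees_lift (act_fun f) (pl f)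
| Lift_vf i : rees_lift (act_vf (d i)) (taut T (d i))
| Lift_0 : rees_lift (fun=> 0) 0
| Lift_opp x a : rees_lift x a -> rees_lift (fun m => - x m) (- a)
| Lift_add x z a b : rees_lift x a -> rees_lift z b -> rees_lift (fun m => x m + z m) (a + b)
| Lift_mul x z a b : rees_lift x a -> rees_lift z b -> rees_lift (fun m => x (z m)) (a * b).

Lemma rees_liftD x a m m' : rees_lift x a -> x (m + m') = x m + x m'.
Proof.
move=> lx; elim: lx m m' => {x a} [f|i||x a _ IH|x z a b _ IHx _ IHz|x z a b _ IHx _ IHz] m m'.
- by apply/funext => j; rewrite /act_fun /O_act reesD scalerDr.
- by rewrite -shiftD; congr (shift _); apply/funext => j; rewrite reesD scalerDr.
- by rewrite addr0.
- by rewrite IH opprD.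
- by rewrite IHx IHz addrACA.
- by rewrite IHz IHx.
Qed.

Lemma rees_lift_shift x a m : rees_lift x a -> x (shift m) = shift (x m).
Proof.
have s0 : shift (0 : N) = 0 by apply/funext => -[].
move=> lx; elim: lx m => {x a} [f|i||x a _ IH|x z a b _ IHx _ IHz|x z a b _ IHx _ IHz] m.
- by apply/funext => -[|j] //; rewrite /act_fun /O_act /= scaler0.
- by congr (shift _); apply/funext => -[|j] //=; rewrite scaler0.
- by rewrite s0.
- by apply: (addrI (shift (x m))); rewrite -shiftD subrr s0 IH subrr.
- by rewrite IHx IHz shiftD.
- by rewrite IHz IHx.
Qed.

Lemma rees_lift_ex a : exists x, rees_lift x a.
Proof.
apply: (cot_generated aU co (Q := fun a => exists x, rees_lift x a)) => {a}.
- by move=> f; exists (act_fun f); constructor.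
- by move=> i; exists (act_vf (d i)); constructor.
- by move=> a b [x lx] [z lz]; exists (fun m => x m + z m); constructor.
- by move=> a b [x lx] [z lz]; exists (fun m => x (z m)); constructor.
Qed.

Lemma rees_lift_act x a (m : N) : rees_lift x a -> x 0 = 0.
Proof. by move=> lx; apply: (addrI (x 0)); rewrite -(rees_liftD _ _ lx) !addr0. Qed.

Lemma rees_liftN x a m : rees_lift x a -> x (- m) = - x m.
Proof.
move=> lx; apply: (addrI (x m)); rewrite -(rees_liftD _ _ lx) !subrr; exact: (rees_lift_act 0 lx).
Qed.

Let br := poisson D.
Let dD i : lderivation kS (D i). Proof. by case: hD. Qed.

Let has_br (x z : N -> N) a b := exists w, rees_lift w (br a b) /\
  forall m, x (z m) - z (x m) = shift (w m).

Lemma shift0 : shift (0 : N) = 0. Proof. by apply/funext => -[]. Qed.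

Lemma shiftN (m : N) : shift (- m) = - shift m.
Proof. by apply: (addrI (shift m)); rewrite -shiftD !subrr shift0. Qed.

Lemma has_br_sym x z a b : has_br x z a b -> has_br z x b a.
Proof.
move=> [w [lw e]]; exists (fun m => - w m); split.
  by rewrite /br poissonC; exact: Lift_opp.
by move=> m; rewrite shiftN -e opprB.
Qed.

(** The commutator and the Poisson bracket are both derivations in the first argument, so that the
    generators suffice. *)
Lemma has_br_ind z b : rees_lift z b ->
  (forall f, has_br (act_fun f) z (pl f) b) -> (forall i, has_br (act_vf (d i)) z (taut T (d i)) b) ->
  forall x a, rees_lift x a -> has_br x z a b.
Proof.
move=> lz hf hv x a lx; elim: lx => {x a} // [|x a lx [w [lw e]]|x x' a a' lx [w [lw e]] lx' [w' [lw' e']]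
  |x x' a a' lx [w [lw e]] lx' [w' [lw' e']]].
- exists (fun=> 0); split; first by rewrite /br (poisson0l dD); constructor.
  by move=> m; rewrite (rees_lift_act 0 lz) subrr shift0.
- exists (fun m => - w m); split; first by rewrite /br (poissonNl dD); constructor.
  by move=> m; rewrite (rees_liftN _ lz) shiftN -e opprB opprK addrC.
- exists (fun m => w m + w' m); split; first by rewrite /br (poissonDl dD); constructor.
  by move=> m; rewrite (rees_liftD _ _ lz) shiftD -e -e' opprD addrACA.
- exists (fun m => x (w' m) + w (x' m)); split.
    rewrite /br (poissonMl dD) [a' * _]mulrC; constructor; exact: Lift_mul.
  move=> m; rewrite shiftD -(rees_lift_shift _ lx) -e -e' (rees_liftD _ _ lx) (rees_liftN _ lx).
  by rewrite addrA subrK.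
Qed.

Lemma rees_lift_br x z a b : rees_lift x a -> rees_lift z b ->
  exists w, rees_lift w (br a b) /\ forall m, x (z m) - z (x m) = shift (w m).
Proof.
have [_ DX _] := hD.
have plc f : br (pl f) 0 = 0 by rewrite /br (poisson0r dD).
have ff f g : has_br (act_fun f) (act_fun g) (pl f) (pl g).
  exists (fun=> 0); split.
    rewrite (_ : br _ _ = 0); first by constructor.
    rewrite /br /poisson big1 // => l _.
    by rewrite !(cot_dual_pull ds _ _ hD).2; ring.
  move=> m; rewrite shift0; apply/funext => i; rewrite reesD reesN /act_fun /O_act !scalerA -scalerBl.
  rewrite (_ : _ - _ = 0 :> Dsheaf U) ?scale0r //.
  by apply: dopP => V h g' /=; ring.
have vf i f : has_br (act_vf (d i)) (act_fun f) (taut T (d i)) (pl f).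
  exists (act_fun (dop_app (sval (d i)) f)); split.
    rewrite (_ : br _ _ = pl (dop_app (sval (d i)) f)); first by constructor.
    rewrite /br /poisson -(cot_coord_r T y d) (bigD1 i) //= big1 => [|l li].
      rewrite !DX eqxx (cot_dual_pull ds _ _ hD).1 eq_lrshift mul1r mul0r subr0 addr0 //.
    by rewrite !DX eq_lrshift eq_rshift (negPf li) !mul0r subr0.
  move=> m; apply/funext => -[|j]; rewrite reesD reesN /act_vf /act_fun /O_act /=.
    by rewrite scaler0 subrr.
  rewrite !scalerA -scalerBl; congr (_ *: _).
  apply: dopP => V h g /=; rewrite (svalP (d i) V h) -(dfam_res _ (@subset_refl _ U) h) /dop_app; ring.
have vv i j : has_br (act_vf (d i)) (act_vf (d j)) (taut T (d i)) (taut T (d j)).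
  exists (fun=> 0); split.
    rewrite (_ : br _ _ = 0); first by constructor.
    by rewrite /br /poisson -!(cot_coord_r T y d) big1 // => l _; rewrite !DX !eq_lrshift mulr0 mul0r subr0.
  move=> m; rewrite shift0; apply/funext => -[|[|l]]; rewrite reesD reesN /act_vf /=.
  - by rewrite subrr.
  - by rewrite !scaler0 subrr.
  - by rewrite !scalerA -scalerBl (coordinates_commute co ds) subrr scale0r.
move=> lx lz; move: lx; apply: (has_br_ind lz) => [f|i]; apply: has_br_sym; move: lz.
- apply: has_br_ind => [|g|j]; [by constructor | exact: ff | exact: vf].
- apply: has_br_ind => [|g|j]; [by constructor | by apply: has_br_sym; exact: vf | exact: vv].
Qed.

Section Filtered.
Variables (G : filtration M) (k0 : int).
Arguments G : clear implicits.
Hypothesis cG : compatible_filtration G.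
Hypothesis Gk0 : forall k m, (k <= k0)%R -> (G k U m : Prop) -> m = 0.

Definition rees_in (m : N) := (forall i : nat, G (k0 + i%:Z) U (m i)) /\
  exists B, forall i, (B <= i)%N -> m i = 0.

Lemma filt0 k : G k U 0. Proof. by case: cG => /(_ k) [[h _ _ _ _] _] _ _ _ _; exact: h. Qed.
Lemma filtD k m m' : G k U m -> G k U m' -> G k U (m + m').
Proof. by case: cG => /(_ k) [[_ h _ _ _] _] _ _ _ _; exact: h. Qed.
Lemma filt_fun k f m : G k U m -> G k U (O_act f m).
Proof. by case: cG => /(_ k) [[_ _ h _ _] _] _ _ _ _; exact: h. Qed.
Lemma filtN k m : G k U m -> G k U (- m).
Proof.
move=> /(filt_fun (-1)); congr (G _ _ _); rewrite -scaleN1r /O_act; congr (_ *: _).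
by apply: dopP => V h f /=; rewrite rmorphN rmorph1 mulN1r.
Qed.
Lemma filtS k m : G k U m -> G (k + 1) U m.
Proof. by case: cG => _ h _ _ _; exact: h. Qed.
Lemma filt_vf k (v : vfield U) m : G k U m -> G (k + 1) U ((sval v : Dsheaf U) *: m).
Proof. by case: cG => _ _ _ _ h; apply: (h 1%N); exact: vfield_order. Qed.

Lemma rees_in0 : rees_in 0. Proof. by split=> [i|]; [exact: filt0 | exists 0%N]. Qed.
Lemma rees_inD m m' : rees_in m -> rees_in m' -> rees_in (m + m').
Proof.
move=> [Gm [B hB]] [Gm' [B' hB']]; split=> [i|]; first by rewrite reesD; exact: filtD.
exists (maxn B B') => i; rewrite geq_max => /andP [/hB e /hB' e'].
by rewrite reesD e e' addr0.
Qed.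
Lemma rees_inN m : rees_in m -> rees_in (- m).
Proof.
move=> [Gm [B hB]]; split=> [i|]; first by rewrite reesN; exact: filtN.
by exists B => i /hB e; rewrite reesN e oppr0.
Qed.
Lemma rees_in_sum (I : Type) (r : seq I) (F : I -> N) : (forall i, rees_in (F i)) ->
  rees_in (\sum_(i <- r) F i).
Proof. by move=> h; apply: big_ind => //; [exact: rees_in0 | exact: rees_inD]. Qed.
Lemma rees_in_shift m : rees_in m -> rees_in (shift m).
Proof.
move=> [Gm [B hB]]; split=> [[|i]|] /=; first exact: filt0.
  by rewrite intS [1 + _]addrC addrA; exact: filtS.
by exists B.+1 => -[//|i]; rewrite ltnS => /hB.
Qed.
Lemma rees_in_single i m : G (k0 + i%:Z) U m -> rees_in (single i m).
Proof.
move=> Gm; split=> [j|]; first by rewrite /single; case: eqP => [->|_] //; exact: filt0.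
by exists i.+1 => j ij; rewrite /single gtn_eqF.
Qed.
Lemma rees_lift_in x a m : rees_lift x a -> rees_in m -> rees_in (x m).
Proof.
move=> lx; elim: lx m => {x a} [f|i||x a _ IH|x z a b _ IHx _ IHz|x z a b _ IHx _ IHz] m hm.
- case: hm => Gm [B hB]; split=> [j|]; first exact: filt_fun.
  by exists B => j /hB e; rewrite /act_fun e /O_act scaler0.
- case: hm => Gm [B hB]; split=> [[|j]|]; first exact: filt0.
    by rewrite intS [1 + _]addrC addrA; exact: filt_vf.
  by exists B.+1 => -[//|j]; rewrite ltnS /act_vf /= => /hB ->; rewrite scaler0.
- exact: rees_in0.
- exact/rees_inN/IH.
- by apply: rees_inD; [exact: IHx | exact: IHz].
- exact/IHx/IHz.
Qed.

Variables (E : Omodule T) (s : int -> forall U : opens Y, M U -> E (minv pi U)).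
Arguments s : clear implicits.
Hypothesis gr : is_gr G s.

Lemma gr0 k : s k U 0 = 0.
Proof.
by apply: (addrI (s k U 0)); rewrite -(gr_add gr) ?addr0 //; exact: filt0.
Qed.

(** A bound beyond which the entries vanish, chosen classically, with 0 as default for infinite
    sequences; [rees_qE] shows that the choice does not affect [rees_q]. *)
Definition rees_bound (m : N) : nat :=
  if pselect (exists B, forall i, (B <= i)%N -> m i = 0) is left e then sval (cid e) else 0%N.

Definition rees_q (m : N) : E (minv pi U) :=
  \sum_(i < rees_bound m) s (k0 + i%:Z) U (m i).

Lemma rees_qE m B : (forall i, (B <= i)%N -> m i = 0) ->
  rees_q m = \sum_(i < B) s (k0 + i%:Z) U (m i).
Proof.
have key B1 B2 : (B1 <= B2)%N -> (forall i, (B1 <= i)%N -> m i = 0) ->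
    \sum_(i < B1) s (k0 + i%:Z) U (m i) = \sum_(i < B2) s (k0 + i%:Z) U (m i).
  move=> le h; rewrite (big_ord_widen B2 (fun i => s (k0 + i%:Z) U (m i)) le) big_mkcond /=.
  by apply: eq_bigr => i _; case: ltnP => // /h ->; rewrite gr0.
move=> hB; rewrite /rees_q /rees_bound; case: pselect => [e|[]]; last by exists B.
case: (cid e) => B' /= hB'; rewrite (key _ (maxn B B')) ?leq_maxr // -(key B) ?leq_maxl //.
Qed.

Lemma rees_qD m m' : rees_in m -> rees_in m' -> rees_q (m + m') = rees_q m + rees_q m'.
Proof.
move=> [Gm [B hB]] [Gm' [B' hB']].
rewrite (@rees_qE m (maxn B B')) => [|i]; last by rewrite geq_max => /andP [/hB].
rewrite (@rees_qE m' (maxn B B')) => [|i]; last by rewrite geq_max => /andP [_ /hB'].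
rewrite (@rees_qE (m + m') (maxn B B')) => [|i]; last first.
  by rewrite geq_max => /andP [/hB e /hB' e']; rewrite reesD e e' addr0.
by rewrite -big_split; apply: eq_bigr => i _; rewrite reesD (gr_add gr).
Qed.

Lemma rees_q_shift m : rees_in m -> rees_q (shift m) = 0.
Proof.
move=> [Gm [B hB]]; rewrite (@rees_qE _ B.+1); last by case=> [//|i]; rewrite ltnS => /hB.
rewrite big_ord_recl gr0 add0r big1 // => i _; apply/(gr_ker gr) => //=.
  by rewrite /bump intS [1 + _]addrC addrA; exact: filtS.
by rewrite /bump intS [1 + _]addrC addrA addrK.
Qed.

(** Directness of the sum makes every class vanish separately, so that each [m i] lies one step
    lower in the filtration; the entry of degree [k0] is 0 because the filtration vanishes there. *)
Lemma rees_q_ker m : rees_in m -> rees_q m = 0 -> exists m', rees_in m' /\ m = shift m'.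
Proof.
move=> [Gm [B hB]]; rewrite (rees_qE hB) => q0.
have s0 i : s (k0 + i%:Z) U (m i) = 0.
  have [lt|/hB ->] := ltnP i B; last exact: gr0.
  exact: (gr_direct gr (m := fun i : 'I_B => m i) aU (fun i => Gm i) q0 (Ordinal lt)).
have m0 : m 0%N = 0 by apply: (Gk0 (k := k0)) => //; have := Gm 0%N; rewrite addr0.
exists (fun i => m i.+1); split; last by apply/funext => -[|i].
split=> [i|]; last by exists B => i le; apply: hB; exact: leq_trans le _.
have := s0 i.+1; rewrite (gr_ker gr) // intS [1 + _]addrC addrA addrK //.
Qed.

Lemma rees_q_single i m : rees_q (single i m) = s (k0 + i%:Z) U m.
Proof.
rewrite (@rees_qE _ i.+1) => [|j ij]; last by rewrite /single gtn_eqF.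
rewrite big_ord_recr /= {2}/single eqxx big1 ?add0r // => j _.
by rewrite /single ltn_eqF // gr0.
Qed.

Lemma rees_q_sum (I : Type) (r : seq I) (F : I -> N) : (forall i, rees_in (F i)) ->
  rees_q (\sum_(i <- r) F i) = \sum_(i <- r) rees_q (F i).
Proof.
move=> hF; suff [] : rees_in (\sum_(i <- r) F i) /\ rees_q (\sum_(i <- r) F i) = \sum_(i <- r) rees_q (F i) by [].
apply: (big_ind2 (fun a b => rees_in a /\ rees_q a = b)) => [|a b a' b' [ha <-] [ha' <-]|i _] //.
  split; first exact: rees_in0.
  by rewrite (@rees_qE _ 0%N) ?big_ord0.
by split; [exact: rees_inD | exact: rees_qD].
Qed.

Lemma rees_q_surj e : exists m, rees_in m /\ rees_q m = e.
Proof.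
have [k [l [m [Gm ->]]]] := gr_span gr e aU.
have /choice [F hF] (i : 'I_l) : exists m', rees_in m' /\ rees_q m' = s (k + i%:Z) U (m i).
  (* The indices given by [gr_span] may start below [k0], where the sections are zero. *)
  have [le|lt] := boolP (k + i%:Z <= k0)%R.
    rewrite (Gk0 le (Gm i)) gr0; exists 0; split; first exact: rees_in0.
    by rewrite (@rees_qE _ 0%N) ?big_ord0.
  have [j ej] : exists j : nat, k + i%:Z = k0 + j%:Z.
    by exists (absz (k + i%:Z - k0)%R); move: lt; lia.
  exists (single j (m i)); rewrite rees_q_single ej; split=> //.
  by apply: rees_in_single; rewrite -ej.
exists (\sum_i F i); split; first by apply: rees_in_sum => i; case: (hF i).
by rewrite rees_q_sum => [|i]; [apply: eq_bigr => i _; case: (hF i) | case: (hF i)].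
Qed.

Lemma rees_lift_q x a m : rees_lift x a -> rees_in m -> rees_q (x m) = a *: rees_q m.
Proof.
move=> lx; elim: lx m => {x a} [f|i||x a lx IH|x z a b lx IHx lz IHz|x z a b lx IHx lz IHz] m hm.
- case: (hm) => Gm [B hB]; rewrite (rees_qE hB) scaler_sumr (@rees_qE _ B).
    by apply: eq_bigr => j _; rewrite (gr_fun gr).
  by move=> j /hB e; rewrite /act_fun e /O_act scaler0.
- case: (hm) => Gm [B hB]; rewrite (rees_qE hB) scaler_sumr (@rees_qE _ B.+1).
    rewrite big_ord_recl gr0 add0r; apply: eq_bigr => j _.
    by rewrite /= /bump intS [1 + _]addrC addrA (gr_taut gr).
  by case=> [//|j]; rewrite ltnS /act_vf /= => /hB ->; rewrite scaler0.
- by rewrite scale0r (@rees_qE _ 0%N) ?big_ord0.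
- apply: (addrI (rees_q (x m))); rewrite -rees_qD; [|exact: rees_lift_in lx hm |exact: rees_inN (rees_lift_in lx hm)].
  by rewrite subrr (@rees_qE _ 0%N) ?big_ord0 // IH // -scalerDl subrr scale0r.
- rewrite rees_qD ?IHx ?IHz ?scalerDl //; [exact: rees_lift_in lx hm | exact: rees_lift_in lz hm].
- by rewrite IHx ?IHz ?scalerA //; exact: rees_lift_in lz hm.
Qed.

Theorem char_prime_involutive (charL : [pchar L] =i pred0) (P : set S) f g :
  finitely_generated_algebra U -> locally_ringed T -> coherent_module E ->
  min_prime (ann (E (minv pi U))) P -> P f -> P g -> P (br f g).
Proof.
move=> fgU lrT cE mP.
have [gens Sfg] := cot_fg T aU co fgU.
apply: (min_prime_involutive charL Sfg (br := br) _ _ _ _ mP (N := N) (Nin := rees_in)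
  (t := @shift _) (q := rees_q) (lift := rees_lift)).
- exact: (poissonMl dD).
- by move=> a b c; exact: (poissonMr dD).
- exact: (poisson0l dD).
- exact: coherent_fg (cot_affine T aU).
- exact: rees_inD.
- exact: rees_inN.
- exact: rees_in0.
- exact: shiftD.
- exact: rees_in_shift.
- exact: shift_inj.
- exact: rees_qD.
- exact: rees_q_shift.
- exact: rees_q_ker.
- exact: rees_q_surj.
- by move=> x a m m'; exact: rees_liftD.
- by move=> x a m lx; exact: rees_lift_in lx.
- by move=> x a m; exact: rees_lift_shift.
- by move=> x a m; exact: rees_lift_q.
- exact: Lift_0.
- exact: Lift_opp.
- exact: rees_lift_ex.
- exact: Lift_add.
- exact: Lift_mul.
- by move=> x z a b lx lz; have [w [lw e]] := rees_lift_br lx lz; exists w; split=> // m _.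
Qed.

End Filtered.

(** * Comparison of two good filtrations over an affine open set *)

Section Compare.
Hypotheses (lrY : locally_ringed Y) (lrT : locally_ringed T).

Lemma compat_le (G : filtration M) : compatible_filtration G -> forall (k k' : int) (V : opens Y) (m : M V),
  (k <= k')%R -> G k V m -> G k' V m.
Proof.
move=> [_ GS _ _ _] k k' V m le Gm.
have [j ->] : exists j : nat, k' = k + j%:Z by exists (absz (k' - k)%R); move: le; lia.
elim: j => [|j IH]; first by rewrite addr0.
by rewrite intS [1 + _]addrC addrA; exact: GS.
Qed.

(** The filtration is exhaustive only locally; finitely many principal sets cover [U], and the
    largest index can be used on all of them. *)
Lemma filt_exhaust (G : filtration M) (k0 : int) : compatible_filtration G ->
  forall m : M U, exists c : nat, G (k0 + c%:Z) U m.
Proof.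
move=> cG m; have [cO _ exh _ _] := cG.
have nat_bound (k : int) : exists c : nat, (k <= k0 + c%:Z)%R.
  by exists (absz (k - k0)%R); lia.
have [x Ux|l [f [Ff cf]]] := affine_cover lrY aU
   (F := [set f | exists c : nat, G (k0 + c%:Z) (basic_open f) (mres (@basic_open_sub _ _ U f) m)]).
  have [V [h [k [Vx Gk]]]] := exh U m x Ux.
  have [f [uf fV]] := affine_basis aU h Vx; have [c hc] := nat_bound k.
  exists f; split=> //; exists c; apply: (compat_le cG hc).
  have [[_ _ _ Gr _] _] := cO k.
  have := Gr _ _ fV _ Gk; congr (G k _ _).
  have [_ rr] := m_presheaf M; exact: esym (rr U V _ h fV _ m).
have /choice [c hc] := Ff.
pose C := (\sum_i c i)%N; exists C.
have [[_ _ _ _ loc] _] := cO (k0 + C%:Z); apply: loc => x /cf [i ui].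
exists (basic_open (f i)), (@basic_open_sub _ _ U (f i)); split=> //.
apply: (compat_le cG _ (hc i)); have : (c i <= C)%N by rewrite /C (bigD1 i) //= leq_addr.
by clear; lia.
Qed.

Section Two.
Variables (G G' : filtration M) (k0 : int).
Arguments G : clear implicits.
Arguments G' : clear implicits.
Hypotheses (cG : compatible_filtration G) (cG' : compatible_filtration G').
Hypothesis Gk0 : forall (k : int) (m : M U), (k <= k0)%R -> (G k U m : Prop) -> m = 0.
Variables (E : Omodule T) (s : int -> forall U : opens Y, M U -> E (minv pi U)).
Arguments s : clear implicits.
Hypotheses (gr : is_gr G s) (cE : coherent_module E).

Lemma iter_shiftE c (m : N) i : iter c (@shift _) m (i + c)%N = m i.
Proof. by elim: c => [|c IH]; rewrite ?addn0 // addnS. Qed.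

Lemma iter_shift_lt c (m : N) i : (i < c)%N -> iter c (@shift _) m i = 0.
Proof. by elim: c i => // c IH [|i] //; rewrite ltnS; exact: IH. Qed.

Lemma lift_iter_shift x a c m : rees_lift x a -> x (iter c (@shift _) m) = iter c (@shift _) (x m).
Proof. by move=> lx; elim: c => //= c IH; rewrite (rees_lift_shift _ lx) IH. Qed.

Lemma iter_shift_in (H' : filtration M) c m : compatible_filtration H' ->
  (exists B, forall i, (B <= i)%N -> m i = 0) ->
  (forall i : nat, H' (k0 + (i + c)%:Z) U (m i)) -> rees_in H' k0 (iter c (@shift _) m).
Proof.
move=> cH [B hB] hm; split=> [i|].
  have [lt|le] := ltnP i c; first by rewrite iter_shift_lt //; exact: filt0.
  by rewrite -(subnK le) iter_shiftE.
exists (B + c)%N => i le; rewrite -(@subnK c i) ?iter_shiftE ?hB //; lia.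
Qed.

(* The coefficients of [m] on finitely many generators of the graded module
   lift to operators which preserve both Rees modules. *)
Lemma filt_compare : exists c : nat, forall (k : int) m, (G k U m : Prop) -> G' (k + c%:Z) U m.
Proof.
have [r [v hv]] := coherent_fg lrT cE (cot_affine T aU).
have /choice [w hw] j := rees_q_surj cG Gk0 gr (v j).
have wi j := (hw j).1; have wq j := (hw j).2.
have /choice [B hB] j : exists B, forall i, (B <= i)%N -> w j i = 0 by case: (wi j).
pose B1 := (\max_j B j)%N.
have /choice [e he] (ji : 'I_r * 'I_B1) := filt_exhaust k0 cG' (w ji.1 ji.2).
pose c := (\sum_ji e ji)%N.
have hc j i : G' (k0 + (i + c)%:Z) U (w j i).
  have [lt|le] := ltnP i B1.
    apply: (compat_le cG' _ (he (j, Ordinal lt))).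
    have : (e (j, Ordinal lt) <= c)%N by rewrite /c (bigD1 (j, Ordinal lt)) //= leq_addr.
    by clear; lia.
  rewrite hB; first exact: filt0.
  by apply: leq_trans le; exact: leq_bigmax.
have win j : rees_in G' k0 (iter c (@shift _) (w j)).
  by apply: iter_shift_in => //; exists (B j); exact: hB.
have key (i : nat) m : (G (k0 + i%:Z) U m : Prop) -> G' (k0 + (i + c)%:Z) U m.
  elim/ltn_ind: i m => i IH m Gm.
  have [f hf] := hv (s (k0 + i%:Z) U m).
  have /choice [x hx] j := rees_lift_ex (f j).
  have xw j : rees_in G k0 (x j (w j)) by exact: rees_lift_in (hx j) (wi j).
  (* The class of [m] is a combination of the classes of the [w j]. What remains after subtracting
     the lifted combination is a shift, whose entry at [i] comes from the preceding degree, where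
     the induction hypothesis applies. *)
  have [||n' [n'in en]] := rees_q_ker cG Gk0 gr (m := single i m - \sum_j x j (w j)).
  - by apply: rees_inD => //; [exact: rees_in_single | apply: rees_inN => //; exact: rees_in_sum].
  - have qs : rees_q k0 s (single i m) = \sum_j rees_q k0 s (x j (w j)).
      rewrite (rees_q_single k0 cG gr) hf; apply: eq_bigr => j _.
      by rewrite (rees_lift_q cG gr (hx j)) // wq.
    have sin : rees_in G k0 (single i m) by exact: rees_in_single.
    have xin : rees_in G k0 (\sum_j x j (w j)) by exact: rees_in_sum.
    apply: (addIr (rees_q k0 s (\sum_j x j (w j)))).
    rewrite -(rees_qD cG gr) //; last by apply: rees_inD => //; exact: rees_inN.
    by rewrite subrK add0r qs (rees_q_sum cG gr).
  have -> : m = \sum_j x j (w j) i + shift n' i.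
    by rewrite -en reesD reesN rees_sum addrC subrK /single eqxx.
  apply: filtD => //.
    apply: big_ind => [||j _]; [exact: filt0 | by move=> a b; exact: filtD |].
    have := rees_lift_in cG' (hx j) (win j).
    by rewrite (lift_iter_shift _ _ (hx j)) => -[/(_ (i + c)%N)]; rewrite iter_shiftE.
  have sh j : j = i -> G' (k0 + (j + c)%:Z) U (shift n' j).
    case: j => [|j] ji; first exact: filt0.
    have [Gn _] := n'in; have := IH j _ _ (Gn j); rewrite -ji => /(_ (leqnn _)).
    by apply: (compat_le cG'); lia.
  exact: sh.
exists c => k m Gm; have [le|lt] := boolP (k <= k0)%R.
  by rewrite (Gk0 le Gm); exact: filt0.
have [i ei] : exists i : nat, k = k0 + i%:Z by exists (absz (k - k0)%R); move: lt; lia.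
by move: Gm; rewrite ei => /key; rewrite PoszD addrA.
Qed.

End Two.

(* If [x] lifts [f] and each Rees module contains the [c]-th shift of the other,
   then [x ^ (2 c + 1)] maps the second Rees module to its shift. *)
Lemma ann_radical (G G' : filtration M) (E E' : Omodule T)
    (s : int -> forall U : opens Y, M U -> E (minv pi U))
    (s' : int -> forall U : opens Y, M U -> E' (minv pi U)) :
  compatible_filtration G -> compatible_filtration G' -> is_gr G s -> is_gr G' s' ->
  coherent_module E -> coherent_module E' ->
  forall f, ann (E (minv pi U)) f -> exists l, ann (E' (minv pi U)) (f ^+ l).
Proof.
move=> cG cG' gr gr' cE cE' f hf.
have [_ _ _ [k1 b1] _] := cG; have [_ _ _ [k2 b2] _] := cG'.
pose k0 : int := if (k1 <= k2)%R then k1 else k2.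
have le1 : (k0 <= k1)%R by rewrite /k0; case: ifP => //; lia.
have le2 : (k0 <= k2)%R by rewrite /k0; case: ifP => //; lia.
have Gk0 (k : int) (m : M U) : (k <= k0)%R -> G k U m -> m = 0.
  by move=> le; apply: b1; lia.
have Gk0' (k : int) (m : M U) : (k <= k0)%R -> G' k U m -> m = 0.
  by move=> le; apply: b2; lia.
have [c1 hc1] := filt_compare cG cG' Gk0 gr cE.
have [c2 hc2] := filt_compare cG' cG Gk0' gr' cE'.
have [x lx] := rees_lift_ex f.
have step m : rees_in G k0 m -> exists m', rees_in G k0 m' /\ x m = shift m'.
  move=> hm; apply: (rees_q_ker cG Gk0 gr); first exact: rees_lift_in lx hm.
  by rewrite (rees_lift_q cG gr lx hm) hf.
have steps l m : rees_in G k0 m -> exists m', rees_in G k0 m' /\ iter l x m = iter l (@shift _) m'.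
  move=> hm; elim: l => [|l [m' [hm' e]]] /=; first by exists m.
  have [m2 [hm2 e2]] := step _ hm'; exists m2; split=> //.
  by rewrite e (lift_iter_shift _ _ lx) e2 -iterSr.
(* The shift by [c2] leads into the Rees module of [G], the shift by [c1] leads back, and one more
   shift makes the class in [E'] zero. *)
pose l := (c1 + c2).+1; exists l => e.
have [m [hm <-]] := rees_q_surj cG' Gk0' gr' e.
have lxl j : rees_lift (fun z => iter j.+1 x z) (f ^+ j.+1).
  elim: j => [|j IH]; first by rewrite expr1.
  by rewrite exprS; exact: (Lift_mul lx IH).
rewrite -(rees_lift_q cG' gr' (lxl _)) //.
have [Gm fin] := hm.
have [|m2 [hm2 e2]] := steps l (iter c2 (@shift _) m).
  apply: (iter_shift_in (H' := G)) => // i.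
  by rewrite PoszD addrA; exact: hc2.
rewrite (lift_iter_shift c2 m (lxl (c1 + c2)%N)) in e2.
have inj a (m1 m3 : N) : iter a (@shift _) m1 = iter a (@shift _) m3 -> m1 = m3.
  by move=> h; apply/funext => i; rewrite -(iter_shiftE a m1 i) h iter_shiftE.
have -> : iter (c1 + c2).+1 x m = shift (iter c1 (@shift _) m2).
  by apply: (inj c2); rewrite e2 -iterS -iterD addnS addnC.
apply: (rees_q_shift cG' gr').
apply: (iter_shift_in (H' := G')) => //; first by case: hm2.
by move=> i; have [Gi _] := hm2; rewrite PoszD addrA; exact: hc1.
Qed.

Lemma gr_support_sub (G G' : filtration M) (E E' : Omodule T)
    (s : int -> forall U : opens Y, M U -> E (minv pi U))
    (s' : int -> forall U : opens Y, M U -> E' (minv pi U)) z :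
  compatible_filtration G -> compatible_filtration G' -> is_gr G s -> is_gr G' s' ->
  coherent_module E -> coherent_module E' -> minv pi U z ->
  support E' z -> support E z.
Proof.
move=> cG cG' gr gr' cE cE' Uz.
have aP := cot_affine T aU.
rewrite !(support_ann lrT _ aP Uz) // => h f hf uf.
have [l hl] := ann_radical cG cG' gr gr' cE cE' hf.
by apply: (h _ hl); exact: unit_atX.
Qed.

End Compare.
End Rees.

(** * Dimension *)

Section Specialization.
Variable X : topologicalType.

Lemma closure1P (x x' : X) : closure [set x] x' <-> forall N : opens X, N x' -> N x.
Proof.
split=> [cx N Nx'|h B].
  have [|z [-> //]] := cx N; exact: (open_nbhs_nbhs (conj (oset_open N) Nx')).
rewrite nbhsE => -[N [oN Nx'] NB]; exists x; split=> //; apply: NB.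
exact: (h (Opens oN) Nx').
Qed.

Lemma sub_closure1 (x : X) (C : set X) : closed C -> C x -> closure [set x] `<=` C.
Proof. by move=> cC Cx z /closure1P h; apply: contrapT => nC; exact: (h (Opens (closed_openC cC)) nC). Qed.

(** The traces on [S] of the closures of the points are taken in reverse order, [x 0] being the most
    generic point. *)
Lemma chain_dim (S : set X) (x : nat -> X) m : (forall i, (i <= m)%N -> S (x i)) ->
  (forall i, (i < m)%N -> closure [set x i] (x i.+1) /\ ~ closure [set x i.+1] (x i)) -> dim_ge S m.
Proof.
move=> Sx spec; have cx z : closure [set z] z by exact: subset_closure.
exists (fun i => S `&` closure [set x (m - i)%N]); split=> [i le|i lt].
  have Sxi : S (x (m - i)%N) by apply: Sx; exact: leq_subr.
  split; first split; first by exists (x (m - i)%N).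
    move=> C D cC cD sub; have [|Cx|Dx] := sub (x (m - i)%N); first by split.
      by left=> z [_]; exact: sub_closure1.
    by right=> z [_]; exact: sub_closure1.
  apply/seteqP; split=> z [Sz cz]; split=> //.
    by apply: subset_closure.
  by apply: closed_closure => B nB; have [w [[_ cw] Bw]] := cz B nB; exists w.
have e : (m - i = (m - i.+1).+1)%N by rewrite subnSK.
have [s1 s2] := spec (m - i.+1)%N ltac:(lia).
rewrite e; split.
  by move=> z [Sz cz]; split=> //; move: z cz {Sz}; apply: sub_closure1 => //; exact: closed_closure.
move=> h; apply: s2; have [|_ //] := h (x (m - i.+1)%N).
by split=> //; apply: Sx; exact: leq_subr.
Qed.

Lemma dim_ge_le (S : set X) m n : (m <= n)%N -> dim_ge S n -> dim_ge S m.
Proof.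
move=> le [Z [h1 h2]]; exists Z; split=> i lt; [apply: h1 | apply: h2]; exact: leq_trans lt le.
Qed.

Lemma component_clopen (y : X) (D : set X) : open D -> closed D -> D y ->
  connected_component setT y `<=` D.
Proof.
move=> oD cD Dy z [C [Cy _ cC] Cz].
have e : C `&` D = C.
  by apply: cC; [exists y | exists D | exists D].
by move: Cz; rewrite -e => -[].
Qed.

Lemma component_closure1 (x y z : X) : closure [set x] y -> closure [set x] z ->
  connected_component setT y z.
Proof.
move=> xy xz; exists (closure [set x]) => //; split=> //.
exact/connected_closure/connected1.
Qed.
End Specialization.

Section SchemeDimension.
Variables (L : fieldType) (X : ringedSpace L) (lr : locally_ringed X).
Implicit Types (U V W : opens X).

Lemma affine_spec U (aU : affine U) x x' : U x' ->
  (forall f : O U, unit_at f x' -> unit_at f x) -> closure [set x] x'.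
Proof.
move=> Ux' h; apply/closure1P => N Nx'.
have [f [uf fN]] := affine_basis aU (@opensIl _ U N) (conj Ux' Nx').
by have [] := fN x (h f uf).
Qed.

Lemma affine_not_spec U x x' (f : O U) : unit_at f x -> ~ unit_at f x' -> ~ closure [set x'] x.
Proof. by move=> uf nf /closure1P /(_ (basic_open f) uf). Qed.

Lemma prime_chain_dim U (aU : affine U) (S : set X) (Q : nat -> set (O U)) m :
  (forall i, (i <= m)%N -> prime_ideal (Q i)) -> (forall i, (i < m)%N -> Q i `<` Q i.+1) ->
  (forall i x, (i <= m)%N -> U x -> (forall f, Q i f <-> ~ unit_at f x) -> S x) -> dim_ge S m.
Proof.
move=> pQ lt hS.
have /choice [x hx] i : exists x, (i <= m)%N -> U x /\ forall f, Q i f <-> ~ unit_at f x.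
  have [le|gt] := leqP i m; last first.
    have [x [Ux _]] := affine_point aU (pQ 0%N (leq0n m)).
    by exists x.
  by have [x hx] := affine_point aU (pQ i le); exists x.
apply: (@chain_dim _ S x) => i le.
  by have [Ux h] := hx i le; exact: (hS i).
have [Ux h] := hx i (ltnW le); have [Ux' h'] := hx i.+1 le.
have [sub nsub] := lt i le; split.
  apply: (affine_spec aU) => // f uf; apply: contrapT => /h /sub /h'; exact.
move=> sp; apply: nsub => f /h' nf; apply/h => uf.
exact: (affine_not_spec uf nf).
Qed.

Lemma irreducible_prime U (Z : set X) z : irreducible Z -> Z z -> U z ->
  prime_ideal [set f : O U | forall x, Z x -> U x -> ~ unit_at f x].
Proof.
move=> [_ irr] Zz Uz; split=> /=.
- by move=> x _ Ux; case: (point_prime lr Ux).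
- by move=> h; apply: (h z) => //; exact: unit_at1.
- by move=> a b ha hb x Zx Ux; case: (point_prime lr Ux) => _ _ h _ _; apply: h; [exact: ha | exact: hb].
- by move=> a b hb x Zx Ux /unit_atM [_]; exact: hb.
- move=> a b hab.
  have cl (f : O U) : closed (~` basic_open f) by apply: open_closedC; exact: oset_open.
  have [x Zx|h|h] := irr _ _ (cl a) (cl b).
  + have [Ux|nU] := pselect (U x); last by left=> /unit_at_in.
    case: (point_prime lr Ux) => _ _ _ _ /(_ a b) h; apply: h; exact: hab.
  + by left=> x Zx Ux; exact: h.
  + by right=> x Zx Ux; exact: h.
Qed.

(** A point [c] of the smallest set lies in the whole chain. If the ideals of [Z i] and [Z i.+1] on
    a neighbourhood of [c] agreed, [Z i.+1] would be covered by the closure of [Z i] and the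
    complement of the neighbourhood; being irreducible and containing [c], it would lie in the
    former. *)
Lemma dim_ge_chain (S : set X) n : dim_ge S n -> exists2 c, S c & forall U, affine U -> U c ->
  exists Q : nat -> set (O U), (forall i, (i <= n)%N -> prime_ideal (Q i)) /\
    (forall i, (i < n)%N -> Q i.+1 `<` Q i).
Proof.
move=> [Z [hZ lt]].
have [[c Z0c] _] := (hZ 0%N (leq0n n)).1.
have Zc i : (i <= n)%N -> Z i c.
  elim: i => // i IH le; have [sub _] := lt i le; exact/sub/IH/ltnW.
have ZS i : (i <= n)%N -> Z i `<=` S.
  by move=> le; rewrite (hZ i le).2; exact: subIsetl.
exists c; first exact: (ZS 0%N (leq0n n) c Z0c).
move=> U aU Uc; exists (fun i => [set f | forall x, Z i x -> U x -> ~ unit_at f x]); split=> i le.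
  by apply: irreducible_prime (Zc i le) Uc; case: (hZ i le).
have [sub nsub] := lt i le; split.
  by move=> f h x Zx; apply: h; exact: sub.
move=> h; apply: nsub => x Zx.
have [irr eZ] := hZ i.+1 le; have [_ eZi] := hZ i (ltnW le).
have [_ /(_ (closure (Z i)) (~` U))] := irr.
move=> /(_ (@closed_closure _ _) (open_closedC (oset_open U))) [z Zz|sub'|sub'].
- have [Uz|nU] := pselect (U z); last by right.
  left; apply: contrapT => nz.
  have [f [uf fN]] := affine_basis aU (@opensIl _ U (Opens (closed_openC (@closed_closure _ (Z i))))) (conj Uz nz).
  have ff : forall x, Z i x -> U x -> ~ unit_at f x.
    by move=> w Zw Uw /fN [_]; apply; exact: subset_closure.
  by apply: (h f ff z Zz Uz).
- by rewrite eZi; split; [exact: ZS Zx | exact: sub'].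
- by case: (sub' c (Zc _ le)).
Qed.

(** The function [f] is a unit at [y] and lies in each of the finitely many primes that contain a
    unit at [y]. So a point [x] of [basic_open f] has a generization [w] that specializes to [y] as
    well, and the closure of [w] is connected. *)
Lemma component_near U (aU : affine U) y : U y -> noeth (O U) ->
  exists V : opens X, V y /\ V `<=` connected_component setT y.
Proof.
move=> Uy nU.
have i0 := ideal0 (O U).
have [s [sp sQ]] := finite_primes nU i0.
have pt x (Ux : U x) : exists p, [/\ p \in s, prime_ideal p & forall f : O U, p f -> ~ unit_at f x].
  have [|p [ps pQ]] := sQ _ (point_prime lr Ux).
    by move=> _ -> /=; case: (point_prime lr Ux).
  by exists p; split=> //; case: (sp p ps).
have [f [uf hf]] : exists f : O U, unit_at f y /\
    forall p : set (O U), p \in s -> (exists a, p a /\ unit_at a y) -> p f.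
  elim: s sp {sQ pt} => [|q s IH] sp; first by exists 1; split=> //; exact: unit_at1.
  have [|f [uf hf]] := IH; first by move=> p ps; apply: sp; rewrite inE ps orbT.
  have iq : ideal q by apply/prime_ideal_ideal; case: (sp q) => //; rewrite inE eqxx.
  have [[a [qa ua]]|no] := pselect (exists a, q a /\ unit_at a y).
    exists (a * f); split; first exact/unit_atM.
    move=> p; rewrite inE => /predU1P [-> _|ps ex].
      by rewrite mulrC; case: iq => _ _; apply.
    have ip : ideal p by apply/prime_ideal_ideal; case: (sp p) => //; rewrite inE ps orbT.
    by case: ip => _ _; apply; exact: hf.
  exists f; split=> // p; rewrite inE => /predU1P [-> /no //|ps ex]; exact: hf.
exists (basic_open f); split=> // x fx; have Ux := unit_at_in fx.
have [p [ps pp px]] := pt x Ux.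
have py a : p a -> ~ unit_at a y.
  by move=> pa ua; apply: (px f) => //; apply: hf => //; exists a.
have [w [Uw hw]] := affine_point aU pp.
apply: (@component_closure1 _ w).
  by apply: (affine_spec aU) => // a ua; apply: contrapT => /hw /py.
by apply: (affine_spec aU) => // a ua; apply: contrapT => /hw /px.
Qed.

Lemma component_open y : (forall x, exists U, [/\ U x, affine U & noeth (O U)]) ->
  open (connected_component setT y : set X).
Proof.
move=> h; rewrite openE => c yc; rewrite /interior nbhsE /=.
have [U [Uc aU nU]] := h c; have [V [Vc hV]] := component_near aU Uc nU.
exists V; first by split=> //; exact: oset_open.
by move=> z /hV cz; exact: connected_component_trans yc cz.
Qed.

(** Over a residue field, the Jacobian matrices between the two systems multiply to an identity
    matrix, which bounds [n1] by [n2]; then the roles are exchanged. *)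
Lemma coordinates_dim U U' n n' y d y' d' x : U x -> U' x ->
  coordinates (U := U) (n := n) y d -> coordinates (U := U') (n := n') y' d' -> n = n'.
Proof.
suff le U1 U2 n1 n2 y1 d1 y2 d2 : U1 x -> U2 x ->
  coordinates (U := U1) (n := n1) y1 d1 -> coordinates (U := U2) (n := n2) y2 d2 -> (n1 <= n2)%N.
  by move=> Ux U'x co co'; apply/eqP; rewrite eqn_leq (le _ _ _ _ _ _ _ _ Ux U'x co co')
     (le _ _ _ _ _ _ _ _ U'x Ux co' co).
move=> Ux U'x [dy1 _] [_ span2].
pose V := opensI U1 U2; have h1 : V `<=` U1 := @opensIl _ U1 U2; have h2 : V `<=` U2 := @opensIr _ U1 U2.
have Vx : V x by split.
have [K [phi _]] := residue_field (point_prime lr Vx).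
pose D1 i := dres h1 (sval (d1 i)).
have derD i : derivation (D1 i) by move=> W k f g /=; exact: (svalP (d1 i)).
apply: (@mulmx1_min _ _ _ (\matrix_(i < n1, j < n2) phi (dop_app (D1 i) (res h2 (y2 j))))
  (\matrix_(j < n2, l < n1) phi (dfam (sval (d2 j)) h2 (res h1 (y1 l))))).
apply/matrixP => i l; rewrite !mxE.
have e : dop_app (D1 i) (res h1 (y1 l)) = (i == l)%:R.
  rewrite /dop_app /D1 /= -(rmorph_nat (res h1)) -dy1 /dop_app (dfam_res _ _ (subset_trans (@subset_refl _ V) h1)).
  by [].
rewrite -(rmorph_nat phi) -e.
have eD : D1 i = _ := span2 V h2 (exist _ _ (derD i)).
rewrite (congr1 (fun P => dop_app P (res h1 (y1 l))) eD) /=.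
have sumE q (F : 'I_q -> dop V) g : dfam (\sum_i F i) (@subset_refl _ V) g = \sum_i dfam (F i) (@subset_refl _ V) g.
  by apply: (big_morph (fun P : dop V => dfam P (@subset_refl _ V) g)).
rewrite [in RHS]/dop_app sumE rmorph_sum; apply: eq_bigr => j _ /=; rewrite !mxE rmorphM; congr (phi _ * phi _).
  by rewrite res_id.
by rewrite (Prop_irrelevance (subset_trans _ h2) h2).
Qed.

End SchemeDimension.

(** * Minimal primes, derivations and the independence of coordinates *)

Section MinimalPrimes.
Variables (L : fieldType) (charL : [pchar L] =i pred0).
Variables (A : comPzRingType) (k : {rmorphism L -> A}).

Lemma natr_inv n : exists u : A, u * n.+1%:R = 1.
Proof.
exists (k n.+1%:R^-1); rewrite -(rmorph_nat k) -rmorphM mulVf ?rmorph1 //.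
by rewrite ((pcharf0P L).1 charL).
Qed.

(** Some [h * a ^+ n] is 0 with [h] outside [P]. Differentiation removes one factor [a] at a time in
    favour of [D a], and multiplication by [h * D a] absorbs the other terms of the Leibniz rule;
    [n.+1] is invertible. In the end [h' * D a ^+ e = 0] with [h'] outside [P]. *)
Lemma min_prime_derivation P D a : lderivation k D -> min_prime [set 0] P -> P a -> P (D a).
Proof.
move=> [DD DM Dk] mP Pa; have [pP _ _] := mP.
have i0 := ideal0 A.
have DX x j : D (x ^+ j.+1) = x ^+ j * D x *+ j.+1.
  elim: j => [|j IH]; first by rewrite expr1 expr0 mul1r.
  by rewrite exprS DM IH exprS [RHS]mulrS -mulrnAr; rewrite /GRing.scale /= mulrnAr addrC mulrC -mulrnAl; ring.
have D0 : D 0 = 0 by have := Dk 0; rewrite rmorph0.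
have [h [n [Ph e0]]] := min_prime_nilp i0 mP Pa.
suff [h' [e [Ph' he]]] : exists h' e, ~ P h' /\ h' * D a ^+ e = 0.
  have : P (h' * D a ^+ e) by rewrite he; case: pP.
  by case: (pP) => _ _ _ _ pr /pr [//|]; exact: prime_X.
have {e0} : exists e, h * a ^+ n * D a ^+ e = 0 by exists 0%N; rewrite expr0 mulr1.
elim: n h Ph => [|n IH] h Ph [e he]; first by exists h, e; rewrite expr0 mulr1 in he.
apply: (IH (h * h)); first exact: prime_notM.
exists e.+2; have [u hu] := natr_inv n.
have := congr1 (fun z => h * D a * D z) he.
rewrite D0 mulr0 DM DM DX /GRing.scale /=.
set b := D a; set x := a ^+ n; rewrite exprS -/x in he *.
have e3 : h * b * (h * (a * x) * D (b ^+ e)) = 0.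
  case: (e) he => [|e'] he; last first.
    rewrite DX; transitivity (h * b ^+ 1 * (h * (a * x) * b ^+ e') * D b *+ e'.+1); first by rewrite -mulrnAr; ring.
    have -> : h * b ^+ 1 * (h * (a * x) * b ^+ e') = h * (h * (a * x) * b ^+ e'.+1) by rewrite [b ^+ e'.+1]exprS; ring.
    by rewrite he mulr0 mul0r mul0rn.
  by rewrite expr0 mulr1 in he; rewrite he mul0r mulr0.
move=> eq; have {eq} : h * b * (b ^+ e * (h * (x * b *+ n.+1))) = 0.
  rewrite -[RHS]eq mulrDr e3 add0r !mulrDr.
  rewrite (_ : h * b * (b ^+ e * (a * x * D h)) = b * D h * (h * (a * x) * b ^+ e)); last by ring.
  by rewrite he mulr0 addr0.
have -> : h * b * (b ^+ e * (h * (x * b *+ n.+1))) = (h * h * x * b ^+ e.+2) * n.+1%:R.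
  by rewrite -mulr_natr !exprS; ring.
by move/(congr1 (fun z => z * u)); rewrite mul0r -mulrA [_ * u]mulrC hu mulr1.
Qed.

(** The invariant is that the derivations of index at least [m] kill the algebra generated by the
    first [m] coordinates. A relation of the next coordinate is then differentiated as if its
    coefficients were constants, and it remains in [P] by [min_prime_derivation]. *)
Lemma coordinates_tower n (y : 'I_n -> A) d P : dual_system k y d -> min_prime [set 0] P ->
  exists xs O, tower k P xs O /\ size xs = n.
Proof.
move=> [dD dy _] mP; have [pP _ _] := mP; have iP := prime_ideal_ideal pP.
suff key m : (m <= n)%N -> exists xs O, [/\ tower k P xs O, size xs = m &
    forall c, O c -> forall i : 'I_n, (m <= i)%N -> d i c = 0].
  by have [xs [Q [t sz _]]] := key n (leqnn n); exists xs, Q.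
elim: m => [_|m IH lt].
  exists [::], (range k); split=> //; first exact: Tower0.
  by move=> _ [c _ <-] i _; case: (dD i).
have [xs [Q [t sz hQ]]] := IH (ltnW lt); pose j := Ordinal lt.
have sQ := tower_subalg t.
have [DD DM Dk] := dD j.
have d0 i : d i 0 = 0 by case: (dD i) => _ _ /(_ 0); rewrite rmorph0.
have dsum i l (F : 'I_l -> A) : d i (\sum_a F a) = \sum_a d i (F a).
  by apply: (big_morph (d i)) => //; case: (dD i).
have djX l : d j (y j ^+ l) = y j ^+ l.-1 *+ l.
  elim: l => [|l IHl]; first by rewrite expr0 -(rmorph1 k) Dk.
  rewrite exprS DM IHl dy eqxx /GRing.scale /= mulr1 mulrS addrC; congr (_ + _).
  by case: l {IHl} => [|l]; rewrite ?mulr0n ?mulr0 // mulrnAr -exprS.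
exists (y j :: xs), (adj Q (y j)); split; last first.
- move=> c [l [b [Qb ->]]] i mi; rewrite dsum big1 // => a _.
  case: (dD i) => _ M _; rewrite M (hQ _ (Qb a)) ?(ltnW mi) //.
  have -> : d i (y j ^+ a) = 0.
    elim: (nat_of_ord a) => [|a' IHa]; first by rewrite expr0 -(rmorph1 k); case: (dD i).
    by rewrite exprS M IHa dy -val_eqE /= gtn_eqF // scaler0 /GRing.scale /= mulr0 addr0.
  by rewrite !scaler0 addr0.
- by rewrite /= sz.
apply: TowerS => //.
have dP a : P a -> P (d j a) by exact: min_prime_derivation (dD j) mP.
elim=> [//|l IHl] c Qc hP i.
suff cl : P (c l).
  rewrite ltnS leq_eqVlt => /predU1P [->//|il]; apply: (IHl c) => //.
  have -> : \sum_(a < l) c a * y j ^+ a = \sum_(a < l.+1) c a * y j ^+ a - c l * y j ^+ l.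
    by rewrite big_ord_recr /= addrK.
  by apply: idealB => //; rewrite mulrC; case: iP => _ _; apply.
(* differentiating [l] times leaves [l! c_l] *)
have step : forall q, (q <= l)%N -> P (\sum_(a < l.+1) c a * (y j ^+ (a - q) *+ (a ^_ q))).
  elim=> [_|q IHq lq].
    by rewrite (eq_bigr (fun a : 'I_l.+1 => c a * y j ^+ a)) // => a _; rewrite subn0 ffactn0 mulr1n.
  have := dP _ (IHq (ltnW lq)); congr (P _); rewrite dsum; apply: eq_bigr => a _.
  have -> : c a * (y j ^+ (a - q) *+ a ^_ q) = (c a * y j ^+ (a - q)) * (a ^_ q)%:R by rewrite -mulr_natr mulrA.
  have dn z : d j z%:R = 0 by rewrite -(rmorph_nat k) Dk.
  rewrite DM dn (DM (c a)) djX (hQ _ (Qc a)) // /GRing.scale /= !mulr0 add0r addr0.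
  rewrite ffactnSr subnS -mulr_natl -mulr_natr -[in RHS]mulr_natr natrM; ring.
have := step l (leqnn l); rewrite big_ord_recr /= subnn expr0 ffactnn.
rewrite big1 => [|a _]; last by rewrite ffact_small // mulr0n mulr0.
rewrite add0r => cl.
have [u hu] := natr_inv (l`!.-1); rewrite prednK ?fact_gt0 // in hu.
have -> : c l = u * (c l * (1 *+ l`!)) by rewrite mulrCA -[1 *+ _]/(l`!%:R) hu mulr1.
by case: iP => _ _; apply.
Qed.

End MinimalPrimes.

(** * Characteristic varieties *)

Section Assembly.
Variables (L : fieldType) (charL : [pchar L] =i pred0) (Y : ringedSpace L).
Hypotheses (schY : scheme Y) (ftY : finite_type Y) (smY : locally_formally_smooth Y).
Variables (T : cotangentBundle Y) (M : Dmodule Y).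
Notation pi := (proj T).
Let lrY : locally_ringed Y := schY.1.
Let lrT : locally_ringed T := (cot_scheme T).1.

Lemma noeth_affine U : finitely_generated_algebra (X := Y) U -> noeth (O U).
Proof. by move=> [gens fg]; exact: noeth_fg fg. Qed.

(** A minimal prime below the point [y0] carries the tower of the coordinates, and the primes of a
    chain above it that avoid [f] are points of [V]. *)
Lemma dim_ge_coordinates U n (y : 'I_n -> O U) d y0 (V : opens Y) :
  affine U -> finitely_generated_algebra U -> dual_system (cst U) y d -> U y0 -> V y0 -> dim_ge V n.
Proof.
move=> aU fgU ds Uy Vy.
have [f [uf fV]] := affine_basis aU (@opensIl _ U V) (conj Uy Vy).
have i0 := ideal0 (O U).
have pQ := point_prime lrY Uy.
have [|P [mP PQ _]] := exists_min_prime (noeth_affine fgU) i0 pQ.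
  by move=> _ ->; case: pQ.
have [pP _ _] := mP.
have [xs [Q [t sz]]] := coordinates_tower charL ds mP.
have [gens fg] := fgU.
have Pf : ~ P f by move=> /PQ; apply.
have [|C [_ pC Cf lt]] := prime_chain (m := n) charL pP fg t _ Pf; first by rewrite sz.
apply: (prime_chain_dim aU (Q := C)) => // i x _ Ux hx.
have fx : unit_at f x by apply: contrapT => /hx; exact: Cf.
by have [] := fV x fx.
Qed.

Lemma dim_le_coordinates (S : set Y) n : dim_ge S n -> exists c, S c /\
  exists U n' (y : 'I_n' -> O U) d, [/\ U c, coordinates y d & (n <= n')%N].
Proof.
move=> /(dim_ge_chain lrY) [c Sc hc]; exists c; split=> //.
have [U [n' [y [d [Uc aU [gens fg] co ds]]]]] := local_coordinates lrY schY ftY smY c.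
have [Q [pQ lt]] := hc U aU Uc.
have [xs [R [t <-]]] := chain_tower (cst U) pQ lt.
have [K [phi [hphi _]]] := residue_field (pQ n (leqnn n)).
by exists U, n', y, d; split=> //; have := tower_bound charL hphi fg ds t.
Qed.

(** The points with a system of [n] coordinates form an open set, which is also closed because any
    two systems around a common point have the same length. *)
Lemma coordinates_component (U : opens Y) n (y : 'I_n -> O U) d y0 (U' : opens Y) n'
    (y' : 'I_n' -> O U') d' c :
  U y0 -> coordinates y d -> U' c -> coordinates y' d' ->
  connected_component setT y0 c -> n = n'.
Proof.
move=> Uy co U'c co'.
pose D : set Y := [set x | exists V (z : 'I_n -> O V) e, V x /\ coordinates z e].
have oD : open D.
  rewrite openE => x [V [z [e [Vx cV]]]]; rewrite /interior nbhsE /=.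
  exists V; first by split=> //; exact: oset_open.
  by move=> w Vw; exists V, z, e.
have cD : closed D.
  rewrite -openC openE => x nD; rewrite /interior nbhsE /=.
  have [V [m [z [e [Vx _ _ cV _]]]]] := local_coordinates lrY schY ftY smY x.
  exists V; first by split=> //; exact: oset_open.
  move=> w Vw [V' [z' [e' [V'w cV']]]]; apply: nD.
  have em := coordinates_dim lrY Vw V'w cV cV'; subst m.
  by exists V, z, e.
have Dy : D y0 by exists U, y, d.
move=> /(component_clopen oD cD Dy) [V [z [e [Vc cV]]]].
by have := coordinates_dim lrY Vc U'c cV co'.
Qed.

Variables (G : filtration M) (E : Omodule T)
  (s : int -> forall U : opens Y, M U -> E (minv pi U)).
Hypotheses (cG : compatible_filtration G) (gr : is_gr G s) (cE : coherent_module E).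

(** [P] is a component of the support through [z], and [m] is the length of a maximal tower of
    coordinates modulo [P]. Chains of primes over [P] that avoid [f] give dimension [m] inside [V],
    and [x] is the generic point of the component. *)
Lemma support_dim_isotropic U n (y : 'I_n -> O U) (d : 'I_n -> vfield U) z (V : opens T) :
  affine U -> finitely_generated_algebra U -> coordinates y d ->
  dual_system (cst U) y (fun i => dop_app (sval (d i))) ->
  minv pi U z -> support E z -> V z ->
  exists m, [/\ (n <= m)%N, forall S, support E `&` V `<=` S -> dim_ge S m &
    (m <= n)%N -> exists x, [/\ support E x, V x & isotropic_at (support E) x]].
Proof.
move=> aU fgU co ds Uz sz Vz.
have aP : affine (minv pi U) := cot_affine T aU.
have [gens fg] := cot_fg T aU co fgU.
have nS : noeth (O (minv pi U)) := noeth_fg fg.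
have [D hD] := cot_dual T aU co ds.
have [dD DX univ] := hD.
pose I := ann (E (minv pi U)).
have iI : ideal I := ann_ideal _.
have suppP x : minv pi U x -> (support E x <-> I `<=` [set f | ~ unit_at f x]).
  by move=> Ux; rewrite (support_ann lrT cE aP Ux).
have pQ := point_prime lrT Uz.
have [P [mP PQ [g [Pg gP]]]] := exists_min_prime nS iI pQ ((suppP z Uz).1 sz).
have [pP IP _] := mP.
have [f [uf fV]] := affine_basis aP (@opensIl _ (minv pi U) V) (conj Uz Vz).
have Pf : ~ P f by move=> /PQ; apply.
have [xs [R [t _ xsX xsalg]]] :=
  tower_extend (codom (cot_coord T y d)) pP (Tower0 (cst (minv pi U)) P).
rewrite cats0 in t.
have [_ _ _ [k0 Gk0] _] := cG.
have Pinv a b : P a -> P b -> P (poisson D a b).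
  apply: (char_prime_involutive aU co ds hD cG (k0 := k0) _ gr charL fgU lrT cE mP) => k m le.
  exact: Gk0.
have [||le cert] := isotropic_certificate charL dD DX pP Pinv t.
- by move=> i; apply: xsalg; exact: codom_f.
- by move=> x /xsX /codomP.
exists (size xs); split=> //.
  move=> S VS; have [C [C0 pC Cf lt]] := prime_chain charL pP fg t (leqnn _) Pf.
  apply: (prime_chain_dim aP (Q := C)) => // i x im Ux hx; apply: VS; split.
    apply/(suppP x Ux) => a Ia; apply/hx.
    have sub j : (j <= size xs)%N -> C 0%N `<=` C j.
      elim: j => [_|j IH lj]; first exact: subset_refl.
      have [sub _] := lt j lj; exact: subset_trans (IH (ltnW lj)) sub.
    by apply: (sub i im); rewrite C0; exact: IP.
  have fx : unit_at f x by apply: contrapT => /hx; exact: Cf.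
  by have [] := fV x fx.
move=> /cert [r [h [p [A [B [Ph Pp hc]]]]]].
have [x [Ux hx]] := affine_point aP pP.
have fx : unit_at f x by apply: contrapT => /hx.
exists x; split.
- by apply/(suppP x Ux) => a /IP /hx.
- by have [] := fV x fx.
(* By the choice of [g], the support is on [W] the zero set of [P] alone, so that elements of [P]
   become 0 in a reduced trace; [h] is the denominator of the certificate. *)
pose W := basic_open (g * h).
have WU : W `<=` minv pi U := @basic_open_sub _ _ _ (g * h).
exists U, n, y, d, W, WU; split=> //.
- by rewrite /W /= unit_atM; split; apply: contrapT => /hx.
- by have := affine_isD aP (isD_basic (g * h)).
move=> R' q [qs qk].
pose rho : {rmorphism O (minv pi U) -> R'} := [the {rmorphism O (minv pi U) -> R'} of q \o res WU].
have rP a : P a -> rho a = 0.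
  move=> Pa; apply/qk => w sw Ww; rewrite unit_at_res //.
  have Uw := WU w Ww.
  have gw : unit_at g w by move: Ww; rewrite /W /= unit_atM => -[].
  have := gP _ (point_prime lrT Uw) ((suppP w Uw).1 sw) (fun n => n gw).
  by move=> /(_ a Pa).
have ek : (fun k => q (cst W k)) = (fun k => rho (cst (minv pi U) k)).
  by apply/funext => k; rewrite /rho /= res_cst.
rewrite ek.
have [u hu] : exists u, u * res WU h = 1.
  apply: unit_inverse => w Ww; rewrite unit_at_res //.
  by move: Ww; rewrite /W /= unit_atM => -[].
have := @closed_canonical L charL _ R' (cst (minv pi U)) rho n D (cot_coord T y d) (univ _ rho) r h p A B.
have -> : (fun i : 'I_n => (rho (cot_coord T y d (rshift n i)), rho (cot_coord T y d (lshift n i)))) =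
  (fun i => (q (canonical_1form y d WU i).1, q (canonical_1form y d WU i).2)).
  by apply/funext => i; rewrite cot_coord_l cot_coord_r.
apply.
- by move=> a; exact: rP.
- by move=> i j; exact: rP.
- by exists (q u); rewrite -rmorphM hu rmorph1.
Qed.

(** If [M] had no nonzero section over a principal set around [pi z], all classes over its preimage
    would vanish, and [gr_span] would make the graded module zero there. *)
Lemma support_nonzero z (V : opens Y) : V (pi z) -> support E z ->
  exists U (m : M U), [/\ U `<=` V & m <> 0].
Proof.
move=> Vz sz; have [U [aU Uz]] : exists U, affine U /\ U (pi z).
  by have [U [Uz aU]] := schY.2 (pi z); exists U.
have [f [uf fV]] := affine_basis aU (@opensIl _ U V) (conj Uz Vz).
pose W := basic_open f; have aW : affine W := affine_isD aU (isD_basic f).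
have aP := cot_affine T aW.
have Wz : minv pi W z by [].
apply: contrapT => no.
have m0 (m : M W) : m = 0.
  by apply: contrapT => mn; apply: no; exists W, m; split=> // y /fV [].
apply: ((support_ann lrT cE aP Wz).1 sz 1); last exact: unit_at1.
move=> e; have [k [n [m [Gm ->]]]] := gr_span gr e aW.
rewrite big1 ?scaler0 // => i _; rewrite (m0 (m i)); exact: (gr0 W cG gr).
Qed.

End Assembly.

Theorem corollary6p3p1 (L : fieldType) (charL : [pchar L]%R =i pred0)
    (Y : ringedSpace L) (Y_smooth : smooth_variety Y)
    (T : cotangentBundle Y) (M : Dmodule Y)
    (M_nonzero : nonzero_on M setT) (M_holonomic : holonomic T M)
    (Z : set T) (Z_ss : singular_support M Z) :
  lagrangian Z.
Proof.
have [schY _ ftY smY] := Y_smooth; have lrY := schY.1; have lrT := (cot_scheme T).1.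
have [G [E [s [cG gr cE eZ]]]] := Z_ss.
have [_ [Z' [G' [E' [s' [cG' gr' cE' eZ']]]] dimM]] := M_holonomic.
have coord := local_coordinates lrY schY ftY smY.
(* Holonomicity provides a support [Z'] that may come from another filtration. *)
have eZZ' : Z' = Z.
  rewrite eZ eZ'; apply/seteqP; split=> z sz.
    have [U [n [y [d [Uz aU fgU co ds]]]]] := coord (proj T z).
    have [D hD] := cot_dual T aU co ds.
    by apply: (gr_support_sub aU co lrY lrT cG cG' gr gr' cE cE' _ sz).
  have [U [n [y [d [Uz aU fgU co ds]]]]] := coord (proj T z).
  by apply: (gr_support_sub aU co lrY lrT cG' cG gr' gr cE' cE _ sz).
have noethU x : exists U : opens Y, [/\ U x, affine U & noeth (O U)].
  have [U [n [y [d [Ux aU fgU _ _]]]]] := coord x; exists U; split=> //; exact: noeth_affine.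
pose comp z := connected_component setT (proj T z) : set Y.
have oC z : open (comp z) by exact: component_open.
have Cz z : comp z (proj T z) by exact: connected_component_refl.
have key z : Z z -> exists n, [/\ dim_eq (comp z) n, dim_eq (Z `&` proj T @^-1` comp z) n,
    (forall V : opens Y, V (proj T z) -> dim_ge V n) &
    forall V : opens T, V z -> dim_ge (Z `&` V) n /\ exists x, [/\ Z x, V x & isotropic_at Z x]].
  move=> Zz; have sz : support E z by rewrite -eZ.
  have [n dC dZ] := dimM (proj T z).
  (* A point of the support over the connected component excludes that [M] is zero there. *)
  have {dZ} dZ : dim_eq (Z `&` proj T @^-1` comp z) n.
    rewrite -eZZ'; case: dZ => // no; case: no.
    by have [U [m [UC m0]]] := support_nonzero schY cG gr cE (V := Opens (oC z)) (Cz z) sz; exists U, m.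
  have [U [n' [y [d [Uz aU fgU co ds]]]]] := coord (proj T z).
  have nn' : (n <= n')%N.
    have [c [cc [U' [n2 [y' [d' [U'c co' le]]]]]]] := dim_le_coordinates charL schY ftY smY dC.1.
    by rewrite (coordinates_component schY ftY smY Uz co U'c co' cc).
  pose pC : opens T := minv (proj T) (Opens (oC z)).
  have pCz : pC z := Cz z.
  have loc (V : opens T) : V z -> [/\ n = n', dim_ge (Z `&` V) n &
      exists x, [/\ Z x, V x & isotropic_at Z x]].
    move=> Vz; have [m [n'm gem iso]] :=
      support_dim_isotropic charL cG gr cE (V := opensI V pC) aU fgU co ds Uz sz (conj Vz pCz).
    (* Here holonomicity enters: the support above the connected component has dimension [n], so it
       has no chain of length [m] greater than [n]. *)
    have mn : (m <= n)%N.
      rewrite leqNgt; apply/negP => lt; case: dZ => _; apply; apply: dim_ge_le lt _.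
      by apply: gem; rewrite eZ => x [sx [_ Cx]].
    (* The chain [n <= n' <= m <= n] combines the dimension of the base, involutivity and
       holonomicity. *)
    have en : n = n' by apply/eqP; rewrite eqn_leq nn' (leq_trans n'm mn).
    split=> //.
      apply: dim_ge_le (leq_trans nn' n'm) _; apply: gem; rewrite eZ => x [sx [Vx _]].
      by split.
    rewrite eZ; have [|x [sx [Vx _] ix]] := iso; first exact: leq_trans mn nn'.
    by exists x.
  exists n; split=> // [V Vz|V /loc [] //].
  have [en _ _] := loc pC pCz; rewrite en.
  exact: (dim_ge_coordinates charL schY aU fgU ds Uz Vz).
split.
- rewrite eZ; exact: support_closed.
(* Isotropy is witnessed on a neighbourhood, so this set is open; it is dense in [Z] because [key]
   finds an isotropic point in every neighbourhood of a point of [Z]. *)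
- pose V0 : set T := [set z | isotropic_at Z z].
  have oV : open V0.
    rewrite openE => z [U [n [y [d [W [h [co Wz aW iso]]]]]]]; rewrite /interior nbhsE /=.
    exists W; first by split=> //; exact: oset_open.
    by move=> w Ww; exists U, n, y, d, W, h.
  exists (Opens oV); split=> // z Zz B; rewrite nbhsE => -[N [oN Nz] NB].
  have [n [_ _ _ loc]] := key z Zz.
  have [_ [x [Zx Nx iso]]] := loc (Opens oN) Nz.
  by exists x; split=> //; exact: NB.
- move=> z Zz; have [n [dC dZ geY geZ]] := key z Zz; exists n.
    split; last by move=> V Vz; rewrite setTI; exact: geY.
    by exists (Opens (oC z)); split; [exact: Cz | rewrite setTI].
  split; last by move=> V /geZ [].
  by exists (minv (proj T) (Opens (oC z))); split; [exact: Cz | exact: dZ].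
Qed.
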